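(* Let $h:[0,\infty)\to[0,\infty)$ be a function of class $C^2$ satisfying (A1)–(A3) of the context, and let $H(\varepsilon)=h(|\varepsilon|)$ and $T=DH$. Let $u\in C^1(\mathbb{R}^2,\mathbb{R}^2)$ be an entire weak solution of the stationary generalized Newtonian flow system, i.e. $\operatorname{div}u=0$ in $\mathbb{R}^2$ and $$\int_{\mathbb{R}^2}T(\varepsilon(u)):\varepsilon(\varphi)\,dx-\int_{\mathbb{R}^2}u^ku^i\,\partial_k\varphi^i\,dx=0$$ for all $\varphi\in C_0^\infty(\mathbb{R}^2,\mathbb{R}^2)$ with $\operatorname{div}\varphi=0$. Suppose that $\int_{\mathbb{R}^2}h(|Du|)\,dx<\infty$. Then $u$ is a constant vector.
   Context: Repeated indices are summed over $1,2$; $:$ is the scalar product of matrices and $|\cdot|$ the associated Euclidean norm. $\varepsilon(u)=\frac12(Du+(Du)^T)$ is the symmetric derivative. $S^2$ is the space of symmetric $2\times2$ real matrices, $H:S^2\to\mathbb{R}$ is $H(\varepsilon)=h(|\varepsilon|)$, and $T(\varepsilon)=DH(\varepsilon)=\mu(|\varepsilon|)\varepsilon$ with $\mu(t)=h'(t)/t$. Assumptions on the potential $h$ (nonnegative, of class $C^2$ on $[0,\infty)$): (A1) $h$ is strictly increasing and convex, $h''(0)>0$, and $\lim_{t\to0}h(t)/t=0$. (A2) There is a constant $a$ such that $h(2t)\le a\,h(t)$ for all $t\ge0$. (A3) $h'(t)/t\le h''(t)$ for all $t\ge0$ (with $h'(t)/t$ at $t=0$ understood as its limit $h''(0)$). The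 system is $-\operatorname{div}[T(\varepsilon(u))]+u^k\partial_ku+D\pi=0$, $\operatorname{div}u=0$ in $\mathbb{R}^2$. *)

(* Defs.v *)
From HB Require Import structures.
From mathcomp Require Import all_boot all_order all_algebra.
From mathcomp Require Import all_classical all_reals all_analysis.

Set Implicit Arguments.
Unset Strict Implicit.
Unset Printing Implicit Defensive.

Import Order.TTheory GRing.Theory Num.Theory.
Import numFieldNormedType.Exports.

Local Open Scope classical_set_scope.
Local Open Scope ring_scope.

(* One-sided at an endpoint of an interval [A]; only the values of [f] on [A]
   matter. *)
Definition has_derivative_on (R : realType) (A : set R) (f f' : R -> R) : Prop :=
  forall t, A t ->
    (f s - f t) / (s - t) @[s --> within A t^'] --> f' t.

(* [h] is of class C^2 on [0, oo), with first and second derivatives [h'] and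
   [h'']; functions on [0, oo) are represented by total functions whose values
   on the negative half-line are never used. *)
Definition C2_halfline (R : realType) (h h' h'' : R -> R) : Prop :=
  [/\ has_derivative_on `[0, +oo[ h h',
      has_derivative_on `[0, +oo[ h' h'' &
      {within `[0, +oo[, continuous h''}].

Definition condA1 (R : realType) (h h'' : R -> R) : Prop :=
  [/\ {in `[0, +oo[ &, {homo h : s t / s < t}},
      convex_function (`[0, +oo[ : set R) h,
      0 < h'' 0 &
      h t / t @[t --> 0^'+] --> 0].

Definition condA2 (R : realType) (h : R -> R) : Prop :=
  exists a : R, forall t, 0 <= t -> h (2 * t) <= a * h t.

(* h'(t) / t, extended to t = 0 by its limit h''(0). *)
Definition mu (R : realType) (h' h'' : R -> R) (t : R) : R :=
  if t == 0 then h'' 0 else h' t / t.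

Definition condA3 (R : realType) (h' h'' : R -> R) : Prop :=
  forall t, 0 <= t -> mu h' h'' t <= h'' t.

Definition mxdot (R : realType) (A B : 'M[R]_2) : R :=
  \sum_(i < 2) \sum_(j < 2) A i j * B i j.

(* The norm that the library puts on matrices is the maximum norm. *)
Definition eucl_norm (R : realType) (A : 'M[R]_2) : R := Num.sqrt (mxdot A A).

Definition symm_part (R : realType) (A : 'M[R]_2) : 'M[R]_2 :=
  2^-1 *: (A + A^T).

Definition potential (R : realType) (h : R -> R) (A : 'M[R]_2) : R :=
  h (eucl_norm A).

(* The gradient T = DH with respect to [mxdot] of H as a function on the space
   of symmetric matrices, at a symmetric matrix [A].  For E the symmetric part
   of the elementary matrix (i, j) and S symmetric, mxdot S E = S i j; hence
   the (i, j) entry of the gradient is the derivative of H along E. *)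
Definition stress (R : realType) (h : R -> R) (A : 'M[R]_2) : 'M[R]_2 :=
  \matrix_(i < 2, j < 2) 'D_(symm_part (delta_mx i j)) (potential h) A.

(* (Du)_(i, k) is the k-th partial derivative of u^i; the library's Jacobian
   acts on row vectors, whence the transposition. *)
Definition Du (R : realType) (u : 'rV[R]_2 -> 'rV[R]_2) (x : 'rV[R]_2) :
  'M[R]_2 := (jacobian u x)^T.

Definition sym_grad (R : realType) (u : 'rV[R]_2 -> 'rV[R]_2)
  (x : 'rV[R]_2) : 'M[R]_2 := symm_part (Du u x).

Definition divergence (R : realType) (u : 'rV[R]_2 -> 'rV[R]_2)
  (x : 'rV[R]_2) : R := \tr (Du u x).

Fixpoint class_C (R : realType) (n : nat) (f : 'rV[R]_2 -> 'rV[R]_2) : Prop :=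
  if n is n'.+1 then
    (forall x, differentiable f x) /\ (forall v, class_C n' ('D_v f))
  else continuous f.

Definition test_field (R : realType) (phi : 'rV[R]_2 -> 'rV[R]_2) : Prop :=
  (forall n, class_C n phi) /\ compact (closure [set x | phi x != 0]).

(* Lebesgue measure on the plane lives on R * R; [plane_point] identifies this
   product with the space of row vectors. *)
Definition plane_measure (R : realType) :
    {measure set (measurableTypeR R * measurableTypeR R)%type -> \bar R} :=
  (@lebesgue_measure R \x @lebesgue_measure R)%E.
Arguments plane_measure : clear implicits.

Definition plane_point (R : realType) (p : R * R) : 'rV[R]_2 :=
  \row_(j < 2) if j == 0 then p.1 else p.2.

Definition weak_solution (R : realType) (h : R -> R)
    (u : 'rV[R]_2 -> 'rV[R]_2) : Prop :=
  (forall x, divergence u x = 0) /\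
  forall phi : 'rV[R]_2 -> 'rV[R]_2,
    test_field phi -> (forall x, divergence phi x = 0) ->
    \int[plane_measure R]_p
       (let x := plane_point p in
        mxdot (stress h (sym_grad u x)) (sym_grad phi x))
    - \int[plane_measure R]_p
       (let x := plane_point p in
        \sum_(k < 2) \sum_(i < 2) u x 0 k * u x 0 i * Du phi x i k) = 0.

(* Main.v *)
(** Write u = (Psi_2, - Psi_1) with a stream function Psi of class C^2.  The
    entries of the strain are Psi_12 and (Psi_22 - Psi_11)/2, and the system
    becomes one scalar equation, tested against the same combinations of second
    derivatives of a potential psi.  As Psi has no third derivatives, the
    equation is tested with a backward difference quotient of
    eta (d_s Psi - c), where d_s is a difference quotient, eta a cut-off at
    scale R and c a constant.  By (A3) the viscosity mu is nondecreasing, so the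
    stress is monotone with modulus mu and the leading term controls
    Lambda_s = int eta mu |d_s eps(u)|^2.  The other terms are rewritten with
    Steklov averages; as s -> 0 they converge to integrals over the annulus
    where eta varies.  The convective term is of this kind because
    tr(A^2 A^T) = 0 for a trace-free 2x2 matrix A.

    By (A1)-(A3) the energy density dominates |Du|^2 and |T||Du|, so the energy in the
    annuli of radius R = 4^n tends to 0 along a subsequence.  The Poincare
    inequality gives int |u - c|^2 <= C R^2, and |F(x,y)| <= int |F_12| gives
    sup eta^(1/2) |u - c| <= C R (1 + Lambda_s).  Hence Lambda_s is bounded by an
    arbitrarily small quantity for R large and s small.  So the strain is
    constant; being square integrable it vanishes, Du is then a constant
    skew matrix, and it is zero for the same reason. *)
Require Import Defs.
From HB Require Import structures.
From mathcomp Require Import all_boot all_order all_algebra.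
From mathcomp Require Import ring lra.
From mathcomp Require Import all_classical all_reals all_analysis.
From mathcomp Require Import measurable_realfun.

Set Implicit Arguments.
Unset Strict Implicit.
Unset Printing Implicit Defensive.

Import Order.TTheory GRing.Theory Num.Theory.
Import numFieldNormedType.Exports.

Local Open Scope classical_set_scope.
Local Open Scope ring_scope.

(** * Iterated integrals of continuous functions *)

(** The obstacle is regularity: no second derivatives of u are available, so each identity that
    would differentiate the strain is first written for Steklov averages at a fixed s, where it is
    exact, and only then s tends to 0. A preliminary bound on the quotients of the strain, depending
    on the cut-off, makes the errors of this passage vanish; it is not the bound that closes the
    argument. In the final estimate Lambda_s reappears on the right, because the velocity may grow
    and its weighted supremum is bounded only by r (1 + Lambda_s). This bound enters linearly and
    with a factor r^-1, times the energy of the annulus or a free Young parameter, and can therefore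
    be absorbed. The weight eta^(1/2) comes for free: eta is the square of a bump, so its
    derivatives are O(eta^(1/2)). Finally, the quotients are tested with potentials of class C^2
    while the hypothesis only offers smooth fields; translated products of one-variable kernels,
    superposed, bridge this gap. *)

Lemma open_prod_measurable (R : realType) (U : set (R * R)) :
  open U -> measurable (U : set (measurableTypeR R * measurableTypeR R)).
Proof.
move=> oU.
(* The measure lives on the product sigma-algebra, so the open set is written as a countable union
   of rational squares; an index whose square leaves [U] contributes the empty set. *)
pose B (i : rat * rat * nat) : set (R * R) :=
  ball (ratr i.1.1 : R) (i.2.+1%:R^-1) `*` ball (ratr i.1.2 : R) (i.2.+1%:R^-1).
have -> : U = \bigcup_i (if `[< B i `<=` U >] then B i else set0).
  apply/seteqP; split => [[x y] Uxy|[x y] [i _]]; last first.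
    by case: asboolP => // BU /BU.
  have /nbhs_ballP[e /= e0 eU] := oU _ Uxy.
  have e20 : 0 < e / 2 by rewrite divr_gt0.
  have [n _ /(_ n (leqnn n)) /= ne] := near_infty_natSinv_lt (PosNum e20).
  have rn (z : R) : exists q : rat, `|ratr q - z| < n.+1%:R^-1.
    have [|q] := @rat_in_itvoo R (z - n.+1%:R^-1) (z + n.+1%:R^-1).
      by rewrite ltrD2l (lt_trans (y := 0)) ?oppr_lt0 ?invr_gt0.
    by rewrite in_itv/= -ltr_distl => ?; exists q.
  have [[p px] [q qy]] := (rn x, rn y).
  exists (p, q, n) => //; case: asboolP => [_|]; first by split.
  case => -[x' y'] [/= px' qy']; apply: eU; split; rewrite /ball/=.
  - rewrite (le_lt_trans (ler_distD (ratr p) _ _))// distrC (splitr e).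
    by rewrite ltrD// (lt_trans _ ne).
  - rewrite (le_lt_trans (ler_distD (ratr q) _ _))// distrC (splitr e).
    by rewrite ltrD// (lt_trans _ ne).
apply: countable_bigcupT_measurable => [|i]; first exact: countableP.
case: asboolP => // _.
by apply: measurableX; apply: open_measurable; exact: ball_open.
Qed.

Lemma continuous_prod_measurable (R : realType) (f : R * R -> R) :
  continuous f ->
  measurable_fun (setT : set (measurableTypeR R * measurableTypeR R)) f.
Proof.
move=> cf; apply: (measurability _ (RGenOInfty.measurableE R)).
move=> _ [_ [x ->] <-]; rewrite setTI; apply: open_prod_measurable.
by apply: open_comp => // p _; exact: cf.
Qed.

(* Unoriented: the integral is 0 when [b <= a]. *)
Definition Sint (R : realType) (a b : R) (f : R -> R) : R :=
  \int[@lebesgue_measure R]_(x in `[a, b]) f x.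

(* A record rather than a plain definition, so that unification never unfolds it. *)
Record cont2 (R : realType) (f : R -> R -> R) : Prop :=
  Cont2 { cont2P : continuous (fun p : R * R => f p.1 p.2) }.

Section Sint.
Context {R : realType}.
Notation mu := (@lebesgue_measure R).
Implicit Types (f g : R -> R) (a b c : R).

Lemma cont_integrable a b f : continuous f ->
  mu.-integrable `[a, b] (EFin \o f).
Proof.
move=> cf; apply: continuous_compact_integrable; first exact: segment_compact.
exact: continuous_subspaceT.
Qed.

Lemma SintD a b f g : continuous f -> continuous g ->
  Sint a b (fun x => f x + g x) = Sint a b f + Sint a b g.
Proof. by move=> cf cg; rewrite /Sint RintegralD//; exact: cont_integrable. Qed.

Lemma SintZ a b k f : continuous f ->
  Sint a b (fun x => k * f x) = k * Sint a b f.
Proof. by move=> cf; rewrite /Sint RintegralZl//; exact: cont_integrable. Qed.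

Lemma SintN a b f : continuous f -> Sint a b (fun x => - f x) = - Sint a b f.
Proof.
move=> cf; rewrite -mulN1r -SintZ//.
by congr Sint; apply/funext => x; rewrite mulN1r.
Qed.

Lemma le_Sint a b f g : continuous f -> continuous g ->
  (forall x, a <= x <= b -> f x <= g x) -> Sint a b f <= Sint a b g.
Proof.
by move=> cf cg fg; apply: le_Rintegral => //; exact: cont_integrable.
Qed.

Lemma eq_Sint a b f g : (forall x, a <= x <= b -> f x = g x) ->
  Sint a b f = Sint a b g.
Proof.
by move=> fg; apply: eq_Rintegral => x; rewrite inE/= in_itv; exact: fg.
Qed.

Lemma Sint_cst a b k : a <= b -> Sint a b (fun=> k) = k * (b - a).
Proof.
move=> ab; rewrite /Sint Rintegral_cst//= lebesgue_measure_itv/= lte_fin.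
by move: ab; rewrite le_eqVlt => /orP[/eqP<-|->//]; rewrite ltxx subrr.
Qed.

Lemma Sint_ge0 a b f : (forall x, a <= x <= b -> 0 <= f x) -> 0 <= Sint a b f.
Proof.
by move=> f0; apply: Rintegral_ge0 => x /=; rewrite in_itv; exact: f0.
Qed.

Lemma Sint_norm a b f : continuous f ->
  `|Sint a b f| <= Sint a b (fun x => `|f x|).
Proof.
by move=> cf; apply: le_normr_Rintegral => //; exact: cont_integrable.
Qed.

Lemma Sint_FTC a b (F f : R -> R) : a <= b -> continuous f ->
  (forall x, is_derive x (1:R) F (f x)) -> Sint a b f = F b - F a.
Proof.
rewrite le_eqVlt => /predU1P[<- _ _|ab cf dF].
  by rewrite /Sint set_itv1 Rintegral_set1 subrr.
have cF : continuous F.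
  by move=> x; apply/differentiable_continuous/derivable1_diffP; case: (dF x).
rewrite /Sint /Rintegral (@continuous_FTC2 _ f F)//.
- exact: continuous_subspaceT.
- split; first by move=> x _; case: (dF x).
  + by apply: cvg_at_right_filter; exact: cF.
  + by apply: cvg_at_left_filter; exact: cF.
- by move=> x _; rewrite derive1E; case: (dF x).
Qed.

Lemma Sint_split a b c f : a <= b -> b <= c -> continuous f ->
  Sint a c f = Sint a b f + Sint b c f.
Proof.
move=> ab bc cf; rewrite /Sint -[X in _ = _ + X]Rintegral_itv_obnd_cbnd; last first.
  apply: integrableS (cont_integrable b c cf) => //; exact: subset_itv_oc_cc.
rewrite -(@Rintegral_itvB _ _ (BLeft a) (BRight c) b) ?bnd_simp//.
  by rewrite addrC subrK.
exact: cont_integrable.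
Qed.

Lemma is_derive_Sint a f x : a < x -> continuous f ->
  is_derive x (1:R) (fun t => Sint a t f) (f x).
Proof.
move=> ax cf.
have [] := @continuous_FTC1_closed R f a x (x + 1) _ _ ax (cf x).
- by rewrite ltrDl.
- exact: cont_integrable.
by move=> d e; rewrite -e derive1E; exact: derivableP.
Qed.

End Sint.

Section continuity.
Context {R : realType} {T : topologicalType}.
Implicit Types (a b : T -> R).

Lemma ct_comp (U V : topologicalType) (f : T -> U) (g : U -> V) :
  continuous g -> continuous f -> continuous (fun x => g (f x)).
Proof. by move=> cg cf x; apply: (continuous_comp (cf x)); exact: cg. Qed.

Lemma ct_pair (U V : topologicalType) (f : T -> U) (g : T -> V) :
  continuous f -> continuous g -> continuous (fun x => (f x, g x)).
Proof. by move=> cf cg x; apply: cvg_pair; [exact: cf|exact: cg]. Qed.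

Lemma ct_cst (k : R) : continuous (fun _ : T => k).
Proof. by move=> x; exact: cvg_cst. Qed.

Lemma ct_add a b : continuous a -> continuous b ->
  continuous (fun x => a x + b x).
Proof. by move=> ca cb x; apply: cvgD; [exact: ca|exact: cb]. Qed.

Lemma ct_opp a : continuous a -> continuous (fun x => - a x).
Proof. by move=> ca x; apply: cvgN; exact: ca. Qed.

Lemma ct_mul a b : continuous a -> continuous b ->
  continuous (fun x => a x * b x).
Proof. by move=> ca cb x; apply: cvgM; [exact: ca|exact: cb]. Qed.

Lemma ct_exp a n : continuous a -> continuous (fun x => a x ^+ n).
Proof.
by move=> ca; apply: (ct_comp (g := fun y : R => y ^+ n)) => //; exact: exprn_continuous.
Qed.

Lemma ct_norm a : continuous a -> continuous (fun x => `|a x|).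
Proof. by move=> ca x; apply: cvg_norm; exact: ca. Qed.

Lemma ct_2 (f : R -> R -> R) a b : cont2 f -> continuous a -> continuous b ->
  continuous (fun x => f (a x) (b x)).
Proof.
move=> cf ca cb.
exact: (ct_comp (f := fun x => (a x, b x)) (g := fun p => f p.1 p.2) (cont2P cf) (ct_pair ca cb)).
Qed.

Lemma ct_1 (f : R -> R) a : continuous f -> continuous a ->
  continuous (fun x => f (a x)).
Proof. by move=> cf ca; exact: ct_comp. Qed.

End continuity.

Lemma ct_secT (R : realType) (T : topologicalType) (f : T -> R -> R) x :
  continuous (fun p : T * R => f p.1 p.2) -> continuous (f x).
Proof.
move=> cf; apply: (ct_comp (g := fun p => f p.1 p.2) (f := fun y => (x, y))) => //.
by apply: ct_pair => y; [exact: cvg_cst|exact: cvg_id].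
Qed.

Lemma ct_sec (R : realType) (f : R -> R -> R) x : cont2 f -> continuous (f x).
Proof. by move=> /cont2P; exact: ct_secT. Qed.

Lemma ct_sec2 (R : realType) (f : R -> R -> R) y : cont2 f -> continuous (f^~ y).
Proof.
move=> cf; apply: (ct_2 (a := id) (b := fun=> y)) => // x; last exact: cvg_cst.
exact: cvg_id.
Qed.

(** By compactness of [[a, b]] the sections [f t] converge uniformly as t tends to t0. The parameter
    ranges over an arbitrary topological space so that pairs of real parameters are covered too. *)
Lemma continuous_Sint (R : realType) (T : topologicalType) (a b : R)
    (f : T -> R -> R) :
  continuous (fun p : T * R => f p.1 p.2) ->
  continuous (fun t => Sint a b (f t)).
Proof.
move=> cf t0.
have cft t : continuous (f t) by exact: ct_secT.
have [ba|ab] := ltP b a.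
  have E t : Sint a b (f t) = 0.
    by rewrite /Sint set_itv_ge ?Rintegral_set0// bnd_simp -ltNge.
  by rewrite (_ : (fun t => _) = fun=> 0); [exact: cvg_cst|exact/funext].
apply/cvgrPdist_le => e e0.
(* Adding 1 keeps the denominator positive when a = b. *)
pose e' := e / (b - a + 1).
have ba1 : 0 < b - a + 1 by rewrite ltr_wpDl// subr_ge0.
have e'0 : 0 < e' by rewrite divr_gt0.
have Hn : \forall t \near t0, `[a, b]%classic `<=` (fun y => `|f t0 y - f t y| <= e').
  apply: ((@compact_near_coveringP _ (`[a, b]%classic : set R)).1 (@segment_compact R a b)) => y yab.
  have := cf (t0, y).
  move/cvgrPdist_le => /(_ (e' / 2)).
  rewrite divr_gt0// => /(_ isT)[[U V] /= [Ut0 Vy] UV].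
  exists (V, U) => //= -[y' t] /= [Vy' Ut].
  rewrite (le_trans (ler_distD (f t0 y) _ _))// (splitr e') lerD//.
  + by rewrite distrC; apply: (UV (t0, y')); split => //=; exact: nbhs_singleton.
  + by apply: (UV (t, y')); split.
near=> t.
  have Ht : `[a, b]%classic `<=` (fun y => `|f t0 y - f t y| <= e').
    by near: t.
  have -> : Sint a b (f t0) - Sint a b (f t) = Sint a b (fun y => f t0 y - f t y).
    by rewrite SintD// ?SintN//; exact: ct_opp.
  have cd : continuous (fun y => f t0 y - f t y) by apply: ct_add => //; exact: ct_opp.
  rewrite (le_trans (Sint_norm _ _ cd))//.
  rewrite (le_trans (le_Sint (g := fun=> e') _ _ _))//.
  + exact: ct_norm.
  + by move=> x; exact: cvg_cst.
  + rewrite Sint_cst// -[leRHS](divfK (lt0r_neq0 ba1)) ler_pM2l//.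
    by rewrite lerDl.
Unshelve. all: by end_near. Qed.

Lemma compact_cont_bounded (R : realType) (T : topologicalType) (A : set T)
    (f : T -> R) : compact A -> continuous f ->
  exists2 M : R, 0 <= M & forall x, A x -> `|f x| <= M.
Proof.
move=> cA cf.
have /compact_bounded[M [_ HM]] : compact (f @` A).
  by apply: continuous_compact => //; exact: continuous_subspaceT.
exists (`|M| + 1) => [|x Ax]; first by rewrite addr_ge0.
by apply: HM; [rewrite (le_lt_trans (ler_norm _))// ltrDl|exists x].
Qed.

Section plane_box.
Context {R : realType}.
Variables (f : R -> R -> R) (a b c d : R).
Hypothesis cf : cont2 f.
Notation mu := (@lebesgue_measure R).
Let box : set (measurableTypeR R * measurableTypeR R) := `[a, b] `*` `[c, d].

Let mbox : measurable box.
Proof. exact: measurableX. Qed.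

Lemma integrable_box :
  (plane_measure R).-integrable box (fun p => (f p.1 p.2)%:E).
Proof.
change ((plane_measure R).-integrable box (EFin \o (fun p : measurableTypeR R * measurableTypeR R => f p.1 p.2))).
apply: measurable_bounded_integrable => //.
- have -> : plane_measure R box = (mu `[a, b] * mu `[c, d])%E.
    exact: product_measure1E.
  rewrite !lebesgue_measure_itv/=; do 2 case: ifP => // _.
  + by rewrite -!EFinB -EFinM ltry.
  + by rewrite mule0.
  + by rewrite mul0e.
  + by rewrite mul0e.
- apply: (@measurable_funS _ _ _ _ setT) => //.
  exact: continuous_prod_measurable (cont2P cf).
- have [|M M0 HM] := @compact_cont_bounded R (R * R)%type box (fun p => f p.1 p.2) _ (cont2P cf).
    by apply: compact_setX; exact: segment_compact.
  exists M; split; first by rewrite num_real.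
  by move=> x Mx y yb /=; exact: le_trans (HM _ yb) (ltW Mx).
Qed.

Let integrable_patch :
  (plane_measure R).-integrable setT ((fun p => (f p.1 p.2)%:E) \_ box).
Proof. by apply/integrable_restrict => //; rewrite setTI; exact: integrable_box. Qed.

(** Fubini for the extension of f by zero, whose sections are again extensions by zero. *)
Lemma plane_Sint :
  \int[plane_measure R]_(p in box) f p.1 p.2 = Sint a b (fun x => Sint c d (f x)).
Proof.
rewrite /Rintegral integral_mkcond -integral12_prod_meas1//=.
rewrite /Sint /Rintegral /fubini_F; congr fine.
rewrite [RHS]integral_mkcond; apply: eq_integral => x _.
rewrite /patch; case: ifPn => xab.
- rewrite fineK; last first.
    apply: integrable_fin_num => //; apply: cont_integrable.
    exact: ct_secT (cont2P cf).
  rewrite [RHS]integral_mkcond; apply: eq_integral => y _; rewrite /patch in_setX/= xab/=.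
  by case: ifP.
- by rewrite integral0_eq// => y _; rewrite in_setX/= (negbTE xab).
Qed.

Lemma plane_Sint_swap :
  \int[plane_measure R]_(p in box) f p.1 p.2 = Sint c d (fun y => Sint a b (f^~ y)).
Proof.
rewrite /Rintegral integral_mkcond -integral21_prod_meas1//=.
rewrite /Sint /Rintegral /fubini_G; congr fine.
rewrite [RHS]integral_mkcond; apply: eq_integral => x _.
rewrite /patch; case: ifPn => xab.
- rewrite fineK; last first.
    apply: integrable_fin_num => //; apply: cont_integrable.
    exact: ct_sec2.
  rewrite [RHS]integral_mkcond; apply: eq_integral => y _; rewrite /patch in_setX/= xab/= andbT.
  by case: ifP.
- by rewrite integral0_eq// => y _; rewrite in_setX/= (negbTE xab) andbF.
Qed.

Lemma Sint_Fubini : Sint a b (fun x => Sint c d (f x)) =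
  Sint c d (fun y => Sint a b (f^~ y)).
Proof. by rewrite -plane_Sint plane_Sint_swap. Qed.

End plane_box.

Lemma ct_id (T : topologicalType) : continuous (fun x : T => x).
Proof. by move=> x; exact: cvg_id. Qed.

Lemma ct_fst (T U : topologicalType) : continuous (fun x : T * U => x.1).
Proof. by move=> x; exact: cvg_fst. Qed.

Lemma ct_snd (T U : topologicalType) : continuous (fun x : T * U => x.2).
Proof. by move=> x; exact: cvg_snd. Qed.

Create HintDb cont discriminated.
#[export] Hint Constants Opaque : cont.

Ltac cont2_leaf := match goal with
  | H : cont2 ?f |- cont2 ?f => exact H
  | _ => solve [auto 5 with cont nocore | assumption]
  end.

Ltac cont_step := match goal with
  | |- cont2 (fun _ => _) => apply: Cont2 => /=
  | |- cont2 _ => cont2_leaf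
  | |- continuous (fun _ => ?k) => exact: ct_cst
  | |- continuous (fun x => x) => exact: ct_id
  | |- continuous fst => exact: ct_fst
  | |- continuous snd => exact: ct_snd
  | |- continuous (fun x => _ + _) => apply: ct_add
  | |- continuous (fun x => - _) => apply: ct_opp
  | |- continuous (fun x => _ * _) => apply: ct_mul
  | |- continuous (fun x => _ ^+ _) => apply: ct_exp
  | |- continuous (fun x => `|_|) => apply: ct_norm
  | |- continuous (fun x => Sint _ _ _) => apply: continuous_Sint
  | |- continuous ( *%R ?s) => change (continuous (fun t => s * t))
  | |- continuous ( +%R ?s) => change (continuous (fun t => s + t))
  | |- continuous ( -%R) => change (continuous (fun t => - t))
  | |- continuous (fun x => x.1) => exact: ct_fst
  | |- continuous (fun x => x.2) => exact: ct_snd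
  | |- continuous (fun x => (@?f x).1) => apply: (@ct_comp _ _ _ f fst); [exact: ct_fst|]
  | |- continuous (fun x => (@?f x).2) => apply: (@ct_comp _ _ _ f snd); [exact: ct_snd|]
  | |- continuous (fun x => ?f (@?a x) (@?b x)) => apply: (@ct_2 _ _ f a b); [cont2_leaf| |]
  | |- continuous (fun x => ?f (@?a x)) => is_var f; apply: (@ct_1 _ _ f a); [assumption|]
  | |- continuous ?f => is_var f; assumption
  | |- continuous (?f _) => apply: ct_sec; cont2_leaf
  end.

Ltac prove_cont := repeat cont_step.

(** * Derivatives and primitives on the real line *)

Definition der (R : realType) (f f' : R -> R) :=
  forall x, is_derive x (1:R) f (f' x).

Section der.
Context {R : realType}.
Implicit Types f g : R -> R.

Lemma der_eq f g g' : der f g -> g =1 g' -> der f g'.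
Proof. by move=> fg gg x; rewrite -gg. Qed.

Lemma der_cst (k : R) : der (fun=> k) (fun=> 0).
Proof. by move=> x; exact: is_derive_cst. Qed.

Lemma der_id : der (fun x : R => x) (fun=> 1).
Proof. by move=> x; exact: is_derive_id. Qed.

Lemma der_add f f' g g' : der f f' -> der g g' ->
  der (fun x => f x + g x) (fun x => f' x + g' x).
Proof. by move=> df dg x; have a := df x; have b := dg x; exact: is_deriveD. Qed.

Lemma der_opp f f' : der f f' -> der (fun x => - f x) (fun x => - f' x).
Proof. by move=> df x; have a := df x; exact: is_deriveN. Qed.

Lemma der_mul f f' g g' : der f f' -> der g g' ->
  der (fun x => f x * g x) (fun x => f' x * g x + f x * g' x).
Proof.
move=> df dg x; have a := df x; have b := dg x.
have := is_deriveM a b; rewrite /GRing.scale/= addrC mulrC => D.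
rewrite [f' x * _]mulrC (_ : (fun x => _) = g * f)//.
by apply/funext => t /=; rewrite mulrC.
Qed.

Lemma der_comp f f' g g' : der f f' -> der g g' ->
  der (fun x => f (g x)) (fun x => f' (g x) * g' x).
Proof. by move=> df dg x; exact: is_derive1_comp (df (g x)) (dg x). Qed.

Lemma der_exp f f' n : der f f' ->
  der (fun x => f x ^+ n) (fun x => n%:R * f x ^+ n.-1 * f' x).
Proof.
move=> df; elim: n => [|n IH].
  by apply: der_eq (der_cst 1) _ => x; rewrite !mul0r.
have -> : (fun x => f x ^+ n.+1) = (fun x => f x * f x ^+ n).
  by apply/funext => x; rewrite exprS.
apply: der_eq (der_mul df IH) _ => x /=; case: n {IH} => [|n] /=.
  by rewrite expr0; ring.
by rewrite -[in RHS](natr1 n.+1) !exprS; ring.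
Qed.

Lemma der_cont f f' : der f f' -> continuous f.
Proof.
by move=> df x; apply/differentiable_continuous/derivable1_diffP; case: (df x).
Qed.

End der.

Ltac der_step := match goal with
  | |- der _ _ => eassumption
  | |- der (fun _ => ?k) _ => exact: der_cst
  | |- der (fun x => x) _ => exact: der_id
  | |- der ( *%R ?s) _ => eapply (@der_mul _ (fun=> s) _ (fun t => t) _)
  | |- der ( +%R ?s) _ => eapply (@der_add _ (fun=> s) _ (fun t => t) _)
  | |- der (fun x => _ + _) _ => apply: der_add
  | |- der (fun x => - _) _ => apply: der_opp
  | |- der (fun x => _ * _) _ => apply: der_mul
  | |- der (fun x => _ ^+ _) _ => apply: der_exp
  | |- der (fun x => ?f (@?a x)) _ => is_var f; eapply (@der_comp _ f _ a); [eassumption|]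
  end.
(** The rules synthesise the derivative as an existential variable; what is left is its pointwise
    equality with the announced one. *)
Ltac prove_der := eapply der_eq; [solve [repeat der_step] | move=> ? /=].

Section primitive.
Context {R : realType}.
Implicit Types (f g : R -> R) (a b c x : R).

(** The oriented integral from 0 to x: [Sint] vanishes when its bounds are reversed, so at most one
    of the two terms is nonzero. *)
Definition prim f x := Sint 0 x f - Sint x 0 f.

Lemma Sint_degen a b f : b <= a -> Sint a b f = 0.
Proof.
rewrite le_eqVlt => /predU1P[->|ba]; first by rewrite /Sint set_itv1 Rintegral_set1.
by rewrite /Sint set_itv_ge ?Rintegral_set0// bnd_simp -ltNge.
Qed.

Lemma primE m f x : m <= 0 -> m <= x -> continuous f ->
  prim f x = Sint m x f - Sint m 0 f.
Proof.
move=> m0 mx cf; rewrite /prim; have [x0|/ltW x0] := leP 0 x.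
  by rewrite (Sint_degen _ x0) (Sint_split m0 x0 cf); ring.
by rewrite (Sint_degen _ x0) (Sint_split mx x0 cf); ring.
Qed.

Lemma is_derive_prim f x : continuous f -> is_derive x (1:R) (prim f) (f x).
Proof.
(* A lower bound strictly below both 0 and x turns [prim f] near x into a single integral with a
   fixed left end, up to a constant. *)
move=> cf; pose m := Num.min 0 x - 1.
have m0 : m < 0 by rewrite /m ltrBlDr add0r gt_min ltr01.
have mx : m < x by rewrite /m ltrBlDr gt_min [x < _ + _]ltrDl ltr01 orbT.
have D : is_derive x (1:R) (fun t => Sint m t f - Sint m 0 f) (f x).
  rewrite -[f x]subr0; apply: is_deriveB; exact: is_derive_Sint.
apply: near_eq_is_derive D => //.
near=> t; rewrite (primE (m := m)) ?(ltW m0)//; apply/ltW.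
by near: t; exact: lt_nbhsr.
Unshelve. all: by end_near.
Qed.

Lemma Sint_prim f a b : a <= b -> continuous f -> Sint a b f = prim f b - prim f a.
Proof.
by move=> ab cf; apply: Sint_FTC => // x; exact: is_derive_prim.
Qed.

Lemma Sint_shift f a b c : a <= b -> continuous f ->
  Sint a b (fun x => f (x + c)) = Sint (a + c) (b + c) f.
Proof.
move=> ab cf; rewrite [RHS]Sint_prim ?lerD2r//.
have cf' : continuous (fun x => f (x + c)).
  by prove_cont.
apply: (Sint_FTC (F := fun x => prim f (x + c))) => // x.
have dp : der (prim f) f by move=> t; exact: is_derive_prim.
have D : der (fun x => prim f (x + c)) (fun x => f (x + c)).
  by apply: der_eq (der_comp dp (der_add (@der_id R) (der_cst c))) _ => y; rewrite addr0 mulr1.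
exact: D.
Qed.

Lemma der_nondecreasing f f' a b : a <= b -> der f f' ->
  (forall x, a <= x <= b -> 0 <= f' x) -> f a <= f b.
Proof.
move=> ab df f0.
apply: (@ger0_derive1_ndecr R f a b) => //.
- by move=> x _; case: (df x).
- move=> x; rewrite in_itv/= => /andP[ax xb].
  by rewrite derive1E (@derive_val _ _ _ _ _ _ _ (df x)) f0// !ltW.
- by apply: continuous_subspaceT; exact: der_cont df.
Qed.

(** The primitive of f is nondecreasing with equal values at both ends, hence constant, so its
    derivative f vanishes inside; the end points follow by one-sided limits. *)
Lemma Sint_eq0 f a b : a < b -> continuous f -> (forall x, 0 <= f x) ->
  Sint a b f = 0 -> forall x, a <= x <= b -> f x = 0.
Proof.
move=> ab cf f0 S0.
have p0 x : a <= x -> x <= b -> prim f x = prim f a.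
  move=> ax xb; have dp : der (prim f) f by move=> t; exact: is_derive_prim.
  apply/eqP; rewrite eq_le; apply/andP; split.
  - have := der_nondecreasing xb dp (fun t _ => f0 t).
    have := Sint_prim (ltW ab) cf; rewrite S0 => E; lra.
  - exact: (der_nondecreasing ax dp (fun t _ => f0 t)).
have f1 x : a < x -> x < b -> f x = 0.
  move=> ax xb; have D := is_derive_prim x cf.
  have : is_derive x (1:R) (prim f) 0.
    apply: near_eq_is_derive (is_derive_cst (prim f a) x 1) => //.
    near=> t; rewrite p0//; apply/ltW; near: t.
      exact: lt_nbhsr.
    exact: lt_nbhsl.
  by move=> D'; rewrite -(@derive_val _ _ _ _ _ _ _ D) (@derive_val _ _ _ _ _ _ _ D').
have fe x : a < x -> x < b -> f x = f ((a + b) / 2) by move=> ax xb; rewrite !f1//; lra.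
move=> x /andP[].
rewrite le_eqVlt => /predU1P[<- _|ax].
  have : f @ a^'+ --> f a by apply: cvg_at_right_filter; exact: cf.
  have : f @ a^'+ --> (0 : R).
    apply: cvg_near_cst; near=> t; apply: f1; first by near: t; exact: nbhs_right_gt.
    by near: t; exact: nbhs_right_lt.
  by move=> /cvg_lim <- // /cvg_lim <-.
rewrite le_eqVlt => /predU1P[->|xb]; last exact: f1.
have : f @ b^'- --> f b by apply: cvg_at_left_filter; exact: cf.
have : f @ b^'- --> (0 : R).
  apply: cvg_near_cst; near=> t; apply: f1; last by near: t; exact: nbhs_left_lt.
  by near: t; exact: nbhs_left_gt.
by move=> /cvg_lim <- // /cvg_lim <-.
Unshelve. all: by end_near. Qed.

(** Expansion of the nonnegative variance of g about its mean. *)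
Lemma Sint_sqr g : continuous g -> Sint 0 1 g ^+ 2 <= Sint 0 1 (fun x => g x ^+ 2).
Proof.
move=> cg; set m := Sint 0 1 g.
have : 0 <= Sint 0 1 (fun x => (g x - m) ^+ 2) by apply: Sint_ge0 => x _; exact: sqr_ge0.
have -> : Sint 0 1 (fun x => (g x - m) ^+ 2) =
    Sint 0 1 (fun x => g x ^+ 2 + ((- 2 * m) * g x + m ^+ 2)).
  by apply: eq_Sint => x _; ring.
rewrite SintD; [|by prove_cont|by prove_cont].
rewrite SintD; [|by prove_cont|by prove_cont].
rewrite SintZ// Sint_cst// -/m => H; lra.
Qed.

End primitive.

Global Opaque Sint prim.

(** * Integrals over centred squares *)

Section plane.
Context {R : realType}.
Implicit Types (f g : R -> R -> R) (a b c r s N : R).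

Definition Ibox N f := Sint (- N) N (fun x => Sint (- N) N (f x)).

(** The boundary of the square is included, so that boundary terms vanish in integrations by parts
    over it. *)
Definition bsupp r f := forall x y, r <= `|x| \/ r <= `|y| -> f x y = 0.

Definition D1 f g := forall y, der (f^~ y) (g^~ y).
Definition D2 f g := forall x, der (f x) (g x).

Lemma IboxD N f g : cont2 f -> cont2 g ->
  Ibox N (fun x y => f x y + g x y) = Ibox N f + Ibox N g.
Proof.
move=> cf cg; rewrite /Ibox -SintD; [|by prove_cont|by prove_cont].
by apply: eq_Sint => x _; rewrite SintD//; exact: ct_sec.
Qed.

Lemma IboxZ N k f : cont2 f -> Ibox N (fun x y => k * f x y) = k * Ibox N f.
Proof.
move=> cf; rewrite /Ibox -SintZ; last by prove_cont.
by apply: eq_Sint => x _; rewrite SintZ//; exact: ct_sec.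
Qed.

Lemma IboxN N f : cont2 f -> Ibox N (fun x y => - f x y) = - Ibox N f.
Proof.
move=> cf; rewrite /Ibox -SintN; last by prove_cont.
by apply: eq_Sint => x _; rewrite SintN//; exact: ct_sec.
Qed.

Lemma IboxB N f g : cont2 f -> cont2 g ->
  Ibox N (fun x y => f x y - g x y) = Ibox N f - Ibox N g.
Proof.
by move=> cf cg; rewrite IboxD// ?IboxN//; prove_cont.
Qed.

Lemma le_Ibox N f g : cont2 f -> cont2 g ->
  (forall x y, `|x| <= N -> `|y| <= N -> f x y <= g x y) ->
  Ibox N f <= Ibox N g.
Proof.
move=> cf cg fg; apply: le_Sint; [by prove_cont|by prove_cont|] => x xN.
apply: le_Sint; [exact: ct_sec|exact: ct_sec|] => y yN.
by apply: fg; rewrite ler_norml.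
Qed.

Lemma eq_Ibox N f g : (forall x y, `|x| <= N -> `|y| <= N -> f x y = g x y) ->
  Ibox N f = Ibox N g.
Proof.
move=> fg; apply: eq_Sint => x xN; apply: eq_Sint => y yN.
by apply: fg; rewrite ler_norml.
Qed.

Lemma Ibox_ge0 N f : (forall x y, `|x| <= N -> `|y| <= N -> 0 <= f x y) ->
  0 <= Ibox N f.
Proof.
move=> f0; apply: Sint_ge0 => x xN; apply: Sint_ge0 => y yN.
by apply: f0; rewrite ler_norml.
Qed.

Lemma Ibox_cst N k : 0 <= N -> Ibox N (fun _ _ => k) = k * (4 * N ^+ 2).
Proof.
move=> N0; have NN : - N <= N by lra.
by rewrite /Ibox !Sint_cst//; ring.
Qed.

Lemma Ibox_norm N f : cont2 f -> `|Ibox N f| <= Ibox N (fun x y => `|f x y|).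
Proof.
move=> cf; rewrite (le_trans (Sint_norm _ _ _))//; first by prove_cont.
apply: le_Sint; [by prove_cont|by prove_cont|] => x _.
by apply: Sint_norm; exact: ct_sec.
Qed.

Lemma Ibox_swap N f : cont2 f ->
  Ibox N f = Sint (- N) N (fun y => Sint (- N) N (f^~ y)).
Proof. by move=> cf; rewrite /Ibox Sint_Fubini. Qed.

Lemma Sint_supp (g : R -> R) r a b : continuous g -> 0 <= r -> a <= - r -> r <= b ->
  (forall x, r <= `|x| -> g x = 0) -> Sint a b g = Sint (- r) r g.
Proof.
move=> cg r0 ar rb g0.
have z c d : (forall x, c <= x <= d -> r <= `|x|) -> Sint c d g = 0.
  move=> H; rewrite (@eq_Sint _ _ _ _ (fun=> 0)); last by move=> x /H /g0.
  by have [cd|/ltW dc] := leP c d; [rewrite Sint_cst ?mul0r|rewrite Sint_degen].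
have rr : - r <= r by lra.
have rb' : - r <= b by lra.
rewrite (Sint_split ar rb' cg) (Sint_split rr rb cg) (z a) ?(z r) ?addr0 ?add0r => [//|x xab|x xab].
- by rewrite ler_normr; apply/orP; left; lra.
- by rewrite ler_normr; apply/orP; right; lra.
Qed.

Lemma Ibox_supp N r f : cont2 f -> 0 <= r <= N -> bsupp r f ->
  Ibox N f = Ibox r f.
Proof.
move=> cf /andP[r0 rN] fr; rewrite /Ibox.
have rN' : - N <= - r by lra.
have NN : - N <= N by lra.
rewrite [LHS](@Sint_supp _ r _ _ _ r0 rN' rN); first last.
- move=> x rx; rewrite (@eq_Sint _ _ _ _ (fun=> 0)) ?Sint_cst ?mul0r//.
  by move=> y _; apply: fr; left.
- by prove_cont.
apply: eq_Sint => x _; apply: (Sint_supp (ct_sec cf) r0 rN' rN).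
by move=> y ry; apply: fr; right.
Qed.

Lemma Ibox_le_dom N N' f : cont2 f -> 0 <= N <= N' -> (forall x y, 0 <= f x y) ->
  Ibox N f <= Ibox N' f.
Proof.
move=> cf /andP[N0 NN] f0.
have sub (g : R -> R) : continuous g -> (forall x, 0 <= g x) ->
    Sint (- N) N g <= Sint (- N') N' g.
  move=> cg g0.
  have h1 : - N' <= - N by lra.
  have h2 : - N <= N' by lra.
  have h3 : - N <= N by lra.
  rewrite (Sint_split h1 h2 cg) (Sint_split h3 NN cg).
  have := Sint_ge0 (a := - N') (b := - N) (fun x _ => g0 x).
  have := Sint_ge0 (a := N) (b := N') (fun x _ => g0 x); lra.
apply: le_trans (sub _ _ _); last 2 first.
- by prove_cont.
- by move=> x; apply: Sint_ge0.
apply: le_Sint; [by prove_cont|by prove_cont|] => x _.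
by apply: sub; [exact: ct_sec|].
Qed.

Lemma Sint_shift_supp (g : R -> R) r N a : continuous g -> 0 <= r -> r + `|a| <= N ->
  (forall x, r <= `|x| -> g x = 0) ->
  Sint (- N) N (fun x => g (x + a)) = Sint (- N) N g.
Proof.
move=> cg r0 raN g0.
have := ler_norm a; have := ler_norm (- a); rewrite normrN => a1 a2.
by rewrite Sint_shift ?[LHS](Sint_supp (r := r)) ?[RHS](Sint_supp (r := r))//; lra.
Qed.

Lemma Ibox_shift N r f a b : cont2 f -> 0 <= r -> bsupp r f ->
  r + `|a| <= N -> r + `|b| <= N ->
  Ibox N (fun x y => f (x + a) (y + b)) = Ibox N f.
Proof.
move=> cf r0 fr raN rbN; rewrite /Ibox.
rewrite (@eq_Sint _ _ _ _ (fun x => Sint (- N) N (f (x + a)))); last first.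
  move=> x _; rewrite (Sint_shift_supp (r := r))//; first exact: ct_sec.
  by move=> y ry; apply: fr; right.
rewrite (Sint_shift_supp (r := r) (g := fun x => Sint (- N) N (f x)))//.
  by prove_cont.
have aa := normr_ge0 a.
move=> x rx; rewrite (@eq_Sint _ _ _ _ (fun=> 0)) ?Sint_cst ?mul0r//; first lra.
by move=> y _; apply: fr; left.
Qed.

Lemma Ibox_D1 N f f1 : 0 <= N -> D1 f f1 -> cont2 f1 -> bsupp N f -> Ibox N f1 = 0.
Proof.
move=> N0 df cf fN; rewrite Ibox_swap//.
have NN : - N <= N by lra.
rewrite (@eq_Sint _ _ _ _ (fun=> 0)) ?Sint_cst ?mul0r// => y _.
have cfy : continuous (f1^~ y) by exact: ct_sec2.
rewrite (Sint_FTC NN cfy (df y)).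
by rewrite !fN ?subrr//; left; rewrite ?normrN ger0_norm.
Qed.

Lemma Ibox_D2 N f f2 : 0 <= N -> D2 f f2 -> cont2 f2 -> bsupp N f -> Ibox N f2 = 0.
Proof.
move=> N0 df cf fN; rewrite /Ibox.
have NN : - N <= N by lra.
rewrite (@eq_Sint _ _ _ _ (fun=> 0)) ?Sint_cst ?mul0r// => x _.
rewrite (Sint_FTC NN (ct_sec cf) (df x)).
by rewrite !fN ?subrr//; right; rewrite ?normrN ger0_norm.
Qed.

End plane.

(** * Steklov averages *)

Section average.
Context {R : realType}.
Implicit Types (f g : R -> R -> R) (a b c r s N : R).

(** Mean of f over the horizontal segment from x to x + s; the rescaling to [[0, 1]] makes it
    meaningful for every s, negative values included. *)
Definition steklov1 s f x y := Sint 0 1 (fun t => f (x + s * t) y).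
Definition steklov2 s f x y := Sint 0 1 (fun t => f x (y + s * t)).

Lemma cont2_A1 s f : cont2 f -> cont2 (steklov1 s f).
Proof. by move=> cf; rewrite /steklov1; prove_cont. Qed.

Lemma cont2_A2 s f : cont2 f -> cont2 (steklov2 s f).
Proof. by move=> cf; rewrite /steklov2; prove_cont. Qed.

Hint Resolve cont2_A1 cont2_A2 : cont.

Lemma Sint01_affine (g G : R -> R) s x : s != 0 -> continuous g -> der G g ->
  Sint 0 1 (fun t => g (x + s * t)) = (G (x + s) - G x) / s.
Proof.
move=> s0 cg dG.
have cg' : continuous (fun t => g (x + s * t)) by prove_cont.
have dG' : der (fun t => s^-1 * G (x + s * t)) (fun t => g (x + s * t)).
  by prove_der; field.
rewrite (Sint_FTC ler01 cg' dG') mulr1 mulr0 addr0; field.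
by rewrite s0.
Qed.

Lemma A1_D1 s f f1 : s != 0 -> cont2 f1 -> D1 f f1 ->
  steklov1 s f1 = fun x y => (f (x + s) y - f x y) / s.
Proof.
move=> s0 cf df; apply/funext => x; apply/funext => y.
by rewrite /steklov1 (Sint01_affine x s0 (ct_sec2 (y := y) cf) (df y)).
Qed.

Lemma A2_D2 s f f2 : s != 0 -> cont2 f2 -> D2 f f2 ->
  steklov2 s f2 = fun x y => (f x (y + s) - f x y) / s.
Proof.
move=> s0 cf df; apply/funext => x; apply/funext => y.
by rewrite /steklov2 (Sint01_affine y s0 (ct_sec cf) (df x)).
Qed.

Lemma der_dq (P p : R -> R) s : der P p ->
  der (fun x => (P (x + s) - P x) / s) (fun x => (p (x + s) - p x) / s).
Proof. by move=> dP; prove_der; ring. Qed.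

(** Averaging gains one derivative: f is only continuous, yet its average is differentiable, with
    the difference quotient as exact derivative. Together with [A1_D1] this lets quotients play the
    role of derivatives. *)
Lemma D1_A1 s f : s != 0 -> cont2 f ->
  D1 (steklov1 s f) (fun x y => (f (x + s) y - f x y) / s).
Proof.
move=> s0 cf y.
have dp : der (prim (f^~ y)) (f^~ y) by move=> t; apply: is_derive_prim; exact: ct_sec2.
rewrite (_ : (steklov1 s f)^~ y = fun x => (prim (f^~ y) (x + s) - prim (f^~ y) x) / s).
  exact: der_dq dp.
by apply/funext => x; rewrite /steklov1 (Sint01_affine x s0 (ct_sec2 (y := y) cf) dp).
Qed.

Lemma D2_A2 s f : s != 0 -> cont2 f ->
  D2 (steklov2 s f) (fun x y => (f x (y + s) - f x y) / s).
Proof.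
move=> s0 cf x.
have cfx : continuous (f x) by exact: ct_sec.
have dp : der (prim (f x)) (f x) by move=> t; exact: is_derive_prim.
rewrite (_ : steklov2 s f x = fun y => (prim (f x) (y + s) - prim (f x) y) / s).
  exact: der_dq dp.
by apply/funext => y; rewrite /steklov2 (Sint01_affine y s0 cfx dp).
Qed.

Lemma A12 s s' f : cont2 f -> steklov1 s (steklov2 s' f) = steklov2 s' (steklov1 s f).
Proof.
move=> cf; apply/funext => x; apply/funext => y; rewrite /steklov1 /steklov2.
rewrite (@Sint_Fubini _ (fun t t' => f (x + s * t) (y + s' * t')))//.
by prove_cont.
Qed.

Lemma A1_sqr s f x y : cont2 f -> steklov1 s f x y ^+ 2 <= steklov1 s (fun x y => f x y ^+ 2) x y.
Proof. by move=> cf; apply: Sint_sqr; prove_cont. Qed.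

Lemma A2_sqr s f x y : cont2 f -> steklov2 s f x y ^+ 2 <= steklov2 s (fun x y => f x y ^+ 2) x y.
Proof. by move=> cf; apply: Sint_sqr; prove_cont. Qed.

(** For each t the translation by s t is transposed onto the compactly supported g, and Fubini
    exchanges the average with the plane integral. Thus the adjoint of the average with step s is
    the one with step - s. *)
Lemma Ibox_A1 s r N f g : cont2 f -> cont2 g -> 0 <= r -> bsupp r g ->
  r + `|s| <= N ->
  Ibox N (fun x y => g x y * steklov1 s f x y) = Ibox N (fun x y => steklov1 (- s) g x y * f x y).
Proof.
move=> cf cg r0 gr rsN; rewrite /Ibox /steklov1.
transitivity (Sint 0 1 (fun t => Ibox N (fun x y => g x y * f (x + s * t) y))).
  rewrite /Ibox (Sint_Fubini (f := fun t x => Sint (- N) N (fun y => g x y * f (x + s * t) y))); last by prove_cont.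
  apply: eq_Sint => x _.
  rewrite (Sint_Fubini (f := fun t y => g x y * f (x + s * t) y)); last by prove_cont.
  by apply: eq_Sint => y _; rewrite SintZ//; prove_cont.
transitivity (Sint 0 1 (fun t => Ibox N (fun x y => g (x + - s * t) y * f x y))).
  apply: eq_Sint => t /andP[t0 t1].
  rewrite -(@Ibox_shift _ N r (fun x y => g x y * f (x + s * t) y) (- s * t) 0 _ r0).
  - by apply: eq_Ibox => x y _ _; rewrite addr0 mulNr subrK.
  - by prove_cont.
  - by move=> x y xy; rewrite gr ?mul0r.
  - rewrite normrM normrN (ger0_norm t0); apply: le_trans rsN.
    by rewrite lerD2l ler_piMr.
  - by rewrite normr0 addr0; have := normr_ge0 s; lra.
rewrite /Ibox (Sint_Fubini (f := fun t x => Sint (- N) N (fun y => g (x + - s * t) y * f x y))); last by prove_cont.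
apply: eq_Sint => x _.
rewrite (Sint_Fubini (f := fun t y => g (x + - s * t) y * f x y)); last by prove_cont.
apply: eq_Sint => y _; rewrite [RHS]mulrC -SintZ; last by prove_cont.
by apply: eq_Sint => t _; rewrite mulrC.
Qed.

Lemma Ibox_A2 s r N f g : cont2 f -> cont2 g -> 0 <= r -> bsupp r g ->
  r + `|s| <= N ->
  Ibox N (fun x y => g x y * steklov2 s f x y) = Ibox N (fun x y => steklov2 (- s) g x y * f x y).
Proof.
move=> cf cg r0 gr rsN.
have cAf : cont2 (steklov2 s f) by exact: cont2_A2.
have cAg : cont2 (steklov2 (- s) g) by exact: cont2_A2.
rewrite !Ibox_swap; [|by prove_cont|by prove_cont].
(* Exchanging the coordinates reduces the vertical average to the horizontal one. *)
pose tr (h : R -> R -> R) x y := h y x.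
have ctr h : cont2 h -> cont2 (tr h) by move=> ch; rewrite /tr; prove_cont.
have := @Ibox_A1 s r N (tr f) (tr g) (ctr _ cf) (ctr _ cg) r0 _ rsN; apply.
by move=> x y [xr|yr]; apply: gr; [right|left].
Qed.

Definition unif_small (F : R -> R -> R -> R) := forall r k, 0 < k ->
  \forall s \near 0^'+, forall x y, `|x| <= r -> `|y| <= r -> `|F s x y| <= k.

(** Uniform continuity on a square by compactness; the displaced point may leave the square. *)
Lemma cont2_unif f r k : cont2 f -> 0 < k -> exists2 d : R, 0 < d &
  forall x y a b, `|x| <= r -> `|y| <= r -> `|a| <= d -> `|b| <= d ->
    `|f (x + a) (y + b) - f x y| <= k.
Proof.
move=> cf k0.
have Hn : \forall ab \near ((0, 0) : R * R), (`[- r, r] `*` `[- r, r])%classic `<=`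
    (fun p : R * R => `|f (p.1 + ab.1) (p.2 + ab.2) - f p.1 p.2| <= k).
  pose K : set (R * R) := `[- r, r] `*` `[- r, r].
  have cK : compact K by apply: compact_setX; exact: segment_compact.
  have := (@compact_near_coveringP _ K).1 cK _ (nbhs ((0, 0) : R * R))
    (fun ab p => `|f (p.1 + ab.1) (p.2 + ab.2) - f p.1 p.2| <= k) _.
  apply => p _.
  have c : continuous (fun q : (R * R) * (R * R) =>
      f (q.1.1 + q.2.1) (q.1.2 + q.2.2) - f q.1.1 q.1.2).
    have c11 : continuous (fun q : (R * R) * (R * R) => q.1.1) := ct_comp (@ct_fst R R) (@ct_fst _ _).
    have c12 : continuous (fun q : (R * R) * (R * R) => q.1.2) := ct_comp (@ct_snd R R) (@ct_fst _ _).
    have c21 : continuous (fun q : (R * R) * (R * R) => q.2.1) := ct_comp (@ct_fst R R) (@ct_snd _ _).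
    have c22 : continuous (fun q : (R * R) * (R * R) => q.2.2) := ct_comp (@ct_snd R R) (@ct_snd _ _).
    by prove_cont.
  have := c (p, (0, 0)); move/cvgrPdist_le => /(_ _ k0) /=.
  by rewrite !addr0 subrr; under eq_near do rewrite sub0r normrN.
case/nbhs_ballP : Hn => e /= e0 He.
exists (e / 2) => [|x y a b xr yr ad bd]; first by rewrite divr_gt0.
have h (z : R) : `|z| <= e / 2 -> ball (0 : R) e z.
  by rewrite /ball/= sub0r normrN => /le_lt_trans; apply; rewrite ltr_pdivrMr// ltr_pMr// ltr1n.
apply: (He (a, b) _ (x, y)); first by split; exact: h.
by split; rewrite /= in_itv/= -ler_norml.
Qed.

End average.

#[export] Hint Resolve cont2_A1 cont2_A2 : cont.

Global Opaque Ibox.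

(** * Limits as the step s tends to 0 from the right *)

Section limits.
Context {R : realType}.
Implicit Types (f g : R -> R -> R) (F G : R -> R -> R -> R) (X Y : R -> R).

Definition small X := forall k, 0 < k -> \forall s \near 0^'+, `|X s| <= k.

Definition bdd X := exists C, \forall s \near 0^'+, X s <= C.

Definition unif_cvg F f := unif_small (fun s x y => F s x y - f x y).

Lemma near01 : \forall s \near (0:R)^'+, 0 < s <= 1.
Proof.
near=> s; apply/andP; split; first by near: s; exact: nbhs_right_gt.
by near: s; apply: nbhs_right_le.
Unshelve. all: by end_near. Qed.

Lemma small0 : small (fun=> 0).
Proof. by move=> k k0; near=> s; rewrite normr0 ltW. Unshelve. all: by end_near. Qed.

Lemma smallD X Y : small X -> small Y -> small (fun s => X s + Y s).
Proof.
move=> sX sY k k0; have k2 : 0 < k / 2 by rewrite divr_gt0.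
have hX := sX _ k2; have hY := sY _ k2.
near=> s; rewrite (le_trans (ler_normD _ _))// (splitr k) lerD//.
- by near: s; exact: hX.
- by near: s; exact: hY.
Unshelve. all: by end_near. Qed.

Lemma smallN X : small X -> small (fun s => - X s).
Proof.
move=> sX k k0; have hX := sX _ k0; near=> s; rewrite normrN.
by near: s; exact: hX.
Unshelve. all: by end_near. Qed.

Lemma small_eq X Y : small X -> (\forall s \near 0^'+, Y s = X s) -> small Y.
Proof.
move=> sX E k k0; have hX := sX _ k0; near=> s.
have -> : Y s = X s by near: s; exact: E.
by near: s; exact: hX.
Unshelve. all: by end_near. Qed.

Lemma unif_smallD F G : unif_small F -> unif_small G -> unif_small (fun s x y => F s x y + G s x y).
Proof.
move=> uF uG r k k0; have k2 : 0 < k / 2 by rewrite divr_gt0.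
have hF := uF r _ k2; have hG := uG r _ k2.
near=> s => x y xr yr; rewrite (le_trans (ler_normD _ _))// (splitr k) lerD//.
- by move: x y xr yr; near: s; exact: hF.
- by move: x y xr yr; near: s; exact: hG.
Unshelve. all: by end_near. Qed.

Lemma unif_smallN F : unif_small F -> unif_small (fun s x y => - F s x y).
Proof.
move=> uF r k k0; have hF := uF r _ k0.
by near=> s => x y xr yr; rewrite normrN; move: x y xr yr; near: s.
Unshelve. all: by end_near. Qed.

Lemma unif_small_eq F G : unif_small F -> (\forall s \near 0^'+, G s = F s) -> unif_small G.
Proof.
move=> uF E r k k0; have hF := uF r _ k0.
near=> s => x y xr yr.
have -> : G s = F s by near: s; exact: E.
by move: x y xr yr; near: s; exact: hF.
Unshelve. all: by end_near. Qed.

Lemma unif_smallM F G : unif_small F -> unif_small G -> unif_small (fun s x y => F s x y * G s x y).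
Proof.
move=> uF uG r k k0; have hF := uF r _ k0; have hG := uG r _ ltr01.
near=> s => x y xr yr; rewrite normrM -[k]mulr1 ler_pM//.
- by move: x y xr yr; near: s; exact: hF.
- by move: x y xr yr; near: s; exact: hG.
Unshelve. all: by end_near. Qed.

Lemma cont2_bounded f r : cont2 f ->
  exists2 C, 0 < C & forall x y, `|x| <= r -> `|y| <= r -> `|f x y| <= C.
Proof.
move=> cf.
have [|C C0 HC] := @compact_cont_bounded R (R * R)%type (`[- r, r] `*` `[- r, r]) _ _ (cont2P cf).
  by apply: compact_setX; exact: segment_compact.
exists (C + 1) => [|x y xr yr]; first by rewrite ltr_wpDl.
rewrite (le_trans (HC (x, y) _)) ?lerDl//.
by split; rewrite /= in_itv/= -ler_norml.
Qed.

Lemma unif_smallMc F g : unif_small F -> cont2 g -> unif_small (fun s x y => F s x y * g x y).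
Proof.
move=> uF cg r k k0; have [C C0 HC] := cont2_bounded r cg.
have kC : 0 < k / C by rewrite divr_gt0.
have hF := uF r _ kC.
near=> s => x y xr yr; rewrite normrM -[k](divfK (lt0r_neq0 C0)) ler_pM//.
- by move: x y xr yr; near: s; exact: hF.
- exact: HC.
Unshelve. all: by end_near. Qed.

Lemma unif_cvg_cst f : unif_cvg (fun=> f) f.
Proof.
by move=> r k k0; near=> s => x y _ _; rewrite subrr normr0 ltW.
Unshelve. all: by end_near. Qed.

Lemma unif_cvgD F G f g : unif_cvg F f -> unif_cvg G g ->
  unif_cvg (fun s x y => F s x y + G s x y) (fun x y => f x y + g x y).
Proof.
move=> uF uG; apply: unif_small_eq (unif_smallD uF uG) _; near=> s.
by apply/funext => x; apply/funext => y; ring.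
Unshelve. all: by end_near. Qed.

Lemma unif_cvgN F f : unif_cvg F f -> unif_cvg (fun s x y => - F s x y) (fun x y => - f x y).
Proof.
move=> uF; apply: unif_small_eq (unif_smallN uF) _; near=> s.
by apply/funext => x; apply/funext => y; ring.
Unshelve. all: by end_near. Qed.

Lemma unif_cvgM F G f g : cont2 f -> cont2 g -> unif_cvg F f -> unif_cvg G g ->
  unif_cvg (fun s x y => F s x y * G s x y) (fun x y => f x y * g x y).
Proof.
move=> cf cg uF uG.
apply: unif_small_eq (unif_smallD (unif_smallM uF uG) (unif_smallD (unif_smallMc uF cg) (unif_smallMc uG cf))) _; near=> s.
by apply/funext => x; apply/funext => y; ring.
Unshelve. all: by end_near. Qed.

Lemma unif_cvg_shift f a b : cont2 f -> unif_cvg (fun s x y => f (x + s * a) (y + s * b)) f.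
Proof.
move=> cf r k k0; have [d d0 Hd] := cont2_unif r cf k0.
have h (c : R) : \forall s \near (0:R)^'+, `|s * c| <= d.
  near=> s; rewrite normrM.
  have s0 : 0 < s by near: s; exact: nbhs_right_gt.
  rewrite (gtr0_norm s0) (le_trans (y := s * (`|c| + 1)))//.
    by rewrite ler_pM2l// lerDl.
  rewrite -ler_pdivlMr ?ltr_wpDl//; near: s; apply: nbhs_right_le.
  by rewrite divr_gt0// ltr_wpDl.
near=> s => x y xr yr; apply: Hd => //.
- by near: s; exact: h.
- by near: s; exact: h.
Unshelve. all: by end_near. Qed.

Lemma Sint01_near (g h : R -> R) k : continuous g ->
  (forall t, 0 <= t <= 1 -> `|g t - k| <= h 0) -> `|Sint 0 1 g - k| <= h 0.
Proof.
move=> cg H.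
have -> : Sint 0 1 g - k = Sint 0 1 (fun t => g t + - k).
  by rewrite SintD ?Sint_cst//; [ring|exact: ct_cst].
have cgk : continuous (fun t => g t + - k) by prove_cont.
rewrite (le_trans (Sint_norm _ _ cgk))//.
rewrite (le_trans (@le_Sint _ _ _ _ (fun=> h 0) _ _ H))//; [by prove_cont|exact: ct_cst|].
by rewrite Sint_cst// subr0 mulr1.
Qed.

(** The factor e of modulus at most 1 treats the averages with steps s and - s, adjoint to each
    other, at once. *)
Lemma unif_cvg_A1 F f e : `|e| <= 1 -> cont2 f -> (forall s, cont2 (F s)) -> unif_cvg F f ->
  unif_cvg (fun s => steklov1 (s * e) (F s)) f.
Proof.
move=> e1 cf cF uF r k k0; have k2 : 0 < k / 2 by rewrite divr_gt0.
have [d d0 Hd] := cont2_unif r cf k2; have hF := uF (r + 1) _ k2.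
near=> s => x y xr yr.
have s0 : 0 < s by near: s; exact: nbhs_right_gt.
have s1 : s <= 1 by near: s; exact: nbhs_right_le.
have sd : s <= d by near: s; exact: nbhs_right_le.
rewrite /steklov1; apply: (Sint01_near (h := fun=> k)); first by prove_cont.
move=> t /andP[t0 t1].
have st : `|s * e * t| <= s.
  rewrite !normrM (gtr0_norm s0) (ger0_norm t0) -mulrA ler_piMr ?(ltW s0)//.
  by rewrite mulr_ile1.
rewrite (le_trans (ler_distD (f (x + s * e * t) y) _ _))// (splitr k) lerD//.
- have hs : forall x y, `|x| <= r + 1 -> `|y| <= r + 1 -> `|F s x y - f x y| <= k / 2 by near: s.
  apply: hs; last by rewrite (le_trans yr)// lerDl.
  by rewrite (le_trans (ler_normD _ _))// lerD// (le_trans st).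
- rewrite -[X in f _ X - _]addr0; apply: Hd => //; first exact: le_trans sd.
  by rewrite normr0 ltW.
Unshelve. all: by end_near. Qed.

Lemma unif_cvg_tr F f : unif_cvg F f -> unif_cvg (fun s x y => F s y x) (fun x y => f y x).
Proof.
move=> uF r k k0; have hF := uF r _ k0; near=> s => x y xr yr.
by move: y x yr xr; near: s.
Unshelve. all: by end_near. Qed.

Lemma unif_cvg_A2 F f e : `|e| <= 1 -> cont2 f -> (forall s, cont2 (F s)) -> unif_cvg F f ->
  unif_cvg (fun s => steklov2 (s * e) (F s)) f.
Proof.
move=> e1 cf cF uF.
have cf' : cont2 (fun x y => f y x) by prove_cont.
have cF' s : cont2 (fun x y => F s y x) by prove_cont.
exact: unif_cvg_tr (unif_cvg_A1 e1 cf' cF' (unif_cvg_tr uF)).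
Qed.

(** A locally uniformly vanishing factor against one that is bounded in L^1. Errors involving
    quotients of the strain disappear in this way, since those quotients are bounded but not known
    to converge. *)
Lemma small_Ibox N F G : 0 <= N -> unif_small F -> (forall s, cont2 (F s)) -> (forall s, cont2 (G s)) ->
  bdd (fun s => Ibox N (fun x y => `|G s x y|)) ->
  small (fun s => Ibox N (fun x y => F s x y * G s x y)).
Proof.
move=> N0 uF cF cG [C HC] k k0.
have kC : 0 < k / (`|C| + 1) by rewrite divr_gt0// ltr_wpDl.
have hF := uF N _ kC; near=> s.
have cFG : cont2 (fun x y => F s x y * G s x y) by prove_cont.
have hs : forall x y, `|x| <= N -> `|y| <= N -> `|F s x y| <= k / (`|C| + 1) by near: s.
have hC : Ibox N (fun x y => `|G s x y|) <= C by near: s.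
rewrite (le_trans (Ibox_norm _ cFG))//.
rewrite (le_trans (@le_Ibox _ _ _ (fun x y => k / (`|C| + 1) * `|G s x y|) _ _ _))//.
- by prove_cont.
- by prove_cont.
- by move=> x y xN yN; rewrite normrM ler_wpM2r//; exact: hs.
- rewrite IboxZ; last by prove_cont.
  rewrite -[leRHS](divfK (lt0r_neq0 (ltr_wpDl (normr_ge0 C) ltr01))) ler_pM2l//.
  by rewrite (le_trans hC)// (le_trans (ler_norm _))// lerDl.
Unshelve. all: by end_near. Qed.

End limits.

(** * Difference quotients *)

(* The boolean [e] selects a coordinate direction: true for x, false for y. *)
Section directions.
Context {R : realType}.
Implicit Types (f g : R -> R -> R) (F G : R -> R -> R -> R) (e : bool) (s : R).

Definition translate e s f x y : R :=
  f (x + (if e then s else 0)) (y + (if e then 0 else s)).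
Definition diff_quot e s f x y : R := (translate e s f x y - f x y) / s.
Definition steklov e s := if e then steklov1 s else (@steklov2 R s).
Definition partial e f g := if e then D1 f g else D2 f g.

Lemma cont2_sh e s f : cont2 f -> cont2 (translate e s f).
Proof. by move=> cf; rewrite /translate; prove_cont. Qed.

Lemma cont2_dq e s f : cont2 f -> cont2 (diff_quot e s f).
Proof. by move=> cf; have := @cont2_sh e s f cf => cs; rewrite /diff_quot; prove_cont. Qed.

Lemma cont2_Av e s f : cont2 f -> cont2 (steklov e s f).
Proof. by case: e => cf; [exact: cont2_A1|exact: cont2_A2]. Qed.

Hint Resolve cont2_sh cont2_dq cont2_Av : cont.

Lemma Av_Dd e s f f' : s != 0 -> cont2 f' -> partial e f f' -> steklov e s f' = diff_quot e s f.
Proof.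
case: e => s0 cf df; rewrite /steklov.
- rewrite (A1_D1 s0 cf df); apply/funext => x; apply/funext => y.
  by rewrite /diff_quot /translate addr0.
- rewrite (A2_D2 s0 cf df); apply/funext => x; apply/funext => y.
  by rewrite /diff_quot /translate addr0.
Qed.

Lemma Dd_Av e s f : s != 0 -> cont2 f -> partial e (steklov e s f) (diff_quot e s f).
Proof.
case: e => s0 cf.
- rewrite (_ : diff_quot true s f = fun x y => (f (x + s) y - f x y) / s); first exact: D1_A1.
  by apply/funext => x; apply/funext => y; rewrite /diff_quot /translate addr0.
- rewrite (_ : diff_quot false s f = fun x y => (f x (y + s) - f x y) / s); first exact: D2_A2.
  by apply/funext => x; apply/funext => y; rewrite /diff_quot /translate addr0.
Qed.

Lemma Av_comm e s f : cont2 f -> steklov e s (steklov (~~ e) s f) = steklov1 s (steklov2 s f).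
Proof. by case: e => cf /=; [reflexivity|rewrite A12]. Qed.

Lemma Sint_sh (a b c : R) (g h : R -> R) : continuous g -> continuous h ->
  Sint a b (fun t => (g t - h t) / c) = (Sint a b g - Sint a b h) / c.
Proof.
move=> cg ch; rewrite -[RHS]mulrC -SintN// -SintD//; last by prove_cont.
rewrite -SintZ; last by prove_cont.
by apply: eq_Sint => t _; rewrite mulrC.
Qed.

Lemma Av_dq e s f : cont2 f -> steklov (~~ e) s (diff_quot e s f) = diff_quot e s (steklov (~~ e) s f).
Proof.
move=> cf; apply/funext => x; apply/funext => y.
case: e; rewrite /steklov/= /steklov1 /steklov2 /diff_quot /translate Sint_sh; try by prove_cont.
- by congr ((_ - _) / _); apply: eq_Sint => t _; rewrite !addr0.
- by congr ((_ - _) / _); apply: eq_Sint => t _; rewrite !addr0.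
Qed.

(** Averaging in both directions makes both partial derivatives available: the one in direction e is
    the quotient in direction e averaged in the other direction ([Dd_smooth]). *)
Definition smooth s f := steklov1 s (steklov2 s f).

Lemma Dd_smooth e s f : s != 0 -> cont2 f ->
  partial e (smooth s f) (steklov (~~ e) s (diff_quot e s f)).
Proof.
move=> s0 cf; rewrite Av_dq// /smooth -(Av_comm e)//.
by apply: Dd_Av => //; exact: cont2_Av.
Qed.

Lemma Dd_smooth' e s f f' : s != 0 -> cont2 f -> cont2 f' -> partial e f f' ->
  partial e (smooth s f) (smooth s f').
Proof.
move=> s0 cf cf' df.
have := Dd_smooth e s0 cf.
have := @Av_comm (~~ e) s f' cf'; rewrite negbK => E.
by rewrite -(Av_Dd s0 cf' df) E.
Qed.

Lemma cont2_smooth s f : cont2 f -> cont2 (smooth s f).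
Proof. by move=> cf; apply: cont2_A1; exact: cont2_A2. Qed.

Hint Resolve cont2_smooth : cont.

Lemma Ibox_Av e s r N f g : cont2 f -> cont2 g -> 0 <= r -> bsupp r g ->
  r + `|s| <= N ->
  Ibox N (fun x y => g x y * steklov e s f x y) = Ibox N (fun x y => steklov e (- s) g x y * f x y).
Proof. by case: e; [exact: Ibox_A1|exact: Ibox_A2]. Qed.

Lemma Av_sqr e s f x y : cont2 f -> steklov e s f x y ^+ 2 <= steklov e s (fun x y => f x y ^+ 2) x y.
Proof. by case: e; [exact: A1_sqr|exact: A2_sqr]. Qed.

Lemma Ibox_sh e s r N f : cont2 f -> 0 <= r -> bsupp r f -> r + `|s| <= N ->
  Ibox N (translate e s f) = Ibox N f.
Proof.
move=> cf r0 fr rsN; have := normr_ge0 s => ss.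
by rewrite /translate; case: e; apply: (@Ibox_shift _ N r) => //; rewrite normr0; lra.
Qed.

Lemma unif_cvg_sh e f : cont2 f -> unif_cvg (fun s => translate e s f) f.
Proof.
move=> cf.
have := unif_cvg_shift (if e then 1 else 0) (if e then 0 else 1) cf.
move=> H; apply: unif_small_eq H _; near=> s; apply/funext => x; apply/funext => y.
by rewrite /translate; case: e; rewrite ?mulr0 ?mulr1.
Unshelve. all: by end_near. Qed.

Lemma unif_cvg_Av e F f : cont2 f -> (forall s, cont2 (F s)) -> unif_cvg F f ->
  unif_cvg (fun s => steklov e s (F s)) f.
Proof.
move=> cf cF uF; case: e.
- have := @unif_cvg_A1 R F f 1 _ cf cF uF; rewrite normr1 => /(_ (lexx _)).
  by under eq_fun do rewrite mulr1.
- have := @unif_cvg_A2 R F f 1 _ cf cF uF; rewrite normr1 => /(_ (lexx _)).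
  by under eq_fun do rewrite mulr1.
Qed.

Lemma unif_cvg_AvN e F f : cont2 f -> (forall s, cont2 (F s)) -> unif_cvg F f ->
  unif_cvg (fun s => steklov e (- s) (F s)) f.
Proof.
move=> cf cF uF; case: e.
- have := @unif_cvg_A1 R F f (-1) _ cf cF uF; rewrite normrN1 => /(_ (lexx _)).
  by under eq_fun do rewrite mulrN1.
- have := @unif_cvg_A2 R F f (-1) _ cf cF uF; rewrite normrN1 => /(_ (lexx _)).
  by under eq_fun do rewrite mulrN1.
Qed.

Lemma unif_cvg_smooth f : cont2 f -> unif_cvg (fun s => smooth s f) f.
Proof.
move=> cf; have := @unif_cvg_Av false (fun=> f) f cf (fun=> cf) (unif_cvg_cst f) => H.
by apply: (@unif_cvg_Av true _ f cf _ H) => s; exact: cont2_A2.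
Qed.

Lemma unif_cvg_dq e f f' : cont2 f' -> partial e f f' -> unif_cvg (fun s => diff_quot e s f) f'.
Proof.
move=> cf' df; have H := @unif_cvg_Av e (fun=> f') f' cf' (fun=> cf') (unif_cvg_cst f').
apply: unif_small_eq H _; near=> s; apply/funext => x; apply/funext => y.
by rewrite (Av_Dd _ cf' df)// gt_eqF//; near: s; exact: nbhs_right_gt.
Unshelve. all: by end_near. Qed.

Lemma unif_cvg_sub F G f g : unif_cvg F f -> unif_cvg G g ->
  unif_cvg (fun s x y => F s x y - G s x y) (fun x y => f x y - g x y).
Proof. by move=> uF uG; apply: unif_cvgD => //; exact: unif_cvgN. Qed.

Lemma bsupp_sh e s r f : bsupp r f -> bsupp (r + `|s|) (translate e s f).
Proof.
move=> fr x y xy; apply: fr.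
have tri (a : R) : r + `|s| <= `|a| -> r <= `|a + s|.
  by move=> h; have := ler_normB (a + s) s; rewrite addrK; lra.
have tri0 (a : R) : r + `|s| <= `|a| -> r <= `|a + 0|.
  by rewrite addr0; apply: le_trans; rewrite lerDl.
by case: e xy => -[h|h];
  [left; exact: tri|right; exact: tri0|left; exact: tri0|right; exact: tri].
Qed.

End directions.

#[export] Hint Resolve cont2_sh cont2_dq cont2_Av cont2_smooth : cont.

Ltac partial_step := first [match goal with
  | H : D1 ?f _ |- der (fun t => ?f t ?y) _ => exact (H y)
  | H : D2 ?f _ |- der (fun t => ?f ?x t) _ => exact (H x)
  | H : D2 ?f _ |- der (?f ?x) _ => exact (H x)
  | H : forall i j, is_true (i < 3)%N -> D1 (?E i j) _ |- der (fun t => ?E ?i ?j t ?y) _ => exact (H i j isT y)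
  | H : forall i j, is_true (j < 3)%N -> D2 (?E i j) _ |- der (fun t => ?E ?i ?j ?x t) _ => exact (H i j isT x)
  | H : forall i j, is_true (j < 3)%N -> D2 (?E i j) _ |- der (?E ?i ?j ?x) _ => exact (H i j isT x)
  end | der_step].
Ltac prove_partial := let z := fresh "z" in intro z; eapply der_eq; [solve [repeat partial_step] | move=> ? /=].

(** * The weak equation and its difference quotients *)

Section weak.
Context {R : realType}.
Implicit Types (f g : R -> R -> R).

Lemma D1_shift a b f f1 : D1 f f1 -> D1 (fun x y => f (x + a) (y + b)) (fun x y => f1 (x + a) (y + b)).
Proof.
move=> df y; have dfy := df (y + b).
have d2 : der (fun x : R => x + a) (fun=> 1) by prove_der; rewrite addr0.
by apply: der_eq (der_comp dfy d2) _ => x; rewrite mulr1.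
Qed.

Lemma D2_shift a b f f2 : D2 f f2 -> D2 (fun x y => f (x + a) (y + b)) (fun x y => f2 (x + a) (y + b)).
Proof.
move=> df x; have dfx := df (x + a).
have d2 : der (fun y : R => y + b) (fun=> 1) by prove_der; rewrite addr0.
by apply: der_eq (der_comp dfx d2) _ => y; rewrite mulr1.
Qed.

Lemma D1_sh e s f f1 : D1 f f1 -> D1 (translate e s f) (translate e s f1).
Proof. exact: D1_shift. Qed.

Lemma D2_sh e s f f1 : D2 f f1 -> D2 (translate e s f) (translate e s f1).
Proof. exact: D2_shift. Qed.

Lemma D1_dq e s f f1 : D1 f f1 -> D1 (diff_quot e s f) (diff_quot e s f1).
Proof. by move=> df; have dsf := D1_sh e s df; rewrite /diff_quot; prove_partial; ring. Qed.

Lemma D2_dq e s f f1 : D2 f f1 -> D2 (diff_quot e s f) (diff_quot e s f1).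
Proof. by move=> df; have dsf := D2_sh e s df; rewrite /diff_quot; prove_partial; ring. Qed.

Lemma D1_sub f f1 g g1 : D1 f f1 -> D1 g g1 ->
  D1 (fun x y => f x y - g x y) (fun x y => f1 x y - g1 x y).
Proof. by move=> df dg; prove_partial. Qed.

Lemma D2_sub f f1 g g1 : D2 f f1 -> D2 g g1 ->
  D2 (fun x y => f x y - g x y) (fun x y => f1 x y - g1 x y).
Proof. by move=> df dg; prove_partial. Qed.

(** A single [f12] serves as both mixed derivatives; continuity of the lower orders is recovered by
    [cont2_of_partials]. *)
Definition C2data f f1 f2 f11 f12 f22 := [/\ D1 f f1, D2 f f2, D1 f1 f11 & D2 f1 f12] /\
  [/\ D1 f2 f12, D2 f2 f22, cont2 f11, cont2 f12 & cont2 f22].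

(* The momentum equation tested with the solenoidal field (psi_2, - psi_1);
   for s = T(eps(u)) - u (x) u, S1 stands for s_11 - s_22 and S2 for 2 s_12. *)
Definition weak_eq (S1 S2 : R -> R -> R) := forall N psi p1 p2 p11 p12 p22, 0 <= N ->
  C2data psi p1 p2 p11 p12 p22 -> bsupp N psi ->
  [/\ bsupp N p11, bsupp N p12 & bsupp N p22] ->
  Ibox N (fun x y => S1 x y * p12 x y + S2 x y * ((p22 x y - p11 x y) / 2)) = 0.

Lemma Ibox_sh_mul e s r N f p : cont2 f -> cont2 p -> 0 <= r -> bsupp r p -> r + `|s| <= N ->
  Ibox N (fun x y => f x y * translate e (- s) p x y) = Ibox N (fun x y => translate e s f x y * p x y).
Proof.
move=> cf cp r0 pr rsN.
have cs : cont2 (translate e s f) by exact: cont2_sh.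
have cm : cont2 (fun x y => translate e s f x y * p x y) by prove_cont.
have sm : bsupp r (fun x y => translate e s f x y * p x y).
  by move=> x y xy; rewrite pr ?mulr0.
have rs : r + `|- s| <= N by rewrite normrN.
rewrite -(@Ibox_sh _ e (- s) r N _ cm r0 sm rs).
apply: eq_Ibox => x y _ _; rewrite {1}/translate; congr (_ * _).
by rewrite /translate; case: e {cs cm sm}; rewrite !addr0 subrK.
Qed.

(** The equation is tested with the backward difference of psi, and transposing the translation
    moves the difference onto the coefficients. The margin |s| accommodates the translated
    support. *)
Lemma weak_shift S1 S2 e s r N psi p1 p2 p11 p12 p22 : weak_eq S1 S2 ->
  cont2 S1 -> cont2 S2 -> 0 <= r -> r + `|s| <= N ->
  C2data psi p1 p2 p11 p12 p22 -> bsupp r psi ->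
  [/\ bsupp r p11, bsupp r p12 & bsupp r p22] ->
  Ibox N (fun x y => diff_quot e s S1 x y * p12 x y + diff_quot e s S2 x y * ((p22 x y - p11 x y) / 2)) = 0.
Proof.
move=> W cS1 cS2 r0 rsN [[d1 d2 d11 d12] [d21 d22 c11 c12 c22]] pr [pr11 pr12 pr22].
have ss := normr_ge0 s.
pose Q f x y := translate e (- s) f x y - f x y.
have Qs f : bsupp r f -> bsupp N (Q f).
  move=> fr x y xy; rewrite /Q fr ?subr0; last by case: xy => h; [left|right]; lra.
  have H := @bsupp_sh R e (- s) r f fr; rewrite normrN in H; apply: H.
  by case: xy => h; [left|right]; lra.
have N0 : 0 <= N by lra.
have cs11 : cont2 (translate e (- s) p11) by exact: cont2_sh.
have cs12 : cont2 (translate e (- s) p12) by exact: cont2_sh.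
have cs22 : cont2 (translate e (- s) p22) by exact: cont2_sh.
have cS1' : cont2 (translate e s S1) by exact: cont2_sh.
have cS2' : cont2 (translate e s S2) by exact: cont2_sh.
have CD : C2data (Q psi) (Q p1) (Q p2) (Q p11) (Q p12) (Q p22).
  split; split.
  + by apply: D1_sub => //; exact: D1_sh.
  + by apply: D2_sub => //; exact: D2_sh.
  + by apply: D1_sub => //; exact: D1_sh.
  + by apply: D2_sub => //; exact: D2_sh.
  + by apply: D1_sub => //; exact: D1_sh.
  + by apply: D2_sub => //; exact: D2_sh.
  + by rewrite /Q; prove_cont.
  + by rewrite /Q; prove_cont.
  + by rewrite /Q; prove_cont.
have E := W N (Q psi) (Q p1) (Q p2) (Q p11) (Q p12) (Q p22) N0 CD (Qs _ pr)
  (And3 (Qs _ pr11) (Qs _ pr12) (Qs _ pr22)).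
pose X (f g : R -> R -> R) := Ibox N (fun x y => f x y * g x y).
have XE (f p : R -> R -> R) : cont2 f -> cont2 p -> bsupp r p ->
    X f (translate e (- s) p) = X (translate e s f) p.
  by move=> cf cp sp; exact: (@Ibox_sh_mul e s r).
have c2 : cont2 (fun x y => (p22 x y - p11 x y) / 2) by prove_cont.
have c2s : cont2 (translate e (- s) (fun x y => (p22 x y - p11 x y) / 2)) by exact: cont2_sh.
have s2 : bsupp r (fun x y => (p22 x y - p11 x y) / 2).
  by move=> x y xy; rewrite pr11 ?pr22// subrr mul0r.
have : X S1 (translate e (- s) p12) - X S1 p12 + (X S2 (translate e (- s) (fun x y => (p22 x y - p11 x y) / 2))
   - X S2 (fun x y => (p22 x y - p11 x y) / 2)) = 0.
  rewrite /X -!IboxB; [|by prove_cont|by prove_cont|by prove_cont|by prove_cont].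
  rewrite -IboxD; [|by prove_cont|by prove_cont].
  by rewrite -[RHS]E; apply: eq_Ibox => x y _ _; rewrite /Q /translate; field.
rewrite (XE S1 p12 cS1 c12 pr12) (XE S2 _ cS2 c2 s2) /X -!IboxB; [|by prove_cont|by prove_cont|by prove_cont|by prove_cont].
rewrite -IboxD; [|by prove_cont|by prove_cont] => E2.
rewrite -[RHS](mulr0 s^-1) -E2 -IboxZ; last by prove_cont.
by apply: eq_Ibox => x y _ _; rewrite /diff_quot; ring.
Qed.

End weak.

(** * The differentiated equation *)

Section cutoff.
Context {R : realType}.

(* [E i j] is the derivative of order (i, j) of the cut-off [E 0 0]. The last
   field, |E i j|^2 <= C E 0 0, lets every derivative of the cut-off be absorbed. *)
Record cutoff (E : nat -> nat -> R -> R -> R) (r : R) : Prop := Cutoff {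
  cut_r : 0 <= r;
  cut_cont : forall i j, cont2 (E i j);
  cut_D1 : forall i j, (i < 3)%N -> D1 (E i j) (E i.+1 j);
  cut_D2 : forall i j, (j < 3)%N -> D2 (E i j) (E i j.+1);
  cut_supp : forall i j, bsupp r (E i j);
  cut_ge0 : forall x y, 0 <= E 0%N 0%N x y;
  cut_le1 : forall x y, E 0%N 0%N x y <= 1;
  cut_sqr : exists2 C, 0 < C & forall i j x y, (i + j <= 3)%N ->
    E i j x y ^+ 2 <= C * E 0%N 0%N x y }.

Lemma unif_cvg_bounded F (f : R -> R -> R) r : cont2 f -> unif_cvg F f ->
  exists2 C, 0 < C & \forall s \near 0^'+, forall x y, `|x| <= r -> `|y| <= r ->
    `|F s x y| <= C.
Proof.
move=> cf uF; have [C C0 HC] := cont2_bounded r cf; have hF := uF r _ ltr01.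
exists (C + 1); first by rewrite ltr_wpDl// ltW.
near=> s => x y xr yr.
have h : forall x y, `|x| <= r -> `|y| <= r -> `|F s x y - f x y| <= 1 by near: s.
rewrite -[F s x y](subrK (f x y)) (le_trans (ler_normD _ _))// addrC lerD//; [exact: HC|exact: h].
Unshelve. all: by end_near. Qed.

(** Young's inequality in which, thanks to k^2 <= K E, the quadratic term keeps the weight E and can
    be absorbed. *)
Lemma amgm2 (L w k E K d : R) : 0 < d -> 0 < K -> k ^+ 2 <= K * E ->
  2 * L * w * k <= d * w ^+ 2 * E + L ^+ 2 * K / d.
Proof.
move=> d0 K0 kE.
have E1 : k ^+ 2 / K <= E by rewrite ler_pdivrMr// mulrC.
have h : d * w ^+ 2 * (k ^+ 2 / K) <= d * w ^+ 2 * E.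
  by rewrite ler_wpM2l// mulr_ge0 ?sqr_ge0// ltW.
apply: le_trans (lerD h (lexx _)).
rewrite -subr_ge0.
have -> : d * w ^+ 2 * (k ^+ 2 / K) + L ^+ 2 * K / d - 2 * L * w * k =
  (d * w * k - L * K) ^+ 2 / (d * K).
  by field; rewrite !gt_eqF.
by rewrite divr_ge0 ?sqr_ge0// mulr_ge0// ltW.
Qed.

End cutoff.

(** Monotonicity yields 2 m0 E (wa^2 + wb^2). The terms linear in w produce, by Young's inequality,
    two quadratic ones, each at most 2 d E (wa^2 + wb^2); the choice d = m0 / 4 leaves exactly
    m0. *)
Lemma rough_pt (R : realType) (m0 L B K d E wa wb ka kb ta tb na nb : R) :
  0 < m0 -> d = m0 / 4 -> 0 < K -> 0 <= L -> 0 <= B -> 0 <= E -> E <= 1 ->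
  m0 * (wa ^+ 2 + wb ^+ 2) <= ta * wa + tb * wb ->
  `|ta| <= L * (`|wa| + `|wb|) -> `|tb| <= L * (`|wa| + `|wb|) ->
  `|na| <= B -> `|nb| <= B -> (`|ka| + `|kb|) ^+ 2 <= K * E ->
  m0 * (E * (wa ^+ 2 + wb ^+ 2)) <= (2 * ta - na) * (E * wa + ka) +
    (2 * tb - nb) * (E * wb + kb) + (L ^+ 2 * K / d + B ^+ 2 / d + B * (K + 1)).
Proof.
move=> m00 dE K0 L0 B0 E0 E1 mon hta htb hna hnb hk.
set w := `|wa| + `|wb| in hta htb; set k := `|ka| + `|kb| in hk.
have d0 : 0 < d by rewrite dE divr_gt0.
have w2 : w ^+ 2 <= 2 * (wa ^+ 2 + wb ^+ 2).
  rewrite /w -(real_normK (num_real wa)) -(real_normK (num_real wb)).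
  have := sqr_ge0 (`|wa| - `|wb|); nra.
have w0 : 0 <= w by rewrite addr_ge0.
have k0 : 0 <= k by rewrite addr_ge0.
have pr (t v b c : R) : `|t| <= b -> `|v| <= c -> - (b * c) <= t * v.
  move=> tb_ vc; have : `|t * v| <= b * c by rewrite normrM ler_pM.
  by rewrite ler_norml => /andP[].
have h1 : - (L * w * `|ka|) <= ta * ka by exact: pr.
have h2 : - (L * w * `|kb|) <= tb * kb by exact: pr.
have pr' (t v b c : R) : `|t| <= b -> `|v| <= c -> t * v <= b * c.
  move=> tb_ vc; have : `|t * v| <= b * c by rewrite normrM ler_pM.
  by rewrite ler_norml => /andP[].
have h3 : na * wa <= B * `|wa| by exact: pr'.
have h4 : nb * wb <= B * `|wb| by exact: pr'.
have h5 : na * ka <= B * `|ka| by exact: pr'.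
have h6 : nb * kb <= B * `|kb| by exact: pr'.
have h7 := amgm2 L w d0 K0 hk.
have h8 : B * w * E <= d * w ^+ 2 * E + B ^+ 2 / d.
  have : 0 <= (d * w - B) ^+ 2 / d * E + B ^+ 2 / d * (1 - E) + B * w * E.
    have d0' := ltW d0; have E1' : 0 <= 1 - E by rewrite subr_ge0.
    apply: addr_ge0; last by rewrite mulr_ge0// mulr_ge0.
    by apply: addr_ge0; apply: mulr_ge0 => //; rewrite divr_ge0// sqr_ge0.
  suff -> : (d * w - B) ^+ 2 / d * E + B ^+ 2 / d * (1 - E) + B * w * E =
    d * w ^+ 2 * E + B ^+ 2 / d - B * w * E by rewrite subr_ge0.
  by field; rewrite gt_eqF.
have kK : k <= K + 1.
  rewrite leNgt; apply/negP => lt; have : K * E <= K by rewrite ler_piMr// ltW.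
  nra.
have h9 : B * k <= B * (K + 1) by rewrite ler_wpM2l.
have m1 : E * (m0 * (wa ^+ 2 + wb ^+ 2)) <= E * (ta * wa + tb * wb) by rewrite ler_wpM2l.
have m3 : E * (na * wa) <= E * (B * `|wa|) by rewrite ler_wpM2l.
have m4 : E * (nb * wb) <= E * (B * `|wb|) by rewrite ler_wpM2l.
have m5 : d * w ^+ 2 * E <= d * (2 * (wa ^+ 2 + wb ^+ 2)) * E.
  by rewrite ler_wpM2r// ler_wpM2l// ltW.
move: h1 h2 h5 h6 h7 h8 h9 m1 m3 m4 m5; rewrite dE.
set X := L ^+ 2 * K / _; set Y := B ^+ 2 / _; set S := wa ^+ 2 + wb ^+ 2.
have kE : L * w * k = L * w * `|ka| + L * w * `|kb| by rewrite /k; ring.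
have kB : B * k = B * `|ka| + B * `|kb| by rewrite /k; ring.
have wE : B * w * E = E * (B * `|wa|) + E * (B * `|wb|) by rewrite /w; ring.
have kL : 2 * L * w * k = 2 * (L * w * `|ka| + L * w * `|kb|) by rewrite -kE; ring.
rewrite kB wE kL; clearbody w k X Y S; lra.
Qed.

Section flow.
Context {R : realType}.
Variables (Ps P1 P2 P11 P12 P22 M : R -> R -> R) (m0 : R).

(* Stream function Ps with u = (P2, - P1): the strain is the matrix
   [[P12, off_strain], [off_strain, - P12]] and M is its viscosity. *)
Definition off_strain x y : R := (P22 x y - P11 x y) / 2.
Definition TA x y : R := M x y * P12 x y.
Definition TB x y : R := M x y * off_strain x y.
(** With u = (P2, - P1), [Na] is u_1^2 - u_2^2 and [Nb] is 2 u_1 u_2, the same combinations of the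
    convective tensor as those of the stress in [weak_eq]. *)
Definition Na x y : R := P2 x y ^+ 2 - P1 x y ^+ 2.
Definition Nb x y : R := - 2 * P1 x y * P2 x y.
Definition weak1 x y : R := 2 * TA x y - Na x y.
Definition weak2 x y : R := 2 * TB x y - Nb x y.

(** What is retained of the constitutive law is a viscosity bounded below, monotonicity with the
    mean of two viscosities as modulus, and a locally Lipschitz stress. The potential itself does
    not appear. *)
Record flow : Prop := Flow {
  fl_c0 : cont2 Ps; fl_c1 : cont2 P1; fl_c2 : cont2 P2;
  fl_c11 : cont2 P11; fl_c12 : cont2 P12; fl_c22 : cont2 P22; fl_cM : cont2 M;
  fl_d1 : D1 Ps P1; fl_d2 : D2 Ps P2; fl_d11 : D1 P1 P11;
  fl_d12 : D2 P1 P12; fl_d21 : D1 P2 P12; fl_d22 : D2 P2 P22;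
  fl_weak : weak_eq weak1 weak2;
  fl_m0 : 0 < m0;
  fl_M : forall x y, m0 <= M x y;
  fl_mono : forall x y x' y' : R, (M x y + M x' y') / 2 *
      ((P12 x' y' - P12 x y) ^+ 2 + (off_strain x' y' - off_strain x y) ^+ 2) <=
    (TA x' y' - TA x y) * (P12 x' y' - P12 x y) +
    (TB x' y' - TB x y) * (off_strain x' y' - off_strain x y);
  fl_lip : forall r : R, exists2 L : R, 0 < L & forall x y x' y' : R,
    `|x| <= r -> `|y| <= r -> `|x'| <= r -> `|y'| <= r ->
    `|TA x' y' - TA x y| <= L * (`|P12 x' y' - P12 x y| + `|off_strain x' y' - off_strain x y|) /\
    `|TB x' y' - TB x y| <= L * (`|P12 x' y' - P12 x y| + `|off_strain x' y' - off_strain x y|) }.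

Hypothesis FL : flow.

Lemma cont2_be : cont2 off_strain. Proof. by have [] := FL => *; rewrite /off_strain; prove_cont. Qed.
Lemma cont2_TA : cont2 TA. Proof. by have [] := FL => *; rewrite /TA; prove_cont. Qed.
Lemma cont2_TB : cont2 TB.
Proof. by have cb := cont2_be; have [] := FL => *; rewrite /TB; prove_cont. Qed.
Lemma cont2_Na : cont2 Na. Proof. by have [] := FL => *; rewrite /Na; prove_cont. Qed.
Lemma cont2_Nb : cont2 Nb. Proof. by have [] := FL => *; rewrite /Nb; prove_cont. Qed.

(** Commutators with the cut-off: for psi = E00 f, the derivative psi_12 is E00 f_12 + [Ka], and
    (psi_22 - psi_11) / 2 is E00 (f_22 - f_11) / 2 + [Kb]. *)
Definition Ka (E : nat -> nat -> R -> R -> R) f f1 f2 x y : R :=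
  E 1%N 0%N x y * f2 x y + E 0%N 1%N x y * f1 x y + E 1%N 1%N x y * f x y.
Definition Kb (E : nat -> nat -> R -> R -> R) f f1 f2 x y : R :=
  E 0%N 1%N x y * f2 x y - E 1%N 0%N x y * f1 x y +
  (E 0%N 2%N x y - E 2%N 0%N x y) / 2 * f x y.

(* Tested with the backward difference quotient of E00 (dq Ps - c): the
   constant c, to be chosen as a mean of dq Ps, only enters with derivatives of E00. *)
Lemma cut_identity E (r N : R) e (s c : R) : cutoff E r -> s != 0 -> r + `|s| <= N ->
  Ibox N (fun x y =>
    (2 * diff_quot e s TA x y - diff_quot e s Na x y) * (E 0%N 0%N x y * diff_quot e s P12 x y +
       Ka E (fun x y => diff_quot e s Ps x y - c) (diff_quot e s P1) (diff_quot e s P2) x y) +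
    (2 * diff_quot e s TB x y - diff_quot e s Nb x y) * (E 0%N 0%N x y * diff_quot e s off_strain x y +
       Kb E (fun x y => diff_quot e s Ps x y - c) (diff_quot e s P1) (diff_quot e s P2) x y)) = 0.
Proof.
have cbe := cont2_be; have cTA := cont2_TA; have cTB := cont2_TB.
have cNa := cont2_Na; have cNb := cont2_Nb.
have [cPs cP1 cP2 cP11 cP12 cP22 cM dPs1 dPs2 dP11 dP12 dP21 dP22 weak _ _ _ _] := FL.
move=> [r0 cE dE1 dE2 sE _ _ _] s0 rsN.
have cS1 : cont2 weak1 by rewrite /weak1; prove_cont.
have cS2 : cont2 weak2 by rewrite /weak2; prove_cont.
pose q x y := diff_quot e s Ps x y - c.
have cq : cont2 q by rewrite /q; prove_cont.
have dq1 : D1 q (diff_quot e s P1) by have h := @D1_dq R e s _ _ dPs1; rewrite /q; prove_partial; ring.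
have dq2 : D2 q (diff_quot e s P2) by have h := @D2_dq R e s _ _ dPs2; rewrite /q; prove_partial; ring.
have d11 := @D1_dq R e s _ _ dP11; have d12 := @D2_dq R e s _ _ dP12.
have d21 := @D1_dq R e s _ _ dP21; have d22 := @D2_dq R e s _ _ dP22.
pose p x y := E 0%N 0%N x y * q x y.
pose p1 x y := E 1%N 0%N x y * q x y + E 0%N 0%N x y * diff_quot e s P1 x y.
pose p2 x y := E 0%N 1%N x y * q x y + E 0%N 0%N x y * diff_quot e s P2 x y.
pose p11 x y := E 2%N 0%N x y * q x y + 2 * E 1%N 0%N x y * diff_quot e s P1 x y + E 0%N 0%N x y * diff_quot e s P11 x y.
pose p12 x y := E 1%N 1%N x y * q x y + E 1%N 0%N x y * diff_quot e s P2 x y + E 0%N 1%N x y * diff_quot e s P1 x y + E 0%N 0%N x y * diff_quot e s P12 x y.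
pose p22 x y := E 0%N 2%N x y * q x y + 2 * E 0%N 1%N x y * diff_quot e s P2 x y + E 0%N 0%N x y * diff_quot e s P22 x y.
have CD : C2data p p1 p2 p11 p12 p22.
  split; split.
  - by rewrite /p /p1; prove_partial; ring.
  - by rewrite /p /p2; prove_partial; ring.
  - by rewrite /p1 /p11; prove_partial; ring.
  - by rewrite /p1 /p12; prove_partial; ring.
  - by rewrite /p2 /p12; prove_partial; ring.
  - by rewrite /p2 /p22; prove_partial; ring.
  - by rewrite /p11; prove_cont.
  - by rewrite /p12; prove_cont.
  - by rewrite /p22; prove_cont.
have z i j x y : r <= `|x| \/ r <= `|y| -> E i j x y = 0 := sE i j x y.
have sp : bsupp r p by move=> x y xy; rewrite /p z ?mul0r.
have sps : [/\ bsupp r p11, bsupp r p12 & bsupp r p22].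
  by split=> x y xy; rewrite /p11 /p12 /p22 !z// !(mul0r, mulr0, addr0).
rewrite -(@weak_shift R weak1 weak2 e s r N p p1 p2 p11 p12 p22 weak cS1 cS2 r0 rsN CD sp sps).
apply: eq_Ibox => x y _ _.
by rewrite /Ka /Kb /p12 /p11 /p22 /q /weak1 /weak2 /off_strain /diff_quot /translate; field.
Qed.

Lemma dq_mono e s x y : (M x y + translate e s M x y) / 2 *
    (diff_quot e s P12 x y ^+ 2 + diff_quot e s off_strain x y ^+ 2) <=
  diff_quot e s TA x y * diff_quot e s P12 x y + diff_quot e s TB x y * diff_quot e s off_strain x y.
Proof.
have := fl_mono FL x y (x + (if e then s else 0)) (y + (if e then 0 else s)).
rewrite -!/(translate e s _ x y) => H.
have -> : (M x y + translate e s M x y) / 2 * (diff_quot e s P12 x y ^+ 2 + diff_quot e s off_strain x y ^+ 2) =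
  (M x y + translate e s M x y) / 2 * ((translate e s P12 x y - P12 x y) ^+ 2 + (translate e s off_strain x y - off_strain x y) ^+ 2) * s^-1 ^+ 2.
  by rewrite /diff_quot; ring.
have -> : diff_quot e s TA x y * diff_quot e s P12 x y + diff_quot e s TB x y * diff_quot e s off_strain x y =
  ((translate e s TA x y - TA x y) * (translate e s P12 x y - P12 x y) + (translate e s TB x y - TB x y) * (translate e s off_strain x y - off_strain x y)) * s^-1 ^+ 2.
  by rewrite /diff_quot; ring.
by rewrite ler_wpM2r// sqr_ge0.
Qed.

Lemma dq_lip (r : R) : exists2 L : R, 0 < L & forall e s x y, 0 < s <= 1 -> `|x| <= r -> `|y| <= r ->
  `|diff_quot e s TA x y| <= L * (`|diff_quot e s P12 x y| + `|diff_quot e s off_strain x y|) /\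
  `|diff_quot e s TB x y| <= L * (`|diff_quot e s P12 x y| + `|diff_quot e s off_strain x y|).
Proof.
have [L L0 HL] := fl_lip FL (r + 1); exists L => // e s x y /andP[s0 s1] xr yr.
have r1 (a : R) : `|a| <= r -> `|a| <= r + 1 by move=> ar; rewrite (le_trans ar)// lerDl.
have r2 (a : R) (b : bool) : `|a| <= r -> `|a + (if b then s else 0)| <= r + 1.
  move=> ar; rewrite (le_trans (ler_normD _ _))// lerD//.
  by case: b; rewrite ?normr0// gtr0_norm.
have r3 (a : R) (b : bool) : `|a| <= r -> `|a + (if b then 0 else s)| <= r + 1.
  by move=> ar; have := r2 a (~~ b) ar; case: b.
have [] := HL x y _ _ (r1 _ xr) (r1 _ yr) (r2 _ e xr) (r3 _ e yr).
rewrite -!/(translate e s _ x y) => h1 h2.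
have E (f : R -> R -> R) : `|diff_quot e s f x y| = `|translate e s f x y - f x y| / s.
  by rewrite /diff_quot normrM normfV (gtr0_norm s0).
rewrite !E -!mulrDl !mulrA.
by split; rewrite ler_pM2r ?invr_gt0.
Qed.

(** [Pd e] is the derivative of Ps in direction e, a velocity component up to sign; [Pdx] and [Pdy]
    are its partial derivatives, [Nad] and [Nbd] the derivatives of [Na] and [Nb] in direction e. *)
Definition Pd (e : bool) := if e then P1 else P2.
Definition Pdx (e : bool) := if e then P11 else P12.
Definition Pdy (e : bool) := if e then P12 else P22.
Definition Nad e x y : R := 2 * P2 x y * Pdy e x y - 2 * P1 x y * Pdx e x y.
Definition Nbd e x y : R := - 2 * Pdx e x y * P2 x y - 2 * P1 x y * Pdy e x y.

Lemma cont2_Pd e : cont2 (Pd e). Proof. by have [] := FL => *; case: e. Qed.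
Lemma cont2_Pd1 e : cont2 (Pdx e). Proof. by have [] := FL => *; case: e. Qed.
Lemma cont2_Pd2 e : cont2 (Pdy e). Proof. by have [] := FL => *; case: e. Qed.

Lemma cont2_Nad e : cont2 (Nad e).
Proof.
have c1 := cont2_Pd1 e; have c2 := cont2_Pd2 e.
by have [] := FL => *; rewrite /Nad; prove_cont.
Qed.

Lemma cont2_Nbd e : cont2 (Nbd e).
Proof.
have c1 := cont2_Pd1 e; have c2 := cont2_Pd2 e.
by have [] := FL => *; rewrite /Nbd; prove_cont.
Qed.

Lemma unif_cvg_dNa e : unif_cvg (fun s => diff_quot e s Na) (Nad e).
Proof.
apply: (unif_cvg_dq (cont2_Nad e)); have [] := FL => *.
by rewrite /Nad /Na; case: e; rewrite /partial /Pdx /Pdy; prove_partial; ring.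
Qed.

Lemma unif_cvg_dNb e : unif_cvg (fun s => diff_quot e s Nb) (Nbd e).
Proof.
apply: (unif_cvg_dq (cont2_Nbd e)); have [] := FL => *.
by rewrite /Nbd /Nb; case: e; rewrite /partial /Pdx /Pdy; prove_partial; ring.
Qed.

Lemma unif_cvg_dPs e : unif_cvg (fun s => diff_quot e s Ps) (Pd e).
Proof. by apply: (unif_cvg_dq (cont2_Pd e)); have [] := FL => *; case: (e). Qed.
Lemma unif_cvg_dP1 e : unif_cvg (fun s => diff_quot e s P1) (Pdx e).
Proof. by apply: (unif_cvg_dq (cont2_Pd1 e)); have [] := FL => *; case: (e). Qed.
Lemma unif_cvg_dP2 e : unif_cvg (fun s => diff_quot e s P2) (Pdy e).
Proof. by apply: (unif_cvg_dq (cont2_Pd2 e)); have [] := FL => *; case: (e). Qed.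

Lemma normKab (E : nat -> nat -> R -> R -> R) (f f1 f2 : R -> R -> R) (x y Q Ce : R) : 0 < Q -> 0 < Ce ->
  (forall i j, (i + j <= 3)%N -> E i j x y ^+ 2 <= Ce * E 0%N 0%N x y) ->
  `|f x y| <= Q -> `|f1 x y| <= Q -> `|f2 x y| <= Q ->
  (`|Ka E f f1 f2 x y| + `|Kb E f f1 f2 x y|) ^+ 2 <= 4 * Q ^+ 2 * (9 * Ce * E 0%N 0%N x y).
Proof.
move=> Q0 Ce0 HE fQ f1Q f2Q.
pose a1 : R := `|E 1%N 0%N x y|; pose a2 := `|E 0%N 1%N x y|; pose a3 := `|E 1%N 1%N x y|.
pose a4 := `|E 0%N 2%N x y|; pose a5 := `|E 2%N 0%N x y|.
have tri3 (a b c : R) : `|a + b + c| <= `|a| + `|b| + `|c|.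
  by rewrite (le_trans (ler_normD _ _))// lerD2r ler_normD.
have ka : `|Ka E f f1 f2 x y| <= Q * (a1 + a2 + a3).
  rewrite /Ka (le_trans (tri3 _ _ _))// !normrM -/a1 -/a2 -/a3.
  have : a1 * `|f2 x y| <= a1 * Q by rewrite ler_wpM2l// normr_ge0.
  have : a2 * `|f1 x y| <= a2 * Q by rewrite ler_wpM2l// normr_ge0.
  have : a3 * `|f x y| <= a3 * Q by rewrite ler_wpM2l// normr_ge0.
  by lra.
have kb : `|Kb E f f1 f2 x y| <= Q * (a1 + a2 + (a4 + a5) / 2).
  rewrite /Kb (le_trans (tri3 _ _ _))// normrN !normrM -/a1 -/a2.
  have : a2 * `|f2 x y| <= a2 * Q by rewrite ler_wpM2l// normr_ge0.
  have : a1 * `|f1 x y| <= a1 * Q by rewrite ler_wpM2l// normr_ge0.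
  have : `|E 0%N 2%N x y - E 2%N 0%N x y| * `|2^-1| * `|f x y| <= (a4 + a5) * `|2^-1| * Q.
    rewrite ler_pM// ler_wpM2r ?normr_ge0//.
    by rewrite (le_trans (ler_normB _ _)).
  by rewrite (@ger0_norm _ (2^-1)) ?invr_ge0//; lra.
have b1 : a1 ^+ 2 <= Ce * E 0%N 0%N x y by rewrite /a1 -normrX ger0_norm ?sqr_ge0// HE.
have b2 : a2 ^+ 2 <= Ce * E 0%N 0%N x y by rewrite /a2 -normrX ger0_norm ?sqr_ge0// HE.
have b3 : a3 ^+ 2 <= Ce * E 0%N 0%N x y by rewrite /a3 -normrX ger0_norm ?sqr_ge0// HE.
have b4 : a4 ^+ 2 <= Ce * E 0%N 0%N x y by rewrite /a4 -normrX ger0_norm ?sqr_ge0// HE.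
have b5 : a5 ^+ 2 <= Ce * E 0%N 0%N x y by rewrite /a5 -normrX ger0_norm ?sqr_ge0// HE.
have a10 : 0 <= a1 by exact: normr_ge0.
have a20 : 0 <= a2 by exact: normr_ge0.
have a30 : 0 <= a3 by exact: normr_ge0.
have a40 : 0 <= a4 by exact: normr_ge0.
have a50 : 0 <= a5 by exact: normr_ge0.
(* The two bounds add up to Q times a combination of a1, ..., a5 with weights 2, 2, 1, 1/2, 1/2, of
   total 6, whence the factor 36 = 6^2. *)
apply: (le_trans (y := (Q * (a1 + a2 + a3) + Q * (a1 + a2 + (a4 + a5) / 2)) ^+ 2)).
  have h0 : 0 <= `|Ka E f f1 f2 x y| + `|Kb E f f1 f2 x y| by rewrite addr_ge0.
  by rewrite lerXn2r// ?nnegrE ?lerD//; apply: le_trans (lerD ka kb).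
have -> : (Q * (a1 + a2 + a3) + Q * (a1 + a2 + (a4 + a5) / 2)) ^+ 2 =
  Q ^+ 2 * (2 * a1 + 2 * a2 + a3 + (a4 + a5) / 2) ^+ 2 by field.
rewrite [leRHS](_ : _ = Q ^+ 2 * (36 * (Ce * E 0%N 0%N x y))); last by ring.
rewrite ler_wpM2l ?sqr_ge0//.
have sq (a b : R) : 0 <= (a - b) ^+ 2 := sqr_ge0 _.
have := sq a1 a2; have := sq a1 a3; have := sq a1 a4; have := sq a1 a5.
have := sq a2 a3; have := sq a2 a4; have := sq a2 a5.
have := sq a3 a4; have := sq a3 a5; have := sq a4 a5.
nra.
Qed.

(* Bound depending on the cut-off: it only serves to make the passage s -> 0 possible. *)
Lemma rough e E r : cutoff E r -> exists2 C : R, 0 < C & \forall s \near 0^'+,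
  Ibox (r + 1) (fun x y => E 0%N 0%N x y * (diff_quot e s P12 x y ^+ 2 + diff_quot e s off_strain x y ^+ 2)) <= C.
Proof.
move=> cut; have cbe := cont2_be; have cTA := cont2_TA; have cTB := cont2_TB.
have cNa := cont2_Na; have cNb := cont2_Nb.
have [cPs cP1 cP2 cP11 cP12 cP22 cM _ _ _ _ _ _ _ m00 Mge mono lip] := FL.
have [r0 cE dE1 dE2 sE E0 E1 [Ce Ce0 HCe]] := cut.
pose N := r + 1.
have [L L0 HL] := dq_lip N.
have [Ba Ba0 HBa] := unif_cvg_bounded N (cont2_Nad e) (unif_cvg_dNa e).
have [Bb Bb0 HBb] := unif_cvg_bounded N (cont2_Nbd e) (unif_cvg_dNb e).
have [Q0 Q00 HQ0] := unif_cvg_bounded N (cont2_Pd e) (unif_cvg_dPs e).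
have [Q1 Q10 HQ1] := unif_cvg_bounded N (cont2_Pd1 e) (unif_cvg_dP1 e).
have [Q2 Q20 HQ2] := unif_cvg_bounded N (cont2_Pd2 e) (unif_cvg_dP2 e).
pose Q := Q0 + Q1 + Q2; pose B := Ba + Bb; pose K := 36 * Q ^+ 2 * Ce; pose d := m0 / 4.
have Q_gt0 : 0 < Q by rewrite !addr_gt0.
have B_gt0 : 0 < B by rewrite addr_gt0.
have K_gt0 : 0 < K by rewrite !mulr_gt0// exprn_gt0.
have d_gt0 : 0 < d by rewrite divr_gt0.
pose C1 := L ^+ 2 * K / d + B ^+ 2 / d + B * (K + 1).
have C1_gt0 : 0 < C1.
  rewrite !addr_gt0// ?mulr_gt0 ?invr_gt0 ?exprn_gt0 ?addr_gt0//.
have N_gt0 : 0 < N by rewrite ltr_wpDl.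
have KK x : 4 * Q ^+ 2 * (9 * Ce * x) = K * x by rewrite /K; ring.
have Q0Q : Q0 <= Q by rewrite /Q -addrA lerDl addr_ge0// ltW.
have Q1Q : Q1 <= Q by rewrite /Q addrAC lerDr addr_ge0// ltW.
have Q2Q : Q2 <= Q by rewrite /Q lerDr addr_ge0// ltW.
exists (C1 * (4 * N ^+ 2) / m0).
  by rewrite divr_gt0// mulr_gt0// mulr_gt0// exprn_gt0.
near=> s.
have s0 : 0 < s by near: s; exact: nbhs_right_gt.
have s1 : s <= 1 by near: s; exact: nbhs_right_le.
have s01 : 0 < s <= 1 by rewrite s0.
have rsN : r + `|s| <= N by rewrite gtr0_norm// lerD2l.
have hBa : forall x y, `|x| <= N -> `|y| <= N -> `|diff_quot e s Na x y| <= Ba by near: s.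
have hBb : forall x y, `|x| <= N -> `|y| <= N -> `|diff_quot e s Nb x y| <= Bb by near: s.
have hQ0 : forall x y, `|x| <= N -> `|y| <= N -> `|diff_quot e s Ps x y| <= Q0 by near: s.
have hQ1 : forall x y, `|x| <= N -> `|y| <= N -> `|diff_quot e s P1 x y| <= Q1 by near: s.
have hQ2 : forall x y, `|x| <= N -> `|y| <= N -> `|diff_quot e s P2 x y| <= Q2 by near: s.
have I0 := cut_identity e 0 cut (lt0r_neq0 s0) rsN.
set X := (X in Ibox N X = 0) in I0.
pose W x y := E 0%N 0%N x y * (diff_quot e s P12 x y ^+ 2 + diff_quot e s off_strain x y ^+ 2).
have cW : cont2 W by rewrite /W; prove_cont.
have cX : cont2 X.
  rewrite /X /Ka /Kb; prove_cont.
have cXC : cont2 (fun x y => X x y + C1) by prove_cont.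
have cmW : cont2 (fun x y => m0 * W x y) by prove_cont.
have : Ibox N (fun x y => m0 * W x y) <= Ibox N (fun x y => X x y + C1).
  apply: le_Ibox => // x y xN yN; move=> {I0}.
  have KE := normKab Q_gt0 Ce0 (fun i j ij => HCe i j x y ij) (f := fun x y => diff_quot e s Ps x y - 0)
    (f1 := diff_quot e s P1) (f2 := diff_quot e s P2).
  rewrite /X /W /C1; apply: rough_pt => //.
  - exact: ltW.
  - exact: ltW.
  - apply: le_trans (dq_mono e s x y).
    rewrite ler_wpM2r ?addr_ge0 ?sqr_ge0//.
    have := Mge x y; have := Mge (x + (if e then s else 0)) (y + (if e then 0 else s)).
    by rewrite -/(translate e s M x y) ler_pdivlMr// mulr_natr mulr2n => *; exact: lerD.
  - by have [] := HL e s x y s01 xN yN.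
  - by have [] := HL e s x y s01 xN yN.
  - by rewrite (le_trans (hBa _ _ xN yN))// lerDl ltW.
  - by rewrite (le_trans (hBb _ _ xN yN))// lerDr ltW.
  - apply: le_trans (KE _ _ _) _; last by rewrite KK.
    + by rewrite subr0; exact: le_trans (hQ0 _ _ xN yN) Q0Q.
    + exact: le_trans (hQ1 _ _ xN yN) Q1Q.
    + exact: le_trans (hQ2 _ _ xN yN) Q2Q.
have cC : cont2 (fun _ _ : R => C1) by prove_cont.
rewrite IboxZ// IboxD// I0 add0r Ibox_cst ?(ltW N_gt0)// => H.
by rewrite ler_pdivlMr// mulrC.
Unshelve. all: by end_near. Qed.

End flow.

(** * Local bounds uniform in s and discrete integration by parts *)

Section boundedness.
Context {R : realType}.
Implicit Types (F G : R -> R -> R -> R).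

Definition bddL1 F := forall N : R, 0 <= N -> bdd (fun s => Ibox N (fun x y => `|F s x y|)).
Definition bddL2 F := forall N : R, 0 <= N -> bdd (fun s => Ibox N (fun x y => F s x y ^+ 2)).

Definition has_cutoffs := forall N : R, 0 <= N -> exists E r,
  @cutoff R E r /\ forall x y, `|x| <= N -> `|y| <= N -> E 0%N 0%N x y = 1.

Lemma bdd_le (X Y : R -> R) : bdd Y -> (\forall s \near 0^'+, X s <= Y s) -> bdd X.
Proof.
move=> [C HC] H; exists C; near=> s; apply: (le_trans (y := Y s)).
  by near: s; exact: H.
by near: s; exact: HC.
Unshelve. all: by end_near. Qed.

Lemma bddD (X Y : R -> R) : bdd X -> bdd Y -> bdd (fun s => X s + Y s).
Proof.
move=> [C HC] [C' HC']; exists (C + C'); near=> s; apply: lerD.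
  by near: s; exact: HC.
by near: s; exact: HC'.
Unshelve. all: by end_near. Qed.

Lemma bddZ c (X : R -> R) : 0 <= c -> bdd X -> bdd (fun s => c * X s).
Proof.
move=> c0 [C HC]; exists (c * C); near=> s; apply: ler_wpM2l => //.
by near: s; exact: HC.
Unshelve. all: by end_near. Qed.

Lemma bdd_cst (c : R) : bdd (fun=> c).
Proof. by exists c; near=> s. Unshelve. all: by end_near. Qed.

Lemma bddL2_L1 F : (forall s, cont2 (F s)) -> bddL2 F -> bddL1 F.
Proof.
move=> cF bF N N0; apply: bdd_le (bddD (bdd_cst (1 * (4 * N ^+ 2))) (bF N N0)) _.
near=> s; rewrite -Ibox_cst// -IboxD; [|by prove_cont|by prove_cont].
apply: le_Ibox; [by prove_cont|by prove_cont|] => x y _ _.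
rewrite -(real_normK (num_real (F s x y))).
have := sqr_ge0 (`|F s x y| - 1); have := normr_ge0 (F s x y); nra.
Unshelve. all: by end_near. Qed.

Lemma bddL1_L2 F : (forall s, cont2 (F s)) ->
  bddL2 F -> bddL1 (fun s x y => F s x y ^+ 2).
Proof.
move=> cF bF N N0; apply: bdd_le (bF N N0) _; near=> s.
apply: le_Ibox; [by prove_cont|by prove_cont|] => x y _ _.
by rewrite ger0_norm ?sqr_ge0.
Unshelve. all: by end_near. Qed.

Lemma bddL1D F G : (forall s, cont2 (F s)) -> (forall s, cont2 (G s)) ->
  bddL1 F -> bddL1 G -> bddL1 (fun s x y => F s x y + G s x y).
Proof.
move=> cF cG bF bG N N0; apply: bdd_le (bddD (bF N N0) (bG N N0)) _.
near=> s; rewrite -IboxD; [|by prove_cont|by prove_cont].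
by apply: le_Ibox; [by prove_cont|by prove_cont|] => x y _ _; exact: ler_normD.
Unshelve. all: by end_near. Qed.

Lemma bddL2D F G : (forall s, cont2 (F s)) -> (forall s, cont2 (G s)) ->
  bddL2 F -> bddL2 G -> bddL2 (fun s x y => F s x y + G s x y).
Proof.
move=> cF cG bF bG N N0.
apply: bdd_le (bddZ (ler0n R 2) (bddD (bF N N0) (bG N N0))) _.
near=> s; rewrite -IboxD; [|by prove_cont|by prove_cont].
rewrite -IboxZ; last by prove_cont.
apply: le_Ibox; [by prove_cont|by prove_cont|] => x y _ _.
have := sqr_ge0 (F s x y - G s x y); nra.
Unshelve. all: by end_near. Qed.

Lemma bddL2Z c F : (forall s, cont2 (F s)) ->
  bddL2 F -> bddL2 (fun s x y => c * F s x y).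
Proof.
move=> cF bF N N0; apply: bdd_le (bddZ (sqr_ge0 c) (bF N N0)) _.
near=> s; rewrite -IboxZ; last by prove_cont.
by apply: le_Ibox; [by prove_cont|by prove_cont|] => x y _ _; rewrite exprMn.
Unshelve. all: by end_near. Qed.

Lemma bddL2_eq F G : bddL2 F -> (forall s, s != 0 -> G s = F s) -> bddL2 G.
Proof.
move=> bF E N N0; apply: bdd_le (bF N N0) _; near=> s.
have s0 : 0 < s by near: s; exact: nbhs_right_gt.
by rewrite E ?gt_eqF.
Unshelve. all: by end_near. Qed.

Lemma bddL1M F G g : cont2 g -> (forall s, cont2 (F s)) -> (forall s, cont2 (G s)) ->
  bddL1 F -> unif_cvg G g -> bddL1 (fun s x y => G s x y * F s x y).
Proof.
move=> cg cF cG bF uG N N0; have [C C0 HC] := unif_cvg_bounded N cg uG.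
apply: bdd_le (bddZ (ltW C0) (bF N N0)) _.
near=> s; rewrite -IboxZ; last by prove_cont.
apply: le_Ibox; [by prove_cont|by prove_cont|] => x y xN yN.
rewrite normrM ler_wpM2r//; move: x y xN yN; near: s; exact: HC.
Unshelve. all: by end_near. Qed.

Lemma Av_le1 e s (f : R -> R -> R) x y : cont2 f -> (forall x y, 0 <= f x y <= 1) ->
  0 <= steklov e s f x y <= 1.
Proof.
move=> cf f01; have c1 : continuous (fun _ : R => 1 : R) by exact: ct_cst.
have H (g : R -> R) : continuous g -> (forall t, 0 <= g t <= 1) -> 0 <= Sint 0 1 g <= 1.
  move=> cg g01; apply/andP; split; first by apply: Sint_ge0 => t _; have /andP[] := g01 t.
  rewrite (le_trans (@le_Sint _ _ _ _ (fun=> 1) cg c1 _)) ?Sint_cst// ?subr0 ?mulr1// => t _.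
  by have /andP[] := g01 t.
by case: e; rewrite /steklov /steklov1 /steklov2; apply: H => //; prove_cont.
Qed.

(** The average is transposed onto a cut-off equal to 1 on the square, and the averaged cut-off is
    at most 1. The larger square depends neither on f nor on s. *)
Lemma Ibox_Av_le : has_cutoffs -> forall N : R, 0 <= N -> exists2 N' : R, 0 <= N' &
  forall e s (f : R -> R -> R), cont2 f -> (forall x y, 0 <= f x y) -> 0 < s <= 1 ->
  Ibox N (steklov e s f) <= Ibox N' f.
Proof.
move=> HC N N0; have [E [r [cut E1]]] := HC _ N0.
have [r0 cE _ _ sE E0 Ele _] := cut.
pose N' := Num.max N (r + 1).
have NN' : N <= N' by rewrite le_max lexx.
have rN' : r + 1 <= N' by rewrite le_max lexx orbT.
exists N' => [|e s f cf f0 /andP[s0 s1]]; first exact: le_trans NN'.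
have cA : cont2 (steklov e s f) by exact: cont2_Av.
have cAE : cont2 (steklov e (- s) (E 0%N 0%N)) by exact: cont2_Av.
have A0 x y : 0 <= steklov e s f x y.
  by rewrite /steklov; case: (e); apply: Sint_ge0 => t _.
apply: (le_trans (y := Ibox N (fun x y => E 0%N 0%N x y * steklov e s f x y))).
  by apply: le_Ibox => //; [by prove_cont|] => x y xN yN; rewrite E1// mul1r.
apply: (le_trans (y := Ibox N' (fun x y => E 0%N 0%N x y * steklov e s f x y))).
  by apply: Ibox_le_dom; [by prove_cont|by rewrite N0|] => x y; exact: mulr_ge0.
rewrite (@Ibox_Av _ e s r)//; last by rewrite gtr0_norm//; lra.
apply: le_Ibox => //; first by prove_cont.
move=> x y _ _; have /andP[_ h] := @Av_le1 e (- s) (E 0%N 0%N) x y (cE _ _) (fun x y => introT andP (conj (E0 x y) (Ele x y))).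
by rewrite ler_piMl.
Qed.

Lemma bddL2_Av e F : has_cutoffs -> (forall s, cont2 (F s)) -> bddL2 F ->
  bddL2 (fun s => steklov e s (F s)).
Proof.
move=> HC cF bF N N0; have [N' N'0 HN'] := Ibox_Av_le HC N0.
apply: bdd_le (bF N' N'0) _; near=> s.
have s01 : 0 < s <= 1 by near: s; exact: near01.
have cA : cont2 (steklov e s (F s)) by exact: cont2_Av.
have cA2 : cont2 (steklov e s (fun x y => F s x y ^+ 2)) by apply: cont2_Av; prove_cont.
have c2 : cont2 (fun x y => F s x y ^+ 2) by prove_cont.
apply: le_trans (HN' e s (fun x y => F s x y ^+ 2) c2 (fun x y => sqr_ge0 _) s01).
by apply: le_Ibox => // [|x y _ _]; [by prove_cont|exact: Av_sqr].
Unshelve. all: by end_near. Qed.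

Lemma small_diff N F G g : 0 <= N -> cont2 g -> (forall s, cont2 (F s)) ->
  (forall s, cont2 (G s)) -> bddL1 F -> unif_cvg G g ->
  small (fun s => Ibox N (fun x y => G s x y * F s x y) - Ibox N (fun x y => g x y * F s x y)).
Proof.
move=> N0 cg cF cG bF uG.
have cGg s : cont2 (fun x y => G s x y - g x y) by prove_cont.
apply: small_eq (small_Ibox N0 uG cGg cF (bF N N0)) _; near=> s.
rewrite -IboxB; [|by prove_cont|by prove_cont].
by apply: eq_Ibox => x y _ _; ring.
Unshelve. all: by end_near. Qed.

(** The transposed quotient of g is an average of g', and this average is moved back onto f. The
    identity is exact for each s although f is only continuous. *)
Lemma Ibox_dq_ibp e s (r N : R) f g g' : s != 0 -> cont2 f -> cont2 g -> cont2 g' -> partial e g g' ->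
  0 <= r -> bsupp r g -> bsupp r g' -> r + `|s| <= N ->
  Ibox N (fun x y => diff_quot e s f x y * g x y) = - Ibox N (fun x y => steklov e s f x y * g' x y).
Proof.
move=> s0 cf cg cg' dg r0 sg sg' rsN.
have cA : cont2 (steklov e s f) by exact: cont2_Av.
have cs : cont2 (translate e s f) by exact: cont2_sh.
have cs' : cont2 (translate e (- s) g) by exact: cont2_sh.
have cA' : cont2 (steklov e (- s) g') by exact: cont2_Av.
transitivity (s^-1 * (Ibox N (fun x y => translate e s f x y * g x y) - Ibox N (fun x y => f x y * g x y))).
  rewrite -IboxB; [|by prove_cont|by prove_cont].
  rewrite -IboxZ; last by prove_cont.
  by apply: eq_Ibox => x y _ _; rewrite /diff_quot; ring.
rewrite -(Ibox_sh_mul e cf cg r0 sg rsN).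
rewrite (@eq_Ibox _ N (fun x y => steklov e s f x y * g' x y) (fun x y => g' x y * steklov e s f x y)); last first.
  by move=> x y _ _; rewrite mulrC.
rewrite (@Ibox_Av _ e s r)//.
rewrite (Av_Dd _ cg' dg) ?oppr_eq0// -IboxB; [|by prove_cont|by prove_cont].
rewrite -IboxZ; last by prove_cont.
rewrite -IboxN; last by prove_cont.
by apply: eq_Ibox => x y _ _; rewrite /diff_quot; field.
Qed.

Lemma dq_comm e e' s (f : R -> R -> R) : diff_quot e s (diff_quot e' s f) = diff_quot e' s (diff_quot e s f).
Proof.
apply/funext => x; apply/funext => y; rewrite /diff_quot /translate.
by case: e; case: e'; rewrite ?addr0; ring.
Qed.

End boundedness.

(** * Averaged third derivatives of the stream function *)

Section third_derivatives.
Context {R : realType}.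
Variables (Ps P1 P2 P11 P12 P22 M : R -> R -> R) (m0 : R).
Hypothesis FL : flow Ps P1 P2 P11 P12 P22 M m0.
Hypothesis HC : @has_cutoffs R.
Notation be := (off_strain P11 P22).
Notation Pd := (Pd P1 P2).
Notation Pd1 := (Pdx P11 P12).
Notation Pd2 := (Pdy P12 P22).

Let cP12 : cont2 P12. Proof. by case: FL. Qed.
Let cP11 : cont2 P11. Proof. by case: FL. Qed.
Let cP22 : cont2 P22. Proof. by case: FL. Qed.
Let cbe : cont2 be. Proof. exact: cont2_be FL. Qed.

(** [rough] for a cut-off equal to 1 on the given square: the weight drops out and the bound becomes
    local. *)
Lemma bddL2_W e : bddL2 (fun s => diff_quot e s P12) /\ bddL2 (fun s => diff_quot e s be).
Proof.
suff H (N : R) : 0 <= N -> bdd (fun s => Ibox N (fun x y => diff_quot e s P12 x y ^+ 2 + diff_quot e s be x y ^+ 2)).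
  split => N N0; apply: bdd_le (H N N0) _; near=> s.
    by apply: le_Ibox; [by prove_cont|by prove_cont|] => x y _ _; rewrite lerDl sqr_ge0.
  by apply: le_Ibox; [by prove_cont|by prove_cont|] => x y _ _; rewrite lerDr sqr_ge0.
move=> N0; have [E [r [cut E1]]] := HC N0.
have [C C0 HCr] := rough FL e cut.
have cE := cut_cont cut; have E0 := cut_ge0 cut.
pose N' := Num.max N (r + 1).
have NN' : N <= N' by rewrite le_max lexx.
have rN' : r + 1 <= N' by rewrite le_max lexx orbT.
have r0 := cut_r cut.
exists C; near=> s.
have h : Ibox (r + 1) (fun x y => E 0%N 0%N x y * (diff_quot e s P12 x y ^+ 2 + diff_quot e s be x y ^+ 2)) <= C by near: s.
apply: le_trans h.
pose f x y := E 0%N 0%N x y * (diff_quot e s P12 x y ^+ 2 + diff_quot e s be x y ^+ 2).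
have cf : cont2 f by rewrite /f; prove_cont.
have sf : bsupp r f by move=> x y xy; rewrite /f (cut_supp cut) ?mul0r.
have f0 x y : 0 <= f x y by rewrite mulr_ge0// addr_ge0// sqr_ge0.
have r1 : 0 <= r <= r + 1 by apply/andP; split; lra.
have r2 : 0 <= r <= N' by apply/andP; split; lra.
rewrite -/f (Ibox_supp cf r1 sf) -(Ibox_supp cf r2 sf).
apply: (le_trans (y := Ibox N f)).
  by apply: le_Ibox; [by prove_cont|exact: cf|] => x y xN yN; rewrite /f E1// mul1r.
by apply: Ibox_le_dom; [exact: cf|rewrite N0 NN'|exact: f0].
Unshelve. all: by end_near. Qed.

(** Substitutes for the third derivatives of Ps, twice in direction e and once in x ([third1]) or y
    ([third2]): the exact derivatives in direction e of [smooth s] applied to second derivatives.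
    [Va] and [Vb] are the same for the strain entries. *)
Definition third1 e s := steklov (~~ e) s (diff_quot e s (Pd1 e)).
Definition third2 e s := steklov (~~ e) s (diff_quot e s (Pd2 e)).
Definition Va e s := steklov (~~ e) s (diff_quot e s P12).
Definition Vb e s := steklov (~~ e) s (diff_quot e s be).

Lemma cont2_T1 e s : cont2 (third1 e s).
Proof. by have h := cont2_Pd1 FL e; rewrite /third1; prove_cont. Qed.
Lemma cont2_T2 e s : cont2 (third2 e s).
Proof. by have h := cont2_Pd2 FL e; rewrite /third2; prove_cont. Qed.
Lemma cont2_Va e s : cont2 (Va e s). Proof. by rewrite /Va; prove_cont. Qed.
Lemma cont2_Vb e s : cont2 (Vb e s). Proof. by rewrite /Vb; prove_cont. Qed.

Lemma bddL2_Va e : bddL2 (Va e).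
Proof.
have c s : cont2 (diff_quot e s P12) by prove_cont.
exact: (@bddL2_Av R (~~ e) (fun s => diff_quot e s P12) HC c (proj1 (bddL2_W e))).
Qed.

Lemma bddL2_Vb e : bddL2 (Vb e).
Proof.
have c s : cont2 (diff_quot e s be) by prove_cont.
exact: (@bddL2_Av R (~~ e) (fun s => diff_quot e s be) HC c (proj2 (bddL2_W e))).
Qed.

(** Both sides are the same double difference quotient of a first derivative of Ps; the averages
    make the mixed third derivatives commute exactly for each s. *)
Lemma T12_21 s : s != 0 -> steklov2 s (diff_quot true s P12) = steklov1 s (diff_quot false s P11) /\
  steklov2 s (diff_quot true s P22) = steklov1 s (diff_quot false s P12).
Proof.
move=> s0; have [cPs cP1 cP2 _ _ _ cM dPs1 dPs2 dP11 dP12 dP21 dP22 _ _ _ _ _] := FL.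
have a1 : steklov2 s (diff_quot true s P12) = diff_quot true s (steklov2 s P12) := @Av_dq R true s P12 cP12.
have a2 : steklov1 s (diff_quot false s P11) = diff_quot false s (steklov1 s P11) := @Av_dq R false s P11 cP11.
have a3 : steklov2 s (diff_quot true s P22) = diff_quot true s (steklov2 s P22) := @Av_dq R true s P22 cP22.
have a4 : steklov1 s (diff_quot false s P12) = diff_quot false s (steklov1 s P12) := @Av_dq R false s P12 cP12.
have b1 : steklov2 s P12 = diff_quot false s P1 := @Av_Dd R false s P1 P12 s0 cP12 dP12.
have b2 : steklov1 s P11 = diff_quot true s P1 := @Av_Dd R true s P1 P11 s0 cP11 dP11.
have b3 : steklov2 s P22 = diff_quot false s P2 := @Av_Dd R false s P2 P22 s0 cP22 dP22.
have b4 : steklov1 s P12 = diff_quot true s P2 := @Av_Dd R true s P2 P12 s0 cP12 dP21.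
by rewrite a1 a2 a3 a4 b1 b2 b3 b4; split; exact: dq_comm.
Qed.

(** All third derivatives of Ps are combinations of first derivatives of the strain, as in Korn's
    inequality: with beta = (Psi_22 - Psi_11) / 2 one has Psi_111 = Psi_122 - 2 beta_1. *)
Lemma T1E e s x y : s != 0 -> third1 e s x y = if e then Va false s x y - 2 * Vb true s x y else Va false s x y.
Proof.
move=> s0; have [h1 h2] := T12_21 s0.
have c1 : cont2 (diff_quot true s P22) by prove_cont.
have c2 : cont2 (diff_quot true s P11) by prove_cont.
have c3 : cont2 (diff_quot true s P12) by prove_cont.
case: e; rewrite /third1 /Va /Vb /= /Pd1.
- rewrite -h2 /steklov2 -SintZ; last by prove_cont.
  rewrite -SintN; last by prove_cont.
  rewrite -SintD; [|by prove_cont|by prove_cont].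
  by apply: eq_Sint => t _; rewrite /diff_quot /be /translate; field.
- by [].
Qed.

Lemma T2E e s x y : s != 0 -> third2 e s x y = if e then Va true s x y else Va true s x y + 2 * Vb false s x y.
Proof.
move=> s0; have [h1 h2] := T12_21 s0.
have c1 : cont2 (diff_quot false s P22) by prove_cont.
have c2 : cont2 (diff_quot false s P11) by prove_cont.
have c3 : cont2 (diff_quot false s P12) by prove_cont.
case: e; rewrite /third2 /Va /Vb /= /Pd2//.
rewrite h1.
rewrite /steklov1 -SintZ; last by prove_cont.
rewrite -SintD; [|by prove_cont|by prove_cont].
by apply: eq_Sint => t _; rewrite /diff_quot /be /translate; field.
Qed.

Lemma bddL2_T1 e : bddL2 (third1 e).
Proof.
case: e.
- have H : bddL2 (fun s x y => Va false s x y + -2 * Vb true s x y).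
    apply: bddL2D (bddL2_Va _) _ => [s|s|]; [exact: cont2_Va|by have := cont2_Vb true s => h; prove_cont|].
    apply: bddL2Z (bddL2_Vb _) => s; exact: cont2_Vb.
  apply: bddL2_eq H _ => s s0; apply/funext => x; apply/funext => y.
  by rewrite T1E// mulNr.
- apply: bddL2_eq (bddL2_Va false) _ => s s0; apply/funext => x; apply/funext => y.
  by rewrite T1E.
Qed.

Lemma bddL2_T2 e : bddL2 (third2 e).
Proof.
case: e.
- apply: bddL2_eq (bddL2_Va true) _ => s s0; apply/funext => x; apply/funext => y.
  by rewrite T2E.
- have H : bddL2 (fun s x y => Va true s x y + 2 * Vb false s x y).
    apply: bddL2D (bddL2_Va _) _ => [s|s|]; [exact: cont2_Va|by have := cont2_Vb false s => h; prove_cont|].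
    apply: bddL2Z (bddL2_Vb _) => s; exact: cont2_Vb.
  apply: bddL2_eq H _ => s s0; apply/funext => x; apply/funext => y.
  by rewrite T2E.
Qed.

End third_derivatives.

(** * Passage to the limit in the difference quotients *)

Section limit.
Local Opaque smooth steklov diff_quot translate.
Context {R : realType}.
Variables (Ps P1 P2 P11 P12 P22 M : R -> R -> R) (m0 : R).
Hypothesis FL : flow Ps P1 P2 P11 P12 P22 M m0.
Hypothesis HC : @has_cutoffs R.
Variables (E : nat -> nat -> R -> R -> R) (r : R) (cut : cutoff E r) (c : bool -> R).
Notation be := (off_strain P11 P22).
Notation TA := (TA P12 M).
Notation TB := (TB P11 P22 M).
Notation Na := (Na P1 P2).
Notation Nb := (Nb P1 P2).
Notation Nad := (Nad P1 P2 P11 P12 P22).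
Notation Nbd := (Nbd P1 P2 P11 P12 P22).
Notation Pd := (Pd P1 P2).
Notation Pd1 := (Pdx P11 P12).
Notation Pd2 := (Pdy P12 P22).
Notation T1 := (third1 P11 P12).
Notation T2 := (third2 P12 P22).
Notation Va := (Va P12).
Notation Vb := (Vb P11 P22).
Notation N := (r + 1).
Notation E00 := (E 0%N 0%N).

Let cP12 : cont2 P12. Proof. by case: FL. Qed.
Let cP11 : cont2 P11. Proof. by case: FL. Qed.
Let cP22 : cont2 P22. Proof. by case: FL. Qed.
Let cP1 : cont2 P1. Proof. by case: FL. Qed.
Let cP2 : cont2 P2. Proof. by case: FL. Qed.
Let cPs : cont2 Ps. Proof. by case: FL. Qed.
Let cM : cont2 M. Proof. by case: FL. Qed.
Let cbe : cont2 be. Proof. exact: cont2_be FL. Qed.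
Let cTA : cont2 TA. Proof. exact: cont2_TA FL. Qed.
Let cTB : cont2 TB. Proof. exact: cont2_TB FL. Qed.
Let cNa : cont2 Na. Proof. exact: cont2_Na FL. Qed.
Let cNb : cont2 Nb. Proof. exact: cont2_Nb FL. Qed.
Let cNad e : cont2 (Nad e). Proof. exact: cont2_Nad FL e. Qed.
Let cNbd e : cont2 (Nbd e). Proof. exact: cont2_Nbd FL e. Qed.
Let cPd e : cont2 (Pd e). Proof. exact: cont2_Pd FL e. Qed.
Let cPd1 e : cont2 (Pd1 e). Proof. exact: cont2_Pd1 FL e. Qed.
Let cPd2 e : cont2 (Pd2 e). Proof. exact: cont2_Pd2 FL e. Qed.
Let cE i j : cont2 (E i j). Proof. exact: (@cut_cont R E r cut i j). Qed.
Let r0 : 0 <= r. Proof. exact: cut_r cut. Qed.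
Let N0 : 0 <= N. Proof. by rewrite addr_ge0. Qed.
Let cT1 e s : cont2 (T1 e s). Proof. exact: cont2_T1 FL e s. Qed.
Let cT2 e s : cont2 (T2 e s). Proof. exact: cont2_T2 FL e s. Qed.
Let cVa e s : cont2 (Va e s). Proof. exact: cont2_Va FL e s. Qed.
Let cVb e s : cont2 (Vb e s). Proof. exact: cont2_Vb FL e s. Qed.

Hint Resolve cP11 cP12 cP22 cE cT1 cT2 cVa cVb cPd cPd1 cPd2 cNad cNbd : cont.

Definition asym_eq (X Y : R -> R) := small (fun s => X s - Y s).

Lemma asym_eq_trans X Y Z : asym_eq X Y -> asym_eq Y Z -> asym_eq X Z.
Proof.
move=> h1 h2; apply: small_eq (smallD h1 h2) _; near=> s; ring.
Unshelve. all: by end_near. Qed.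

Lemma asym_eq_sym X Y : asym_eq X Y -> asym_eq Y X.
Proof. by move=> h; apply: small_eq (smallN h) _; near=> s; ring. Unshelve. all: by end_near. Qed.

Lemma asym_eq_eq X Y : (forall s, 0 < s <= 1 -> X s = Y s) -> asym_eq X Y.
Proof.
move=> H; apply: small_eq small0 _; near=> s; rewrite H ?subrr//.
by near: s; exact: near01.
Unshelve. all: by end_near. Qed.

Lemma asym_eqD X Y X' Y' : asym_eq X Y -> asym_eq X' Y' -> asym_eq (fun s => X s + X' s) (fun s => Y s + Y' s).
Proof. by move=> h1 h2; apply: small_eq (smallD h1 h2) _; near=> s; ring. Unshelve. all: by end_near. Qed.

Lemma asym_eqN X Y : asym_eq X Y -> asym_eq (fun s => - X s) (fun s => - Y s).
Proof. by move=> h1; apply: small_eq (smallN h1) _; near=> s; ring. Unshelve. all: by end_near. Qed.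

Lemma asym_eq_comb (a b x y z w : R -> R) : asym_eq (fun s => - a s) (fun s => x s + z s) ->
  asym_eq (fun s => - b s) (fun s => y s + w s) ->
  asym_eq (fun s => - (a s + b s)) (fun s => (x s + y s) + (z s + w s)).
Proof. by move=> h1 h2; apply: small_eq (smallD h1 h2) _; near=> s; ring. Unshelve. all: by end_near. Qed.

Lemma small_lim F G (f g : R -> R -> R) : cont2 f -> cont2 g -> (forall s, cont2 (F s)) -> (forall s, cont2 (G s)) ->
  unif_cvg F f -> unif_cvg G g ->
  asym_eq (fun s => Ibox N (fun x y => F s x y * G s x y)) (fun=> Ibox N (fun x y => f x y * g x y)).
Proof.
move=> cf cg cF cG uF uG.
have c1 (s : R) : cont2 (fun x y : R => 1 : R) by prove_cont.
have c2 s : cont2 (fun x y => F s x y * G s x y - f x y * g x y) by prove_cont.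
have b1 : bdd (fun s => Ibox N (fun x y => `|1 : R|)) by exact: bdd_cst.
apply: small_eq (small_Ibox N0 (unif_cvgM cf cg uF uG) c2 c1 b1) _; near=> s.
rewrite -IboxB; [|by prove_cont|by prove_cont].
by apply: eq_Ibox => x y _ _; rewrite mulr1.
Unshelve. all: by end_near. Qed.

Lemma cont2_Ka f f1 f2 : cont2 f -> cont2 f1 -> cont2 f2 -> cont2 (Ka E f f1 f2).
Proof. by move=> *; rewrite /Ka; prove_cont. Qed.
Lemma cont2_Kb f f1 f2 : cont2 f -> cont2 f1 -> cont2 f2 -> cont2 (Kb E f f1 f2).
Proof. by move=> *; rewrite /Kb; prove_cont. Qed.

Lemma unif_cvg_Ka F F1 F2 f f1 f2 : cont2 f -> cont2 f1 -> cont2 f2 ->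
  unif_cvg F f -> unif_cvg F1 f1 -> unif_cvg F2 f2 ->
  unif_cvg (fun s => Ka E (F s) (F1 s) (F2 s)) (Ka E f f1 f2).
Proof.
move=> cf cf1 cf2 u u1 u2; rewrite /Ka.
apply: unif_cvgD; first apply: unif_cvgD.
- by apply: unif_cvgM => //; exact: unif_cvg_cst.
- by apply: unif_cvgM => //; exact: unif_cvg_cst.
- by apply: unif_cvgM => //; exact: unif_cvg_cst.
Qed.

Lemma unif_cvg_Kb F F1 F2 f f1 f2 : cont2 f -> cont2 f1 -> cont2 f2 ->
  unif_cvg F f -> unif_cvg F1 f1 -> unif_cvg F2 f2 ->
  unif_cvg (fun s => Kb E (F s) (F1 s) (F2 s)) (Kb E f f1 f2).
Proof.
move=> cf cf1 cf2 u u1 u2; rewrite /Kb.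
apply: unif_cvgD; first apply: unif_cvg_sub.
- by apply: unif_cvgM => //; exact: unif_cvg_cst.
- by apply: unif_cvgM => //; exact: unif_cvg_cst.
- apply: unif_cvgM => //; first by prove_cont.
  exact: unif_cvg_cst (fun x y => (E 0%N 2%N x y - E 2%N 0%N x y) / 2).
Qed.

(** Two discretisations with the same limit [Ka0]: [Kad] is the one delivered by the tested
    equation, while [Kas] is built from double averages and can be differentiated. *)
Definition Kad e s := Ka E (fun x y => diff_quot e s Ps x y - c e) (diff_quot e s P1) (diff_quot e s P2).
Definition Kbd e s := Kb E (fun x y => diff_quot e s Ps x y - c e) (diff_quot e s P1) (diff_quot e s P2).
Definition Kas e s := Ka E (fun x y => smooth s (Pd e) x y - c e) (smooth s (Pd1 e)) (smooth s (Pd2 e)).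
Definition Kbs e s := Kb E (fun x y => smooth s (Pd e) x y - c e) (smooth s (Pd1 e)) (smooth s (Pd2 e)).
Definition Ka0 e := Ka E (fun x y => Pd e x y - c e) (Pd1 e) (Pd2 e).
Definition Kb0 e := Kb E (fun x y => Pd e x y - c e) (Pd1 e) (Pd2 e).

Let cPdc e : cont2 (fun x y => Pd e x y - c e).
Proof. by have := cPd e => h; prove_cont. Qed.
Let csP e s : cont2 (smooth s (Pd e)). Proof. exact: cont2_smooth. Qed.
Let csP1 e s : cont2 (smooth s (Pd1 e)). Proof. exact: cont2_smooth. Qed.
Let csP2 e s : cont2 (smooth s (Pd2 e)). Proof. exact: cont2_smooth. Qed.

Lemma cont2_Kad e s : cont2 (Kad e s). Proof. by apply: cont2_Ka; prove_cont. Qed.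
Lemma cont2_Kbd e s : cont2 (Kbd e s). Proof. by apply: cont2_Kb; prove_cont. Qed.
Lemma cont2_Kas e s : cont2 (Kas e s).
Proof. by have := csP e s => h; apply: cont2_Ka => //; prove_cont. Qed.
Lemma cont2_Kbs e s : cont2 (Kbs e s).
Proof. by have := csP e s => h; apply: cont2_Kb => //; prove_cont. Qed.
Lemma cont2_Ka0 e : cont2 (Ka0 e). Proof. exact: cont2_Ka. Qed.
Lemma cont2_Kb0 e : cont2 (Kb0 e). Proof. exact: cont2_Kb. Qed.

Lemma unif_cvg_Kad e : unif_cvg (Kad e) (Ka0 e) /\ unif_cvg (Kbd e) (Kb0 e).
Proof.
have h := unif_cvg_sub (unif_cvg_dPs FL e) (@unif_cvg_cst R (fun _ _ => c e)).
have h1 := unif_cvg_dP1 FL e; have h2 := unif_cvg_dP2 FL e.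
by split; [apply: unif_cvg_Ka|apply: unif_cvg_Kb].
Qed.

Lemma unif_cvg_Kas e : unif_cvg (Kas e) (Ka0 e) /\ unif_cvg (Kbs e) (Kb0 e).
Proof.
have h := unif_cvg_sub (unif_cvg_smooth (cPd e)) (@unif_cvg_cst R (fun _ _ => c e)).
have h1 := unif_cvg_smooth (cPd1 e); have h2 := unif_cvg_smooth (cPd2 e).
by split; [apply: unif_cvg_Ka|apply: unif_cvg_Kb].
Qed.

Lemma bddL1_dT e : bddL1 (fun s => diff_quot e s TA) /\ bddL1 (fun s => diff_quot e s TB).
Proof.
have [bA bB] := bddL2_W FL HC e.
have ca s : cont2 (diff_quot e s P12) by prove_cont.
have cb s : cont2 (diff_quot e s be) by prove_cont.
have b1 := bddL2_L1 ca bA; have b2 := bddL2_L1 cb bB.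
suff H (T : R -> R -> R) : cont2 T -> (forall K : R, exists2 L : R, 0 < L & forall s x y, 0 < s <= 1 -> `|x| <= K -> `|y| <= K ->
  `|diff_quot e s T x y| <= L * (`|diff_quot e s P12 x y| + `|diff_quot e s be x y|)) -> bddL1 (fun s => diff_quot e s T).
  split; apply: H => // K; have [L L0 HL] := dq_lip FL K; exists L => // s x y s01 xK yK.
  + by have [] := HL e s x y s01 xK yK.
  + by have [] := HL e s x y s01 xK yK.
move=> cT H K K0; have [L L0 HL] := H K.
apply: bdd_le (bddZ (ltW L0) (bddD (b1 K K0) (b2 K K0))) _.
near=> s; rewrite -IboxD; [|by prove_cont|by prove_cont].
rewrite -IboxZ; last by prove_cont.
apply: le_Ibox; [by prove_cont|by prove_cont|] => x y xK yK.
by apply: HL => //; near: s; exact: near01.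
Unshelve. all: by end_near. Qed.

(** [ee e] is the cut-off differentiated once more in direction e. The derivative of [Kas] in that
    direction splits into [KTa], which carries the averaged third derivatives, and [KLas], which
    converges locally uniformly. *)
Definition ee (e : bool) i j := if e then E i.+1 j else E i j.+1.
Definition Pdd (e : bool) := if e then P11 else P22.
Definition KLa e (f f1 f2 fe : R -> R -> R) x y : R :=
  ee e 1 0 x y * f2 x y + ee e 0 1 x y * f1 x y + ee e 1 1 x y * f x y + E 1%N 1%N x y * fe x y.
Definition KLb e (f f1 f2 fe : R -> R -> R) x y : R :=
  ee e 0 1 x y * f2 x y - ee e 1 0 x y * f1 x y + (ee e 0 2 x y - ee e 2 0 x y) / 2 * f x y +
  (E 0%N 2%N x y - E 2%N 0%N x y) / 2 * fe x y.
Definition KLas e s := KLa e (fun x y => smooth s (Pd e) x y - c e) (smooth s (Pd1 e)) (smooth s (Pd2 e)) (smooth s (Pdd e)).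
Definition KLbs e s := KLb e (fun x y => smooth s (Pd e) x y - c e) (smooth s (Pd1 e)) (smooth s (Pd2 e)) (smooth s (Pdd e)).
Definition KLa0 e := KLa e (fun x y => Pd e x y - c e) (Pd1 e) (Pd2 e) (Pdd e).
Definition KLb0 e := KLb e (fun x y => Pd e x y - c e) (Pd1 e) (Pd2 e) (Pdd e).
Definition KTa e s x y : R := E 1%N 0%N x y * T2 e s x y + E 0%N 1%N x y * T1 e s x y.
Definition KTb e s x y : R := E 0%N 1%N x y * T2 e s x y - E 1%N 0%N x y * T1 e s x y.

Let cee e i j : cont2 (ee e i j). Proof. by rewrite /ee; case: e. Qed.
Let cPdd e : cont2 (Pdd e). Proof. by rewrite /Pdd; case: e. Qed.

Lemma cont2_KLa e f f1 f2 fe : cont2 f -> cont2 f1 -> cont2 f2 -> cont2 fe -> cont2 (KLa e f f1 f2 fe).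
Proof.
by have h1 := cee e 1 0; have h2 := cee e 0 1; have h3 := cee e 1 1; move=> *; rewrite /KLa; prove_cont.
Qed.
Lemma cont2_KLb e f f1 f2 fe : cont2 f -> cont2 f1 -> cont2 f2 -> cont2 fe -> cont2 (KLb e f f1 f2 fe).
Proof.
by have h1 := cee e 1 0; have h2 := cee e 0 1; have h3 := cee e 0 2; have h4 := cee e 2 0; move=> *; rewrite /KLb; prove_cont.
Qed.

Lemma cont2_KT e s : cont2 (KTa e s) /\ cont2 (KTb e s).
Proof. by have h1 := cT1 e s; have h2 := cT2 e s; rewrite /KTa /KTb; split; prove_cont. Qed.

Lemma unif_cvg_KL e : unif_cvg (KLas e) (KLa0 e) /\ unif_cvg (KLbs e) (KLb0 e).
Proof.
have h := unif_cvg_sub (unif_cvg_smooth (cPd e)) (@unif_cvg_cst R (fun _ _ => c e)).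
have h1 := unif_cvg_smooth (cPd1 e); have h2 := unif_cvg_smooth (cPd2 e); have h3 := unif_cvg_smooth (cPdd e).
have k1 := cee e 1 0; have k2 := cee e 0 1; have k3 := cee e 0 2; have k4 := cee e 2 0; have k5 := cee e 1 1.
split.
- apply: unif_cvgD; first apply: unif_cvgD; first apply: unif_cvgD; (apply: unif_cvgM => //; exact: unif_cvg_cst).
- apply: unif_cvgD; first apply: unif_cvgD; first apply: unif_cvg_sub.
  + by apply: unif_cvgM => //; exact: unif_cvg_cst.
  + by apply: unif_cvgM => //; exact: unif_cvg_cst.
  + apply: unif_cvgM => //; first by prove_cont.
    exact: unif_cvg_cst (fun x y => (ee e 0 2 x y - ee e 2 0 x y) / 2).
  + apply: unif_cvgM => //; first by prove_cont.
    exact: unif_cvg_cst (fun x y => (E 0%N 2%N x y - E 2%N 0%N x y) / 2).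
Qed.

Lemma bddL1_KD e : bddL1 (fun s x y => KTa e s x y + KLas e s x y) /\
  bddL1 (fun s x y => KTb e s x y + KLbs e s x y).
Proof.
have b1 := bddL2_L1 (cT1 e) (bddL2_T1 FL HC e).
have b2 := bddL2_L1 (cT2 e) (bddL2_T2 FL HC e).
have bM i j (F : R -> R -> R -> R) : (forall s, cont2 (F s)) -> bddL1 F -> bddL1 (fun s x y => E i j x y * F s x y).
  move=> cF bF; exact: (bddL1M (cE i j) cF (fun=> cE i j) bF (@unif_cvg_cst R (E i j))).
have cM' i j (F : R -> R -> R -> R) : (forall s, cont2 (F s)) -> forall s, cont2 (fun x y => E i j x y * F s x y).
  by move=> cF s; prove_cont.
have bN (F : R -> R -> R -> R) : (forall s, cont2 (F s)) -> bddL1 F -> bddL1 (fun s x y => - F s x y).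
  move=> cF bF K K0; apply: bdd_le (bF K K0) _; near=> s.
  by apply: le_Ibox; [by prove_cont|by prove_cont|] => x y _ _; rewrite normrN.
have bU (F : R -> R -> R -> R) f : cont2 f -> (forall s, cont2 (F s)) -> unif_cvg F f -> bddL1 F.
  move=> cf cF uF K K0; have [C C0 HCC] := unif_cvg_bounded K cf uF.
  exists (C * (4 * K ^+ 2)); near=> s; rewrite -Ibox_cst//.
  apply: le_Ibox; [by prove_cont|by prove_cont|] => x y xK yK.
  by move: x y xK yK; near: s; exact: HCC.
have [u1 u2] := unif_cvg_KL e.
have k0 : cont2 (KLa0 e) by apply: cont2_KLa => //; exact: cPdc.
have k1 : cont2 (KLb0 e) by apply: cont2_KLb => //; exact: cPdc.
have k2 s : cont2 (KLas e s) by apply: cont2_KLa; prove_cont.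
have k3 s : cont2 (KLbs e s) by apply: cont2_KLb; prove_cont.
split.
- apply: bddL1D => [s|s||]; [by have [] := cont2_KT e s|exact: k2| |exact: bU k0 k2 u1].
  apply: bddL1D => [s|s||]; [by prove_cont|by prove_cont|exact: bM|exact: bM].
- apply: bddL1D => [s|s||]; [by have [] := cont2_KT e s|exact: k3| |exact: bU k1 k3 u2].
  apply: bddL1D => [s|s||]; [by prove_cont|by prove_cont|exact: bM|].
  by apply: bN => [s|]; [by prove_cont|exact: bM].
Unshelve. all: by end_near. Qed.

Lemma Dd_Kas e s : s != 0 -> partial e (Kas e s) (fun x y => KTa e s x y + KLas e s x y) /\
  partial e (Kbs e s) (fun x y => KTb e s x y + KLbs e s x y).
Proof.
move=> s0; have [_ _ _ _ _ _ _ dPs1 dPs2 dP11 dP12 dP21 dP22 _ _ _ _ _] := FL.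
have dE1 := @cut_D1 R E r cut; have dE2 := @cut_D2 R E r cut.
have d1 : partial e (smooth s (Pd1 e)) (T1 e s) := Dd_smooth e s0 (cPd1 e).
have d2 : partial e (smooth s (Pd2 e)) (T2 e s) := Dd_smooth e s0 (cPd2 e).
have d : partial e (smooth s (Pd e)) (smooth s (Pdd e)).
  apply: Dd_smooth' => //.
  by rewrite /Pdd; case: (e).
rewrite /Kas /Kbs /Ka /Kb /KTa /KTb /KLas /KLbs /KLa /KLb /ee.
move: d d1 d2; rewrite /partial; case: e => d d1 d2.
- change (D1 (smooth s (Pd true)) (smooth s (Pd1 true))) in d.
  set f := smooth s (Pd true) in d *; set f1 := smooth s (Pd1 true) in d d1 *.
  set f2 := smooth s (Pd2 true) in d2 *.
  set t1 := T1 true s in d1 *; set t2 := T2 true s in d2 *.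
  clearbody f f1 f2 t1 t2.
  by split; prove_partial; field.
- change (D2 (smooth s (Pd false)) (smooth s (Pd2 false))) in d.
  set f := smooth s (Pd false) in d *; set f2 := smooth s (Pd2 false) in d d2 *.
  set f1 := smooth s (Pd1 false) in d1 *.
  set t1 := T1 false s in d1 *; set t2 := T2 false s in d2 *.
  clearbody f f1 f2 t1 t2.
  by split; prove_partial; field.
Qed.

Lemma bsupp_K e s : [/\ bsupp r (Kas e s), bsupp r (Kbs e s),
  bsupp r (fun x y => KTa e s x y + KLas e s x y) & bsupp r (fun x y => KTb e s x y + KLbs e s x y)].
Proof.
have z i j x y : r <= `|x| \/ r <= `|y| -> E i j x y = 0 := @cut_supp R E r cut i j x y.
by split=> x y xy; rewrite /Kas /Kbs /Ka /Kb /KTa /KTb /KLas /KLbs /KLa /KLb /ee;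
  repeat match goal with |- context [smooth ?u ?f ?a ?b] => generalize (smooth u f a b); intro end;
  repeat match goal with |- context [third1 _ _ ?u ?f ?a ?b] => generalize (third1 P11 P12 u f a b); intro end;
  repeat match goal with |- context [third2 _ _ ?u ?f ?a ?b] => generalize (third2 P12 P22 u f a b); intro end;
  case: (e);
  rewrite !(z _ _ _ _ xy) !(mul0r, addr0, subr0).
Qed.

(** The commutator is replaced by its differentiable version, the quotient of the stress is
    integrated by parts, and the averaged stress is replaced by the stress. Only the part with third
    derivatives, bounded but not known to converge, still depends on s. *)
Lemma stress_term e : asym_eq (fun s => - (Ibox N (fun x y => diff_quot e s TA x y * Kad e s x y) + Ibox N (fun x y => diff_quot e s TB x y * Kbd e s x y)))
  (fun s => (Ibox N (fun x y => TA x y * KTa e s x y) + Ibox N (fun x y => TB x y * KTb e s x y)) +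
     (Ibox N (fun x y => TA x y * KLa0 e x y) + Ibox N (fun x y => TB x y * KLb0 e x y))).
Proof.
have k0 : cont2 (KLa0 e) by apply: cont2_KLa => //; exact: cPdc.
have k1 : cont2 (KLb0 e) by apply: cont2_KLb => //; exact: cPdc.
have k2 s : cont2 (KLas e s) by apply: cont2_KLa; prove_cont.
have k3 s : cont2 (KLbs e s) by apply: cont2_KLb; prove_cont.
have k4 s : cont2 (KTa e s) by have [] := cont2_KT e s.
have k5 s : cont2 (KTb e s) by have [] := cont2_KT e s.
have k6 s : cont2 (Kas e s) := cont2_Kas e s.
have k7 s : cont2 (Kbs e s) := cont2_Kbs e s.
have [bA bB] := bddL1_dT e; have [ua ub] := unif_cvg_Kad e; have [va vb] := unif_cvg_Kas e.
have [la lb] := unif_cvg_KL e; have [da db] := bddL1_KD e.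
have gen (T : R -> R -> R) (K_d K_s : R -> R -> R -> R) K_0 (KT KLs : R -> R -> R -> R) KL0 : cont2 T ->
    bddL1 (fun s => diff_quot e s T) -> cont2 K_0 -> cont2 KL0 -> (forall s, cont2 (K_d s)) -> (forall s, cont2 (K_s s)) ->
    (forall s, cont2 (KT s)) -> (forall s, cont2 (KLs s)) -> unif_cvg K_d K_0 -> unif_cvg K_s K_0 -> unif_cvg KLs KL0 ->
    bddL1 (fun s x y => KT s x y + KLs s x y) ->
    (forall s, s != 0 -> partial e (K_s s) (fun x y => KT s x y + KLs s x y)) ->
    (forall s, bsupp r (K_s s)) -> (forall s, bsupp r (fun x y => KT s x y + KLs s x y)) ->
    asym_eq (fun s => - Ibox N (fun x y => diff_quot e s T x y * K_d s x y))
       (fun s => Ibox N (fun x y => T x y * KT s x y) + Ibox N (fun x y => T x y * KL0 x y)).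
  move=> cT bT cK0 cKL0 cKd cKs cKT cKLs uKd uKs uKL bKD dK sK sKD.
  have cdT s : cont2 (diff_quot e s T) by prove_cont.
  have h1 := small_diff N0 cK0 cdT cKd bT uKd.
  have h2 := small_diff N0 cK0 cdT cKs bT uKs.
  have h3 : asym_eq (fun s => Ibox N (fun x y => K_s s x y * diff_quot e s T x y))
      (fun s => - Ibox N (fun x y => steklov e s T x y * (KT s x y + KLs s x y))).
    apply: asym_eq_eq => s /andP[s0 s1].
    have cD : cont2 (fun x y => KT s x y + KLs s x y) by prove_cont.
    have sN : r + `|s| <= N by rewrite gtr0_norm// lerD2l.
    rewrite -(Ibox_dq_ibp (lt0r_neq0 s0) cT (cKs s) cD (dK s (lt0r_neq0 s0)) r0 (sK s) (sKD s) sN).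
    by apply: eq_Ibox => x y _ _; rewrite mulrC.
  have cD s : cont2 (fun x y => KT s x y + KLs s x y) by prove_cont.
  have cAT s : cont2 (steklov e s T) by prove_cont.
  have h4 := small_diff N0 cT cD cAT bKD (@unif_cvg_Av R e (fun=> T) T cT (fun=> cT) (@unif_cvg_cst R T)).
  have h5 := small_lim cT cKL0 (fun=> cT) cKLs (@unif_cvg_cst R T) uKL.
  have h6 : asym_eq (fun s => Ibox N (fun x y => T x y * (KT s x y + KLs s x y)))
     (fun s => Ibox N (fun x y => T x y * KT s x y) + Ibox N (fun x y => T x y * KLs s x y)).
    apply: asym_eq_eq => s _; rewrite -IboxD; [|by prove_cont|by prove_cont].
    by apply: eq_Ibox => x y _ _; rewrite mulrDr.
  have h0 : asym_eq (fun s => Ibox N (fun x y => diff_quot e s T x y * K_d s x y)) (fun s => Ibox N (fun x y => K_d s x y * diff_quot e s T x y)).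
    by apply: asym_eq_eq => s _; apply: eq_Ibox => x y _ _; rewrite mulrC.
  have g1 := asym_eq_trans (asym_eq_trans h0 h1) (asym_eq_trans (asym_eq_sym h2) h3).
  have g2 := asym_eqN g1; have g3 := asym_eq_trans h4 h6.
  have z : asym_eq (fun s => Ibox N (fun x y => T x y * KT s x y)) (fun s => Ibox N (fun x y => T x y * KT s x y)).
    by apply: asym_eq_eq.
  have g4 := asym_eq_trans g3 (asym_eqD z h5).
  have g5 : asym_eq (fun s => - - Ibox N (fun x y => steklov e s T x y * (KT s x y + KLs s x y))) (fun s => Ibox N (fun x y => steklov e s T x y * (KT s x y + KLs s x y))).
    by apply: asym_eq_eq => s _; rewrite opprK.
  exact: asym_eq_trans g2 (asym_eq_trans g5 g4).
have ga := gen TA (Kad e) (Kas e) (Ka0 e) (KTa e) (KLas e) (KLa0 e) cTA bA (cont2_Ka0 e) k0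
  (cont2_Kad e) k6 k4 k2 ua va la da (fun s s0 => proj1 (Dd_Kas e s0))
  (fun s => let: And4 h _ _ _ := bsupp_K e s in h) (fun s => let: And4 _ _ h _ := bsupp_K e s in h).
have gb := gen TB (Kbd e) (Kbs e) (Kb0 e) (KTb e) (KLbs e) (KLb0 e) cTB bB (cont2_Kb0 e) k1
  (cont2_Kbd e) k7 k5 k3 ub vb lb db (fun s s0 => proj2 (Dd_Kas e s0))
  (fun s => let: And4 _ h _ _ := bsupp_K e s in h) (fun s => let: And4 _ _ _ h := bsupp_K e s in h).
exact: asym_eq_comb ga gb.
Qed.

(* (FF1, FF2) is a flux whose divergence is the cubic convective term: the part
   without second derivatives of u, tr(A^2 A^T) for A = Du, vanishes as tr A = 0. *)
Definition FF1 (p1 p2 p11 p12 p22 : R -> R -> R) x y : R :=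
  (p11 x y ^+ 2 + 2 * p12 x y ^+ 2 + p22 x y ^+ 2) / 2 * p2 x y +
  p12 x y * (p2 x y * p12 x y + p1 x y * p11 x y) + p22 x y * (p2 x y * p22 x y + p1 x y * p12 x y).
Definition FF2 (p1 p2 p11 p12 p22 : R -> R -> R) x y : R :=
  - ((p11 x y ^+ 2 + 2 * p12 x y ^+ 2 + p22 x y ^+ 2) / 2 * p1 x y +
  p11 x y * (p2 x y * p12 x y + p1 x y * p11 x y) + p12 x y * (p2 x y * p22 x y + p1 x y * p12 x y)).

(** The product rule applied to averaged fields. Unlike the quotients of [Na], these expressions
    satisfy the algebraic cancellation of [conv_exact] exactly. *)
Definition Nads e s x y : R := 2 * smooth s P2 x y * smooth s (Pd2 e) x y - 2 * smooth s P1 x y * smooth s (Pd1 e) x y.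
Definition Nbds e s x y : R := - 2 * smooth s (Pd1 e) x y * smooth s P2 x y - 2 * smooth s P1 x y * smooth s (Pd2 e) x y.

Lemma unif_cvgZ (k : R) (F : R -> R -> R -> R) (f : R -> R -> R) : cont2 f -> unif_cvg F f -> unif_cvg (fun s x y => k * F s x y) (fun x y => k * f x y).
Proof. by move=> cf uF; apply: unif_cvgM => //; [prove_cont|exact: (@unif_cvg_cst R (fun _ _ => k))]. Qed.

Lemma unif_cvg_Nads e : unif_cvg (Nads e) (Nad e).
Proof.
have h1 := unif_cvg_smooth cP1; have h2 := unif_cvg_smooth cP2.
have h3 := unif_cvg_smooth (cPd1 e); have h4 := unif_cvg_smooth (cPd2 e).
by apply: unif_cvg_sub; apply: unif_cvgM => //; [by prove_cont|exact: unif_cvgZ|by prove_cont|exact: unif_cvgZ].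
Qed.

Lemma unif_cvg_Nbds e : unif_cvg (Nbds e) (Nbd e).
Proof.
have h1 := unif_cvg_smooth cP1; have h2 := unif_cvg_smooth cP2.
have h3 := unif_cvg_smooth (cPd1 e); have h4 := unif_cvg_smooth (cPd2 e).
by apply: unif_cvg_sub; apply: unif_cvgM => //; [by prove_cont|exact: unif_cvgZ|by prove_cont|exact: unif_cvgZ].
Qed.

Lemma cont2_Nads e s : cont2 (Nads e s). Proof. by rewrite /Nads; prove_cont. Qed.
Lemma cont2_Nbds e s : cont2 (Nbds e s). Proof. by rewrite /Nbds; prove_cont. Qed.

Lemma D_smooth2 s : s != 0 ->
  [/\ D1 (smooth s P11) (fun x y => Va false s x y - 2 * Vb true s x y),
      D1 (smooth s P12) (Va true s) & D1 (smooth s P22) (Va false s)] /\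
  [/\ D2 (smooth s P11) (Va true s), D2 (smooth s P12) (Va false s) &
      D2 (smooth s P22) (fun x y => Va true s x y + 2 * Vb false s x y)].
Proof.
move=> s0; have [h1 h2] := T12_21 FL s0.
split; split.
- have := Dd_smooth true s0 cP11; rewrite /partial => H y x; have := H y x.
  by have /= := T1E FL true x y s0; rewrite /third1/= => ->.
- exact: (Dd_smooth true s0 cP12).
- have H : D1 (smooth s P22) (steklov2 s (diff_quot true s P22)) := Dd_smooth true s0 cP22.
  by rewrite h2 in H.
- have H : D2 (smooth s P11) (steklov1 s (diff_quot false s P11)) := Dd_smooth false s0 cP11.
  by rewrite -h1 in H.
- exact: (Dd_smooth false s0 cP12).
- have := Dd_smooth false s0 cP22; rewrite /partial => H x y; have := H x y.
  by have /= := T2E FL false x y s0; rewrite /third2/= => ->.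
Qed.

Lemma Ibox_sum4 (f1 f2 f3 f4 : R -> R -> R) : cont2 f1 -> cont2 f2 -> cont2 f3 -> cont2 f4 ->
  (Ibox N f1 + Ibox N f2) + (Ibox N f3 + Ibox N f4) =
  Ibox N (fun x y => (f1 x y + f2 x y) + (f3 x y + f4 x y)).
Proof.
move=> c1 c2 c3 c4; rewrite -(IboxD N c1 c2) -(IboxD N c3 c4) -IboxD//; prove_cont.
Qed.

(** The divergence theorem for E00 times the flux of the averaged fields: these obey the Leibniz
    rule, so the cubic cancellation holds before the limit. *)
Lemma conv_exact s : 0 < s <= 1 ->
  (Ibox N (fun x y => E00 x y * Nads true s x y * Va true s x y) +
   Ibox N (fun x y => E00 x y * Nbds true s x y * Vb true s x y)) +
  (Ibox N (fun x y => E00 x y * Nads false s x y * Va false s x y) +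
   Ibox N (fun x y => E00 x y * Nbds false s x y * Vb false s x y)) =
  - (Ibox N (fun x y => E 1%N 0%N x y * FF1 (smooth s P1) (smooth s P2) (smooth s P11) (smooth s P12) (smooth s P22) x y) +
     Ibox N (fun x y => E 0%N 1%N x y * FF2 (smooth s P1) (smooth s P2) (smooth s P11) (smooth s P12) (smooth s P22) x y)).
Proof.
move=> /andP[s_gt0 _]; have s0 := lt0r_neq0 s_gt0.
have [_ _ _ _ _ _ _ _ _ dP11 dP12 dP21 dP22 _ _ _ _ _] := FL.
have [[d111 d121 d221] [d112 d122 d222]] := D_smooth2 s0.
have d11 : D1 (smooth s P1) (smooth s P11) := @Dd_smooth' R true s P1 P11 s0 cP1 cP11 dP11.
have d12 : D2 (smooth s P1) (smooth s P12) := @Dd_smooth' R false s P1 P12 s0 cP1 cP12 dP12.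
have d21 : D1 (smooth s P2) (smooth s P12) := @Dd_smooth' R true s P2 P12 s0 cP2 cP12 dP21.
have d22 : D2 (smooth s P2) (smooth s P22) := @Dd_smooth' R false s P2 P22 s0 cP2 cP22 dP22.
have dE1 := @cut_D1 R E r cut; have dE2 := @cut_D2 R E r cut.
rewrite /Nads /Nbds /Pdx /Pdy.
have c1 := cont2_smooth s cP1.
have c2 := cont2_smooth s cP2.
have c11 := cont2_smooth s cP11.
have c12 := cont2_smooth s cP12.
have c22 := cont2_smooth s cP22.
move: c1 c2 c11 c12 c22 d11 d12 d21 d22 d111 d121 d221 d112 d122 d222.
have ca1 := cVa true s; have ca2 := cVa false s; have cb1 := cVb true s; have cb2 := cVb false s.
move: ca1 ca2 cb1 cb2.
set p1 := smooth s P1; set p2 := smooth s P2; set p11 := smooth s P11; set p12 := smooth s P12; set p22 := smooth s P22.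
set a1 := Va true s; set a2 := Va false s; set b1 := Vb true s; set b2 := Vb false s.
clearbody p1 p2 p11 p12 p22 a1 a2 b1 b2.
move=> ca1 ca2 cb1 cb2 c1 c2 c11 c12 c22 d11 d12 d21 d22 d111 d121 d221 d112 d122 d222.
pose t111 x y := a2 x y - 2 * b1 x y; pose t222 x y := a1 x y + 2 * b2 x y.
(* [G1] and [G2] are the partial derivatives of E00 [FF1] in x and of E00 [FF2] in y; their sum is
   the convective integrand plus the terms with the gradient of E00. *)
pose G1 x y := E 1%N 0%N x y * FF1 p1 p2 p11 p12 p22 x y + E00 x y * (
  (p11 x y * t111 x y + 2 * p12 x y * a1 x y + p22 x y * a2 x y) * p2 x y +
  (p11 x y ^+ 2 + 2 * p12 x y ^+ 2 + p22 x y ^+ 2) / 2 * p12 x y +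
  a1 x y * (p2 x y * p12 x y + p1 x y * p11 x y) +
  p12 x y * (p12 x y * p12 x y + p2 x y * a1 x y + p11 x y * p11 x y + p1 x y * t111 x y) +
  a2 x y * (p2 x y * p22 x y + p1 x y * p12 x y) +
  p22 x y * (p12 x y * p22 x y + p2 x y * a2 x y + p11 x y * p12 x y + p1 x y * a1 x y)).
pose G2 x y := E 0%N 1%N x y * FF2 p1 p2 p11 p12 p22 x y - E00 x y * (
  (p11 x y * a1 x y + 2 * p12 x y * a2 x y + p22 x y * t222 x y) * p1 x y +
  (p11 x y ^+ 2 + 2 * p12 x y ^+ 2 + p22 x y ^+ 2) / 2 * p12 x y +
  a1 x y * (p2 x y * p12 x y + p1 x y * p11 x y) +
  p11 x y * (p22 x y * p12 x y + p2 x y * a2 x y + p12 x y * p11 x y + p1 x y * a1 x y) +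
  a2 x y * (p2 x y * p22 x y + p1 x y * p12 x y) +
  p12 x y * (p22 x y * p22 x y + p2 x y * t222 x y + p12 x y * p12 x y + p1 x y * a2 x y)).
have dG1 : D1 (fun x y => E00 x y * FF1 p1 p2 p11 p12 p22 x y) G1.
  by rewrite /FF1 /G1 /FF1 /t111; prove_partial; field.
have dG2 : D2 (fun x y => E00 x y * FF2 p1 p2 p11 p12 p22 x y) G2.
  by rewrite /FF2 /G2 /FF2 /t222; prove_partial; field.
have cG1 : cont2 G1 by rewrite /G1 /FF1 /t111; prove_cont.
have cG2 : cont2 G2 by rewrite /G2 /FF2 /t222; prove_cont.
have z x y : N <= `|x| \/ N <= `|y| -> E00 x y = 0.
  by move=> xy; apply: (@cut_supp R E r cut); case: xy => h; [left|right]; lra.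
have i1 := Ibox_D1 N0 dG1 cG1 (fun x y xy => etrans (congr1 ( *%R^~ _) (z x y xy)) (mul0r _)).
have i2 := Ibox_D2 N0 dG2 cG2 (fun x y xy => etrans (congr1 ( *%R^~ _) (z x y xy)) (mul0r _)).
have cF1 : cont2 (FF1 p1 p2 p11 p12 p22) by rewrite /FF1; prove_cont.
have cF2 : cont2 (FF2 p1 p2 p11 p12 p22) by rewrite /FF2; prove_cont.
rewrite Ibox_sum4 -?IboxD; [|by prove_cont..].
rewrite -[RHS]add0r -[X in X - _]addr0 -{1}i1 -i2 -(IboxD N cG1 cG2) -?IboxB; [|by prove_cont|by prove_cont].
by apply: eq_Ibox => x y _ _; rewrite /G1 /G2 /FF1 /FF2 /t111 /t222; field.
Qed.

(** The quotient of X is replaced by its uniform approximation [nds]. To trade the quotient of Y for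
    its average, the average is transposed onto E00 [nds], where it changes the factor only by a
    uniformly small amount. *)
Lemma conv1 e (X Y nd : R -> R -> R) (nds : R -> R -> R -> R) : cont2 X -> cont2 Y -> cont2 nd ->
  (forall s, cont2 (nds s)) -> unif_cvg (fun s => diff_quot e s X) nd -> unif_cvg nds nd -> bddL2 (fun s => diff_quot e s Y) ->
  asym_eq (fun s => Ibox N (fun x y => diff_quot e s X x y * (E00 x y * diff_quot e s Y x y)))
     (fun s => Ibox N (fun x y => E00 x y * nds s x y * steklov (~~ e) s (diff_quot e s Y) x y)).
Proof.
move=> cX cY cnd cnds uX uN bY.
have cdY s : cont2 (diff_quot e s Y) by prove_cont.
have bY1 := bddL2_L1 cdY bY.
have bF : bddL1 (fun s x y => E00 x y * diff_quot e s Y x y).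
  exact: (bddL1M (cE 0 0) cdY (fun=> cE 0 0) bY1 (@unif_cvg_cst R E00)).
have cF s : cont2 (fun x y => E00 x y * diff_quot e s Y x y) by prove_cont.
have cdX s : cont2 (diff_quot e s X) by prove_cont.
have h1 := small_diff N0 cnd cF cdX bF uX.
have cEn : cont2 (fun x y => E00 x y * nd x y) by prove_cont.
have cEs s : cont2 (fun x y => E00 x y * nds s x y) by prove_cont.
have uE := unif_cvgM (cE 0 0) cnd (@unif_cvg_cst R E00) uN.
have cA s : cont2 (steklov (~~ e) (- s) (fun x y => E00 x y * nds s x y)) by exact: cont2_Av.
have h2 := small_diff N0 cEn cdY cA bY1 (unif_cvg_AvN (~~ e) cEn cEs uE).
apply: asym_eq_trans h1 _; apply: asym_eq_sym; apply: asym_eq_trans.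
  2: apply: asym_eq_trans h2 _; apply: asym_eq_eq => s _; apply: eq_Ibox => x y _ _; by rewrite mulrAC [RHS]mulrC mulrAC.
apply: asym_eq_eq => s /andP[s0 s1].
rewrite (@Ibox_Av R (~~ e) s r N (diff_quot e s Y) (fun x y => E00 x y * nds s x y))//.
- by move=> x y xy; rewrite (@cut_supp R E r cut)// mul0r.
- by rewrite gtr0_norm// lerD2l.
Qed.

Lemma cont2_FF p1 p2 p11 p12 p22 : cont2 p1 -> cont2 p2 -> cont2 p11 -> cont2 p12 -> cont2 p22 ->
  cont2 (FF1 p1 p2 p11 p12 p22) /\ cont2 (FF2 p1 p2 p11 p12 p22).
Proof. by move=> *; rewrite /FF1 /FF2; split; prove_cont. Qed.

Lemma unif_cvg_sqr (F : R -> R -> R -> R) (f : R -> R -> R) : cont2 f -> unif_cvg F f -> unif_cvg (fun s x y => F s x y ^+ 2) (fun x y => f x y ^+ 2).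
Proof.
move=> cf uF; apply: unif_small_eq (unif_cvgM cf cf uF uF) _; near=> s.
by apply/funext => x; apply/funext => y; rewrite !expr2.
Unshelve. all: by end_near. Qed.

Lemma unif_cvg_FF (p1 p2 p11 p12 p22 : R -> R -> R) (q1 q2 q11 q12 q22 : R -> R -> R -> R) :
  cont2 p1 -> cont2 p2 -> cont2 p11 -> cont2 p12 -> cont2 p22 ->
  unif_cvg q1 p1 -> unif_cvg q2 p2 -> unif_cvg q11 p11 -> unif_cvg q12 p12 -> unif_cvg q22 p22 ->
  unif_cvg (fun s => FF1 (q1 s) (q2 s) (q11 s) (q12 s) (q22 s)) (FF1 p1 p2 p11 p12 p22) /\
  unif_cvg (fun s => FF2 (q1 s) (q2 s) (q11 s) (q12 s) (q22 s)) (FF2 p1 p2 p11 p12 p22).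
Proof.
move=> c1 c2 c11 c12 c22 u1 u2 u11 u12 u22.
have uM := fun f g F G (cf : cont2 f) (cg : cont2 g) => @unif_cvgM R F G f g cf cg.
have uS : unif_cvg (fun s x y => (q11 s x y ^+ 2 + 2 * q12 s x y ^+ 2 + q22 s x y ^+ 2) / 2)
  (fun x y => (p11 x y ^+ 2 + 2 * p12 x y ^+ 2 + p22 x y ^+ 2) / 2).
  apply: unif_cvgM; [by prove_cont|by prove_cont| |exact: (@unif_cvg_cst R (fun _ _ => 2^-1))].
  apply: unif_cvgD; last exact: unif_cvg_sqr.
  apply: unif_cvgD; first exact: unif_cvg_sqr.
  by apply: unif_cvgZ; [prove_cont|exact: unif_cvg_sqr].
have uA : unif_cvg (fun s x y => q2 s x y * q12 s x y + q1 s x y * q11 s x y) (fun x y => p2 x y * p12 x y + p1 x y * p11 x y).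
  by apply: unif_cvgD; exact: unif_cvgM.
have uB : unif_cvg (fun s x y => q2 s x y * q22 s x y + q1 s x y * q12 s x y) (fun x y => p2 x y * p22 x y + p1 x y * p12 x y).
  by apply: unif_cvgD; exact: unif_cvgM.
split.
- apply: unif_cvgD; first apply: unif_cvgD.
  + by apply: unif_cvgM uS u2 => //; prove_cont.
  + by apply: unif_cvgM u12 uA => //; prove_cont.
  + by apply: unif_cvgM u22 uB => //; prove_cont.
- apply: unif_cvgN; apply: unif_cvgD; first apply: unif_cvgD.
  + by apply: unif_cvgM uS u1 => //; prove_cont.
  + by apply: unif_cvgM u11 uA => //; prove_cont.
  + by apply: unif_cvgM u12 uB => //; prove_cont.
Qed.

Notation G1 := (FF1 P1 P2 P11 P12 P22).
Notation G2 := (FF2 P1 P2 P11 P12 P22).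

Lemma conv_term : asym_eq (fun s =>
   (Ibox N (fun x y => diff_quot true s Na x y * (E00 x y * diff_quot true s P12 x y)) +
    Ibox N (fun x y => diff_quot true s Nb x y * (E00 x y * diff_quot true s be x y))) +
   (Ibox N (fun x y => diff_quot false s Na x y * (E00 x y * diff_quot false s P12 x y)) +
    Ibox N (fun x y => diff_quot false s Nb x y * (E00 x y * diff_quot false s be x y))))
  (fun=> - (Ibox N (fun x y => E 1%N 0%N x y * G1 x y) + Ibox N (fun x y => E 0%N 1%N x y * G2 x y))).
Proof.
have hA e := conv1 cNa cP12 (cNad e) (cont2_Nads e) (unif_cvg_dNa FL e) (unif_cvg_Nads e) (proj1 (bddL2_W FL HC e)).
have hB e := conv1 cNb cbe (cNbd e) (cont2_Nbds e) (unif_cvg_dNb FL e) (unif_cvg_Nbds e) (proj2 (bddL2_W FL HC e)).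
have h := asym_eqD (asym_eqD (hA true) (hB true)) (asym_eqD (hA false) (hB false)).
apply: asym_eq_trans h _; apply: asym_eq_trans (asym_eq_eq conv_exact) _.
have [u1 u2] := unif_cvg_FF cP1 cP2 cP11 cP12 cP22 (unif_cvg_smooth cP1) (unif_cvg_smooth cP2) (unif_cvg_smooth cP11) (unif_cvg_smooth cP12) (unif_cvg_smooth cP22).
have [c1 c2] := cont2_FF cP1 cP2 cP11 cP12 cP22.
have cs s := cont2_FF (cont2_smooth s cP1) (cont2_smooth s cP2) (cont2_smooth s cP11) (cont2_smooth s cP12) (cont2_smooth s cP22).
apply: asym_eqN; apply: asym_eqD.
- exact: (small_lim (cE 1 0) c1 (fun=> cE 1 0) (fun s => proj1 (cs s)) (@unif_cvg_cst R (E 1%N 0%N)) u1).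
- exact: (small_lim (cE 0 1) c2 (fun=> cE 0 1) (fun s => proj2 (cs s)) (@unif_cvg_cst R (E 0%N 1%N)) u2).
Qed.

Definition asym_le (X Y : R -> R) := forall k : R, 0 < k -> \forall s \near 0^'+, X s <= Y s + k.

Lemma asym_le_trans X Y Z : asym_le X Y -> asym_le Y Z -> asym_le X Z.
Proof.
move=> h1 h2 k k0; have k2 : 0 < k / 2 by rewrite divr_gt0.
have {}h1 := h1 _ k2; have {}h2 := h2 _ k2.
near=> s.
have a1 : X s <= Y s + k / 2 by near: s.
have a2 : Y s <= Z s + k / 2 by near: s.
lra.
Unshelve. all: by end_near. Qed.

Lemma asym_leD X Y X' Y' : asym_le X Y -> asym_le X' Y' -> asym_le (fun s => X s + X' s) (fun s => Y s + Y' s).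
Proof.
move=> h1 h2 k k0; have k2 : 0 < k / 2 by rewrite divr_gt0.
have {}h1 := h1 _ k2; have {}h2 := h2 _ k2.
near=> s.
have a1 : X s <= Y s + k / 2 by near: s.
have a2 : X' s <= Y' s + k / 2 by near: s.
lra.
Unshelve. all: by end_near. Qed.

Lemma asym_eq_le X Y : asym_eq X Y -> asym_le X Y.
Proof.
move=> h k k0; have {}h := h k k0; near=> s.
have : `|X s - Y s| <= k by near: s.
by rewrite ler_norml => /andP[_]; lra.
Unshelve. all: by end_near. Qed.

Lemma asym_le_le X Y : (forall s, 0 < s <= 1 -> X s <= Y s) -> asym_le X Y.
Proof.
move=> H k k0; near=> s.
by rewrite (le_trans (H s _)) ?lerDl ?(ltW k0)//; near: s; exact: near01.
Unshelve. all: by end_near. Qed.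

Definition hessian_energy e s := Ibox N (fun x y => E00 x y * M x y * (diff_quot e s P12 x y ^+ 2 + diff_quot e s be x y ^+ 2)).

(** After Jensen's inequality the average is transposed onto the weight E00 M; this weight is
    continuous, so its averages converge uniformly. *)
Lemma jensen e Y : cont2 Y -> bddL2 (fun s => diff_quot e s Y) ->
  asym_le (fun s => Ibox N (fun x y => E00 x y * M x y * steklov (~~ e) s (diff_quot e s Y) x y ^+ 2))
       (fun s => Ibox N (fun x y => E00 x y * M x y * diff_quot e s Y x y ^+ 2)).
Proof.
move=> cY bY.
have cdY s : cont2 (diff_quot e s Y) by prove_cont.
have cdY2 s : cont2 (fun x y => diff_quot e s Y x y ^+ 2) by prove_cont.
have bY2 := bddL1_L2 cdY bY.
have cEM : cont2 (fun x y => E00 x y * M x y) by prove_cont.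
have cA s : cont2 (steklov (~~ e) (- s) (fun x y => E00 x y * M x y)) by exact: cont2_Av.
have h2 := small_diff N0 cEM cdY2 cA bY2 (unif_cvg_AvN (~~ e) cEM (fun=> cEM) (@unif_cvg_cst R (fun x y => E00 x y * M x y))).
apply: asym_le_trans (asym_eq_le h2); apply: asym_le_le => s /andP[s0 s1].
rewrite -(@Ibox_Av R (~~ e) s r N (fun x y => diff_quot e s Y x y ^+ 2) (fun x y => E00 x y * M x y))//; first last.
- by rewrite gtr0_norm// lerD2l.
- by move=> x y xy; rewrite (@cut_supp R E r cut)// mul0r.
have cV : cont2 (steklov (~~ e) s (diff_quot e s Y)) by exact: cont2_Av.
have cV2 : cont2 (steklov (~~ e) s (fun x y => diff_quot e s Y x y ^+ 2)) by exact: cont2_Av.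
apply: le_Ibox; [by prove_cont|by prove_cont|] => x y _ _.
apply: ler_wpM2l; last exact: Av_sqr.
rewrite mulr_ge0//; first exact: (cut_ge0 cut).
by apply: ltW; apply: lt_le_trans (fl_m0 FL) (fl_M FL _ _).
Qed.

(** The modulus of monotonicity is the mean of M at two neighbouring points; it converges uniformly
    to M and may be replaced by it against a factor bounded in L^1. *)
Lemma mono_term e : asym_le (hessian_energy e) (fun s => Ibox N (fun x y => diff_quot e s TA x y * (E00 x y * diff_quot e s P12 x y)) +
  Ibox N (fun x y => diff_quot e s TB x y * (E00 x y * diff_quot e s be x y))).
Proof.
have [bA bB] := bddL2_W FL HC e.
have ca s : cont2 (diff_quot e s P12) by prove_cont.
have cb s : cont2 (diff_quot e s be) by prove_cont.
have cta s : cont2 (diff_quot e s TA) by prove_cont.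
have ctb s : cont2 (diff_quot e s TB) by prove_cont.
have csM s : cont2 (translate e s M) by prove_cont.
have cW s : cont2 (fun x y => E00 x y * (diff_quot e s P12 x y ^+ 2 + diff_quot e s be x y ^+ 2)) by prove_cont.
have ca2 s : cont2 (fun x y => diff_quot e s P12 x y ^+ 2) by prove_cont.
have cb2 s : cont2 (fun x y => diff_quot e s be x y ^+ 2) by prove_cont.
have cab s : cont2 (fun x y => diff_quot e s P12 x y ^+ 2 + diff_quot e s be x y ^+ 2) by prove_cont.
have bW : bddL1 (fun s x y => E00 x y * (diff_quot e s P12 x y ^+ 2 + diff_quot e s be x y ^+ 2)).
  apply: (bddL1M (cE 0 0) cab (fun=> cE 0 0) _ (@unif_cvg_cst R E00)).
  exact: (bddL1D ca2 cb2 (bddL1_L2 ca bA) (bddL1_L2 cb bB)).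
have cMM s : cont2 (fun x y => (M x y + translate e s M x y) / 2) by prove_cont.
have uM : unif_cvg (fun s x y => (M x y + translate e s M x y) / 2) M.
  have := unif_cvgZ 2^-1 _ (unif_cvgD (@unif_cvg_cst R M) (unif_cvg_sh e cM)) => H.
  apply: unif_small_eq (H _) _; first by prove_cont.
  by near=> s; apply/funext => x; apply/funext => y; field.
have h := asym_eq_sym (small_diff N0 cM cW cMM bW uM).
apply: asym_le_trans (asym_le_le _).
  2: move=> s /andP[s0 s1]; rewrite -IboxD; [|by prove_cont|by prove_cont].
  2: apply: (@le_Ibox R N (fun x y => (M x y + translate e s M x y) / 2 * (E00 x y * (diff_quot e s P12 x y ^+ 2 + diff_quot e s be x y ^+ 2)))); [by prove_cont|by prove_cont|move=> x y _ _].
  2: rewrite mulrCA (mulrCA (diff_quot e s TA x y)) (mulrCA (diff_quot e s TB x y)) -mulrDr; apply: ler_wpM2l; [exact: (cut_ge0 cut)|exact: (dq_mono FL)].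
apply: asym_le_trans (asym_eq_le h); apply: asym_le_le => s _.
by rewrite /hessian_energy le_eqVlt; apply/orP; left; apply/eqP; apply: eq_Ibox => x y _ _; ring.
Unshelve. all: by end_near. Qed.

(** By Cauchy-Schwarz the square of the bilinear expression is at most g e0 (a^2 + b^2) (t1^2 +
    t2^2). The weights satisfy 4 (1/32) 8 = 1, as Young's inequality requires; 1/32 is small enough
    to survive the factor 8 of [T_bound]. *)
Lemma young_pt (m e0 g e1 e2 t1 t2 a b : R) : 0 <= m -> 0 <= e0 -> 0 <= g -> e1 ^+ 2 + e2 ^+ 2 <= g * e0 ->
  m * a * (e1 * t2 + e2 * t1) + m * b * (e2 * t2 - e1 * t1) <=
  (e0 * m * (t1 ^+ 2 + t2 ^+ 2)) / 32 + 8 * (g * (m * (a ^+ 2 + b ^+ 2))).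
Proof.
move=> m0' e00 g0 H.
pose X := a * (e1 * t2 + e2 * t1) + b * (e2 * t2 - e1 * t1).
pose T := t1 ^+ 2 + t2 ^+ 2; pose V := a ^+ 2 + b ^+ 2.
have T0 : 0 <= T by rewrite addr_ge0// sqr_ge0.
have V0 : 0 <= V by rewrite addr_ge0// sqr_ge0.
have X2 : X ^+ 2 <= (g * e0) * (V * T).
  apply: le_trans (ler_wpM2r (mulr_ge0 V0 T0) H).
  rewrite /X /T /V -subr_ge0.
  have -> : (e1 ^+ 2 + e2 ^+ 2) * ((a ^+ 2 + b ^+ 2) * (t1 ^+ 2 + t2 ^+ 2)) -
    (a * (e1 * t2 + e2 * t1) + b * (e2 * t2 - e1 * t1)) ^+ 2 =
    (e1 * (a * t1 + b * t2) - e2 * (a * t2 - b * t1)) ^+ 2 by ring.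
  exact: sqr_ge0.
pose Y := e0 * T / 32 + 8 * (g * V).
have Y0 : 0 <= Y by rewrite addr_ge0 ?divr_ge0 ?mulr_ge0.
have XY : X <= Y.
  rewrite leNgt; apply/negP => lt.
  have : Y ^+ 2 < X ^+ 2 by rewrite ltr_pXn2r// nnegrE ltW// (le_lt_trans Y0).
  apply/negP; rewrite -leNgt; apply: le_trans X2 _.
  rewrite -subr_ge0.
  have -> : Y ^+ 2 - g * e0 * (V * T) = (e0 * T / 32 - 8 * (g * V)) ^+ 2 by rewrite /Y; field.
  exact: sqr_ge0.
have -> : m * a * (e1 * t2 + e2 * t1) + m * b * (e2 * t2 - e1 * t1) = m * X by rewrite /X; ring.
apply: le_trans (ler_wpM2l m0' XY) _.
by rewrite /Y /T /V le_eqVlt; apply/orP; left; apply/eqP; field.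
Qed.

Variable G : R -> R -> R.
Hypothesis cG : cont2 G.
Hypothesis G0 : forall x y, 0 <= G x y.
Hypothesis HG : forall x y, E 1%N 0%N x y ^+ 2 + E 0%N 1%N x y ^+ 2 <= G x y * E00 x y.

Lemma M_ge0 x y : 0 <= M x y.
Proof. by apply: ltW; apply: lt_le_trans (fl_m0 FL) (fl_M FL _ _). Qed.

Ltac iblra := repeat match goal with |- context [Ibox ?a ?f] => generalize (Ibox a f); intro end; lra.

Notation GMV := (Ibox N (fun x y => G x y * (M x y * (P12 x y ^+ 2 + be x y ^+ 2)))).

Lemma young_term e s : Ibox N (fun x y => TA x y * KTa e s x y) + Ibox N (fun x y => TB x y * KTb e s x y) <=
  32^-1 * Ibox N (fun x y => E00 x y * M x y * (T1 e s x y ^+ 2 + T2 e s x y ^+ 2)) + 8 * GMV.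
Proof.
have k4 s' : cont2 (KTa e s') by have [] := cont2_KT e s'.
have k5 s' : cont2 (KTb e s') by have [] := cont2_KT e s'.
rewrite -IboxD; [|by prove_cont|by prove_cont].
rewrite -IboxZ; last by prove_cont.
rewrite -IboxZ; last by prove_cont.
rewrite -IboxD; [|by prove_cont|by prove_cont].
apply: le_Ibox; [by prove_cont|by prove_cont|] => x y _ _.
rewrite [X in _ <= X + _]mulrC.
apply: young_pt; [exact: M_ge0|exact: (cut_ge0 cut)|exact: G0|exact: HG].
Qed.

(** By [T1E] and [T2E] the squares are those of a2 - 2 b1, a1, a2 and a1 + 2 b2; their sum is at
    most 8 (a1^2 + a2^2 + b1^2 + b2^2). *)
Lemma T_bound s : s != 0 ->
  Ibox N (fun x y => E00 x y * M x y * (T1 true s x y ^+ 2 + T2 true s x y ^+ 2)) +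
  Ibox N (fun x y => E00 x y * M x y * (T1 false s x y ^+ 2 + T2 false s x y ^+ 2)) <=
  8 * ((Ibox N (fun x y => E00 x y * M x y * Va true s x y ^+ 2) + Ibox N (fun x y => E00 x y * M x y * Vb true s x y ^+ 2)) +
       (Ibox N (fun x y => E00 x y * M x y * Va false s x y ^+ 2) + Ibox N (fun x y => E00 x y * M x y * Vb false s x y ^+ 2))).
Proof.
move=> s0.
have e1 e x y := T1E FL e x y s0; have e2 e x y := T2E FL e x y s0.
move: (cT1 true s) (cT2 true s) (cT1 false s) (cT2 false s) (cVa true s) (cVb true s) (cVa false s) (cVb false s).
move: (e1 true) (e1 false) (e2 true) (e2 false) => /=.
move: (T1 true s) (T2 true s) (T1 false s) (T2 false s) (Va true s) (Vb true s) (Va false s) (Vb false s).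
move=> t1 t2 t3 t4 a1 b1 a2 b2 {}e1 e3 {}e2 e4 *.
rewrite Ibox_sum4 -?IboxD; [|by prove_cont..].
rewrite -IboxZ; last by prove_cont.
apply: le_Ibox; [by prove_cont|by prove_cont|] => x y _ _.
rewrite !(e1, e2, e3, e4).
rewrite -!mulrDr (mulrCA 8); apply: ler_wpM2l; first by rewrite mulr_ge0 ?M_ge0 ?(cut_ge0 cut).
have h1 := sqr_ge0 (a2 x y + 2 * b1 x y); have h2 := sqr_ge0 (a1 x y - 2 * b2 x y); have h3 := sqr_ge0 (a1 x y); have h4 := sqr_ge0 (a2 x y).
have h5 := sqr_ge0 (b1 x y); have h6 := sqr_ge0 (b2 x y).
move: (a1 x y) (a2 x y) (b1 x y) (b2 x y) h1 h2 h3 h4 h5 h6 => *; nra.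
Qed.

Lemma asym_leZ k X Y : 0 <= k -> asym_le X Y -> asym_le (fun s => k * X s) (fun s => k * Y s).
Proof.
move=> k0 h t t0; have tk : 0 < t / (k + 1) by rewrite divr_gt0// ltr_wpDl.
have {}h := h _ tk; near=> s.
have h1 : X s <= Y s + t / (k + 1) by near: s.
have : k * X s <= k * (Y s + t / (k + 1)) by rewrite ler_wpM2l.
have : k * (t / (k + 1)) <= t.
  by rewrite mulrCA ler_piMr// ?(ltW t0)// ler_pdivrMr ?mul1r ?lerDl// ltr_wpDl.
lra.
Unshelve. all: by end_near. Qed.

Lemma young_sum : asym_le (fun s =>
  (Ibox N (fun x y => TA x y * KTa true s x y) + Ibox N (fun x y => TB x y * KTb true s x y)) +
  (Ibox N (fun x y => TA x y * KTa false s x y) + Ibox N (fun x y => TB x y * KTb false s x y)))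
  (fun s => (hessian_energy true s + hessian_energy false s) / 4 + 16 * GMV).
Proof.
pose J s := (Ibox N (fun x y => E00 x y * M x y * Va true s x y ^+ 2) + Ibox N (fun x y => E00 x y * M x y * Vb true s x y ^+ 2)) +
       (Ibox N (fun x y => E00 x y * M x y * Va false s x y ^+ 2) + Ibox N (fun x y => E00 x y * M x y * Vb false s x y ^+ 2)).
apply: (@asym_le_trans _ (fun s => 4^-1 * J s + 16 * GMV)).
  apply: asym_le_le => s /andP[s0 _].
  have hJ : _ <= 8 * J s := T_bound (lt0r_neq0 s0).
  move: (young_term true s) (young_term false s) hJ; move: (J s) => ?; iblra.
have lJ : asym_le J (fun s => hessian_energy true s + hessian_energy false s).
  have jA e := jensen cP12 (proj1 (bddL2_W FL HC e)).
  have jB e := jensen cbe (proj2 (bddL2_W FL HC e)).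
  apply: asym_le_trans (asym_leD (asym_leD (jA true) (jB true)) (asym_leD (jA false) (jB false))) _.
  apply: asym_le_le => s _; rewrite /hessian_energy Ibox_sum4 -?IboxD; [|by prove_cont..].
  rewrite le_eqVlt; apply/orP; left; apply/eqP; apply: eq_Ibox => x y _ _; ring.
have z : asym_le (fun=> 16 * GMV) (fun=> 16 * GMV) by apply: asym_le_le.
have h4 : 0 <= 4^-1 :> R by rewrite invr_ge0.
apply: asym_le_trans (asym_leD (asym_leZ h4 lJ) z) _.
by apply: asym_le_le => s _; rewrite lerD2r mulrC.
Qed.

Lemma coef_term e : asym_eq (fun s => Ibox N (fun x y => diff_quot e s Na x y * Kad e s x y) + Ibox N (fun x y => diff_quot e s Nb x y * Kbd e s x y))
  (fun=> Ibox N (fun x y => Nad e x y * Ka0 e x y) + Ibox N (fun x y => Nbd e x y * Kb0 e x y)).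
Proof.
have [ua ub] := unif_cvg_Kad e.
have ca s : cont2 (diff_quot e s Na) by prove_cont.
have cb s : cont2 (diff_quot e s Nb) by prove_cont.
apply: asym_eqD.
- exact: (small_lim (cNad e) (cont2_Ka0 e) ca (cont2_Kad e) (unif_cvg_dNa FL e) ua).
- exact: (small_lim (cNbd e) (cont2_Kb0 e) cb (cont2_Kbd e) (unif_cvg_dNb FL e) ub).
Qed.

Lemma cut_split e s : 0 < s <= 1 ->
  2 * (Ibox N (fun x y => diff_quot e s TA x y * (E00 x y * diff_quot e s P12 x y)) + Ibox N (fun x y => diff_quot e s TB x y * (E00 x y * diff_quot e s be x y))) =
  2 * - (Ibox N (fun x y => diff_quot e s TA x y * Kad e s x y) + Ibox N (fun x y => diff_quot e s TB x y * Kbd e s x y)) +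
  (Ibox N (fun x y => diff_quot e s Na x y * (E00 x y * diff_quot e s P12 x y)) + Ibox N (fun x y => diff_quot e s Nb x y * (E00 x y * diff_quot e s be x y))) +
  (Ibox N (fun x y => diff_quot e s Na x y * Kad e s x y) + Ibox N (fun x y => diff_quot e s Nb x y * Kbd e s x y)).
Proof.
move=> /andP[s0 s1].
have sN : r + `|s| <= N by rewrite gtr0_norm// lerD2l.
have := cut_identity FL e (c e) cut (lt0r_neq0 s0) sN.
have cka := cont2_Kad e s; have ckb := cont2_Kbd e s.
rewrite -/(Kad e s) -/(Kbd e s).
have cta : cont2 (diff_quot e s TA) by prove_cont.
have ctb : cont2 (diff_quot e s TB) by prove_cont.
have cna : cont2 (diff_quot e s Na) by prove_cont.
have cnb : cont2 (diff_quot e s Nb) by prove_cont.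
have cpa : cont2 (diff_quot e s P12) by prove_cont.
have cpb : cont2 (diff_quot e s be) by prove_cont.
set ta := diff_quot e s TA in cta *; set tb := diff_quot e s TB in ctb *; set na := diff_quot e s Na in cna *.
set nb := diff_quot e s Nb in cnb *; set pa := diff_quot e s P12 in cpa *; set pb := diff_quot e s be in cpb *.
set ka := Kad e s in cka *; set kb := Kbd e s in ckb *.
clearbody ta tb na nb pa pb ka kb => H.
have H2 : Ibox N (fun x y => (2 * ta x y - na x y) * (E00 x y * pa x y + ka x y) + (2 * tb x y - nb x y) * (E00 x y * pb x y + kb x y)) =
  2 * ((Ibox N (fun x y => ta x y * (E00 x y * pa x y)) + Ibox N (fun x y => tb x y * (E00 x y * pb x y))) +
       (Ibox N (fun x y => ta x y * ka x y) + Ibox N (fun x y => tb x y * kb x y))) -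
  ((Ibox N (fun x y => na x y * (E00 x y * pa x y)) + Ibox N (fun x y => nb x y * (E00 x y * pb x y))) +
   (Ibox N (fun x y => na x y * ka x y) + Ibox N (fun x y => nb x y * kb x y))).
  rewrite !Ibox_sum4; [|by prove_cont..].
  rewrite -IboxZ; last by prove_cont.
  rewrite -IboxB; [|by prove_cont|by prove_cont].
  by apply: eq_Ibox => x y _ _; ring.
move: H; rewrite H2 => {H2}; iblra.
Qed.

(** The limits of all terms free of third derivatives, together with the remainder of Young's
    inequality, which is the first summand; every other integrand carries a derivative of the
    cut-off. *)
Definition rest : R := 32 * GMV +
  2 * ((Ibox N (fun x y => TA x y * KLa0 true x y) + Ibox N (fun x y => TB x y * KLb0 true x y)) +
       (Ibox N (fun x y => TA x y * KLa0 false x y) + Ibox N (fun x y => TB x y * KLb0 false x y))) -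
  (Ibox N (fun x y => E 1%N 0%N x y * G1 x y) + Ibox N (fun x y => E 0%N 1%N x y * G2 x y)) +
  ((Ibox N (fun x y => Nad true x y * Ka0 true x y) + Ibox N (fun x y => Nbd true x y * Kb0 true x y)) +
   (Ibox N (fun x y => Nad false x y * Ka0 false x y) + Ibox N (fun x y => Nbd false x y * Kb0 false x y))).

Lemma limit_comb (La Lb Aa Ab Ka Kb Xa Xb Ca Cb Ya Yb : R -> R) (la lb g cv cf : R) :
  asym_le (fun s => La s + Lb s) (fun s => Aa s + Ab s) ->
  asym_le (fun s => - Ka s + - Kb s) (fun s => (Ya s + la) + (Yb s + lb)) ->
  asym_le (fun s => Xa s + Xb s) (fun=> cv) -> asym_le (fun s => Ca s + Cb s) (fun=> cf) ->
  asym_le (fun s => Ya s + Yb s) (fun s => (La s + Lb s) / 4 + 16 * g) ->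
  (forall s, 0 < s <= 1 -> 2 * Aa s = 2 * - Ka s + Xa s + Ca s) ->
  (forall s, 0 < s <= 1 -> 2 * Ab s = 2 * - Kb s + Xb s + Cb s) ->
  asym_le (fun s => 3 / 2 * (La s + Lb s)) (fun=> 32 * g + 2 * (la + lb) + cv + cf).
Proof.
move=> h1 h2 h3 h4 h5 E1 E2 k k0; have k8 : 0 < k / 8 by rewrite divr_gt0.
have {}h1 := h1 _ k8; have {}h2 := h2 _ k8; have {}h3 := h3 _ k8; have {}h4 := h4 _ k8; have {}h5 := h5 _ k8.
near=> s.
have s01 : 0 < s <= 1 by near: s; exact: near01.
have {}E1 := E1 s s01; have {}E2 := E2 s s01.
have g1 : La s + Lb s <= Aa s + Ab s + k / 8 by near: s; exact: h1.
have g2 : - Ka s + - Kb s <= (Ya s + la) + (Yb s + lb) + k / 8 by near: s; exact: h2.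
have g3 : Xa s + Xb s <= cv + k / 8 by near: s; exact: h3.
have g4 : Ca s + Cb s <= cf + k / 8 by near: s; exact: h4.
have g5 : Ya s + Yb s <= (La s + Lb s) / 4 + 16 * g + k / 8 by near: s; exact: h5.
lra.
Unshelve. all: by end_near. Qed.

Lemma limit_ineq : asym_le (fun s => 3 / 2 * (hessian_energy true s + hessian_energy false s)) (fun=> rest).
Proof.
have st e := asym_eq_le (stress_term e).
exact: (limit_comb (asym_leD (mono_term true) (mono_term false)) (asym_leD (st true) (st false))
  (asym_eq_le conv_term) (asym_leD (asym_eq_le (coef_term true)) (asym_eq_le (coef_term false)))
  young_sum (cut_split true) (cut_split false)).
Qed.

End limit.

(** * Cut-off functions *)

Section bump.
Context {R : realType}.
Implicit Types (t : R) (f : R -> R).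

(** The n-th power of the positive part of t. Finite smoothness is enough for the cut-off, which is
    differentiated at most three times. *)
Definition pospow n t := ((t + `|t|) / 2) ^+ n.

Lemma pospow_cont n : continuous (@pospow n).
Proof.
apply: (@ct_exp _ _ (fun t : R => (t + `|t|) / 2)).
by repeat first [exact: norm_continuous|cont_step].
Qed.

Lemma pospow_le0 n t : t <= 0 -> pospow n.+1 t = 0.
Proof. by move=> t0; rewrite /pospow ler0_norm// subrr mul0r exprS mul0r. Qed.

Lemma pospow_ge0 n t : 0 <= pospow n t.
Proof.
rewrite /pospow exprn_ge0// divr_ge0//; have := ler_norm (- t); rewrite normrN; lra.
Qed.

Lemma mul_pospow k n t : t ^+ k * pospow n.+1 t = pospow (k + n).+1 t.
Proof.
have [t0|t0] := leP t 0; first by rewrite !pospow_le0// mulr0.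
rewrite /pospow gtr0_norm//; have -> : (t + t) / 2 = t by field.
by rewrite -exprD addnS.
Qed.

Lemma der_sqr_norm : der (fun t => t * `|t|) (fun t => 2 * `|t|).
Proof.
have cn : continuous (fun t : R => `|t|) by prove_cont.
pose k t := prim (fun t => `|t|) t - prim (fun t => `|t|) 0.
have dp : der (prim (fun t : R => `|t|)) (fun t => `|t|) by move=> t; exact: is_derive_prim.
have dk : der (fun t => 2 * k t) (fun t => 2 * `|t|) by rewrite /k; prove_der; ring.
rewrite (_ : (fun t => t * `|t|) = (fun t => 2 * k t))//.
apply/funext => t; have [t0|/ltW t0] := leP 0 t.
- have <- : Sint 0 t (fun t => `|t|) = k t by rewrite Sint_prim.
  rewrite (@eq_Sint _ _ _ _ (fun x => x)); last by move=> x /andP[x0 _]; rewrite ger0_norm.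
  have dF : der (fun x : R => x ^+ 2 / 2) (fun x => x) by prove_der; field.
  by rewrite (Sint_FTC t0 (@ct_id R) dF) ger0_norm//; field.
- have -> : k t = - Sint t 0 (fun t => `|t|) by rewrite Sint_prim// opprB.
  rewrite (@eq_Sint _ _ _ _ (fun x => - x)); last by move=> x /andP[_ x0]; rewrite ler0_norm.
  have dF : der (fun x : R => - (x ^+ 2 / 2)) (fun x => - x) by prove_der; field.
  have cN : continuous (fun x : R => - x) by prove_cont.
  by rewrite (Sint_FTC t0 cN dF) ler0_norm//; field.
Qed.

(** The second power reduces to t |t|; higher ones follow by multiplication with t^n, since the
    product vanishes for t <= 0. *)
Lemma der_pospow n : der (@pospow n.+2) (fun t => n.+2%:R * pospow n.+1 t).
Proof.
have d2 : der (@pospow 2) (fun t => 2 * pospow 1 t).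
  have d := der_sqr_norm.
  have E : der (fun t => (t ^+ 2 + t * `|t|) / 2) (fun t => 2 * pospow 1 t).
    apply: der_eq (der_mul (der_add (der_exp 2 (@der_id R)) d) (der_cst 2^-1)) _ => t /=.
    by rewrite /pospow; field.
  rewrite (_ : pospow 2 = fun t => (t ^+ 2 + t * `|t|) / 2)//.
  apply/funext => t; rewrite /pospow.
  have : `|t| ^+ 2 = t ^+ 2 by rewrite real_normK// num_real.
  by move=> H; rewrite expr2 mulrACA -expr2 sqrrD H; field.
rewrite (_ : pospow n.+2 = fun t => t ^+ n * pospow 2 t); last first.
  by apply/funext => t; rewrite mul_pospow addn1.
apply: der_eq (der_mul (der_exp n (@der_id R)) d2) _ => t /=.
rewrite mulr1 -mulrA mul_pospow mulrCA mul_pospow addn1 addn0.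
case: n => [|n]; first by rewrite !mul0r add0r.
by rewrite -mulrDl -natrD addn2.
Qed.

Lemma der_pospow_comp n f f' : der f f' ->
  der (fun t => pospow n.+2 (f t)) (fun t => n.+2%:R * pospow n.+1 (f t) * f' t).
Proof. by move=> df; exact: der_comp (@der_pospow n) df. Qed.

(* The bump is pospow 12 v, the square of bump_root: this is what makes its
   first three derivatives controlled by bump_root. *)
Let v t : R := 1 - pospow 4 (t ^+ 2 - 1).
Let v1 t : R := - 8 * t * pospow 3 (t ^+ 2 - 1).
Let v2 t : R := - 8 * pospow 3 (t ^+ 2 - 1) - 48 * t ^+ 2 * pospow 2 (t ^+ 2 - 1).
Let v3 t : R := - 144 * t * pospow 2 (t ^+ 2 - 1) - 192 * t ^+ 3 * pospow 1 (t ^+ 2 - 1).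

Let dv : der v v1.
Proof. by rewrite /v; eapply der_eq; [repeat first [apply: der_pospow_comp|der_step]|move=> t /=; rewrite /v1; ring]. Qed.
Let dv1 : der v1 v2.
Proof. by rewrite /v1; eapply der_eq; [repeat first [apply: der_pospow_comp|der_step]|move=> t /=; rewrite /v2; ring]. Qed.
Let dv2 : der v2 v3.
Proof. by rewrite /v2; eapply der_eq; [repeat first [apply: der_pospow_comp|der_step]|move=> t /=; rewrite /v3; ring]. Qed.

Definition bump_root t := pospow 6 (v t).
Definition bump_root1 t := 6 * pospow 5 (v t) * v1 t.
(** The derivatives of the bump up to order 3; larger indices repeat order 3 as a default value. *)
Definition bump (i : nat) t : R := match i with
  | 0 => pospow 12 (v t)
  | 1 => 12 * v1 t * pospow 11 (v t)
  | 2 => 132 * v1 t ^+ 2 * pospow 10 (v t) + 12 * v2 t * pospow 11 (v t)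
  | _ => 1320 * v1 t ^+ 3 * pospow 9 (v t) + 396 * v1 t * v2 t * pospow 10 (v t) + 12 * v3 t * pospow 11 (v t)
  end.

Lemma der_bump i : (i < 3)%N -> der (bump i) (bump i.+1).
Proof.
case: i => [|[|[|//]]] _; rewrite /bump.
- by apply: der_eq (der_pospow_comp 10 dv) _ => t /=; ring.
- by eapply der_eq; [repeat first [eassumption|apply: der_pospow_comp|der_step]|move=> t /=; ring].
- by eapply der_eq; [repeat first [eassumption|apply: der_pospow_comp|der_step]|move=> t /=; ring].
Qed.

Lemma der_bump_root : der bump_root bump_root1.
Proof. exact: der_pospow_comp. Qed.

Let cv : continuous v. Proof. exact: der_cont dv. Qed.
Let cv1 : continuous v1. Proof. exact: der_cont dv1. Qed.
Let cv2 : continuous v2. Proof. exact: der_cont dv2. Qed.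
Let cpv n f : continuous f -> continuous (fun t => pospow n (f t)).
Proof. by move=> cf; apply: ct_comp => //; exact: pospow_cont. Qed.
Let cv3 : continuous v3.
Proof.
have q : continuous (fun t : R => t ^+ 2 - 1) by prove_cont.
rewrite /v3; apply: ct_add; [|apply: ct_opp]; apply: ct_mul.
- by prove_cont.
- exact: cpv q.
- by prove_cont.
- exact: cpv q.
Qed.

Let c_v1 (k : R) n : continuous (fun t => k * v1 t ^+ n).
Proof. by apply: ct_mul; [exact: ct_cst|apply: ct_exp; exact: cv1]. Qed.
Let c_v2 (k : R) : continuous (fun t => k * v2 t).
Proof. by apply: ct_mul; [exact: ct_cst|exact: cv2]. Qed.
Let c_v3 (k : R) : continuous (fun t => k * v3 t).
Proof. by apply: ct_mul; [exact: ct_cst|exact: cv3]. Qed.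
Let c_v11 (k : R) : continuous (fun t => k * v1 t).
Proof. by apply: ct_mul; [exact: ct_cst|exact: cv1]. Qed.
Let c_v12 (k : R) : continuous (fun t => k * v1 t * v2 t).
Proof. by apply: ct_mul; [apply: ct_mul; [exact: ct_cst|exact: cv1]|exact: cv2]. Qed.
Let c_p n : continuous (fun t => pospow n (v t)).
Proof. exact: cpv cv. Qed.

Lemma bump_cont i : continuous (bump i).
Proof.
case: i => [|[|[|i]]]; rewrite /bump.
- exact (@c_p 12).
- exact (ct_mul (@c_v11 12) (@c_p 11)).
- exact (ct_add (ct_mul (@c_v1 132 2) (@c_p 10)) (ct_mul (@c_v2 12) (@c_p 11))).
- exact (ct_add (ct_add (ct_mul (@c_v1 1320 3) (@c_p 9)) (ct_mul (@c_v12 396) (@c_p 10))) (ct_mul (@c_v3 12) (@c_p 11))).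
Qed.

Lemma bump_root_cont : continuous bump_root.
Proof. exact: cpv. Qed.

Lemma bump_root1_cont : continuous bump_root1.
Proof. rewrite /bump_root1; repeat first [exact: cv|exact: cv1|apply: cpv|cont_step]. Qed.

Lemma bump0E t : bump 0 t = bump_root t ^+ 2.
Proof. by rewrite /bump /bump_root /pospow -exprM. Qed.

Let v_le1 t : v t <= 1.
Proof. by rewrite /v gerBl pospow_ge0. Qed.

Lemma bump_root_ge0 t : 0 <= bump_root t. Proof. exact: pospow_ge0. Qed.

Let pv_le1 t : (v t + `|v t|) / 2 <= 1.
Proof.
have [v0|v0] := leP (v t) 0; first by rewrite ler0_norm// subrr mul0r.
by rewrite gtr0_norm//; have := v_le1 t; lra.
Qed.

Let pv_ge0 t : 0 <= (v t + `|v t|) / 2.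
Proof. exact: (pospow_ge0 1). Qed.

Lemma bump_root_le1 t : bump_root t <= 1.
Proof. by rewrite /bump_root /pospow exprn_ile1. Qed.

Let pv_le n t : (6 <= n)%N -> pospow n (v t) <= bump_root t.
Proof. by move=> n6; rewrite /bump_root /pospow ler_wiXn2l. Qed.

Let v_in t : `|t| <= 1 -> [/\ v t = 1, v1 t = 0, v2 t = 0 & v3 t = 0].
Proof.
move=> t1; have t2 : t ^+ 2 - 1 <= 0.
  by rewrite subr_le0 -real_normK ?num_real// exprn_ile1.
by rewrite /v /v1 /v2 /v3 !pospow_le0// !(mulr0, subr0).
Qed.

Let v_out t : 2 <= `|t| -> v t <= 0.
Proof.
move=> t2; have h : 3 <= t ^+ 2 - 1.
  have : 2 ^+ 2 <= `|t| ^+ 2 by rewrite ler_pXn2r// nnegrE.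
  by rewrite real_normK ?num_real// expr2; lra.
rewrite /v subr_le0 /pospow ger0_norm; last by lra.
have -> : (t ^+ 2 - 1 + (t ^+ 2 - 1)) / 2 = t ^+ 2 - 1 by field.
by apply: exprn_ege1; lra.
Qed.

Lemma bump_root_in t : `|t| <= 1 -> bump_root t = 1.
Proof.
by move=> /v_in[vt _ _ _]; rewrite /bump_root /pospow vt normr1 (_ : (1 + 1) / 2 = 1) ?expr1n//; field.
Qed.

Lemma bump_root_out t : 2 <= `|t| -> bump_root t = 0.
Proof. by move=> /v_out; exact: pospow_le0. Qed.

Lemma bump_root1_out t : 2 <= `|t| -> bump_root1 t = 0.
Proof. by move=> /v_out v0; rewrite /bump_root1 pospow_le0// mulr0 mul0r. Qed.

Lemma bump_in i t : (0 < i)%N -> `|t| <= 1 -> bump i t = 0.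
Proof.
move=> i0 /v_in[_ e1 e2 e3].
by case: i i0 => [//|[|[|i]]] _; rewrite /bump ?e1 ?e2 ?e3; ring.
Qed.

Lemma bump_out i t : 2 <= `|t| -> bump i t = 0.
Proof.
by move=> /v_out v0; case: i => [|[|[|i]]]; rewrite /bump !pospow_le0// !(mulr0, mul0r, addr0).
Qed.

Let dom f := exists2 C : R, 0 <= C & forall t, `|f t| <= C * bump_root t.

Let domD (f g : R -> R) : dom f -> dom g -> dom (fun t => f t + g t).
Proof.
move=> [C C0 hC] [D D0 hD]; exists (C + D); first exact: addr_ge0.
by move=> t; rewrite mulrDl (le_trans (ler_normD _ _))// lerD.
Qed.

(** The positive part of [v] lies in [[0, 1]], so its powers from the sixth on are dominated by
    [bump_root], while g is bounded on the support by compactness. *)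
Let dom_pow n (g : R -> R) : (6 <= n)%N -> continuous g -> dom (fun t => g t * pospow n (v t)).
Proof.
move=> n6 cg; have [|K K0 HK] := @compact_cont_bounded R R `[-2, 2] g _ cg; first exact: segment_compact.
exists K => // t; have [t2|/ltW t2] := leP `|t| 2; last first.
  by rewrite bump_root_out// (_ : n = n.-1.+1) ?pospow_le0 ?v_out// ?mulr0 ?normr0//; case: n n6.
rewrite normrM ler_pM//; first by apply: HK; rewrite /= in_itv/= -ler_norml.
by rewrite ger0_norm ?pospow_ge0// pv_le.
Qed.

Let dom_bump i : dom (bump i).
Proof.
case: i => [|[|[|i]]]; rewrite /bump.
- have [C C0 hC] := dom_pow (isT : (6 <= 12)%N) (@ct_cst R R 1).
  by exists C => // t; have := hC t; rewrite mul1r.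
- exact (@dom_pow 11 _ isT (@c_v11 12)).
- by apply: domD; [exact (@dom_pow 10 _ isT (@c_v1 132 2))|exact (@dom_pow 11 _ isT (@c_v2 12))].
- apply: domD; first apply: domD.
  + exact (@dom_pow 9 _ isT (@c_v1 1320 3)).
  + exact (@dom_pow 10 _ isT (@c_v12 396)).
  + exact (@dom_pow 11 _ isT (@c_v3 12)).
Qed.

Lemma bump_bound : exists2 C : R, 1 <= C & (forall i t, `|bump i t| <= C * bump_root t) /\
  (forall t, `|bump_root1 t| <= C).
Proof.
have [C0 p0 h0] := dom_bump 0; have [C1 p1 h1] := dom_bump 1.
have [C2 p2 h2] := dom_bump 2; have [C3 p3 h3] := dom_bump 3.
have [|K K0 HK] := @compact_cont_bounded R R `[-2, 2] bump_root1 _ bump_root1_cont; first exact: segment_compact.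
pose C := 1 + C0 + C1 + C2 + C3 + K.
exists C; first by rewrite /C; lra.
have le (X t D : R) : `|X| <= D * bump_root t -> D <= C -> `|X| <= C * bump_root t.
  by move=> h DC; apply: le_trans h _; rewrite ler_wpM2r// bump_root_ge0.
split=> [i t|t].
- case: i => [|[|[|i]]]; [apply: le (h0 t) _|apply: le (h1 t) _|apply: le (h2 t) _|apply: le (h3 t) _]; rewrite /C; lra.
- apply: (@le_trans _ _ K); last by rewrite /C; lra.
  have [t2|/ltW t2] := leP `|t| 2; first by apply: HK; rewrite /= in_itv/= -ler_norml.
  by rewrite /bump_root1 pospow_le0 ?v_out// mulr0 mul0r normr0.
Qed.

End bump.

Global Opaque pospow bump bump_root bump_root1.

(** * Rescaled cut-offs of the plane *)

Section cutoff_family.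
Context {R : realType}.
Implicit Types (r x y t : R).

Definition cutE r i j x y : R :=
  r^-1 ^+ (i + j) * (bump i (r^-1 * x) * bump j (r^-1 * y)).
(** The square root of the cut-off [cutE r 0 0] (see [cutEZ]), itself differentiable; [cutZ12] is
    the mixed derivative that enters the supremum estimate. *)
Definition cutZ r x y : R := bump_root (r^-1 * x) * bump_root (r^-1 * y).
Definition cutZ1 r x y : R := r^-1 * (bump_root1 (r^-1 * x) * bump_root (r^-1 * y)).
Definition cutZ2 r x y : R := r^-1 * (bump_root (r^-1 * x) * bump_root1 (r^-1 * y)).
Definition cutZ12 r x y : R := r^-1 ^+ 2 * (bump_root1 (r^-1 * x) * bump_root1 (r^-1 * y)).

Let sc (f : R -> R) r : continuous f -> continuous (fun x => f (r^-1 * x)).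
Proof. by move=> cf; prove_cont. Qed.

Let dsc (f f' : R -> R) r : der f f' -> der (fun x => f (r^-1 * x)) (fun x => r^-1 * f' (r^-1 * x)).
Proof. by move=> df; prove_der; ring. Qed.

Let c2m (k : R) (f g : R -> R) : continuous f -> continuous g -> cont2 (fun x y => k * (f x * g y)).
Proof. by move=> cf cg; prove_cont. Qed.

Let d1m (k : R) (f f' g : R -> R) : der f f' -> D1 (fun x y => k * (f x * g y)) (fun x y => k * (f' x * g y)).
Proof. by move=> df y; prove_der; ring. Qed.
Let d2m (k : R) (f g g' : R -> R) : der g g' -> D2 (fun x y => k * (f x * g y)) (fun x y => k * (f x * g' y)).
Proof. by move=> df y; prove_der; ring. Qed.

Lemma cutE_cont r i j : cont2 (cutE r i j).
Proof. by apply: c2m; apply: sc; exact: bump_cont. Qed.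

Lemma cutZ_cont r : [/\ cont2 (cutZ r), cont2 (cutZ1 r), cont2 (cutZ2 r) & cont2 (cutZ12 r)].
Proof.
have c0 := @sc _ r (@bump_root_cont R); have c1 := @sc _ r (@bump_root1_cont R).
split; try exact: c2m.
by have := c2m 1 c0 c0; under eq_fun do under eq_fun do rewrite mul1r.
Qed.

Lemma D_ext1 (f g g' : R -> R -> R) : D1 f g -> (forall x y, g x y = g' x y) -> D1 f g'.
Proof. by move=> d e y; apply: der_eq (d y) _ => x; exact: e. Qed.
Lemma D_ext2 (f g g' : R -> R -> R) : D2 f g -> (forall x y, g x y = g' x y) -> D2 f g'.
Proof. by move=> d e y; apply: der_eq (d y) _ => x; exact: e. Qed.

Lemma cutE_D1 r i j : (i < 3)%N -> D1 (cutE r i j) (cutE r i.+1 j).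
Proof.
move=> i3; apply: D_ext1 (d1m _ _ (dsc r (@der_bump R i i3))) _ => x y.
by rewrite /cutE addSn exprS; ring.
Qed.

Lemma cutE_D2 r i j : (j < 3)%N -> D2 (cutE r i j) (cutE r i j.+1).
Proof.
move=> j3; apply: D_ext2 (d2m _ _ (dsc r (@der_bump R j j3))) _ => x y.
by rewrite /cutE addnS exprS; ring.
Qed.

Lemma cutZ_D r : [/\ D1 (cutZ r) (cutZ1 r), D2 (cutZ r) (cutZ2 r) & D2 (cutZ1 r) (cutZ12 r)].
Proof.
have d := dsc r (@der_bump_root R); split.
- have := d1m 1 (fun y => bump_root (r^-1 * y)) d => H y.
  apply: der_eq (_ : der _ (fun x => 1 * (r^-1 * bump_root1 (r^-1 * x) * bump_root (r^-1 * y)))) _; last by move=> x; rewrite /cutZ1; ring.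
  by rewrite (_ : (cutZ r)^~ y = fun x => 1 * (bump_root (r^-1 * x) * bump_root (r^-1 * y))); [exact: H|apply/funext => x; rewrite mul1r].
- have := d2m 1 (fun y => bump_root (r^-1 * y)) d => H x.
  apply: der_eq (_ : der _ (fun y => 1 * (bump_root (r^-1 * x) * (r^-1 * bump_root1 (r^-1 * y))))) _; last by move=> y; rewrite /cutZ2; ring.
  by rewrite (_ : cutZ r x = fun y => 1 * (bump_root (r^-1 * x) * bump_root (r^-1 * y))); [exact: H|apply/funext => y; rewrite mul1r].
- apply: D_ext2 (d2m _ _ d) _ => x y; rewrite /cutZ12; ring.
Qed.

Let out r x : 0 < r -> 2 * r <= `|x| -> 2 <= `|r^-1 * x|.
Proof. by move=> r0 h; rewrite normrM normfV (gtr0_norm r0) ler_pdivlMl// mulrC. Qed.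
Let inn r x : 0 < r -> `|x| <= r -> `|r^-1 * x| <= 1.
Proof. by move=> r0 h; rewrite normrM normfV (gtr0_norm r0) ler_pdivrMl// mulr1. Qed.

Lemma cutE_out r i j : 0 < r -> bsupp (2 * r) (cutE r i j).
Proof.
move=> r0 x y [h|h]; rewrite /cutE; first by rewrite (bump_out _ (out r0 h)) mul0r mulr0.
by rewrite (bump_out j (out r0 h)) !mulr0.
Qed.

Lemma cutE_in r i j x y : 0 < r -> (0 < i + j)%N -> `|x| <= r -> `|y| <= r -> cutE r i j x y = 0.
Proof.
move=> r0; rewrite addn_gt0 /cutE => /orP[h|h] xr yr; first by rewrite (bump_in h (inn r0 xr)) mul0r mulr0.
by rewrite (bump_in h (inn r0 yr)) !mulr0.
Qed.

Lemma cutZ_ge0 r x y : 0 <= cutZ r x y.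
Proof. by rewrite mulr_ge0// bump_root_ge0. Qed.

Lemma cutZ_le1 r x y : cutZ r x y <= 1.
Proof. by rewrite mulr_ile1 ?bump_root_ge0 ?bump_root_le1. Qed.

Lemma cutZ_in r x y : 0 < r -> `|x| <= r -> `|y| <= r -> cutZ r x y = 1.
Proof. by move=> r0 xr yr; rewrite /cutZ !bump_root_in ?mulr1 ?inn. Qed.

Lemma cutZ_out r : 0 < r -> bsupp (2 * r) (cutZ r).
Proof.
move=> r0 x y [h|h]; rewrite /cutZ; first by rewrite (bump_root_out (out r0 h)) mul0r.
by rewrite (bump_root_out (out r0 h)) mulr0.
Qed.

Lemma cutZ1_out r : 0 < r -> bsupp (2 * r) (cutZ1 r).
Proof.
move=> r0 x y [h|h]; rewrite /cutZ1; first by rewrite (bump_root1_out (out r0 h)) mul0r mulr0.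
by rewrite (bump_root_out (out r0 h)) !mulr0.
Qed.

Lemma cutEZ r x y : cutE r 0 0 x y = cutZ r x y ^+ 2.
Proof. by rewrite /cutE addn0 expr0 mul1r !bump0E /cutZ -exprMn. Qed.

Let n3 (a b c : R) : `|a * (b * c)| = `|a| * (`|b| * `|c|).
Proof. by rewrite !normrM. Qed.

Lemma cut_bounds : exists2 C : R, 1 <= C & forall r, 0 < r ->
  [/\ forall i j x y, `|cutE r i j x y| <= C * r^-1 ^+ (i + j) * cutZ r x y,
      forall x y, `|cutZ1 r x y| <= C * r^-1,
      forall x y, `|cutZ2 r x y| <= C * r^-1 &
      forall x y, `|cutZ12 r x y| <= C * r^-1 ^+ 2].
Proof.
have [C C1 [hb hr]] := @bump_bound R; have C0 : 0 <= C by apply: le_trans C1.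
have CC : C <= C ^+ 2 by rewrite expr2 ler_peMl.
exists (C ^+ 2); first exact: le_trans CC.
move=> r r0; have ri : 0 <= r^-1 by rewrite invr_ge0 ltW.
have rn n : 0 <= r^-1 ^+ n by exact: exprn_ge0.
split=> [i j x y|x y|x y|x y].
- rewrite /cutE /cutZ n3 (ger0_norm (rn _)) [leRHS](_ : _ = r^-1 ^+ (i + j) * ((C * bump_root (r^-1 * x)) * (C * bump_root (r^-1 * y)))); last by ring.
  by rewrite ler_wpM2l// ler_pM.
- rewrite /cutZ1 n3 (ger0_norm ri) mulrC ler_wpM2r// (le_trans _ CC)//.
  by rewrite -[leRHS]mulr1; apply: ler_pM => //; rewrite ger0_norm ?bump_root_ge0 ?bump_root_le1.
- rewrite /cutZ2 n3 (ger0_norm ri) mulrC ler_wpM2r// (le_trans _ CC)//.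
  by rewrite -[leRHS]mul1r; apply: ler_pM => //; rewrite ger0_norm ?bump_root_ge0 ?bump_root_le1.
- by rewrite /cutZ12 n3 (ger0_norm (rn 2)) mulrC ler_wpM2r// expr2 ler_pM.
Qed.

Lemma cutE_cutoff r : 1 <= r -> cutoff (cutE r) (2 * r).
Proof.
move=> r1; have r0 : 0 < r by apply: lt_le_trans r1.
have [C C1 /(_ r r0)[HE _ _ _]] := cut_bounds.
have C0 : 0 <= C by apply: le_trans C1.
split.
- by rewrite mulr_ge0// ltW.
- exact: cutE_cont.
- exact: cutE_D1.
- exact: cutE_D2.
- by move=> i j; exact: cutE_out.
- by move=> x y; rewrite cutEZ sqr_ge0.
- by move=> x y; rewrite cutEZ exprn_ile1// ?cutZ_ge0 ?cutZ_le1.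
- exists (C ^+ 2); first by rewrite exprn_gt0// (lt_le_trans _ C1).
  move=> i j x y _; rewrite cutEZ -exprMn -real_normK ?num_real//.
  have CZ : 0 <= C * cutZ r x y by rewrite mulr_ge0// cutZ_ge0.
  apply: lerXn2r; [by rewrite nnegrE|by rewrite nnegrE|].
  apply: le_trans (HE i j x y) _; rewrite ler_wpM2r ?cutZ_ge0//.
  by rewrite ler_piMr// exprn_ile1 ?invr_ge0 ?invf_le1// ltW.
Qed.

Lemma cutoffs : @has_cutoffs R.
Proof.
move=> N N0; exists (cutE (N + 1)), (2 * (N + 1)); split.
  by apply: cutE_cutoff; rewrite lerDr.
by move=> x y xN yN; rewrite cutEZ cutZ_in ?expr1n//; lra.
Qed.

End cutoff_family.

(** * Poincare and supremum estimates *)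

Section inequalities.
Context {R : realType}.
Implicit Types (f g : R -> R -> R) (a b N l : R).

Lemma Sint_CS (g : R -> R) a b : a <= b -> continuous g ->
  Sint a b g ^+ 2 <= (b - a) * Sint a b (fun x => g x ^+ 2).
Proof.
rewrite le_eqVlt => /predU1P[<- _|ab cg].
  by rewrite !Sint_degen// expr0n subrr mul0r.
have ba : 0 < b - a by rewrite subr_gt0.
pose m := Sint a b g / (b - a).
have : 0 <= Sint a b (fun x => (g x - m) ^+ 2) by apply: Sint_ge0 => x _; exact: sqr_ge0.
have -> : Sint a b (fun x => (g x - m) ^+ 2) =
    Sint a b (fun x => g x ^+ 2 + ((- 2 * m) * g x + m ^+ 2)).
  by apply: eq_Sint => x _; ring.
rewrite SintD; [|by prove_cont|by prove_cont].
rewrite SintD; [|by prove_cont|by prove_cont].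
rewrite SintZ// Sint_cst ?(ltW ab)//.
have -> : Sint a b g = m * (b - a) by rewrite /m divfK// gt_eqF.
move=> H; have {}H : 0 <= (b - a) * (Sint a b (fun x => g x ^+ 2) + (- 2 * m * (m * (b - a)) + m ^+ 2 * (b - a))).
  by rewrite mulr_ge0// ltW.
rewrite -subr_ge0; apply: le_trans H _; rewrite le_eqVlt; apply/orP; left; apply/eqP; ring.
Qed.

(** [Ibox] is opaque at this point; its defining equation is recovered from the swapped form by
    Fubini. *)
Lemma IboxE N f : cont2 f -> Ibox N f = Sint (- N) N (fun x => Sint (- N) N (f x)).
Proof. by move=> cf; rewrite (Ibox_swap _ cf) -(Sint_Fubini (- N) N (- N) N cf). Qed.

Lemma Sint_sub (g : R -> R) a b N : continuous g -> (forall x, 0 <= g x) -> - N <= a -> a <= b -> b <= N ->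
  Sint a b g <= Sint (- N) N g.
Proof.
move=> cg g0 Na ab bN; have aN : a <= N by apply: le_trans bN.
rewrite (Sint_split Na aN cg) (Sint_split ab bN cg).
have := Sint_ge0 (a := - N) (b := a) (fun x _ => g0 x).
have := Sint_ge0 (a := b) (b := N) (fun x _ => g0 x); lra.
Qed.

Lemma increment_sqr (G g : R -> R) a b N : der G g -> continuous g -> `|a| <= N -> `|b| <= N ->
  (G b - G a) ^+ 2 <= 2 * N * Sint (- N) N (fun x => g x ^+ 2).
Proof.
move=> dG cg.
have c2 : continuous (fun x => g x ^+ 2) by prove_cont.
wlog ab : a b / a <= b => [H|].
  have [/H//|/ltW ba aN bN] := leP a b.
  by have := H b a ba bN aN; rewrite -sqrrN opprB.
rewrite !ler_norml => /andP[aN1 aN2] /andP[bN1 bN2].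
rewrite -(Sint_FTC ab cg dG); apply: le_trans (Sint_CS ab cg) _.
apply: ler_pM; [by rewrite subr_ge0| |by lra|].
  by apply: Sint_ge0 => x _; exact: sqr_ge0.
by apply: Sint_sub => // x; exact: sqr_ge0.
Qed.

(** If g exceeded the bound everywhere, its integral would exceed itself by 1; the added 1 avoids
    having to attain the mean. *)
Lemma exists_small_section (g : R -> R) l : 0 < l -> continuous g ->
  exists2 y, 0 <= y <= l & g y <= (Sint 0 l g + 1) / l.
Proof.
move=> l0 cg; apply: contrapT => H.
have : Sint 0 l (fun=> (Sint 0 l g + 1) / l) <= Sint 0 l g.
  apply: le_Sint => //; first by prove_cont.
  move=> y y0l; rewrite leNgt; apply/negP => lt; apply: H; exists y => //; exact: ltW.
by rewrite Sint_cst ?(ltW l0)// subr0 divfK ?gt_eqF// gerDl ler10.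
Qed.

(** Every point is reached from (0, y') by a horizontal segment at height y' and a vertical one; y'
    is chosen so that the energy of f1 on that horizontal line is about its mean. The centre is a
    point value rather than a mean so that [center] can bound it by a supremum. *)
Lemma poincare f f1 f2 N l : 0 < l <= N -> D1 f f1 -> D2 f f2 ->
  cont2 f -> cont2 f1 -> cont2 f2 ->
  exists2 y', 0 <= y' <= l & Ibox N (fun x y => (f x y - f 0 y') ^+ 2) <=
    8 * N ^+ 2 * Ibox N (fun x y => f2 x y ^+ 2) + 16 * N ^+ 3 / l * (Ibox N (fun x y => f1 x y ^+ 2) + 1).
Proof.
move=> /andP[l0 lN] d1 d2 cf cf1 cf2.
have N0 : 0 < N by apply: lt_le_trans lN.
have cq1 : cont2 (fun x y => f1 x y ^+ 2) by prove_cont.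
have cq2 : cont2 (fun x y => f2 x y ^+ 2) by prove_cont.
have cg : continuous (fun y => Sint (- N) N (fun x => f1 x y ^+ 2)) by prove_cont.
have [y' y'l hy] := exists_small_section l0 cg.
have I1 : Sint 0 l (fun y => Sint (- N) N (fun x => f1 x y ^+ 2)) <= Ibox N (fun x y => f1 x y ^+ 2).
  rewrite Ibox_swap//; apply: Sint_sub => //; [|by rewrite oppr_le0 ltW|exact: ltW].
  by move=> y; apply: Sint_ge0 => x _; exact: sqr_ge0.
exists y' => //.
have y'N : `|y'| <= N by case/andP: y'l => y0 yl; rewrite ger0_norm//; lra.
pose B := Sint (- N) N (fun x => f1 x y' ^+ 2).
have cA : cont2 (fun x _ : R => Sint (- N) N (fun y => f2 x y ^+ 2)) by prove_cont.
have h x y : `|x| <= N -> `|y| <= N ->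
    (f x y - f 0 y') ^+ 2 <= 4 * N * Sint (- N) N (fun y => f2 x y ^+ 2) + 4 * N * B.
  move=> xN yN.
  have a1 := increment_sqr (d2 x) (ct_sec cf2) y'N yN.
  have zN : `|0 : R| <= N by rewrite normr0 ltW.
  have a2 := increment_sqr (d1 y') (ct_sec2 cf1) zN xN.
  have -> : f x y - f 0 y' = (f x y - f x y') + (f x y' - f 0 y') by ring.
  apply: (@le_trans _ _ (2 * (f x y - f x y') ^+ 2 + 2 * (f x y' - f 0 y') ^+ 2)).
    have := sqr_ge0 ((f x y - f x y') - (f x y' - f 0 y')).
    set u := f x y - _; set v := f x y' - _; nra.
  rewrite /B; lra.
apply: le_trans (le_Ibox _ _ h) _; [by prove_cont|by prove_cont|].
rewrite IboxD; [|by prove_cont|by prove_cont].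
rewrite IboxZ// Ibox_cst ?(ltW N0)//.
have -> : Ibox N (fun x _ => Sint (- N) N (fun y => f2 x y ^+ 2)) = 2 * N * Ibox N (fun x y => f2 x y ^+ 2).
  rewrite Ibox_swap// (_ : 2 * N = N - - N); last by ring.
  rewrite mulrC -Sint_cst; last by lra.
  apply: eq_Sint => y _; by rewrite -IboxE.
have BB : B <= (Ibox N (fun x y => f1 x y ^+ 2) + 1) / l.
  by apply: le_trans hy _; rewrite ler_wpM2r ?invr_ge0 ?(ltW l0)// lerD2r.
have N3 : 0 <= 16 * N ^+ 3 by rewrite mulr_ge0// exprn_ge0// ltW.
have := ler_wpM2l N3 BB.
set I1' := Ibox N (fun x y => f1 x y ^+ 2) in BB *; set I2' := Ibox N _; clearbody I1' I2' => H.
have -> : 16 * N ^+ 3 / l * (I1' + 1) = 16 * N ^+ 3 * ((I1' + 1) / l) by ring.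
have -> : 4 * N * (2 * N * I2') + 4 * N * B * (4 * N ^+ 2) = 8 * N ^+ 2 * I2' + 16 * N ^+ 3 * B by ring.
by rewrite lerD2l.
Qed.

Lemma sup_bound F F1 F12 N x y : 0 <= N -> D1 F F1 -> D2 F1 F12 -> cont2 F1 -> cont2 F12 ->
  bsupp N F -> bsupp N F1 -> `|F x y| <= Ibox N (fun x y => `|F12 x y|).
Proof.
move=> N0 d1 d2 c1 c12 sF sF1.
have cn : cont2 (fun x y => `|F12 x y|) by prove_cont.
have I0 : 0 <= Ibox N (fun x y => `|F12 x y|) by apply: Ibox_ge0.
have [xN|xN] := leP N `|x|; first by rewrite sF ?normr0//; left.
have [yN|yN] := leP N `|y|; first by rewrite sF ?normr0//; right.
have [x1 x2] : - N <= x /\ x <= N by have := ltW xN; rewrite ler_norml => /andP[].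
have [y1 y2] : - N <= y /\ y <= N by have := ltW yN; rewrite ler_norml => /andP[].
have NN : `|- N| = N by rewrite normrN ger0_norm.
have FE : F x y = Sint (- N) x (F1^~ y).
  by rewrite (Sint_FTC x1 (ct_sec2 c1) (d1 y)) (sF (- N)) ?subr0//; left; rewrite NN.
have c1n : continuous (fun t => `|F1 t y|) by prove_cont; exact: ct_sec2.
rewrite FE; apply: le_trans (Sint_norm _ _ (ct_sec2 c1)) _.
have h t : `|F1 t y| <= Sint (- N) N (fun y => `|F12 t y|).
  have -> : F1 t y = Sint (- N) y (F12 t).
    by rewrite (Sint_FTC y1 (ct_sec c12) (d2 t)) (sF1 t (- N)) ?subr0//; right; rewrite NN.
  apply: le_trans (Sint_norm _ _ (ct_sec c12)) _.
  by apply: Sint_sub => //; by prove_cont.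
have cS : continuous (fun t => Sint (- N) N (fun y => `|F12 t y|)) by prove_cont.
apply: le_trans (le_Sint c1n cS (fun t _ => h t)) _.
rewrite IboxE//.
by apply: Sint_sub => // t; apply: Sint_ge0.
Qed.

Lemma Ibox_abs_le f N k : cont2 f -> 0 <= N -> 0 < k ->
  Ibox N (fun x y => `|f x y|) <= k / 2 * Ibox N (fun x y => f x y ^+ 2) + 2 * N ^+ 2 / k.
Proof.
move=> cf N0 k0.
have -> : 2 * N ^+ 2 / k = (2 * k)^-1 * (4 * N ^+ 2) by field; rewrite gt_eqF.
rewrite -Ibox_cst// -IboxZ; last by prove_cont.
rewrite -IboxD; [|by prove_cont|by prove_cont].
apply: le_Ibox; [by prove_cont|by prove_cont|] => x y _ _.
rewrite -(real_normK (num_real (f x y))) -subr_ge0.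
have -> : k / 2 * `|f x y| ^+ 2 + (2 * k)^-1 - `|f x y| = (k * `|f x y| - 1) ^+ 2 / (2 * k).
  by field; rewrite gt_eqF.
by rewrite divr_ge0 ?sqr_ge0// mulr_ge0// ltW.
Qed.

End inequalities.

Ltac clra := repeat match goal with H : context [@Ibox] |- _ => clear H end; lra.
Ltac iblra := repeat match goal with H : context [@Ibox] |- _ => clear H end;
  repeat match goal with |- context [Ibox ?a ?f] => generalize (Ibox a f); intro end; lra.

(** * Supremum bound for the velocity and annuli of small energy *)

Section energy.
Context {R : realType}.
Variables (Ps P1 P2 P11 P12 P22 M : R -> R -> R) (m0 : R).
Hypothesis FL : flow Ps P1 P2 P11 P12 P22 M m0.
Notation be := (off_strain P11 P22).
Notation TA := (TA P12 M).
Notation TB := (TB P11 P22 M).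

Definition sum_abs x y : R := `|P11 x y| + `|P12 x y| + `|P22 x y|.

(** H will be a constant multiple of h(|Du|). Besides the quadratic bounds, [en_T] makes stress
    times |Du| integrable, and [en_T1] bounds the stress alone up to a linear term, which costs a
    factor r on squares of side comparable to r. *)
Record energy (H : R -> R -> R) (K E0 : R) : Prop := Energy {
  en_cont : cont2 H;
  en_ge0 : forall x y, 0 <= H x y;
  en_E : forall N, 0 <= N -> Ibox N H <= E0;
  en_K : 0 <= K;
  en_V : forall x y, M x y * (P12 x y ^+ 2 + be x y ^+ 2) <= H x y;
  en_T : forall x y, (`|TA x y| + `|TB x y|) * sum_abs x y <= H x y;
  en_T1 : forall x y, `|TA x y| + `|TB x y| <= K * (`|P12 x y| + `|be x y|) + H x y;
  en_D : forall x y, P11 x y ^+ 2 + P12 x y ^+ 2 + P22 x y ^+ 2 <= H x y }.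

Variables (H : R -> R -> R) (K E0 : R).
Hypothesis EN : energy H K E0.

Let cP12 : cont2 P12. Proof. by case: FL. Qed.
Let cP11 : cont2 P11. Proof. by case: FL. Qed.
Let cP22 : cont2 P22. Proof. by case: FL. Qed.
Let cP1 : cont2 P1. Proof. by case: FL. Qed.
Let cP2 : cont2 P2. Proof. by case: FL. Qed.
Let cM : cont2 M. Proof. by case: FL. Qed.
Let cbe : cont2 be. Proof. exact: cont2_be FL. Qed.
Let cH : cont2 H. Proof. by case: EN. Qed.

Local Notation Lam r e s := (hessian_energy P11 P12 P22 M (cutE r) (2 * r) e s).

Lemma E0_ge0 : 0 <= E0.
Proof. by have h := en_E EN (lexx 0); apply: le_trans h; apply: Ibox_ge0 => x y _ _; exact: en_ge0 EN x y. Qed.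

Lemma sqr_energy (p : R -> R -> R) N : cont2 p -> 0 <= N -> (forall x y, p x y ^+ 2 <= H x y) ->
  Ibox N (fun x y => p x y ^+ 2) <= E0.
Proof. by move=> cp N0 pH; apply: le_trans (en_E EN N0); apply: le_Ibox => //; prove_cont. Qed.

Lemma unif_cvg_abs (F : R -> R -> R -> R) f N : 0 <= N -> cont2 f -> (forall s, cont2 (F s)) -> unif_cvg F f ->
  asym_le (fun s => Ibox N (fun x y => `|F s x y|)) (fun=> Ibox N (fun x y => `|f x y|)).
Proof.
move=> N0 cf cF uF k k0.
have k4 : 0 < k / (4 * N ^+ 2 + 1) by rewrite divr_gt0// ltr_wpDl// mulr_ge0// exprn_ge0.
have h := uF N _ k4; near=> s.
have hs : forall x y, `|x| <= N -> `|y| <= N -> `|F s x y - f x y| <= k / (4 * N ^+ 2 + 1) by near: s.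
apply: (@le_trans _ _ (Ibox N (fun x y => `|f x y| + k / (4 * N ^+ 2 + 1)))).
  apply: le_Ibox; [by prove_cont|by prove_cont|] => x y xN yN.
  by rewrite -[F s x y](subrK (f x y)) (le_trans (ler_normD _ _))// addrC lerD2l hs.
rewrite IboxD; [|by prove_cont|by prove_cont].
rewrite lerD2l Ibox_cst// -mulrA ler_piMr ?(ltW k0)//.
have p0 : 0 <= 4 * N ^+ 2 by rewrite mulr_ge0// exprn_ge0.
by rewrite mulrC ler_pdivrMr ?mul1r ?lerDl// ltr_wpDl.
Unshelve. all: by end_near. Qed.

Section sup.
Variables (P p1 p2 : R -> R -> R) (e : bool).
Hypotheses (d1 : D1 P p1) (d2 : D2 P p2) (cP : cont2 P) (cp1 : cont2 p1) (cp2 : cont2 p2).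
Hypothesis d12 : forall s, s != 0 -> D2 (smooth s p1) (Va P12 e s).
Hypotheses (p1H : forall x y, p1 x y ^+ 2 <= H x y) (p2H : forall x y, p2 x y ^+ 2 <= H x y).

(** [sup_bound] for [cutZ] times the double average of P. The mixed derivative of a velocity
    component is a derivative of the strain entry P12 (hypothesis [d12]), so the weighted energy
    controls it; the other terms are of lower order. *)
Lemma cutZ_small r k : 1 <= r -> 0 < k -> \forall s \near 0^'+, forall x y : R,
  cutZ r x y * `|P x y| <= Ibox (2 * r + 1) (fun x y => `|cutZ12 r x y * P x y + cutZ1 r x y * p2 x y + cutZ2 r x y * p1 x y|) +
    Ibox (2 * r + 1) (fun x y => `|cutZ r x y * Va P12 e s x y|) + k.
Proof.
move=> r1 k0; have r0 : 0 < r by apply: lt_le_trans r1.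
set N := 2 * r + 1; have N0 : 0 <= N by rewrite /N; clra.
have [cz cz1 cz2 cz12] := cutZ_cont r; have [dz1 dz2 dz12] := cutZ_D r.
have cU (f : R -> R -> R) s (cf : cont2 f) : cont2 (smooth s f) by exact: cont2_smooth.
pose X s x y := cutZ12 r x y * smooth s P x y + cutZ1 r x y * smooth s p2 x y + cutZ2 r x y * smooth s p1 x y.
have cX s : cont2 (X s).
  by have h1 := @cU _ s cP; have h2 := @cU _ s cp1; have h3 := @cU _ s cp2; rewrite /X; prove_cont.
pose X0 x y := cutZ12 r x y * P x y + cutZ1 r x y * p2 x y + cutZ2 r x y * p1 x y.
have cX0 : cont2 X0 by rewrite /X0; prove_cont.
have uX : unif_cvg X X0.
  apply: unif_cvgD; first apply: unif_cvgD.
  - by apply: unif_cvgM => //; [exact: unif_cvg_cst|exact: unif_cvg_smooth].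
  - by apply: unif_cvgM => //; [exact: unif_cvg_cst|exact: unif_cvg_smooth].
  - by apply: unif_cvgM => //; [exact: unif_cvg_cst|exact: unif_cvg_smooth].
have k2 : 0 < k / 2 by rewrite divr_gt0.
have h1 := unif_cvg_abs N0 cX0 cX uX k2.
have h2 := unif_cvg_smooth cP N k2.
have cV s : cont2 (Va P12 e s) := cont2_Va FL e s.
near=> s.
have s0 : s != 0 by apply: lt0r_neq0; near: s; exact: nbhs_right_gt.
have g1 : Ibox N (fun x y => `|X s x y|) <= Ibox N (fun x y => `|X0 x y|) + k / 2 by near: s; exact: h1.
have g2 : forall x y, `|x| <= N -> `|y| <= N -> `|smooth s P x y - P x y| <= k / 2 by near: s; exact: h2.
move=> x y.
have out z : N <= `|z| -> 2 * r <= `|z| by rewrite /N; clra.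
have Zout x' y' : N <= `|x'| \/ N <= `|y'| -> cutZ r x' y' = 0.
  by move=> xy; apply: (cutZ_out r0); case: xy => /out; [left|right].
have rhs0 : 0 <= Ibox N (fun x y => `|X0 x y|) + Ibox N (fun x y => `|cutZ r x y * Va P12 e s x y|) + k.
  by rewrite !addr_ge0// ?Ibox_ge0// ltW.
have [xN|xN] := leP N `|x|; first by rewrite Zout ?mul0r//; left.
have [yN|yN] := leP N `|y|; first by rewrite Zout ?mul0r//; right.
have sd1 : D1 (smooth s P) (smooth s p1) := @Dd_smooth' R true s P p1 s0 cP cp1 d1.
have sd2 : D2 (smooth s P) (smooth s p2) := @Dd_smooth' R false s P p2 s0 cP cp2 d2.
have sd12 := d12 s0.
pose F x y := cutZ r x y * smooth s P x y.
pose F1 x y := cutZ1 r x y * smooth s P x y + cutZ r x y * smooth s p1 x y.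
pose F12 x y := X s x y + cutZ r x y * Va P12 e s x y.
have cs1 := @cU _ s cP; have cs2 := @cU _ s cp1.
have dF1 : D1 F F1.
  rewrite /F /F1; move: (smooth s P) (smooth s p1) (cutZ r) (cutZ1 r) sd1 dz1 => a b c d h h'.
  by prove_partial; ring.
have dF12 : D2 F1 F12.
  rewrite /F1 /F12 /X; move: (smooth s P) (smooth s p1) (smooth s p2) (Va P12 e s) (cutZ r) (cutZ1 r) (cutZ2 r) (cutZ12 r) sd2 sd12 dz2 dz12 => a b c d f g h i h1' h2' h3' h4'.
  by prove_partial; ring.
have cF1 : cont2 F1 by rewrite /F1; prove_cont.
have cF12 : cont2 F12 by have := cX s; have := cV s => *; rewrite /F12; prove_cont.
have Z1out x' y' : 2 * r <= `|x'| \/ 2 * r <= `|y'| -> cutZ1 r x' y' = 0.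
  by move=> xy; exact: (cutZ1_out r0).
have sF : bsupp N F by move=> x' y' xy; rewrite /F Zout ?mul0r.
have sF1 : bsupp N F1.
  move=> x' y' xy; rewrite /F1 Zout// Z1out ?mul0r ?addr0//.
  by case: xy => /out; [left|right].
have B := sup_bound x y N0 dF1 dF12 cF1 cF12 sF sF1.
have B2 : Ibox N (fun x y => `|F12 x y|) <= Ibox N (fun x y => `|X s x y|) + Ibox N (fun x y => `|cutZ r x y * Va P12 e s x y|).
  have := cX s; have := cV s => c1 c2.
  rewrite -IboxD; [|by prove_cont|by prove_cont].
  by apply: le_Ibox; [by prove_cont|by prove_cont|] => x' y' _ _; exact: ler_normD.
have zg := cutZ_ge0 r x y; have zl := cutZ_le1 r x y.
have B3 : cutZ r x y * `|P x y| <= `|F x y| + k / 2.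
  rewrite /F normrM (ger0_norm zg).
  apply: (@le_trans _ _ (cutZ r x y * (`|smooth s P x y| + k / 2))).
    apply: ler_wpM2l => //; rewrite -[P x y](subrK (smooth s P x y)) (le_trans (ler_normD _ _))// addrC lerD2l distrC.
    by apply: g2; exact: ltW.
  by rewrite mulrDr lerD2l ler_piMl// ltW.
have E (a b : R) : a + k / 2 + b + k / 2 = a + b + k by clra.
apply: le_trans B3 (le_trans (lerD (le_trans (le_trans B B2) (lerD g1 (lexx _))) (lexx (k / 2))) _).
by rewrite E.
Unshelve. all: by end_near. Qed.

(** Young's inequality with weight r against the constant 1, whose integral is of order r^2, gives
    linear growth in r; 18 comes from 2 (2 r + 1)^2 / r <= 18 r. *)
Lemma Va_term r : 1 <= r -> asym_le (fun s => Ibox (2 * r + 1) (fun x y => `|cutZ r x y * Va P12 e s x y|))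
  (fun s => r * (Lam r e s / (2 * m0) + 18)).
Proof.
move=> r1; have r0 : 0 < r by apply: lt_le_trans r1.
set N := 2 * r + 1; have N0 : 0 <= N by rewrite /N; clra.
have [cz _ _ _] := cutZ_cont r; have cE := @cutE_cont R r 0 0.
have m00 := fl_m0 FL.
have cV s : cont2 (Va P12 e s) := cont2_Va FL e s.
have jen := jensen FL (cutE_cutoff r1) cP12 (proj1 (bddL2_W FL (@cutoffs R) e)).
rewrite -/N in jen.
have k0 : 0 <= r / (2 * m0) by rewrite divr_ge0 ?mulr_ge0// ltW.
apply: asym_le_trans (_ : asym_le _ (fun s => r / (2 * m0) * Ibox N (fun x y => cutE r 0 0 x y * M x y * Va P12 e s x y ^+ 2) + 18 * r)) _.
  apply: asym_le_le => s _; have cVs := cV s.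
  apply: le_trans (Ibox_abs_le _ N0 r0) _; first by prove_cont.
  apply: lerD; last first.
    rewrite ler_pdivrMr//; have : N ^+ 2 <= (3 * r) ^+ 2 by rewrite ler_pXn2r// ?nnegrE /N; clra.
    by rewrite !expr2; clra.
  have -> : r / (2 * m0) = r / 2 * m0^-1 by field; rewrite gt_eqF.
  rewrite -(mulrA (r / 2)) ler_wpM2l ?divr_ge0 ?(ltW r0)//.
  rewrite -IboxZ; last by prove_cont.
  apply: le_Ibox; [by prove_cont|by prove_cont|] => x y _ _.
  rewrite cutEZ ler_pdivlMl//; have := fl_M FL x y.
  move: (M x y) (cutZ r x y) (Va P12 e s x y) => m z v mm; rewrite -subr_ge0.
  have -> : z ^+ 2 * m * v ^+ 2 - m0 * (z * v) ^+ 2 = (m - m0) * (z * v) ^+ 2 by ring.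
  by rewrite mulr_ge0 ?sqr_ge0// subr_ge0.
have le1 : asym_le (fun s => Ibox N (fun x y => cutE r 0 0 x y * M x y * diff_quot e s P12 x y ^+ 2)) (fun s => Lam r e s).
  apply: asym_le_le => s _; rewrite /hessian_energy; apply: le_Ibox; [by prove_cont|by prove_cont|] => x y _ _.
  rewrite ler_wpM2l ?lerDl ?sqr_ge0// mulr_ge0//; first by rewrite cutEZ sqr_ge0.
  exact: M_ge0 FL x y.
have z : asym_le (fun=> 18 * r) (fun=> 18 * r) by apply: asym_le_le.
apply: asym_le_trans (asym_leD (asym_leZ k0 (asym_le_trans jen le1)) z) _.
apply: asym_le_le => s _; rewrite le_eqVlt; apply/orP; left; apply/eqP.
by field; rewrite gt_eqF.
Qed.

Lemma low_term : exists2 C : R, 0 <= C & forall r, 1 <= r ->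
  Ibox (2 * r + 1) (fun x y => `|cutZ12 r x y * P x y + cutZ1 r x y * p2 x y + cutZ2 r x y * p1 x y|) <= C * r.
Proof.
have [C C1 HC] := @cut_bounds R; have C0 : 0 <= C by apply: le_trans C1.
have [c0 c00 Hc0] := cont2_bounded 1 cP.
have E00 := E0_ge0.
(* Poincare's inequality with l = 1 centres P at a value bounded independently of r. The price is a
   growth of order r^4 for the integral of P^2, still admissible: that of |P| is then of order r^3
   and meets a factor r^-2. *)
pose K1 := 2 * (72 * E0 + 432 * (E0 + 1)) + 72 * c0 ^+ 2.
have K10 : 0 <= K1 by rewrite /K1; have := sqr_ge0 c0; clra.
exists (C * (K1 / 2 + 18) + C * (E0 + 36)).
  by rewrite addr_ge0// mulr_ge0//; clra.
move=> r r1; have r0 : 0 < r by apply: lt_le_trans r1.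
have [_ h1 h2 h12] := HC r r0.
set N := 2 * r + 1; have N0 : 0 <= N by rewrite /N; clra.
have N3 : N <= 3 * r by rewrite /N; clra.
have ri : 0 < r^-1 by rewrite invr_gt0.
have [cz cz1 cz2 cz12] := cutZ_cont r.
have abs1 (p : R -> R -> R) : cont2 p -> (forall x y, p x y ^+ 2 <= H x y) ->
    Ibox N (fun x y => `|p x y|) <= r * (E0 / 2 + 18).
  move=> cp pH; apply: le_trans (Ibox_abs_le cp N0 r0) _.
  have h := sqr_energy cp N0 pH.
  have : r / 2 * Ibox N (fun x y => p x y ^+ 2) <= r / 2 * E0 by rewrite ler_wpM2l// divr_ge0// ltW.
  have : 2 * N ^+ 2 / r <= 18 * r.
    rewrite ler_pdivrMr//; have : N ^+ 2 <= (3 * r) ^+ 2 by rewrite ler_pXn2r// nnegrE; clra.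
    by rewrite !expr2; clra.
  move: h; iblra.
have r2 : r <= r ^+ 2 by rewrite expr2 ler_peMr// ltW.
have r3 : r ^+ 2 <= r ^+ 3 by rewrite exprS ler_peMl// sqr_ge0.
have r4 : r ^+ 3 <= r ^+ 4 by rewrite [r ^+ 4]exprS ler_peMl// exprn_ge0// ltW.
have N2b : N ^+ 2 <= 9 * r ^+ 4.
  have : N ^+ 2 <= (3 * r) ^+ 2 by rewrite ler_pXn2r// nnegrE; clra.
  by rewrite exprMn; clra.
have N3b : N ^+ 3 <= 27 * r ^+ 4.
  have : N ^+ 3 <= (3 * r) ^+ 3 by rewrite ler_pXn2r// nnegrE; clra.
  by rewrite exprMn; clra.
have IP : Ibox N (fun x y => P x y ^+ 2) <= K1 * r ^+ 4.
  have lN : (0 : R) < 1 <= N by apply/andP; split; rewrite /N; clra.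
  have [y' /andP[y0 y1] hp] := poincare lN d1 d2 cP cp1 cp2.
  have b1 := sqr_energy cp1 N0 p1H; have b2 := sqr_energy cp2 N0 p2H.
  have cb : P 0 y' ^+ 2 <= c0 ^+ 2.
    rewrite -real_normK ?num_real// ler_pXn2r ?nnegrE//; last exact: ltW.
    by apply: Hc0; rewrite ?normr0// ger0_norm.
  apply: (@le_trans _ _ (2 * Ibox N (fun x y => (P x y - P 0 y') ^+ 2) + 2 * P 0 y' ^+ 2 * (4 * N ^+ 2))).
    rewrite -Ibox_cst// -IboxZ; last by prove_cont.
    rewrite -IboxD; [|by prove_cont|by prove_cont].
    apply: le_Ibox; [by prove_cont|by prove_cont|] => x y _ _.
    move: (P x y) (P 0 y') => p q; rewrite -subr_ge0.
    by rewrite (_ : _ - _ = (p - 2 * q) ^+ 2) ?sqr_ge0//; ring.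
  have e1 : 8 * N ^+ 2 * Ibox N (fun x y => p2 x y ^+ 2) <= 72 * r ^+ 4 * E0.
    apply: ler_pM => //; [by rewrite mulr_ge0// sqr_ge0|by apply: Ibox_ge0 => *; exact: sqr_ge0|by clra].
  have e2 : 16 * N ^+ 3 / 1 * (Ibox N (fun x y => p1 x y ^+ 2) + 1) <= 432 * r ^+ 4 * (E0 + 1).
    rewrite divr1; apply: ler_pM; [by rewrite mulr_ge0// exprn_ge0| |by clra|by rewrite lerD2r].
    by rewrite addr_ge0// Ibox_ge0// => *; exact: sqr_ge0.
  have e3 : 2 * P 0 y' ^+ 2 * (4 * N ^+ 2) <= 2 * c0 ^+ 2 * (36 * r ^+ 4).
    apply: ler_pM; [by rewrite mulr_ge0// sqr_ge0|by rewrite mulr_ge0// sqr_ge0|by clra|by clra].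
  have tw : 0 <= 2 :> R by [].
  apply: le_trans (lerD (ler_wpM2l tw (le_trans hp (lerD e1 e2))) e3) _.
  by rewrite le_eqVlt; apply/orP; left; apply/eqP; rewrite /K1; ring.
have IA : Ibox N (fun x y => `|P x y|) <= r ^+ 3 * (K1 / 2 + 18).
  apply: le_trans (Ibox_abs_le cP N0 ri) _.
  have a1 : r^-1 / 2 * Ibox N (fun x y => P x y ^+ 2) <= r^-1 / 2 * (K1 * r ^+ 4) by rewrite ler_wpM2l// divr_ge0// ltW.
  have a2 : r^-1 / 2 * (K1 * r ^+ 4) = r ^+ 3 * (K1 / 2) by field; rewrite gt_eqF.
  have a3 : 2 * N ^+ 2 / r^-1 <= 18 * r ^+ 3.
    rewrite invrK; have : N ^+ 2 <= (3 * r) ^+ 2 by rewrite ler_pXn2r// nnegrE; clra.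
    move=> h; have := ler_wpM2r (ltW r0) h; rewrite exprMn exprSr; clra.
  rewrite mulrDr; move: a1 a3; rewrite a2; iblra.
apply: (@le_trans _ _ (C * r^-1 ^+ 2 * Ibox N (fun x y => `|P x y|) + (C * r^-1 * Ibox N (fun x y => `|p2 x y|) + C * r^-1 * Ibox N (fun x y => `|p1 x y|)))).
  rewrite -!IboxZ; [|by prove_cont|by prove_cont|by prove_cont].
  rewrite -IboxD; [|by prove_cont|by prove_cont].
  rewrite -IboxD; [|by prove_cont|by prove_cont].
  apply: le_Ibox; [by prove_cont|by prove_cont|] => x y _ _.
  rewrite addrA; apply: le_trans (ler_normD _ _) _; apply: lerD; last by rewrite normrM ler_wpM2r.
  by apply: le_trans (ler_normD _ _) _; apply: lerD; rewrite normrM ler_wpM2r.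
have q1 := abs1 _ cp1 p1H; have q2 := abs1 _ cp2 p2H.
have Cr : 0 <= C * r^-1 by rewrite mulr_ge0// ltW.
have Cr2 : 0 <= C * r^-1 ^+ 2 by rewrite mulr_ge0// exprn_ge0// ltW.
have t1 := ler_wpM2l Cr2 IA; have t2 := ler_wpM2l Cr q1; have t3 := ler_wpM2l Cr q2.
have E1 : C * r^-1 ^+ 2 * (r ^+ 3 * (K1 / 2 + 18)) = C * (K1 / 2 + 18) * r by field; rewrite gt_eqF.
have E2 : C * r^-1 * (r * (E0 / 2 + 18)) = C * (E0 / 2 + 18) by field; rewrite gt_eqF.
rewrite E1 in t1; rewrite E2 in t2 t3.
have t4 : C * (E0 + 36) <= C * (E0 + 36) * r by rewrite ler_peMr// mulr_ge0//; clra.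
apply: le_trans (lerD t1 (lerD t3 t2)) _.
by rewrite [leRHS]mulrDl lerD2l; clra.
Qed.

(** C depends neither on r nor on s. The unknown weighted energy itself appears on the right, to be
    absorbed later. *)
Lemma sup_est : exists2 C : R, 0 < C & forall r, 1 <= r -> \forall s \near 0^'+, forall x y,
  cutZ r x y * `|P x y| <= C * r * (1 + Lam r e s).
Proof.
have [C C0 HC] := low_term; have m00 := fl_m0 FL.
exists (C + 20 + (2 * m0)^-1).
  by rewrite addr_gt0 ?invr_gt0 ?mulr_gt0//; clra.
move=> r r1; have r0 : 0 < r by apply: lt_le_trans r1.
have h1 := cutZ_small r1 (@ltr01 R); have h2 := Va_term r1 (@ltr01 R); have h3 := HC r r1.
near=> s => x y.
have g1 : forall x y, cutZ r x y * `|P x y| <= Ibox (2 * r + 1) (fun x y => `|cutZ12 r x y * P x y + cutZ1 r x y * p2 x y + cutZ2 r x y * p1 x y|) +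
    Ibox (2 * r + 1) (fun x y => `|cutZ r x y * Va P12 e s x y|) + 1 by near: s; exact: h1.
have g2 : Ibox (2 * r + 1) (fun x y => `|cutZ r x y * Va P12 e s x y|) <= r * (Lam r e s / (2 * m0) + 18) + 1 by near: s; exact: h2.
have L0 : 0 <= Lam r e s.
  apply: Ibox_ge0 => x' y' _ _; rewrite mulr_ge0 ?addr_ge0 ?sqr_ge0// mulr_ge0//; first by rewrite cutEZ sqr_ge0.
  exact: M_ge0 FL x' y'.
have := g1 x y; move: g2 h3 L0; move: (Lam r e s) => L.
have i0 : 0 <= (2 * m0)^-1 by rewrite invr_ge0 mulr_ge0// ltW.
move=> g2 h3 L0 g1'.
have -> : (C + 20 + (2 * m0)^-1) * r * (1 + L) = C * r + (r * (L / (2 * m0) + 18) + 2 * r) + (r * (2 * m0)^-1 + C * r * L + 20 * (r * L)).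
  by field; rewrite gt_eqF.
have p1' : 0 <= r * (2 * m0)^-1 + C * r * L + 20 * (r * L).
  have rL := mulr_ge0 (ltW r0) L0.
  have := mulr_ge0 (ltW r0) i0; have := mulr_ge0 C0 rL; clra.
move: g1' g2 h3 p1'; move: (r * (L / (2 * m0) + 18)) (r * (2 * m0)^-1 + C * r * L + 20 * (r * L)) => X Y; iblra.
Unshelve. all: by end_near. Qed.

End sup.

Local Notation D2f := (fun x y => P11 x y ^+ 2 + P12 x y ^+ 2 + P22 x y ^+ 2).
Notation Pd := (Pd P1 P2).

(* Equal to 1 where the derivatives of the cut-off live; telescoping along powers of 4. *)
Definition annulus r x y : R := cutZ (2 * r) x y - cutZ (r / 2) x y.

Lemma cont2_annulus r : cont2 (annulus r).
Proof. by rewrite /annulus; have [h _ _ _] := cutZ_cont (2 * r); have [h' _ _ _] := cutZ_cont (r / 2); prove_cont. Qed.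

Lemma annulus_ge0 r x y : 0 < r -> 0 <= annulus r x y.
Proof.
move=> r0; rewrite /annulus subr_ge0.
have r2 : 0 < r / 2 by rewrite divr_gt0.
have r2' : 0 < 2 * r by rewrite mulr_gt0.
have [xr|xr] := leP `|x| (2 * r); last first.
  by rewrite (cutZ_out r2) ?cutZ_ge0//; left; have := ltW xr; clra.
have [yr|yr] := leP `|y| (2 * r); last first.
  by rewrite (cutZ_out r2) ?cutZ_ge0//; right; have := ltW yr; clra.
by rewrite (cutZ_in r2')// cutZ_le1.
Qed.

Lemma annulus_le1 r x y : annulus r x y <= 1.
Proof. by rewrite /annulus; have := cutZ_le1 (2 * r) x y; have := cutZ_ge0 (r / 2) x y; clra. Qed.

Lemma cutE_annulus (C r : R) i j x y : 1 <= r -> 0 <= C -> (0 < i + j)%N ->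
  `|cutE r i j x y| <= C * r^-1 ^+ (i + j) * cutZ r x y ->
  `|cutE r i j x y| <= C * r^-1 ^+ (i + j) * (cutZ r x y * annulus r x y).
Proof.
move=> r1 C0 ij h; have r0 : 0 < r by apply: lt_le_trans r1.
have C' : 0 <= C * r^-1 ^+ (i + j) by rewrite mulr_ge0// exprn_ge0// invr_ge0 ltW.
have z0 : 0 <= C * r^-1 ^+ (i + j) * (cutZ r x y * annulus r x y).
  by rewrite mulr_ge0// mulr_ge0 ?cutZ_ge0// annulus_ge0.
have r2 : 0 < r / 2 by rewrite divr_gt0.
have r2' : 0 < 2 * r by rewrite mulr_gt0.
have [xr|xr] := leP (2 * r) `|x|; first by rewrite (cutE_out i j r0) ?normr0//; left.
have [yr|yr] := leP (2 * r) `|y|; first by rewrite (cutE_out i j r0) ?normr0//; right.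
have [/andP[xr' yr']|out] := boolP ((`|x| <= r) && (`|y| <= r)).
  by rewrite cutE_in// normr0.
rewrite /annulus (cutZ_in r2') ?(ltW xr) ?(ltW yr)// (cutZ_out r2) ?subr0 ?mulr1//.
by move: out; rewrite negb_and -!ltNge => /orP[/ltW h'|/ltW h']; [left|right]; clra.
Qed.

Lemma cont2_D2f : cont2 D2f.
Proof. by prove_cont. Qed.

Lemma D2f_ge0 x y : 0 <= D2f x y.
Proof. by rewrite !addr_ge0// sqr_ge0. Qed.

(** The annuli of radii 4^(n+1) have total energy at most E0; if all of them beyond n0 exceeded k,
    the partial sums would outgrow E0. *)
Lemma small_annulus (k r0 : R) : 0 < k -> exists r, [/\ 1 <= r, r0 <= r &
  forall N, 2 * r <= N -> Ibox N (fun x y => annulus r x y * D2f x y) <= k].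
Proof.
move=> k0; have cD := cont2_D2f.
have cz (r : R) : cont2 (cutZ r) by have [] := cutZ_cont r.
pose q (n : nat) : R := 4 ^+ n.
have q1 n : 1 <= q n by rewrite /q exprn_ege1// ler1n.
have q0 n : 0 < q n by apply: lt_le_trans (q1 n).
pose J n := Ibox (4 * q n) (fun x y => cutZ (2 * q n) x y * D2f x y).
have cJ r : cont2 (fun x y => cutZ r x y * D2f x y).
  by have := cz r => h; prove_cont.
have J_le n : J n <= E0.
  apply: le_trans (en_E EN (_ : 0 <= 4 * q n)); last by rewrite mulr_ge0// ltW.
  apply: le_Ibox => // x y _ _; apply: le_trans (en_D EN x y).
  by rewrite ler_piMl ?D2f_ge0 ?cutZ_le1.
have J_ge n : 0 <= J n by apply: Ibox_ge0 => x y _ _; rewrite mulr_ge0 ?cutZ_ge0// D2f_ge0.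
have step n N : 2 * (2 * q n.+1) <= N -> Ibox N (fun x y => annulus (q n.+1) x y * D2f x y) = J n.+1 - J n.
  move=> hN; have qq : q n.+1 = 4 * q n by rewrite /q exprS.
  have p1 : 0 < 2 * q n.+1 by rewrite mulr_gt0.
  have p2 : 0 < 2 * q n by rewrite mulr_gt0.
  have s1 : bsupp (4 * q n.+1) (fun x y => cutZ (2 * q n.+1) x y * D2f x y).
    by move=> x y xy; rewrite (cutZ_out p1) ?mul0r//; rewrite mulrA -natrM.
  have s2 : bsupp (4 * q n) (fun x y => cutZ (2 * q n) x y * D2f x y).
    by move=> x y xy; rewrite (cutZ_out p2) ?mul0r//; rewrite mulrA -natrM.
  have n1 : 0 <= 4 * q n.+1 <= N by have h := q0 n.+1; apply/andP; split; clra.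
  have n2 : 0 <= 4 * q n <= N by have h := q0 n; apply/andP; split; clra.
  rewrite /J -(Ibox_supp (cJ _) n1 s1) -(Ibox_supp (cJ _) n2 s2) -(IboxB _ (cJ _) (cJ _)).
  by apply: eq_Ibox => x y _ _; rewrite /annulus (_ : q n.+1 / 2 = 2 * q n) ?mulrBl// qq; field.
have [n0 hn0] : exists n0 : nat, r0 <= n0%:R.
  by exists (Num.Def.archi_bound `|r0|); apply: ltW; apply: le_lt_trans (ler_norm r0) (archi_boundP (normr_ge0 r0)).
have q_ge n : n%:R <= q n.
  elim: n => [|n IH]; first exact: ltW.
  by rewrite -natr1 /q exprS -/(q n); have := q1 n; clra.
suff [n n0n hn] : exists2 n, (n0 <= n)%N & J n.+1 - J n <= k.
  exists (q n.+1); split => //.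
    apply: le_trans hn0 (le_trans _ (q_ge _)); rewrite ler_nat; exact: leqW.
  move=> N hN; have p1 : 0 < 2 * q n.+1 by rewrite mulr_gt0.
  (* The given square may miss part of the annulus, which extends to 4 r; [step] needs a square
     containing all of it. *)
  pose N' := Num.max N (2 * (2 * q n.+1)).
  have cr := cont2_annulus (q n.+1).
  apply: (@le_trans _ _ (Ibox N' (fun x y => annulus (q n.+1) x y * D2f x y))).
    apply: Ibox_le_dom; [by prove_cont| |by move=> x y; rewrite mulr_ge0 ?annulus_ge0// D2f_ge0].
    by rewrite /N' le_max lexx/= (le_trans _ hN)// ltW.
  by rewrite step// /N' le_max lexx orbT.
apply: contrapT => no.
have big m : k * m%:R <= J (n0 + m)%N.
  elim: m => [|m IH]; first by rewrite mulr0.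
  rewrite -natr1 mulrDr mulr1 addnS.
  have : k < J (n0 + m).+1 - J (n0 + m)%N.
    by rewrite ltNge; apply/negP => h; apply: no; exists (n0 + m)%N => //; exact: leq_addr.
  move: IH; move: (J _) (J _) => a b; clra.
have [m hm] : exists m : nat, E0 / k < m%:R.
  by exists (Num.Def.archi_bound `|E0 / k|); apply: le_lt_trans (ler_norm _) (archi_boundP (normr_ge0 _)).
have := le_trans (big m) (J_le _); rewrite leNgt => /negP; apply.
by rewrite mulrC -ltr_pdivrMr.
Qed.

End energy.

(** * Decay of the weighted second derivatives *)

Section scalars.
Context {R : realType}.
Implicit Types (a b c d e f k m n p q r s t w z : R).

Lemma norm3 a b c : `|a + b + c| <= `|a| + `|b| + `|c|.
Proof. by rewrite (le_trans (ler_normD _ _))// lerD2r ler_normD. Qed.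

Lemma norm4 a b c d : `|a + b + c + d| <= `|a| + `|b| + `|c| + `|d|.
Proof. by rewrite (le_trans (ler_normD _ _))// lerD2r norm3. Qed.

Lemma mean_norm a b k : `|a| <= k -> `|b| <= k -> `|(a - b) / 2| <= k.
Proof.
move=> ha hb; rewrite normrM (@ger0_norm _ (2^-1)) ?invr_ge0//.
by rewrite ler_pdivrMr// (le_trans (ler_normB _ _))// mulr_natr mulr2n lerD.
Qed.

Lemma second_order_pt (k2 k3 m s e1 e2 e3 e4 f1 f2 f3 q : R) : 0 <= k2 ->
  `|e1| <= k2 -> `|e2| <= k2 -> `|e4| <= k2 ->
  `|f1| <= s -> `|f2| <= s -> `|f3| <= s -> `|e3 * q| <= k3 * m ->
  `|e1 * f2 + e2 * f1 + e3 * q + e4 * f3| <= 3 * k2 * s + k3 * m.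
Proof.
move=> k20 h1 h2 h4 g1 g2 g3 g4; apply: le_trans (norm4 _ _ _ _) _.
have t1 : `|e1 * f2| <= k2 * s by rewrite normrM ler_pM.
have t2 : `|e2 * f1| <= k2 * s by rewrite normrM ler_pM.
have t3 : `|e4 * f3| <= k2 * s by rewrite normrM ler_pM.
lra.
Qed.

Lemma quad_pt (p1 p2 p11 p12 p22 : R) :
  `|(p11 ^+ 2 + 2 * p12 ^+ 2 + p22 ^+ 2) / 2 * p2 +
    p12 * (p2 * p12 + p1 * p11) + p22 * (p2 * p22 + p1 * p12)| <=
  2 * (p11 ^+ 2 + p12 ^+ 2 + p22 ^+ 2) * (`|p1| + `|p2|).
Proof.
set D := p11 ^+ 2 + p12 ^+ 2 + p22 ^+ 2.
pose u := (p11 ^+ 2 + 2 * p12 ^+ 2 + p22 ^+ 2) / 2 + p12 ^+ 2 + p22 ^+ 2.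
pose v := p12 * p11 + p22 * p12.
have -> : (p11 ^+ 2 + 2 * p12 ^+ 2 + p22 ^+ 2) / 2 * p2 + p12 * (p2 * p12 + p1 * p11) + p22 * (p2 * p22 + p1 * p12) = u * p2 + v * p1.
  by rewrite /u /v; field.
have hh := (sqr_ge0 p11, sqr_ge0 p12, sqr_ge0 p22).
have hu : `|u| <= 2 * D.
  rewrite ger0_norm /u /D; move: hh => [[]]; lra.
have hv : `|v| <= 2 * D.
  have := (sqr_ge0 (p12 - p11), sqr_ge0 (p12 + p11), sqr_ge0 (p22 - p12), sqr_ge0 (p22 + p12)).
  move: hh => [[? ?] ?] [[[? ?] ?] ?].
  by rewrite ler_norml /v /D; apply/andP; split; nra.
apply: le_trans (ler_normD _ _) _; rewrite !normrM mulrDr addrC.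
by apply: lerD; rewrite ler_wpM2r.
Qed.

(** The factor z retained in the bound for the cut-off derivative pays for the velocity, which is
    bounded only in the form z |p| <= m. *)
Lemma conv_pt (k m w z e p1 p2 D F : R) : 0 <= k -> 0 <= w -> 0 <= z -> 0 <= D -> `|e| <= k * (z * w) -> `|F| <= 2 * D * (`|p1| + `|p2|) ->
  z * `|p1| <= m -> z * `|p2| <= m -> `|e * F| <= 4 * k * m * (w * D).
Proof.
move=> k0 w0 z0 D0 he hF h1 h2; rewrite normrM.
apply: le_trans (ler_pM (normr_ge0 _) (normr_ge0 _) he hF) _.
have -> : k * (z * w) * (2 * D * (`|p1| + `|p2|)) = 2 * k * (w * D) * (z * `|p1| + z * `|p2|) by ring.
have -> : 4 * k * m * (w * D) = 2 * k * (w * D) * (m + m) by ring.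
by rewrite ler_wpM2l ?lerD// !mulr_ge0.
Qed.

Lemma coef_pt (k1 k2 m w z s e1 e2 e3 f1 f2 q n p1 p2 : R) : 0 <= k1 -> 0 <= k2 -> 0 <= w -> 0 <= z -> 0 <= s ->
  `|e1| <= k1 * (z * w) -> `|e2| <= k1 * (z * w) -> `|e3| <= k2 * (z * w) ->
  `|f1| + `|f2| <= s -> `|n| <= 2 * (`|p1| + `|p2|) * s ->
  z * `|p1| <= m -> z * `|p2| <= m ->
  `|n * (e1 * f2 + e2 * f1 + e3 * q)| <= 4 * m * (w * (k1 * s ^+ 2 + k2 * (s * `|q|))).
Proof.
move=> k10 k20 w0 z0 s0 h1 h2 h3 hf hn g1 g2.
have hK : `|e1 * f2 + e2 * f1 + e3 * q| <= (z * w) * (k1 * s + k2 * `|q|).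
  apply: le_trans (norm3 _ _ _) _; rewrite !normrM.
  have t1 : `|e1| * `|f2| <= k1 * (z * w) * `|f2| by rewrite ler_wpM2r.
  have t2 : `|e2| * `|f1| <= k1 * (z * w) * `|f1| by rewrite ler_wpM2r.
  have t3 : `|e3| * `|q| <= k2 * (z * w) * `|q| by rewrite ler_wpM2r.
  have t4 : k1 * (z * w) * (`|f1| + `|f2|) <= k1 * (z * w) * s by rewrite ler_wpM2l// !mulr_ge0.
  have -> : z * w * (k1 * s + k2 * `|q|) = k1 * (z * w) * s + k2 * (z * w) * `|q| by ring.
  move: t1 t2 t3 t4; rewrite mulrDr; lra.
rewrite normrM; apply: le_trans (ler_pM (normr_ge0 _) (normr_ge0 _) hn hK) _.
have -> : 2 * (`|p1| + `|p2|) * s * (z * w * (k1 * s + k2 * `|q|)) = 2 * (z * `|p1| + z * `|p2|) * (w * (k1 * s ^+ 2 + k2 * (s * `|q|))) by ring.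
rewrite ler_wpM2r//; last by lra.
by rewrite mulr_ge0// addr_ge0// !mulr_ge0// exprn_ge0.
Qed.

(** The parameter t separates the energy of the annulus, which is small, from the Poincare term in
    q, which is merely bounded and therefore receives the factor t. *)
Lemma young2_pt (t r s q D w : R) : 0 < t -> 0 < r -> 0 <= w <= 1 -> s ^+ 2 <= 3 * D ->
  w * (r^-1 * s ^+ 2 + r^-1 ^+ 2 * (s * `|q|)) <=
  r^-1 * (3 * (w * D) + (3 / 2 / t) * (w * D) + t / 2 * (r^-1 ^+ 2 * q ^+ 2)).
Proof.
move=> t0 r0 /andP[w0 w1] sD.
have ri : 0 < r^-1 by rewrite invr_gt0.
have h : s * (r^-1 * `|q|) <= s ^+ 2 / t / 2 + t / 2 * (r^-1 * `|q|) ^+ 2.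
  rewrite -subr_ge0; set x := r^-1 * `|q|.
  have -> : s ^+ 2 / t / 2 + t / 2 * x ^+ 2 - s * x = (s - t * x) ^+ 2 / t / 2 by field; rewrite gt_eqF.
  by rewrite !divr_ge0 ?sqr_ge0// ltW.
have -> : w * (r^-1 * s ^+ 2 + r^-1 ^+ 2 * (s * `|q|)) = r^-1 * (w * (s ^+ 2 + s * (r^-1 * `|q|))) by ring.
rewrite ler_wpM2l ?(ltW ri)//.
have sD' : s ^+ 2 / t / 2 <= 3 * D / t / 2 by rewrite !ler_wpM2r ?invr_ge0// ltW.
have e1 : s ^+ 2 + s * (r^-1 * `|q|) <= 3 * D + 3 * D / t / 2 + t / 2 * (r^-1 * `|q|) ^+ 2 by lra.
apply: le_trans (ler_wpM2l w0 e1) _.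
have e2 : (r^-1 * `|q|) ^+ 2 = r^-1 ^+ 2 * q ^+ 2 by rewrite exprMn real_normK// num_real.
rewrite e2 mulrDr.
have e3 : w * (t / 2 * (r^-1 ^+ 2 * q ^+ 2)) <= t / 2 * (r^-1 ^+ 2 * q ^+ 2).
  by rewrite ler_piMl// mulr_ge0 ?divr_ge0 ?(ltW t0)// mulr_ge0 ?sqr_ge0.
apply: lerD => //; rewrite le_eqVlt; apply/orP; left; apply/eqP.
by field; rewrite gt_eqF.
Qed.

End scalars.

Section rest.
Context {R : realType}.
Variables (Ps P1 P2 P11 P12 P22 M : R -> R -> R) (m0 : R).
Hypothesis FL : flow Ps P1 P2 P11 P12 P22 M m0.
Notation be := (off_strain P11 P22).
Notation TA := (TA P12 M).
Notation TB := (TB P11 P22 M).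
Notation Pd := (Pd P1 P2).
Variables (H : R -> R -> R) (K E0 : R).
Hypothesis EN : energy P11 P12 P22 M H K E0.
Notation S := (sum_abs P11 P12 P22).
Notation D := (fun x y => P11 x y ^+ 2 + P12 x y ^+ 2 + P22 x y ^+ 2).

Let cP12 : cont2 P12. Proof. by case: FL. Qed.
Let cP11 : cont2 P11. Proof. by case: FL. Qed.
Let cP22 : cont2 P22. Proof. by case: FL. Qed.
Let cP1 : cont2 P1. Proof. by case: FL. Qed.
Let cP2 : cont2 P2. Proof. by case: FL. Qed.
Let cM : cont2 M. Proof. by case: FL. Qed.
Let cbe : cont2 be. Proof. exact: cont2_be FL. Qed.
Let cTA : cont2 TA. Proof. exact: cont2_TA FL. Qed.
Let cTB : cont2 TB. Proof. exact: cont2_TB FL. Qed.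
Let cH : cont2 H. Proof. by case: EN. Qed.
Let cS : cont2 S. Proof. by rewrite /sum_abs; prove_cont. Qed.
Let cD : cont2 D. Proof. by prove_cont. Qed.

Lemma S_ge0 x y : 0 <= S x y.
Proof. by rewrite !addr_ge0. Qed.

Lemma S_sqr x y : S x y ^+ 2 <= 3 * D x y.
Proof.
rewrite /sum_abs -(real_normK (num_real (P11 x y))) -(real_normK (num_real (P12 x y))) -(real_normK (num_real (P22 x y))).
move: `|P11 x y| `|P12 x y| `|P22 x y| => a b c.
have := (sqr_ge0 (a - b), sqr_ge0 (a - c), sqr_ge0 (b - c)) => -[[h1 h2] h3]; nra.
Qed.

Lemma Pd_abs e x y : [/\ `|Pdx P11 P12 e x y| <= S x y, `|Pdy P12 P22 e x y| <= S x y,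
  `|Pdd P11 P22 e x y| <= S x y & `|Pdx P11 P12 e x y| + `|Pdy P12 P22 e x y| <= S x y].
Proof.
have h1 := normr_ge0 (P11 x y); have h2 := normr_ge0 (P12 x y); have h3 := normr_ge0 (P22 x y).
by rewrite /sum_abs /Pdx /Pdy /Pdd; case: e; split; clra.
Qed.

Lemma Nd_abs e x y : `|Nad P1 P2 P11 P12 P22 e x y| <= 2 * (`|P1 x y| + `|P2 x y|) * S x y /\
  `|Nbd P1 P2 P11 P12 P22 e x y| <= 2 * (`|P1 x y| + `|P2 x y|) * S x y.
Proof.
have [h1 h2 _ _] := Pd_abs e x y.
rewrite /Nad /Nbd; move: h1 h2; move: (Pdx _ _ _ _ _) (Pdy _ _ _ _ _) (S x y) (P1 x y) (P2 x y) => a b s p q h1 h2.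
have pa : `|p| * `|a| <= `|p| * s by rewrite ler_wpM2l.
have pb : `|p| * `|b| <= `|p| * s by rewrite ler_wpM2l.
have qa : `|q| * `|a| <= `|q| * s by rewrite ler_wpM2l.
have qb : `|q| * `|b| <= `|q| * s by rewrite ler_wpM2l.
have n2 : `|2 : R| = 2 by rewrite ger0_norm.
split; apply: le_trans (ler_normB _ _) _.
- by rewrite !normrM n2; clra.
- by rewrite mulNr !mulNr normrN !normrM n2; clra.
Qed.

Lemma Ibox_abs_energy (p : R -> R -> R) r : cont2 p -> 1 <= r -> (forall x y, p x y ^+ 2 <= H x y) ->
  Ibox (2 * r + 1) (fun x y => `|p x y|) <= r * (E0 / 2 + 18).
Proof.
move=> cp r1 pH; have r0 : 0 < r by apply: lt_le_trans r1.
set N := 2 * r + 1; have N0 : 0 <= N by rewrite /N; clra.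
apply: le_trans (Ibox_abs_le cp N0 r0) _.
have h := sqr_energy EN cp N0 pH.
have h1 : r / 2 * Ibox N (fun x y => p x y ^+ 2) <= r / 2 * E0 by rewrite ler_wpM2l// divr_ge0// ltW.
have h2 : 2 * N ^+ 2 / r <= 18 * r.
  rewrite ler_pdivrMr//; have : N ^+ 2 <= (3 * r) ^+ 2 by rewrite ler_pXn2r// ?nnegrE /N; clra.
  by rewrite !expr2; clra.
apply: le_trans (lerD h1 h2) _.
by rewrite le_eqVlt; apply/orP; left; apply/eqP; field.
Qed.

Lemma sq_le_H x y : [/\ P11 x y ^+ 2 <= H x y, P12 x y ^+ 2 <= H x y, P22 x y ^+ 2 <= H x y & be x y ^+ 2 <= H x y].
Proof.
have h := en_D EN x y.
have h1 := sqr_ge0 (P11 x y); have h2 := sqr_ge0 (P12 x y); have h3 := sqr_ge0 (P22 x y).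
split; [clra|clra|clra|].
apply: le_trans h; rewrite /off_strain; move: h1 h2 h3; move: (P11 x y) (P12 x y) (P22 x y) => a b c h1 h2 h3.
have := sqr_ge0 (a + c); nra.
Qed.

Lemma stress_L1 r : 1 <= r -> Ibox (2 * r + 1) (fun x y => `|TA x y| + `|TB x y|) <= r * (K * (E0 + 36) + E0).
Proof.
move=> r1; have r0 : 0 < r by apply: lt_le_trans r1.
have N0 : 0 <= 2 * r + 1 by clra.
have K0 := en_K EN; have E00 := E0_ge0 EN.
apply: (@le_trans _ _ (K * (Ibox (2 * r + 1) (fun x y => `|P12 x y|) + Ibox (2 * r + 1) (fun x y => `|be x y|)) + Ibox (2 * r + 1) H)).
  rewrite -IboxD; [|by prove_cont|by prove_cont].
  rewrite -IboxZ; last by prove_cont.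
  rewrite -IboxD; [|by prove_cont|by prove_cont].
  by apply: le_Ibox; [by prove_cont|by prove_cont|] => x y _ _; exact: en_T1 EN x y.
have h1 := Ibox_abs_energy cP12 r1 (fun x y => let: And4 _ h _ _ := sq_le_H x y in h).
have h2 := Ibox_abs_energy cbe r1 (fun x y => let: And4 _ _ _ h := sq_le_H x y in h).
apply: le_trans (lerD (ler_wpM2l K0 (lerD h1 h2)) (en_E EN N0)) _.
have h3 : E0 <= r * E0 by rewrite ler_peMl.
rewrite [leRHS]mulrDr; apply: lerD h3.
by rewrite le_eqVlt; apply/orP; left; apply/eqP; field.
Qed.

Section estimate.
(** Here m bounds the velocity under the weight [cutZ], a the energy of the annulus, Q is the
    Poincare constant and t the free Young parameter. *)
Variables (C r m a t : R) (c : bool -> R).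
Hypotheses (C1 : 1 <= C) (r1 : 1 <= r) (m_ge0 : 0 <= m) (t0 : 0 < t).
Hypothesis HC : forall i j x y, `|cutE r i j x y| <= C * r^-1 ^+ (i + j) * cutZ r x y.
Hypothesis hm : forall e x y, cutZ r x y * `|Pd e x y| <= m.
Hypothesis hc : forall e, `|c e| <= m.
Local Notation N := (2 * r + 1).
Local Notation w := (annulus r).
Hypothesis ha : Ibox N (fun x y => w x y * D x y) <= a.
Variable Q : R.
Hypothesis hQ : forall e, Ibox N (fun x y => (Pd e x y - c e) ^+ 2) <= Q * r ^+ 2.
Hypothesis Q0 : 0 <= Q.

Let r0 : 0 < r. Proof. exact: lt_le_trans r1. Qed.
Let C0 : 0 <= C. Proof. exact: le_trans C1. Qed.
Let N0 : 0 <= N. Proof. by rewrite addr_ge0// mulr_ge0// ltW. Qed.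
Let ri : 0 < r^-1. Proof. by rewrite invr_gt0. Qed.
Let cE i j : cont2 (cutE r i j). Proof. exact: cutE_cont. Qed.
Let cPd e : cont2 (Pd e). Proof. exact: cont2_Pd FL e. Qed.
Let cPd1 e : cont2 (Pdx P11 P12 e). Proof. exact: cont2_Pd1 FL e. Qed.
Let cPd2 e : cont2 (Pdy P12 P22 e). Proof. exact: cont2_Pd2 FL e. Qed.
Let cNad e : cont2 (Nad P1 P2 P11 P12 P22 e). Proof. exact: cont2_Nad FL e. Qed.
Let cNbd e : cont2 (Nbd P1 P2 P11 P12 P22 e). Proof. exact: cont2_Nbd FL e. Qed.
Let cPdc e : cont2 (fun x y => Pd e x y - c e).
Proof. by have := cPd e => h; prove_cont. Qed.
Let cw : cont2 w. Proof. exact: cont2_annulus. Qed.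
Let Z0 x y : 0 <= cutZ r x y. Proof. exact: cutZ_ge0. Qed.
Let Z1 x y : cutZ r x y <= 1. Proof. exact: cutZ_le1. Qed.
Let w0 x y : 0 <= w x y. Proof. exact: annulus_ge0. Qed.
Let w1 x y : w x y <= 1. Proof. exact: annulus_le1. Qed.
Let Dge x y : 0 <= D x y. Proof. exact: D2f_ge0. Qed.

Let HCw i j x y : (0 < i + j)%N -> `|cutE r i j x y| <= C * r^-1 ^+ (i + j) * (cutZ r x y * w x y).
Proof. by move=> ij; exact: cutE_annulus. Qed.

Let HC1 i j x y : `|cutE r i j x y| <= C * r^-1 ^+ (i + j).
Proof. by apply: le_trans (HC i j x y) _; rewrite ler_piMr// mulr_ge0// exprn_ge0// ltW. Qed.

Let q_le e i j x y : `|cutE r i j x y * (Pd e x y - c e)| <= C * r^-1 ^+ (i + j) * (2 * m).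
Proof.
rewrite normrM; apply: le_trans (ler_wpM2r (normr_ge0 _) (HC i j x y)) _.
rewrite -(mulrA (C * _)); apply: ler_wpM2l; first by rewrite mulr_ge0// exprn_ge0// ltW.
apply: (@le_trans _ _ (cutZ r x y * `|Pd e x y| + `|c e|)).
  apply: le_trans (ler_wpM2l (Z0 x y) (ler_normB _ _)) _.
  by rewrite mulrDr lerD2l ler_piMl.
by rewrite (_ : 2 * m = m + m) ?lerD//; ring.
Qed.

Lemma KL_pt e x y :
  `|KLa0 P1 P2 P11 P12 P22 (cutE r) c e x y| <= 3 * (C * r^-1 ^+ 2) * S x y + C * r^-1 ^+ 3 * (2 * m) /\
  `|KLb0 P1 P2 P11 P12 P22 (cutE r) c e x y| <= 3 * (C * r^-1 ^+ 2) * S x y + C * r^-1 ^+ 3 * (2 * m).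
Proof.
have [h1 h2 h3 _] := Pd_abs e x y.
have k0 : 0 <= C * r^-1 ^+ 2 by rewrite mulr_ge0// exprn_ge0// ltW.
rewrite /KLa0 /KLb0 /KLa /KLb; split.
- apply: second_order_pt; [exact: k0| | | |exact: h1|exact: h2|exact: h3|];
    rewrite /ee; case: (e); first [exact: HC1|exact: (q_le true 2 1)|exact: (q_le false 1 2)].
- have E (x1 x2 x3 x4 : R) : x1 - x2 + x3 + x4 = x1 + - x2 + x3 + x4 by [].
  rewrite -mulNr.
  apply: second_order_pt; [exact: k0| | | |exact: h1|exact: h2|exact: h3|].
  + by rewrite /ee; case: (e); exact: HC1.
  + by rewrite normrN /ee; case: (e); exact: HC1.
  + by apply: mean_norm; exact: HC1.
  + have := q_le e; rewrite /ee => q; rewrite mulrAC mulrBl; apply: mean_norm.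
      by case: (e) q => q; [exact: (q 1 2)|exact: (q 0 3)].
    by case: (e) q => q; [exact: (q 3 0)|exact: (q 2 1)].
Qed.

(** Second derivatives of the cut-off, of size r^-2, meet |T| |Du|, which is integrable; third
    derivatives, of size r^-3, meet the stress alone, whose integral is of order r. *)
Lemma T2_est e : Ibox N (fun x y => TA x y * KLa0 P1 P2 P11 P12 P22 (cutE r) c e x y) +
    Ibox N (fun x y => TB x y * KLb0 P1 P2 P11 P12 P22 (cutE r) c e x y) <=
  3 * (C * r^-1 ^+ 2) * E0 + C * r^-1 ^+ 2 * (2 * m) * (K * (E0 + 36) + E0).
Proof.
have cee i j : cont2 (ee (cutE r) e i j) by rewrite /ee; case: (e).
have cPdd : cont2 (Pdd P11 P22 e) by rewrite /Pdd; case: (e).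
have c1 : cont2 (KLa0 P1 P2 P11 P12 P22 (cutE r) c e).
  have h1 := cee 1 0; have h2 := cee 0 1; have h3 := cee 1 1.
  by have := cPdc e; rewrite /KLa0 /KLa => h; have g1 := cPd1 e; have g2 := cPd2 e; have g := cPd e; prove_cont.
have c2 : cont2 (KLb0 P1 P2 P11 P12 P22 (cutE r) c e).
  have h1 := cee 1 0; have h2 := cee 0 1; have h3 := cee 0 2; have h4 := cee 2 0.
  by have := cPdc e; rewrite /KLb0 /KLb => h; have g1 := cPd1 e; have g2 := cPd2 e; have g := cPd e; prove_cont.
have k0 : 0 <= C * r^-1 ^+ 2 by rewrite mulr_ge0// exprn_ge0// ltW.
have k3 : 0 <= C * r^-1 ^+ 3 * (2 * m).
  by apply: mulr_ge0; [apply: mulr_ge0 => //; rewrite exprn_ge0// ltW|apply: mulr_ge0].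
have h := stress_L1 r1; have hE := en_E EN N0.
apply: (@le_trans _ _ (3 * (C * r^-1 ^+ 2) * Ibox N H + C * r^-1 ^+ 3 * (2 * m) * Ibox N (fun x y => `|TA x y| + `|TB x y|))).
  rewrite -IboxD; [|by prove_cont|by prove_cont].
  have cTT : cont2 (fun x y => `|TA x y| + `|TB x y|) by prove_cont.
  rewrite -(IboxZ N _ cH) -(IboxZ N _ cTT) -IboxD; [|by prove_cont|by prove_cont].
  apply: le_Ibox; [by prove_cont|by prove_cont|] => x y _ _.
  have [ka kb] := KL_pt e x y; have hT := en_T EN x y.
  have kk : 0 <= 3 * (C * r^-1 ^+ 2) by rewrite mulr_ge0.
  have g := ler_wpM2l kk hT.
  move: ka kb g; move: (KLa0 _ _ _ _ _ _ _ _ _ _) (KLb0 _ _ _ _ _ _ _ _ _ _) => ka kb.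
  set k2 := 3 * (C * r^-1 ^+ 2); set kc := C * r^-1 ^+ 3 * (2 * m).
  move: (S x y) (TA x y) (TB x y) (H x y) => s ta tb hh ha' hb' g.
  have t1 : ta * ka <= `|ta| * (k2 * s + kc).
    by apply: le_trans (ler_norm _) _; rewrite normrM ler_wpM2l.
  have t2 : tb * kb <= `|tb| * (k2 * s + kc).
    by apply: le_trans (ler_norm _) _; rewrite normrM ler_wpM2l.
  have E : `|ta| * (k2 * s + kc) + `|tb| * (k2 * s + kc) = k2 * ((`|ta| + `|tb|) * s) + kc * (`|ta| + `|tb|) by ring.
  by apply: le_trans (lerD t1 t2) _; rewrite E lerD2r.
apply: lerD; first by rewrite ler_wpM2l// mulr_ge0.
apply: le_trans (ler_wpM2l k3 h) _.
by rewrite le_eqVlt; apply/orP; left; apply/eqP; field; rewrite gt_eqF.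
Qed.

(** The gradient of the cut-off, of size r^-1 and supported in the annulus, meets a flux quadratic
    in Du; hence the small factor a. *)
Lemma T3_est :
  - (Ibox N (fun x y => cutE r 1 0 x y * FF1 P1 P2 P11 P12 P22 x y) + Ibox N (fun x y => cutE r 0 1 x y * FF2 P1 P2 P11 P12 P22 x y)) <=
  8 * (C * r^-1) * m * a.
Proof.
have [c1 c2] := cont2_FF cP1 cP2 cP11 cP12 cP22.
rewrite -IboxD; [|by prove_cont|by prove_cont].
rewrite -IboxN; last by prove_cont.
have k0 : 0 <= C * r^-1 by rewrite mulr_ge0// ltW.
have k8 : 0 <= 8 * (C * r^-1) * m by apply: mulr_ge0 => //; exact: mulr_ge0.
apply: le_trans (ler_wpM2l k8 ha); rewrite -IboxZ; last by prove_cont.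
apply: le_Ibox; [by prove_cont|by prove_cont|] => x y _ _.
have f1 := quad_pt (P1 x y) (P2 x y) (P11 x y) (P12 x y) (P22 x y).
have f2 : `|FF2 P1 P2 P11 P12 P22 x y| <= 2 * D x y * (`|P1 x y| + `|P2 x y|).
  rewrite /FF2 normrN.
  have := quad_pt (P2 x y) (P1 x y) (P22 x y) (P12 x y) (P11 x y).
  move: (P1 x y) (P2 x y) (P11 x y) (P12 x y) (P22 x y) => p1 p2 p11 p12 p22.
  have -> : 2 * (p22 ^+ 2 + p12 ^+ 2 + p11 ^+ 2) * (`|p2| + `|p1|) = 2 * (p11 ^+ 2 + p12 ^+ 2 + p22 ^+ 2) * (`|p1| + `|p2|) by ring.
  have -> // : (p22 ^+ 2 + 2 * p12 ^+ 2 + p11 ^+ 2) / 2 * p1 + p12 * (p1 * p12 + p2 * p22) + p11 * (p1 * p11 + p2 * p12) =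
    (p11 ^+ 2 + 2 * p12 ^+ 2 + p22 ^+ 2) / 2 * p1 + p11 * (p2 * p12 + p1 * p11) + p12 * (p2 * p22 + p1 * p12) by field.
have b1 : `|cutE r 1 0 x y| <= C * r^-1 * (cutZ r x y * w x y) by have := @HCw 1 0 x y isT; rewrite expr1.
have b2 : `|cutE r 0 1 x y| <= C * r^-1 * (cutZ r x y * w x y) by have := @HCw 0 1 x y isT; rewrite expr1.
have m1 := hm true x y; have m2 := hm false x y.
have g1 := conv_pt k0 (w0 x y) (Z0 x y) (Dge x y) b1 f1 m1 m2.
have g2 := conv_pt k0 (w0 x y) (Z0 x y) (Dge x y) b2 f2 m1 m2.
apply: le_trans (ler_norm _) _; rewrite normrN.
apply: le_trans (ler_normD _ _) (le_trans (lerD g1 g2) _).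
by rewrite le_eqVlt; apply/orP; left; apply/eqP; ring.
Qed.

Lemma T4_est e : Ibox N (fun x y => Nad P1 P2 P11 P12 P22 e x y * Ka0 P1 P2 P11 P12 P22 (cutE r) c e x y) +
    Ibox N (fun x y => Nbd P1 P2 P11 P12 P22 e x y * Kb0 P1 P2 P11 P12 P22 (cutE r) c e x y) <=
  8 * (C * r^-1) * m * (3 * a + (3 / 2 / t) * a + t / 2 * Q).
Proof.
have c1 : cont2 (Ka0 P1 P2 P11 P12 P22 (cutE r) c e) by exact: (cont2_Ka (cutE_cutoff r1)).
have c2 : cont2 (Kb0 P1 P2 P11 P12 P22 (cutE r) c e) by exact: (cont2_Kb (cutE_cutoff r1)).
have cq := cPdc e; have cna := cNad e; have cnb := cNbd e; have cp := cPd e.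
have k8 : 0 <= 8 * (C * r^-1) * m by rewrite !mulr_ge0// ltW.
pose W x y := 3 * (w x y * D x y) + (3 / 2 / t) * (w x y * D x y) + t / 2 * (r^-1 ^+ 2 * (Pd e x y - c e) ^+ 2).
have cW : cont2 W by rewrite /W; prove_cont.
apply: (@le_trans _ _ (8 * (C * r^-1) * m * Ibox N W)).
  rewrite -IboxD; [|by prove_cont|by prove_cont].
  rewrite -(IboxZ _ _ cW); apply: le_Ibox; [by prove_cont|by prove_cont|] => x y _ _.
  have [h1 h2 _ h3] := Pd_abs e x y; have [n1 n2] := Nd_abs e x y.
  have m1 := hm true x y; have m2 := hm false x y.
  have k1 : 0 <= C * r^-1 by rewrite mulr_ge0// ltW.
  have k2 : 0 <= C * r^-1 ^+ 2 by rewrite mulr_ge0// exprn_ge0// ltW.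
  have b1 : `|cutE r 1 0 x y| <= C * r^-1 * (cutZ r x y * w x y) by have := @HCw 1 0 x y isT; rewrite expr1.
  have b2 : `|cutE r 0 1 x y| <= C * r^-1 * (cutZ r x y * w x y) by have := @HCw 0 1 x y isT; rewrite expr1.
  have b3 : `|cutE r 1 1 x y| <= C * r^-1 ^+ 2 * (cutZ r x y * w x y) by exact: @HCw 1 1 x y isT.
  have b4 : `|(cutE r 0 2 x y - cutE r 2 0 x y) / 2| <= C * r^-1 ^+ 2 * (cutZ r x y * w x y).
    by apply: mean_norm; [exact: @HCw 0 2 x y isT|exact: @HCw 2 0 x y isT].
  have g1 := coef_pt (Pd e x y - c e) k1 k2 (w0 x y) (Z0 x y) (S_ge0 x y) b1 b2 b3 h3 n1 m1 m2.
  have b2' : `|- cutE r 1 0 x y| <= C * r^-1 * (cutZ r x y * w x y) by rewrite normrN.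
  have g2 := coef_pt (Pd e x y - c e) k1 k2 (w0 x y) (Z0 x y) (S_ge0 x y) b2 b2' b4 h3 n2 m1 m2.
  rewrite mulNr in g2.
  have ww : 0 <= w x y <= 1 by rewrite w0 w1.
  have yy := young2_pt (Pd e x y - c e) t0 r0 ww (S_sqr x y).
  apply: le_trans (lerD (le_trans (ler_norm _) g1) (le_trans (ler_norm _) g2)) _.
  have k88 : 0 <= 8 * C * m by rewrite !mulr_ge0.
  have := ler_wpM2l k88 yy.
  rewrite -/(W x y); move: (W x y) (S x y) (`|Pd e x y - c e|) (w x y) => W' s q ww' h.
  have E1 : 4 * m * (ww' * (C / r * s ^+ 2 + C * r^-1 ^+ 2 * (s * q))) + 4 * m * (ww' * (C / r * s ^+ 2 + C * r^-1 ^+ 2 * (s * q))) =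
    8 * C * m * (ww' * (r^-1 * s ^+ 2 + r^-1 ^+ 2 * (s * q))) by ring.
  have E2 : 8 * (C / r) * m * W' = 8 * C * m * (r^-1 * W') by ring.
  by rewrite E1 E2.
rewrite ler_wpM2l// /W.
have cwD : cont2 (fun x y => w x y * D x y) by prove_cont.
rewrite IboxD; [|by prove_cont|by prove_cont].
rewrite IboxD; [|by prove_cont|by prove_cont].
rewrite !IboxZ//; [|by prove_cont|by prove_cont].
have t3 : 0 <= 3 / 2 / t by rewrite !divr_ge0// ltW.
have t2 : 0 <= t / 2 by rewrite divr_ge0// ltW.
apply: lerD; first by apply: lerD; rewrite ler_wpM2l.
rewrite ler_wpM2l//.
have r2 : 0 <= r^-1 ^+ 2 by rewrite exprn_ge0// ltW.
apply: le_trans (ler_wpM2l r2 (hQ e)) _.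
by rewrite mulrCA -exprMn mulVf ?gt_eqF// expr1n mulr1.
Qed.

(** The last argument of [rest] is a pointwise bound for |D eta|^2 / eta. The right side is kept
    linear in m with explicit powers of r because m will be of order r (1 + Lambda). *)
Lemma rest_est : rest P1 P2 P11 P12 P22 M (cutE r) (2 * r) c (fun _ _ => 2 * C ^+ 2 * r^-1 ^+ 2) <=
  (64 * C ^+ 2 * E0 + 12 * C * E0 + 8 * C * (K * (E0 + 36) + E0) + C * (80 + 8 * Q)) *
  (r^-1 ^+ 2 * (1 + m) + r^-1 * m * (a + a / t + t)).
Proof.
have E00 := E0_ge0 EN; have K0 := en_K EN.
have a0 : 0 <= a by apply: le_trans ha; apply: Ibox_ge0 => x y _ _; rewrite mulr_ge0.
have r2 : 0 <= r^-1 ^+ 2 by rewrite exprn_ge0// ltW.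
have cMV : cont2 (fun x y => M x y * (P12 x y ^+ 2 + be x y ^+ 2)) by prove_cont.
have t1 : Ibox N (fun x y => 2 * C ^+ 2 * r^-1 ^+ 2 * (M x y * (P12 x y ^+ 2 + be x y ^+ 2))) <= 2 * C ^+ 2 * r^-1 ^+ 2 * E0.
  rewrite IboxZ//; apply: ler_wpM2l; first by rewrite mulr_ge0// mulr_ge0// sqr_ge0.
  apply: le_trans (en_E EN N0).
  by apply: le_Ibox => // x y _ _; exact: en_V EN x y.
have t2 := lerD (T2_est true) (T2_est false).
have t4 := lerD (T4_est true) (T4_est false).
have h32 : 0 <= 32 :> R by [].
have h2 : 0 <= 2 :> R by [].
apply: le_trans (lerD (lerD (lerD (ler_wpM2l h32 t1) (ler_wpM2l h2 t2)) T3_est) t4) _.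
set X := r^-1 ^+ 2; set L := K * (E0 + 36) + E0.
have L0 : 0 <= L by rewrite addr_ge0// mulr_ge0// addr_ge0.
have at0 : 0 <= a / t by rewrite divr_ge0// ltW.
have mr : 0 <= r^-1 * m by rewrite mulr_ge0// ltW.
pose Y := r^-1 * m * a; pose Y' := r^-1 * m * (a / t); pose Y'' := r^-1 * m * t.
have [y0 y0' y0''] : [/\ 0 <= Y, 0 <= Y' & 0 <= Y''] by split; rewrite mulr_ge0// ltW.
have Xm : 0 <= X * m by rewrite mulr_ge0.
have -> : 32 * (2 * C ^+ 2 * X * E0) + 2 * (3 * (C * X) * E0 + C * X * (2 * m) * L + (3 * (C * X) * E0 + C * X * (2 * m) * L)) +
    8 * (C / r) * m * a + (8 * (C / r) * m * (3 * a + 3 / 2 / t * a + t / 2 * Q) + 8 * (C / r) * m * (3 * a + 3 / 2 / t * a + t / 2 * Q)) =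
  (64 * C ^+ 2 * E0 + 12 * C * E0) * X + 8 * C * L * (X * m) + C * (56 * Y + 24 * Y' + 8 * Q * Y'').
  by rewrite /Y /Y' /Y''; field; rewrite !gt_eqF.
have -> : X * (1 + m) + r^-1 * m * (a + a / t + t) = X + X * m + Y + Y' + Y'' by rewrite /Y /Y' /Y''; ring.
set A1' := 64 * C ^+ 2 * E0 + 12 * C * E0; set A2' := 8 * C * L.
have A10 : 0 <= A1' by rewrite addr_ge0// !mulr_ge0// sqr_ge0.
have A20 : 0 <= A2' by rewrite !mulr_ge0.
have -> : (A1' + A2' + C * (80 + 8 * Q)) * (X + X * m + Y + Y' + Y'') =
  A1' * X + A2' * (X * m) + C * (56 * Y + 24 * Y' + 8 * Q * Y'') +
  (A1' * (X * m + Y + Y' + Y'') + A2' * (X + Y + Y' + Y'') + C * (80 * (X + X * m) + 24 * Y + 56 * Y' + 80 * Y'' + 8 * Q * (X + X * m + Y + Y'))) by ring.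
rewrite lerDl; repeat first [assumption | exact: ler0n | apply: addr_ge0 | apply: mulr_ge0].
Qed.

End estimate.
End rest.

(** * From vanishing difference quotients to constant functions *)

Section rigidity.
Context {R : realType}.
Implicit Types (f g : R -> R -> R).

Lemma Ibox_eq0 N f : 0 < N -> cont2 f -> (forall x y, 0 <= f x y) -> Ibox N f = 0 ->
  forall x y, `|x| <= N -> `|y| <= N -> f x y = 0.
Proof.
move=> N0 cf f0 I0 x y; rewrite !ler_norml => xN yN.
have NN : - N < N by lra.
have cS : continuous (fun x => Sint (- N) N (f x)) by prove_cont.
have S0 x' : 0 <= Sint (- N) N (f x') by exact: Sint_ge0.
have z := Sint_eq0 NN cS S0 (etrans (esym (IboxE N cf)) I0).
exact: (Sint_eq0 NN (ct_sec cf) (f0 x) (z x xN)).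
Qed.

Lemma small_cst (k : R) : small (fun=> k) -> k = 0.
Proof.
move=> sk; apply/eqP; rewrite -normr_eq0; apply/eqP/le_anti; rewrite normr_ge0 andbT.
apply/ler_addgt0Pr => e e0; rewrite add0r.
have h := sk e e0; near (0 : R)^'+ => s.
by near: s.
Unshelve. all: by end_near. Qed.

Definition dq_vanish f := forall e N k, 0 <= N -> 0 < k ->
  \forall s \near 0^'+, Ibox N (fun x y => diff_quot e s f x y ^+ 2) <= k.

Lemma small_dq_mul f g e N : cont2 f -> cont2 g -> 0 <= N -> dq_vanish f ->
  small (fun s => Ibox N (fun x y => diff_quot e s f x y * g x y)).
Proof.
move=> cf cg N0 vf k k0.
pose G := Ibox N (fun x y => g x y ^+ 2).
have G0 : 0 <= G by apply: Ibox_ge0 => x y _ _; exact: sqr_ge0.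
(* With this weight both terms of Young's inequality are at most k / 2; the added 1 covers G = 0. *)
pose l := (G + 1) / k.
have l0 : 0 < l by rewrite divr_gt0// ltr_wpDl.
have h := vf e N (k / l) N0 (divr_gt0 k0 l0).
near=> s.
have hs : Ibox N (fun x y => diff_quot e s f x y ^+ 2) <= k / l by near: s; exact: h.
have cd : cont2 (diff_quot e s f) by prove_cont.
apply: le_trans (Ibox_norm _ _) _; first by prove_cont.
apply: (@le_trans _ _ (l / 2 * Ibox N (fun x y => diff_quot e s f x y ^+ 2) + (2 * l)^-1 * G)).
  rewrite /G -!IboxZ; [|by prove_cont|by prove_cont].
  rewrite -IboxD; [|by prove_cont|by prove_cont].
  apply: le_Ibox; [by prove_cont|by prove_cont|] => x y _ _.
  rewrite normrM -(real_normK (num_real (diff_quot e s f x y))) -(real_normK (num_real (g x y))).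
  move: `|diff_quot e s f x y| `|g x y| => p q; rewrite -subr_ge0.
  have -> : l / 2 * p ^+ 2 + (2 * l)^-1 * q ^+ 2 - p * q = (l * p - q) ^+ 2 / (2 * l).
    by field; rewrite gt_eqF.
  by rewrite divr_ge0 ?sqr_ge0// mulr_ge0// ltW.
have t1 : l / 2 * Ibox N (fun x y => diff_quot e s f x y ^+ 2) <= k / 2.
  apply: le_trans (ler_wpM2l _ hs) _; first by rewrite divr_ge0// ltW.
  by rewrite le_eqVlt; apply/orP; left; apply/eqP; field; rewrite gt_eqF.
have t2 : (2 * l)^-1 * G <= k / 2.
  have -> : (2 * l)^-1 * G = k / 2 * (G / (G + 1)).
    by rewrite /l; field; rewrite !gt_eqF// ltr_wpDl.
  by rewrite ler_piMr ?divr_ge0 ?(ltW k0)// ler_pdivrMr ?ltr_wpDl// mul1r lerDl.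
by apply: le_trans (lerD t1 t2) _; rewrite -splitr.
Unshelve. all: by end_near. Qed.

(** Let phi = E (f(. + t) - f). Its average [psi] has as derivative the quotient [g] of phi with
    step - t, and the vanishing of the quotients of f gives that the integral of f g is 0.
    Transposing the translation turns this integral into a multiple of that of E (f(. + t) -
    f)^2. *)
Lemma dq_vanish_shift f e t : cont2 f -> dq_vanish f -> 0 < t -> translate e t f = f.
Proof.
move=> cf vf t0; apply/funext => x0; apply/funext => y0.
pose N := `|x0| + `|y0| + 1.
have N0 : 0 < N by rewrite ltr_wpDl// addr_ge0.
have [E [r [cut E1]]] := cutoffs (ltW N0).
have cE := cut_cont cut; have sE := @cut_supp R E r cut; have r0 := cut_r cut; have E0 := cut_ge0 cut.
have cs : cont2 (translate e t f) by exact: cont2_sh.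
pose phi x y := E 0%N 0%N x y * (translate e t f x y - f x y).
have cphi : cont2 phi by rewrite /phi; prove_cont.
have sphi : bsupp r phi by move=> x y xy; rewrite /phi sE ?mul0r.
have tN0 : - t != 0 by rewrite oppr_eq0 gt_eqF.
pose psi := steklov e (- t) phi; pose g := diff_quot e (- t) phi.
have cpsi : cont2 psi by exact: cont2_Av.
have cg : cont2 g by exact: cont2_dq.
have dpsi : partial e psi g := Dd_Av e tN0 cphi.
pose b := r + t; have b0 : 0 <= b by rewrite addr_ge0// ltW.
have sg : bsupp b g.
  have := @bsupp_sh R e (- t) r phi sphi; rewrite normrN (gtr0_norm t0) -/b => ss x y xy.
  rewrite /g /diff_quot ss// sphi ?subrr ?mul0r//.
  by case: xy => h; [left|right]; apply: le_trans h; rewrite /b lerDl ltW.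
have spsi : bsupp b psi.
  move=> x y xy; rewrite /psi /steklov /steklov1 /steklov2.
  have out (z u : R) : 0 <= u <= 1 -> b <= `|z| -> r <= `|z + - t * u|.
    move=> /andP[u0 u1] bz; have := ler_normB (z + - t * u) (- t * u); rewrite addrK => h.
    have : `|- t * u| <= t by rewrite normrM normrN (gtr0_norm t0) (ger0_norm u0) ler_piMr// ltW.
    by move: bz h; rewrite /b; move: `|z| `|z + _| `|- t * u| => p q v; lra.
  have out0 (z : R) : b <= `|z| -> r <= `|z| by apply: le_trans; rewrite /b lerDl ltW.
  case: (e); rewrite (@eq_Sint _ _ _ _ (fun=> 0)) ?Sint_cst ?mul0r// => u u01; apply: sphi.
  - by case: xy => h; [left; exact: out|right; exact: out0].
  - by case: xy => h; [left; exact: out0|right; exact: out].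
pose N1 := b + 1 + t.
have N10 : 0 <= N1 by rewrite /N1 !addr_ge0// ltW.
have fg0 : Ibox N1 (fun x y => f x y * g x y) = 0.
  apply: small_cst.
  have h1 := small_dq_mul e cf cpsi N10 vf.
  have cAf s : cont2 (steklov e s f) by exact: cont2_Av.
  have bg : bddL1 (fun=> g).
    by move=> K K0; exact: bdd_cst.
  have h2 := small_diff N10 cf (fun=> cg) cAf bg (@unif_cvg_Av R e (fun=> f) f cf (fun=> cf) (@unif_cvg_cst R f)).
  apply: small_eq (smallN (smallD h1 h2)) _; near=> s.
  have s0 : 0 < s by near: s; exact: nbhs_right_gt.
  have s1 : s <= 1 by near: s; exact: nbhs_right_le.
  have bs : b + `|s| <= N1 by rewrite gtr0_norm// /N1; lra.
  rewrite (Ibox_dq_ibp (lt0r_neq0 s0) cf cpsi cg dpsi b0 spsi sg bs).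
  by rewrite addrA addNr add0r opprK.
have I0 : Ibox N1 (fun x y => E 0%N 0%N x y * (translate e t f x y - f x y) ^+ 2) = 0.
  have rN1 : r + `|t| <= N1 by rewrite gtr0_norm// /N1 /b; lra.
  have e1 := Ibox_sh_mul e cf cphi r0 sphi rN1.
  have csp : cont2 (translate e (- t) phi) by exact: cont2_sh.
  transitivity (Ibox N1 (fun x y => translate e t f x y * phi x y) - Ibox N1 (fun x y => f x y * phi x y)).
    rewrite -IboxB; [|by prove_cont|by prove_cont].
    by apply: eq_Ibox => x y _ _; rewrite /phi; ring.
  rewrite -e1 -IboxB; [|by prove_cont|by prove_cont].
  rewrite -[RHS](mulr0 (- t)) -fg0 -IboxZ; last by prove_cont.
  by apply: eq_Ibox => x y _ _; rewrite /g /diff_quot; field; rewrite gt_eqF.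
have cI : cont2 (fun x y => E 0%N 0%N x y * (translate e t f x y - f x y) ^+ 2) by prove_cont.
have xN : `|x0| <= N by rewrite /N -addrA lerDl addr_ge0.
have yN : `|y0| <= N by rewrite /N addrAC lerDr addr_ge0.
pose N2 := Num.max N1 N.
have N2N1 : N1 <= N2 by rewrite le_max lexx.
have N2N : N <= N2 by rewrite le_max lexx orbT.
have N20 : 0 < N2 by apply: lt_le_trans N2N.
have pos x y : 0 <= E 0%N 0%N x y * (translate e t f x y - f x y) ^+ 2 by rewrite mulr_ge0// sqr_ge0.
have rr : 0 <= r <= N1 by rewrite r0 /N1 /b; lra.
have rr2 : 0 <= r <= N2 by case/andP: rr => _ h; rewrite r0 (le_trans h).
have sI : bsupp r (fun x y => E 0%N 0%N x y * (translate e t f x y - f x y) ^+ 2) by move=> x y xy; rewrite sE ?mul0r.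
have I2 : Ibox N2 (fun x y => E 0%N 0%N x y * (translate e t f x y - f x y) ^+ 2) = 0.
  by rewrite (Ibox_supp cI rr2 sI) -(Ibox_supp cI rr sI).
have := Ibox_eq0 N20 cI pos I2 (le_trans xN N2N) (le_trans yN N2N).
by rewrite E1// mul1r => /eqP; rewrite sqrf_eq0 subr_eq0 => /eqP.
Unshelve. all: by end_near. Qed.

Lemma dq_vanish_cst f x y : cont2 f -> dq_vanish f -> f x y = f 0 0.
Proof.
move=> cf vf.
have h1 (a t b : R) : 0 < t -> f (a + t) b = f a b.
  by move=> t0; have := dq_vanish_shift true cf vf t0 => /(congr1 (fun g => g a b)); rewrite /translate addr0.
have h2 (a t b : R) : 0 < t -> f a (b + t) = f a b.
  by move=> t0; have := dq_vanish_shift false cf vf t0 => /(congr1 (fun g => g a b)); rewrite /translate addr0.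
have g1 (a a' b : R) : f a b = f a' b.
  have [aa|aa|->//] := ltgtP a a'.
    by rewrite -(@h1 a (a' - a) b) ?subr_gt0// subrKC.
  by rewrite -(@h1 a' (a - a') b) ?subr_gt0// subrKC.
have g2 (a b b' : R) : f a b = f a b'.
  have [aa|aa|->//] := ltgtP b b'.
    by rewrite -(@h2 a (b' - b) b) ?subr_gt0// subrKC.
  by rewrite -(@h2 a (b - b') b') ?subr_gt0// subrKC.
by rewrite (g1 x 0) (g2 0 y 0).
Qed.

Lemma cst_L2 (k B : R) : (forall N, 0 <= N -> Ibox N (fun _ _ => k ^+ 2) <= B) -> k = 0.
Proof.
move=> H; apply/eqP; rewrite -sqrf_eq0; apply/eqP/le_anti; rewrite sqr_ge0 andbT.
rewrite leNgt; apply/negP => k0.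
have B0 : 0 <= B by have := H 0 (lexx _); rewrite Ibox_cst// expr0n mulr0 mulr0.
(* As N >= 1, the hypothesis gives k^2 N <= 4 k^2 N^2 <= B, against k^2 N = B + k^2. *)
pose N := B / k ^+ 2 + 1.
have N1 : 1 <= N by rewrite lerDr divr_ge0// ltW.
have N0 : 0 <= N by apply: le_trans N1.
have := H N N0; rewrite Ibox_cst// => h.
have NN : N <= N ^+ 2 by rewrite expr2 ler_peMl.
have : k ^+ 2 * N <= B by apply: le_trans h; rewrite ler_pM2l//; lra.
have -> : k ^+ 2 * N = B + k ^+ 2 by rewrite /N; field; rewrite -sqrf_eq0 gt_eqF.
by rewrite gerDl leNgt k0.
Qed.

Lemma near3 (X Y Z W : R -> Prop) : (\forall s \near 0^'+, X s) -> (\forall s \near 0^'+, Y s) ->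
  (\forall s \near 0^'+, Z s) -> (forall s, X s -> Y s -> Z s -> W s) -> \forall s \near 0^'+, W s.
Proof.
move=> hX hY hZ XYZ; near=> s; apply: XYZ.
- by near: s; exact: hX.
- by near: s; exact: hY.
- by near: s; exact: hZ.
Unshelve. all: by end_near. Qed.

(** With t = d, annulus energy d^2 and m = B r (1 + L), all terms are multiples of d (1 + L), the
    factors adding up to at most 5 (1 + B). The two smallness conditions on d absorb half of L and
    bound the rest by k / 4. *)
Lemma absorb (A B d k r L : R) : let T := A * (1 + B) + 1 in let m := B * r * (1 + L) in
  0 <= A -> 0 < B -> 0 < d -> d <= 1 -> 1 <= r -> r^-1 <= d -> 5 * T * d <= 1 / 2 -> 5 * T * d <= k / 4 ->
  0 <= L -> 0 < k ->
  3 / 2 * L <= A * (r^-1 ^+ 2 * (1 + m) + r^-1 * m * (d ^+ 2 + d ^+ 2 / d + d)) + k / 4 -> L <= k.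
Proof.
move=> T m A0 B0 d0 d1 r1 rd dT2 dTk L0 k0 g1.
have rp : 0 < r by apply: lt_le_trans r1.
have fin (l h : R) : 0 <= l -> 0 < h -> 3 / 2 * l <= h / 4 + 1 / 2 * l + h / 4 -> l <= h by lra.
have dE : d ^+ 2 / d = d by rewrite expr2 mulfK ?gt_eqF.
have dd : d ^+ 2 <= d by rewrite expr2 ler_piMl// ltW.
have rm : r^-1 * m = B * (1 + L) by rewrite /m; field; rewrite gt_eqF.
have BL : 0 <= B * (1 + L) by rewrite mulr_ge0 ?addr_ge0// ltW.
have ri0 : 0 <= r^-1 by rewrite invr_ge0 ltW.
have ri1 : r^-1 <= 1 by apply: le_trans d1.
have X : r^-1 ^+ 2 * (1 + m) + r^-1 * m * (d ^+ 2 + d ^+ 2 / d + d) <= 5 * d * ((1 + B) * (1 + L)).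
  rewrite dE.
  have -> : r^-1 ^+ 2 * (1 + m) = r^-1 * (r^-1 + r^-1 * m) by ring.
  rewrite rm.
  have a1 : r^-1 * (r^-1 + B * (1 + L)) <= d * ((1 + L) + B * (1 + L)).
    apply: ler_pM => //; first by rewrite addr_ge0.
    by rewrite lerD2r (le_trans ri1)// lerDl.
  have a2 : B * (1 + L) * (d ^+ 2 + d + d) <= B * (1 + L) * (3 * d) by rewrite ler_wpM2l//; lra.
  apply: le_trans (lerD a1 a2) _; rewrite -subr_ge0.
  have -> : 5 * d * ((1 + B) * (1 + L)) - (d * ((1 + L) + B * (1 + L)) + B * (1 + L) * (3 * d)) = d * (4 * (1 + L) + B * (1 + L)) by ring.
  by rewrite mulr_ge0 ?(ltW d0)// addr_ge0// mulr_ge0// addr_ge0.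
have Y : A * (5 * d * ((1 + B) * (1 + L))) <= 5 * T * d * (1 + L).
  have -> : A * (5 * d * ((1 + B) * (1 + L))) = A * (1 + B) * (5 * d * (1 + L)) by ring.
  have -> : 5 * T * d * (1 + L) = T * (5 * d * (1 + L)) by ring.
  by rewrite ler_wpM2r ?lerDl// mulr_ge0 ?addr_ge0// mulr_ge0// ltW.
have Z : 5 * T * d * (1 + L) <= k / 4 + 1 / 2 * L.
  by rewrite mulrDr mulr1 lerD// ler_wpM2r.
exact: fin L0 k0 (le_trans g1 (lerD (le_trans (ler_wpM2l A0 X) (le_trans Y Z)) (lexx (k / 4)))).
Qed.

End rigidity.

(** * Choice of the radius and rigidity of the flow *)

Section liouville.
Context {R : realType}.
Variables (Ps P1 P2 P11 P12 P22 M : R -> R -> R) (m0 : R).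
Hypothesis FL : flow Ps P1 P2 P11 P12 P22 M m0.
Notation be := (off_strain P11 P22).
Notation Pd := (Pd P1 P2).
Variables (H : R -> R -> R) (K E0 : R).
Hypothesis EN : energy P11 P12 P22 M H K E0.

Let cP12 : cont2 P12. Proof. by case: FL. Qed.
Let cP11 : cont2 P11. Proof. by case: FL. Qed.
Let cP22 : cont2 P22. Proof. by case: FL. Qed.
Let cP1 : cont2 P1. Proof. by case: FL. Qed.
Let cP2 : cont2 P2. Proof. by case: FL. Qed.
Let cM : cont2 M. Proof. by case: FL. Qed.
Let cbe : cont2 be. Proof. exact: cont2_be FL. Qed.

Local Notation Lam r e s := (hessian_energy P11 P12 P22 M (cutE r) (2 * r) e s).

Lemma Lam_ge0 r e s : 0 <= Lam r e s.
Proof.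
apply: Ibox_ge0 => x y _ _; rewrite mulr_ge0 ?addr_ge0 ?sqr_ge0// mulr_ge0//; first by rewrite cutEZ sqr_ge0.
exact: M_ge0 FL x y.
Qed.

Lemma center e r : 1 <= r -> exists2 c, (forall m, (forall x y, cutZ r x y * `|Pd e x y| <= m) -> `|c| <= m) &
  Ibox (2 * r + 1) (fun x y => (Pd e x y - c) ^+ 2) <= (72 * E0 + 432 * (E0 + 1)) * r ^+ 2.
Proof.
move=> r1; have r0 : 0 < r by apply: lt_le_trans r1.
set N := 2 * r + 1; have N0 : 0 <= N by rewrite /N; lra.
have [_ _ _ _ _ _ _ _ _ d11 d12 d21 d22 _ _ _ _ _] := FL.
have d1 : D1 (Pd e) (Pdx P11 P12 e) by case: (e).
have d2 : D2 (Pd e) (Pdy P12 P22 e) by case: (e).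
have c0 := cont2_Pd FL e; have c1 := cont2_Pd1 FL e; have c2 := cont2_Pd2 FL e.
have rN : 0 < r <= N by apply/andP; split => //; rewrite /N; lra.
have [y' /andP[y0 yr] hp] := poincare rN d1 d2 c0 c1 c2.
(* The point (0, y') lies where [cutZ] equals 1, so any bound on [cutZ] times the velocity bounds
   the centre. *)
exists (Pd e 0 y') => [m hm|].
  have := hm 0 y'; rewrite cutZ_in ?mul1r// ?normr0 ?(ltW r0)//.
  by rewrite ger0_norm.
apply: le_trans hp _.
have sq x y := sq_le_H EN x y.
have b1 : Ibox N (fun x y => Pdx P11 P12 e x y ^+ 2) <= E0.
  by apply: (sqr_energy EN c1 N0) => x y; have [h1 h2 h3 _] := sq x y; case: (e).
have b2 : Ibox N (fun x y => Pdy P12 P22 e x y ^+ 2) <= E0.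
  by apply: (sqr_energy EN c2 N0) => x y; have [h1 h2 h3 _] := sq x y; case: (e).
have N3 : N <= 3 * r by rewrite /N; lra.
have n2 : 8 * N ^+ 2 <= 72 * r ^+ 2.
  have : N ^+ 2 <= (3 * r) ^+ 2 by rewrite ler_pXn2r// nnegrE; lra.
  by rewrite exprMn; lra.
have n3 : 16 * N ^+ 3 / r <= 432 * r ^+ 2.
  rewrite ler_pdivrMr// -mulrA -exprSr.
  have : N ^+ 3 <= (3 * r) ^+ 3 by rewrite ler_pXn2r// nnegrE; lra.
  by rewrite exprMn; lra.
have p1 : 0 <= 8 * N ^+ 2 by rewrite mulr_ge0// sqr_ge0.
have p2 : 0 <= 16 * N ^+ 3 / r by rewrite divr_ge0// ?mulr_ge0 ?exprn_ge0// ltW.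
have i1 : 0 <= Ibox N (fun x y => Pdx P11 P12 e x y ^+ 2) by apply: Ibox_ge0 => *; exact: sqr_ge0.
have i2 : 0 <= Ibox N (fun x y => Pdy P12 P22 e x y ^+ 2) by apply: Ibox_ge0 => *; exact: sqr_ge0.
have t1 := ler_pM p1 i2 n2 b2.
have b1' := b1; rewrite -(lerD2r 1) in b1'.
have t2 := ler_pM p2 (addr_ge0 i1 ler01) n3 b1'.
apply: le_trans (lerD t1 t2) _.
by rewrite le_eqVlt; apply/orP; left; apply/eqP; ring.
Qed.

(** The order of choices matters: A and B do not depend on the radius, so d is fixed first, then r
    with annulus energy at most d^2 and r^-1 <= d, and s last. The bound m depends on s through the
    unknown L itself. *)
Lemma Lam_small (k r0 : R) : 0 < k -> exists r, [/\ 1 <= r, r0 <= r &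
  \forall s \near 0^'+, Lam r true s + Lam r false s <= k].
Proof.
move=> k0.
have [C C1 HC] := @cut_bounds R.
have C0 : 0 <= C by apply: le_trans C1.
have E00 := E0_ge0 EN; have K0 := en_K EN.
have [_ _ _ _ _ _ _ _ _ d11 d12 d21 d22 _ _ _ _ _] := FL.
have sq x y := sq_le_H EN x y.
have [B1 B10 HB1] := sup_est FL EN (e := true) d11 d12 cP1 cP11 cP12
  (fun s s0 => let: conj _ (And3 h _ _) := D_smooth2 FL s0 in h)
  (fun x y => let: And4 h _ _ _ := sq x y in h) (fun x y => let: And4 _ h _ _ := sq x y in h).
have [B2 B20 HB2] := sup_est FL EN (e := false) d21 d22 cP2 cP12 cP22
  (fun s s0 => let: conj _ (And3 _ h _) := D_smooth2 FL s0 in h)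
  (fun x y => let: And4 _ h _ _ := sq x y in h) (fun x y => let: And4 _ _ h _ := sq x y in h).
pose B := B1 + B2; have B0 : 0 < B by rewrite addr_gt0.
pose Q := 72 * E0 + 432 * (E0 + 1); have Q0 : 0 <= Q by rewrite /Q; lra.
pose A := 64 * C ^+ 2 * E0 + 12 * C * E0 + 8 * C * (K * (E0 + 36) + E0) + C * (80 + 8 * Q).
have A0 : 0 <= A.
  have CE := mulr_ge0 C0 E00; have CCE := mulr_ge0 (sqr_ge0 C) E00.
  have CKE : 0 <= C * (K * (E0 + 36) + E0) by rewrite mulr_ge0// addr_ge0// mulr_ge0//; lra.
  have CQ : 0 <= C * (80 + 8 * Q) by rewrite mulr_ge0//; lra.
  by rewrite /A; lra.
pose T := A * (1 + B) + 1.
have T0 : 0 < T by rewrite ltr_wpDl// mulr_ge0//; lra.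
pose d := Num.min 1 (Num.min (1 / 2) (k / 4) / (5 * T)).
have mm0 : 0 < Num.min (1 / 2) (k / 4) by rewrite lt_min !divr_gt0.
have d0 : 0 < d by rewrite lt_min ltr01 divr_gt0// mulr_gt0.
have d1 : d <= 1 by rewrite ge_min lexx.
have dT : 5 * T * d <= Num.min (1 / 2) (k / 4).
  by rewrite mulrC -ler_pdivlMr ?mulr_gt0// ge_min lexx orbT.
have dT2 : 5 * T * d <= 1 / 2 by apply: le_trans dT _; rewrite ge_min lexx.
have dTk : 5 * T * d <= k / 4 by apply: le_trans dT _; rewrite ge_min lexx orbT.
have dd0 : 0 < d ^+ 2 by rewrite exprn_gt0.
have [r [r1 rr0 ha]] := small_annulus FL EN (Num.max r0 d^-1) dd0.
have rp : 0 < r by apply: lt_le_trans r1.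
have rd : r^-1 <= d.
  by rewrite -[d]invrK lef_pV2 ?posrE ?invr_gt0// (le_trans _ rr0)// le_max lexx orbT.
exists r; split => //; first by apply: le_trans rr0; rewrite le_max lexx.
have [HCr _ _ _] := HC r rp.
have [ca hca hqa] := center true r1; have [cb hcb hqb] := center false r1.
pose c (e : bool) := if e then ca else cb.
pose G (x y : R) := 2 * C ^+ 2 * r^-1 ^+ 2.
have cG : cont2 G by rewrite /G; prove_cont.
have r2 : 0 <= r^-1 ^+ 2 by rewrite exprn_ge0// invr_ge0 ltW.
have G0 x y : 0 <= G x y by rewrite /G mulr_ge0// mulr_ge0// sqr_ge0.
have HG x y : cutE r 1 0 x y ^+ 2 + cutE r 0 1 x y ^+ 2 <= G x y * cutE r 0 0 x y.
  have h i j : `|cutE r i j x y| <= C * r^-1 ^+ (i + j) * cutZ r x y := HCr i j x y.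
  have sqb (u v : R) : `|u| <= v -> u ^+ 2 <= v ^+ 2.
    by move=> uv; rewrite -real_normK ?num_real// lerXn2r// ?nnegrE// (le_trans _ uv).
  have h1 := sqb _ _ (h 1 0); have h2 := sqb _ _ (h 0 1).
  apply: le_trans (lerD h1 h2) _.
  by rewrite /G cutEZ !addn0 !add0n expr1 le_eqVlt; apply/orP; left; apply/eqP; ring.
have lim := limit_ineq FL (@cutoffs R) (cutE_cutoff r1) c cG G0 HG.
have k4 : 0 < k / 4 by rewrite divr_gt0.
have {}lim := lim _ k4; have {}HB1 := HB1 r r1; have {}HB2 := HB2 r r1.
apply: near3 lim HB1 HB2 _ => s g1 g2 g3.
have L1 := Lam_ge0 r true s; have L2 := Lam_ge0 r false s.
set L := Lam r true s + Lam r false s in g1 *.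
have L0 : 0 <= L := addr_ge0 L1 L2.
pose m := B * r * (1 + L).
have m_ge0 : 0 <= m := mulr_ge0 (mulr_ge0 (ltW B0) (ltW rp)) (addr_ge0 ler01 L0).
have hm e x y : cutZ r x y * `|Pd e x y| <= m.
  have le (b l : R) : 0 <= b <= B -> 0 <= l <= L -> b * r * (1 + l) <= m.
    move=> /andP[b0 bB] /andP[l0 lL]; rewrite /m.
    apply: ler_pM; [by rewrite mulr_ge0// ltW|by rewrite addr_ge0| |by rewrite lerD2l].
    by rewrite ler_wpM2r// ltW.
  case: e; [apply: le_trans (g2 x y) _|apply: le_trans (g3 x y) _]; apply: le.
  - by rewrite (ltW B10)/= /B lerDl ltW.
  - by rewrite L1/= /L (lerDl (Lam r true s)) L2.
  - by rewrite (ltW B20)/= /B lerDr ltW.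
  - by rewrite L2/= /L (lerDr (Lam r false s)) L1.
have hc e : `|c e| <= m.
  by case: e; [apply: hca => x y; exact: (hm true)|apply: hcb => x y; exact: (hm false)].
have NN : 2 * r <= 2 * r + 1 by rewrite lerDl.
have hQ e : Ibox (2 * r + 1) (fun x y => (Pd e x y - c e) ^+ 2) <= Q * r ^+ 2 by case: e.
have := rest_est FL EN C1 r1 m_ge0 d0 HCr hm hc (ha _ NN) hQ Q0.
rewrite -/A -/G => hrest.
have {}g1 := le_trans g1 (lerD hrest (lexx (k / 4))).
exact: absorb A0 B0 d0 d1 r1 rd dT2 dTk L0 k0 g1.
Qed.

Lemma vanish : dq_vanish P12 /\ dq_vanish be.
Proof.
have m00 := fl_m0 FL.
suff X e N k : 0 <= N -> 0 < k -> \forall s \near 0^'+, Ibox N (fun x y => diff_quot e s P12 x y ^+ 2 + diff_quot e s be x y ^+ 2) <= k.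
  split=> e N k N0 k0; have h := X e N k N0 k0; near=> s.
  - have g : Ibox N (fun x y => diff_quot e s P12 x y ^+ 2 + diff_quot e s be x y ^+ 2) <= k by near: s; exact: h.
    by apply: le_trans g; apply: le_Ibox; [by prove_cont|by prove_cont|] => x y _ _; rewrite lerDl sqr_ge0.
  - have g : Ibox N (fun x y => diff_quot e s P12 x y ^+ 2 + diff_quot e s be x y ^+ 2) <= k by near: s; exact: h.
    by apply: le_trans g; apply: le_Ibox; [by prove_cont|by prove_cont|] => x y _ _; rewrite lerDr sqr_ge0.
move=> N0 k0; have km : 0 < m0 * k by rewrite mulr_gt0.
have [r [r1 Nr h]] := Lam_small N km; have r0 : 0 < r by apply: lt_le_trans r1.
have Nr2 : 0 <= N <= 2 * r + 1 by apply/andP; split => //; lra.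
near=> s.
have g : Lam r true s + Lam r false s <= m0 * k by near: s; exact: h.
have ge : Lam r e s <= m0 * k.
  by have := Lam_ge0 r true s; have := Lam_ge0 r false s; move: g; case: (e); move: (Lam r true s) (Lam r false s) => a b; lra.
rewrite -(ler_pM2l m00); apply: le_trans ge.
have cE := @cutE_cont R r 0 0.
have cd1 : cont2 (diff_quot e s P12) by prove_cont.
have cd2 : cont2 (diff_quot e s be) by prove_cont.
have cL : cont2 (fun x y => cutE r 0 0 x y * M x y * (diff_quot e s P12 x y ^+ 2 + diff_quot e s be x y ^+ 2)) by prove_cont.
rewrite /hessian_energy; apply: (@le_trans _ _ (Ibox N (fun x y => cutE r 0 0 x y * M x y * (diff_quot e s P12 x y ^+ 2 + diff_quot e s be x y ^+ 2)))).
  rewrite -IboxZ; last by prove_cont.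
  apply: le_Ibox; [by prove_cont|by prove_cont|] => x y xN yN.
  rewrite cutEZ cutZ_in ?(le_trans _ Nr)// expr1n mul1r ler_wpM2r ?addr_ge0 ?sqr_ge0//.
  exact: fl_M FL x y.
apply: Ibox_le_dom; [exact: cL|exact: Nr2|].
move=> x y; rewrite mulr_ge0 ?addr_ge0 ?sqr_ge0// mulr_ge0 ?(M_ge0 FL)//; by rewrite cutEZ sqr_ge0.
Unshelve. all: by end_near. Qed.

Theorem liouville x y : P1 x y = P1 0 0 /\ P2 x y = P2 0 0.
Proof.
have [v1 v2] := vanish.
have [_ _ _ _ _ _ _ _ _ d11 d12 d21 d22 _ _ _ _ _] := FL.
have sq x' y' := sq_le_H EN x' y'.
have z (f : R -> R -> R) : cont2 f -> (forall x y, f x y = f 0 0) -> (forall x y, f x y ^+ 2 <= H x y) -> forall x y, f x y = 0.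
  move=> cf fc fH x' y'; rewrite fc; apply: (@cst_L2 R _ E0) => N N0.
  apply: le_trans (sqr_energy EN cf N0 fH).
  by rewrite le_eqVlt; apply/orP; left; apply/eqP; apply: eq_Ibox => a b _ _; rewrite (fc a b).
have z12 : forall x y, P12 x y = 0.
  by apply: z => // [a b|a b]; [exact: dq_vanish_cst|have [] := sq a b].
have zbe : forall x y, be x y = 0.
  by apply: z => // [a b|a b]; [exact: dq_vanish_cst|have [] := sq a b].
have e22 a b : P22 a b = P11 a b.
  have := zbe a b; rewrite /off_strain => /eqP; rewrite mulf_eq0 invr_eq0 pnatr_eq0 orbF subr_eq0 => /eqP//.
have cst (f f' : R -> R) : der f f' -> (forall x, f' x = 0) -> forall a, f a = f 0.
  move=> df f0 a; apply: is_derive_0_is_cst => t; have := df t; by rewrite f0.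
(* As P12 vanishes, P1 depends on x alone and P2 on y alone; then P11 = P22 depends on neither
   variable, and square integrability makes it zero. *)
have p1y a b : P1 a b = P1 a 0 by exact: (cst _ _ (d12 a) (z12 a)).
have p2x a b : P2 a b = P2 0 b by exact: (cst _ _ (d21 b) (fun a => z12 a b)).
have uniq (f f' g' : R -> R) a : der f f' -> der f g' -> f' a = g' a.
  move=> df dg; have h1 := df a; have h2 := dg a.
  by rewrite -(@derive_val _ _ _ _ _ _ _ h1) (@derive_val _ _ _ _ _ _ _ h2).
have p11 a b : P11 a b = P11 a 0.
  have h0 := d11 0; have hb := d11 b.
  have E : (P1^~ b) = (P1^~ 0) by apply/funext => t; exact: p1y.
  rewrite E in hb; exact: (uniq _ _ _ a hb h0).
have p22 a b : P22 a b = P22 0 b.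
  have h0 := d22 0; have ha := d22 a.
  have E : P2 a = P2 0 by apply/funext => t; exact: p2x.
  rewrite E in ha; exact: (uniq _ _ _ b ha h0).
have z11 : forall x y, P11 x y = 0.
  apply: z => // [a b|a b]; last by have [] := sq a b.
  by rewrite p11 -e22 p22 e22.
split.
- by rewrite p1y; exact: (cst _ _ (d11 0) (fun a => z11 a 0)).
- by rewrite p2x; apply: (cst _ _ (d22 0)) => a; rewrite e22.
Qed.

End liouville.

(** * The potential *)

Section half_line.
Context {R : realType}.
Implicit Types f : R -> R.

Lemma is_derive_dist f (x l : R) :
  (forall k, 0 < k -> exists2 d, 0 < d & forall s, `|s - x| < d ->
     `|f s - f x - l * (s - x)| <= k * `|s - x|) -> is_derive x 1 f l.
Proof.
move=> H.
have C : h^-1 *: (f (h *: (1 : R) + x) - f x) @[h --> 0^'] --> l.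
  apply/cvgrPdist_le => k k0; have [d d0 Hd] := H _ k0.
  apply/nbhs_ballP; exists d => //= z /=; rewrite /ball/= sub0r normrN => zd z0.
  have := Hd (z + x); rewrite addrK => /(_ zd) b.
  rewrite /GRing.scale/= mulr1 -[leRHS](mulfK (_ : `|z| != 0)) ?normr_eq0//.
  rewrite ler_pdivlMr ?normr_gt0// -normrM.
  by rewrite (_ : (_ - _) * z = - (f (z + x) - f x - l * z)) ?normrN//; field.
by split; [apply/cvg_ex; exists l|apply/cvg_lim].
Qed.

Lemma has_derivative_onP f (f' : R -> R) (t k : R) : @has_derivative_on R `[0, +oo[ f f' ->
  0 <= t -> 0 < k -> exists2 d, 0 < d & forall s, 0 <= s -> `|s - t| < d ->
     `|f s - f t - f' t * (s - t)| <= k * `|s - t|.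
Proof.
move=> H t0 k0; have /= := H t; rewrite in_itv/= t0 => /(_ isT).
move=> /cvgrPdist_le/(_ _ k0)/nbhs_ballP[d /= d0 Hd]; exists d => // s s0 sd.
have [->|st] := eqVneq s t; first by rewrite !subrr mulr0 subrr normr0 mulr0.
have b : ball t d s by rewrite /ball/= distrC.
have := Hd s b st; rewrite in_itv/= s0 => /(_ isT); rewrite distrC => e.
have z0 : `|s - t| != 0 by rewrite normr_eq0 subr_eq0.
rewrite -ler_pdivrMr ?normr_gt0 ?subr_eq0// -normfV -normrM.
rewrite (_ : _ / _ = (f s - f t) / (s - t) - f' t)//; field.
by rewrite subr_eq0.
Qed.

Lemma near_same_sign (x s : R) : x != 0 -> `|s - x| < `|x| ->
  Num.sg s = Num.sg x /\ `|s| - `|x| = Num.sg x * (s - x).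
Proof.
move=> x0; have [xp|xn|xe] := ltrgt0P x; last by rewrite xe eqxx in x0.
  rewrite ltr_norml => /andP[h1 h2].
  have sp : 0 < s by lra.
  by rewrite !gtr0_sg// gtr0_norm//; split => //; ring.
rewrite ltr_norml => /andP[h1 h2].
have sp : s < 0 by lra.
by rewrite !ltr0_sg// ltr0_norm//; split => //; ring.
Qed.

Lemma sg_sqr (x : R) : x != 0 -> Num.sg x * Num.sg x = 1.
Proof. by move=> x0; rewrite -expr2 sqr_sg x0. Qed.

(** The even extension replaces the half-line by the whole line; the one-sided derivatives at 0
    match because [f' 0 = 0]. *)
Lemma der_even f (f' : R -> R) : @has_derivative_on R `[0, +oo[ f f' -> f' 0 = 0 ->
  der (fun t : R => f `|t|) (fun t => Num.sg t * f' `|t|).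
Proof.
move=> H f0 x; apply: is_derive_dist => k k0.
have [d d0 Hd] := has_derivative_onP H (normr_ge0 x) k0.
have [x0|x0] := eqVneq x 0.
  exists d => // s; move: Hd; rewrite x0 normr0 sgr0 f0 => Hd; rewrite !subr0 !mul0r subr0 => sd.
  by have := Hd `|s| (normr_ge0 s); rewrite !subr0 normr_id mul0r subr0; apply.
have xp : 0 < `|x| by rewrite normr_gt0.
exists (Num.min d `|x|); first by rewrite lt_min d0.
move=> s; rewrite lt_min => /andP[sd sx].
have [e1 e2] := near_same_sign x0 sx.
have n1 : `|Num.sg x| = 1 by rewrite normr_sg x0.
have := Hd `|s| (normr_ge0 s); rewrite e2 normrM n1 mul1r => /(_ sd).
by rewrite (_ : f' `|x| * _ = Num.sg x * f' `|x| * (s - x))//; ring.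
Qed.

(** Meant for h', whose odd extension is the flux t m(t); the condition [f 0 = 0] makes the
    extension continuous at 0 and its slopes there agree. *)
Lemma der_odd f (f' : R -> R) : @has_derivative_on R `[0, +oo[ f f' -> f 0 = 0 ->
  der (fun t : R => Num.sg t * f `|t|) (fun t => f' `|t|).
Proof.
move=> H f0 x; apply: is_derive_dist => k k0.
have [d d0 Hd] := has_derivative_onP H (normr_ge0 x) k0.
have [x0|x0] := eqVneq x 0.
  exists d => // s; move: Hd; rewrite x0 normr0 sgr0 mul0r f0 => Hd; rewrite !subr0 => sd.
  have [->|s0] := eqVneq s 0; first by rewrite sgr0 !(mul0r, mulr0) subr0 normr0 mulr0.
  have := Hd `|s| (normr_ge0 s); rewrite !subr0 normr_id => /(_ sd).
  rewrite -[leLHS]mul1r -(_ : `|Num.sg s| = 1); last by rewrite normr_sg s0.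
  rewrite -normrM mulrBr [f' 0 * `|s|]mulrC mulrA -numEsg.
  by rewrite [s * f' 0]mulrC.
have xp : 0 < `|x| by rewrite normr_gt0.
exists (Num.min d `|x|); first by rewrite lt_min d0.
move=> s; rewrite lt_min => /andP[sd sx].
have [e1 e2] := near_same_sign x0 sx.
have n1 : `|Num.sg x| = 1 by rewrite normr_sg x0.
have := Hd `|s| (normr_ge0 s); rewrite e2 normrM n1 mul1r => /(_ sd).
rewrite -[`|f `|s| - _ - _|]mul1r -{1}n1 -normrM e1.
rewrite (_ : Num.sg x * (f `|s| - f `|x| - f' `|x| * (Num.sg x * (s - x))) =
  Num.sg x * f `|s| - Num.sg x * f `|x| - (Num.sg x * Num.sg x) * f' `|x| * (s - x)); last by ring.
by rewrite sg_sqr// mul1r.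
Qed.

Lemma continuous_even f : {within `[(0 : R), +oo[, continuous f} -> continuous (fun t : R => f `|t|).
Proof.
move=> /subspace_continuousP cf x; apply/cvgrPdist_le => k k0.
have := cf `|x|; rewrite /= in_itv/= normr_ge0 => /(_ isT)/cvgrPdist_le/(_ _ k0).
move=> /nbhs_ballP[d /= d0 Hd]; apply/nbhs_ballP; exists d => //= s.
rewrite /ball/= => sd; apply: Hd; last by rewrite /= in_itv/= normr_ge0.
by rewrite /ball/=; apply: le_lt_trans sd; exact: ler_dist_dist.
Qed.

End half_line.

(** The form in which (A1)-(A3) are used. Here g is the even extension of h, t m(t) its derivative
    and w the derivative of that flux; [gr_mono] stems from (A3), and [gr_a], that is t g'(t) <= a
    g(t), from doubling. *)
Record growth (R : realType) (g m w : R -> R) (m0 a : R) : Prop := Growth {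
  gr_g : der g (fun t => t * m t);
  gr_F : der (fun t => t * m t) w;
  gr_cm : continuous m;
  gr_cw : continuous w;
  gr_gn : forall t, g `|t| = g t;
  gr_mn : forall t, m `|t| = m t;
  gr_mono : forall s t, 0 <= s <= t -> m s <= m t;
  gr_m0 : 0 < m0;
  gr_m0_le : forall t, m0 <= m t;
  gr_quad : forall t, m0 / 2 * t ^+ 2 <= g t;
  gr_a0 : 0 <= a;
  gr_a : forall t, t ^+ 2 * m t <= a * g t }.

Section potential_growth.
Context {R : realType}.
Variables (h h' h'' : R -> R).
Hypotheses (h_ge0 : forall t, 0 <= t -> 0 <= h t) (hC2 : C2_halfline h h' h'')
  (hA1 : condA1 h h'') (hA2 : condA2 h) (hA3 : condA3 h' h'').

Let dh : @has_derivative_on R `[0, +oo[ h h'. Proof. by case: hC2. Qed.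
Let dh' : @has_derivative_on R `[0, +oo[ h' h''. Proof. by case: hC2. Qed.

Lemma potential_small k : 0 < k -> exists2 d, 0 < d & forall t, 0 < t < d -> `|h t| <= k * t.
Proof.
move=> k0; case: hA1 => _ _ _ /cvgrPdist_le/(_ _ k0)/nbhs_ballP[d /= d0 Hd].
exists d => // t /andP[t0 td].
have := Hd t; rewrite /ball/= sub0r normrN gtr0_norm// td => /(_ isT t0).
by rewrite sub0r normrN normrM normfV [`|t|]gtr0_norm// ler_pdivrMr.
Qed.

(** Comparing the expansion h(t) = h(0) + h'(0) t + o(t) with h(t) = o(t) kills both
    coefficients. *)
Lemma potential_vanish : h 0 = 0 /\ h' 0 = 0.
Proof.
have E k : 0 < k -> exists2 d, 0 < d & forall t, 0 < t < d ->
    `|h t| <= k * t /\ `|h t - h 0 - h' 0 * t| <= k * t.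
  move=> k0; have [d1 d10 H1] := potential_small k0.
  have [d2 d20 H2] := has_derivative_onP dh (lexx 0) k0.
  exists (Num.min d1 d2); first by rewrite lt_min d10.
  move=> t; rewrite lt_min => /andP[t0 /andP[t1 t2]].
  split; first by apply: H1; rewrite t0.
  by have := H2 t (ltW t0); rewrite !subr0 gtr0_norm//; apply.
have h0 : h 0 = 0.
  apply/eqP; rewrite eq_le; apply/andP; split; last exact: h_ge0.
  have [d d0 H] := E 1 ltr01.
  apply/ler_addgt0Pr => e e0; rewrite add0r.
  (* Both errors are at most t, so h(0) <= t (2 + |h'(0)|) for small t; t is then chosen to make
     this at most e. *)
  pose c := 2 + `|h' 0|; have c0 : 0 < c by rewrite /c; have := normr_ge0 (h' 0); lra.
  pose t := Num.min (d / 2) (e / c).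
  have t0 : 0 < t by rewrite lt_min !divr_gt0.
  have td : t < d by rewrite gt_min ltr_pdivrMr// ltr_pMr// ltr1n.
  have te : t * c <= e by rewrite -ler_pdivlMr// ge_min lexx orbT.
  have [] := H t; first by rewrite t0.
  rewrite !ler_norml => /andP[_ h1] /andP[h2 h3].
  have h4 : - (`|h' 0| * t) <= h' 0 * t.
    rewrite -mulNr; apply: ler_wpM2r; first exact: ltW.
    by rewrite lerNl -normrN ler_norm.
  have h5 : h 0 <= t * c by rewrite /c mulrDr [t * `|_|]mulrC; lra.
  exact: le_trans te.
split=> //; apply/eqP; rewrite -normr_le0; apply/ler_addgt0Pr => e e0; rewrite add0r.
have e2 : 0 < e / 2 by lra.
have [d d0 H] := E _ e2.
have t0 : 0 < d / 2 by lra.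
have [] := H (d / 2); first by rewrite t0; lra.
rewrite h0 subr0 => h1; rewrite distrC => h2.
have := ler_normD (h' 0 * (d / 2) - h (d / 2)) (h (d / 2)); rewrite subrK.
rewrite normrM [`|d / 2|]gtr0_norm// => h3.
by rewrite -(ler_pM2r t0); lra.
Qed.

Notation g := (fun t : R => h `|t|).
Notation m := (fun t : R => mu h' h'' `|t|).
Notation w := (fun t : R => h'' `|t|).

Lemma fluxE (t : R) : Num.sg t * h' `|t| = t * m t.
Proof.
rewrite /mu normr_eq0; have [->|t0] := eqVneq t 0; first by rewrite sgr0 !mul0r.
transitivity (Num.sg t * `|t| * (h' `|t| / `|t|)); last by rewrite -numEsg.
by field; rewrite normr_eq0.
Qed.

Lemma flux_der : der (fun t : R => t * m t) w.
Proof.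
rewrite (_ : (fun t : R => t * m t) = (fun t => Num.sg t * h' `|t|)).
  by apply: der_odd => //; case: potential_vanish.
by apply/funext => t; rewrite fluxE.
Qed.

Lemma potential_der : der g (fun t => t * m t).
Proof.
rewrite (_ : (fun t : R => t * m t) = (fun t => Num.sg t * h' `|t|)).
  by apply: der_even => //; case: potential_vanish.
by apply/funext => t; rewrite fluxE.
Qed.

(** At 0 the viscosity is the limit of the difference quotients of the flux, whose derivative there
    is h''(0); elsewhere it is a quotient of continuous functions. *)
Lemma mu_continuous : continuous m.
Proof.
move=> x; have [->|x0] := eqVneq x 0.
  apply/continuous_withinNx.
  have [D DE] := flux_der 0.
  have -> : m 0 = 'D_1 (fun t : R => t * m t) 0 by rewrite DE /mu normr0 eqxx.
  apply: cvg_trans D; apply: near_eq_cvg; near=> s.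
  have s0 : s != 0 by near: s; exact: nbhs_dnbhs_neq.
  by rewrite /GRing.scale/= mulr1 addr0 mul0r subr0 mulrA mulVf ?mul1r.
have cF := @der_cont R _ _ flux_der x.
have : (fun t : R => t^-1 * (t * m t)) @ x --> x^-1 * (x * m x).
  apply: cvgM; last exact: cF.
  by apply: (@cvgV _ _ _ _ (fun t : R => t)) => //; exact: cvg_id.
rewrite mulrA mulVf// mul1r => C; apply: (cvg_trans _ C); apply: near_eq_cvg; near=> t.
have t0 : t != 0 by near: t; apply: (@cvgr_neq0 _ _ _ _ _ (fun t : R => t) x) => //; exact: cvg_id.
by rewrite mulrA mulVf// mul1r.
Unshelve. all: by end_near. Qed.

(** Away from 0 the derivative of m is (w - m) / t, nonnegative by (A3); the value at 0 is reached
    by continuity. *)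
Lemma mu_nondecreasing (s t : R) : 0 <= s <= t -> m s <= m t.
Proof.
have pos (x y : R) : 0 < x -> x <= y -> m x <= m y.
  move=> x0 xy; rewrite -subr_ge0.
  have D (c : R) : 0 < c -> is_derive c (1 : R) m ((w c - m c) / c).
    move=> c0; have := is_deriveM (@is_deriveV R id c 1 1 (lt0r_neq0 c0) (is_derive_id c (1 : R))) (flux_der c).
    rewrite /GRing.scale/= !mulr1 => Dc.
    have -> : (w c - m c) / c = c^-1 * w c + c * m c * - c ^- 2 by field; exact: lt0r_neq0.
    apply: near_eq_is_derive Dc.
    near=> z; change (z^-1 * (z * m z) = m z); rewrite mulrA mulVf ?mul1r//.
    near: z; apply: (@cvgr_neq0 _ _ _ _ _ (fun t : R => t) c); last exact: lt0r_neq0.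
    exact: cvg_id.
  have [||c ci ->] := @MVT_segment R m (fun c => (w c - m c) / c) x y xy.
  - move=> c; rewrite in_itv/= => /andP[xc _]; apply: D; exact: lt_trans xc.
  - by apply: continuous_subspaceT; exact: mu_continuous.
  - move: ci; rewrite in_itv/= => /andP[xc _]; have c0 : 0 < c := lt_le_trans x0 xc.
    rewrite mulr_ge0 ?subr_ge0// mulr_ge0 ?invr_ge0 ?(ltW c0)// subr_ge0.
    by apply: hA3; exact: normr_ge0.
move=> /andP[]; rewrite le_eqVlt => /predU1P[<-|]; last exact: pos.
rewrite le_eqVlt => /predU1P[<-//|t0].
have C : m x @[x --> 0^'+] --> m 0 by apply: cvg_at_right_filter; exact: mu_continuous.
rewrite -(cvg_lim (@Rhausdorff R) C); apply: limr_le; first by apply/cvg_ex; exists (m 0).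
near=> x; apply: pos; near: x; first exact: nbhs_right_gt.
exact: nbhs_right_le.
Unshelve. all: by end_near. Qed.

Lemma potential_gt0_growth : exists a, growth g m w (h'' 0) a.
Proof.
(* The sign of the doubling constant is not given, whence the maximum with 0. *)
case: (hA1) => _ _ w0 _; case: hA2 => a Ha; exists (Num.max a 0).
have m00 : m 0 = h'' 0 by rewrite /mu normr0 eqxx.
have mN t : m `|t| = m t by rewrite normr_id.
have gN t : g `|t| = g t by rewrite normr_id.
have m0 t : h'' 0 <= m t.
  by rewrite -m00 -(mN t); apply: mu_nondecreasing; rewrite lexx normr_ge0.
have cw : continuous w by apply: continuous_even; case: hC2.
split => //; [exact: potential_der|exact: flux_der|exact: mu_continuous| | | |].
- exact: mu_nondecreasing.
- move=> t; rewrite -(gN t) -(real_normK (num_real t)); move: (normr_ge0 t).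
  move: `|t| => {}t t0.
  have D : der (fun s : R => g s - h'' 0 / 2 * s ^+ 2) (fun s => s * m s - h'' 0 * s).
    have dg := potential_der.
    by prove_der; field.
  have [h0 _] := potential_vanish.
  have := der_nondecreasing t0 D; rewrite /= normr0 h0 expr0n/= mulr0 subr0 subr_ge0.
  apply=> s /andP[s0 _]; rewrite [h'' 0 * s]mulrC -mulrBr mulr_ge0// subr_ge0.
  exact: m0.
- by rewrite le_max lexx orbT.
- move=> t; rewrite -(gN t) -(mN t) -(real_normK (num_real t)); move: (normr_ge0 t).
  move: `|t| => {}t t0.
  have t2 : t <= 2 * t by lra.
  have D : der (fun s : R => g s - s * (t * m t)) (fun s => s * m s - t * m t).
    have dg := potential_der.
    by prove_der; field.
  (* The flux is nondecreasing because w >= m >= h''(0) > 0. Hence g(2 t) - g(t) >= t (t m(t)), and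
     doubling bounds g(2 t) by a multiple of g(t). *)
  have dF : forall s, t <= s -> t * m t <= s * m s.
    move=> s ts; apply: (der_nondecreasing ts flux_der) => x /andP[tx _].
    have x0 : 0 <= x by exact: le_trans tx.
    apply: le_trans (ltW w0) (le_trans (m0 x) _).
    by apply: hA3; exact: normr_ge0.
  have H : g t - t * (t * m t) <= g (2 * t) - 2 * t * (t * m t).
    by apply: (der_nondecreasing t2 D) => x /andP[tx _]; rewrite subr_ge0 dF.
  have gt0 : 0 <= g t by apply: h_ge0; exact: normr_ge0.
  have := Ha `|t| (normr_ge0 _).
  have -> : h (2 * `|t|) = g (2 * t) by rewrite normrM ger0_norm// ler0n.
  have : a * g t <= Num.max a 0 * g t by apply: ler_wpM2r => //; rewrite le_max lexx.
  have -> : t ^+ 2 * m t = t * (t * m t) by ring.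
  move=> /= h1 h2; lra.
Qed.

End potential_growth.

(** * Monotonicity and Lipschitz bounds of the stress law *)

Section monotone_law.
Context {R : realType}.
Variables (g m w : R -> R) (m0 a : R).
Hypothesis G : growth g m w m0 a.
Implicit Types A B p q t s : R.

(* The difference of the two sides is (m q - m p) (q^2 - p^2) / 4. *)
Lemma law_monotone p q A B A' B' : 0 <= p -> 0 <= q ->
  p ^+ 2 = 2 * (A ^+ 2 + B ^+ 2) -> q ^+ 2 = 2 * (A' ^+ 2 + B' ^+ 2) ->
  (m p + m q) / 2 * ((A' - A) ^+ 2 + (B' - B) ^+ 2) <=
  (m q * A' - m p * A) * (A' - A) + (m q * B' - m p * B) * (B' - B).
Proof.
move=> p0 q0 pE qE.
have : 0 <= (m q - m p) * (q ^+ 2 - p ^+ 2).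
  have [pq|/ltW qp] := leP p q.
    by rewrite mulr_ge0// subr_ge0 ?(gr_mono G) ?p0// ler_pXn2r.
  by rewrite mulr_le0// subr_le0 ?(gr_mono G) ?q0// ler_pXn2r.
rewrite pE qE; set x := m p; set y := m q; move=> h.
have -> : (y * A' - x * A) * (A' - A) + (y * B' - x * B) * (B' - B) =
  (x + y) / 2 * ((A' - A) ^+ 2 + (B' - B) ^+ 2) +
  (y - x) * (2 * (A' ^+ 2 + B' ^+ 2) - 2 * (A ^+ 2 + B ^+ 2)) / 4 by field.
by rewrite lerDl divr_ge0.
Qed.

Lemma le_sqr_norm A p : 0 <= p -> A ^+ 2 <= p ^+ 2 -> `|A| <= p.
Proof. by move=> p0 h; rewrite -(ler_pXn2r (ltn0Sn 1)) ?nnegrE// real_normK// num_real. Qed.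

Lemma norm_triangle p q A B A' B' : 0 <= p -> 0 <= q ->
  p ^+ 2 = 2 * (A ^+ 2 + B ^+ 2) -> q ^+ 2 = 2 * (A' ^+ 2 + B' ^+ 2) ->
  q <= p + 2 * (`|A' - A| + `|B' - B|).
Proof.
move=> p0 q0 pE qE.
have Ap : `|A| <= p by apply: le_sqr_norm => //; have := sqr_ge0 A; have := sqr_ge0 B; lra.
have Bp : `|B| <= p by apply: le_sqr_norm => //; have := sqr_ge0 A; have := sqr_ge0 B; lra.
set x := `|A' - A|; set y := `|B' - B|.
have x0 : 0 <= x := normr_ge0 _; have y0 : 0 <= y := normr_ge0 _.
rewrite -(ler_pXn2r (ltn0Sn 1)) ?nnegrE//; last by rewrite addr_ge0// mulr_ge0// addr_ge0.
have xE : x ^+ 2 = (A' - A) ^+ 2 by rewrite /x real_normK// num_real.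
have yE : y ^+ 2 = (B' - B) ^+ 2 by rewrite /y real_normK// num_real.
have h1 : A * (A' - A) <= p * x.
  by apply: le_trans (ler_norm _) _; rewrite normrM ler_wpM2r.
have h2 : B * (B' - B) <= p * y.
  by apply: le_trans (ler_norm _) _; rewrite normrM ler_wpM2r.
have h3 : 0 <= x * y by exact: mulr_ge0.
rewrite qE (_ : (p + _) ^+ 2 = p ^+ 2 + 4 * (p * x + p * y) + 4 * (x ^+ 2 + y ^+ 2) + 8 * (x * y)); last by ring.
rewrite pE xE yE.
rewrite (_ : A' ^+ 2 = A ^+ 2 + 2 * (A * (A' - A)) + (A' - A) ^+ 2); last by ring.
rewrite (_ : B' ^+ 2 = B ^+ 2 + 2 * (B * (B' - B)) + (B' - B) ^+ 2); last by ring.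
have := sqr_ge0 (A' - A); have := sqr_ge0 (B' - B); lra.
Qed.

(** Only the flux t m(t) comes with a continuous derivative, not m. The increment of m is multiplied
    by A with |A| <= p, and p (m q - m p) <= q m q - p m p <= W (q - p). *)
Lemma law_lipschitz_le r W p q A A' d : 0 <= p -> p <= q -> q <= r ->
  0 <= W -> (forall t, 0 <= t <= r -> w t <= W) -> `|A| <= p -> q <= p + 2 * d ->
  `|m q * A' - m p * A| <= m r * `|A' - A| + 2 * W * d.
Proof.
move=> p0 pq qr W0 HW Ap qd.
rewrite (_ : m q * A' - _ = m q * (A' - A) + (m q - m p) * A); last by ring.
have q0 : 0 <= q by exact: le_trans pq.
have mq0 : 0 <= m q by exact: le_trans (ltW (gr_m0 G)) (gr_m0_le G q).
have mpq : m p <= m q by apply: (gr_mono G); rewrite p0.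
apply: le_trans (ler_normD _ _) _; apply: lerD.
  by rewrite normrM ger0_norm// ler_wpM2r// (gr_mono G)// q0.
have h0 : 0 <= m q - m p by rewrite subr_ge0.
have -> : 2 * W * d = W * (2 * d) by ring.
have h : q * m q - p * m p <= W * (q - p).
  have dF := gr_F G.
  have D : der (fun t : R => W * t - t * m t) (fun t => W - w t) by prove_der; ring.
  have : W * p - p * m p <= W * q - q * m q.
    apply: (der_nondecreasing pq D) => x /andP[px xq].
    by rewrite subr_ge0 HW// (le_trans p0 px) (le_trans xq qr).
  move=> ?; lra.
rewrite normrM (ger0_norm h0).
apply: le_trans (ler_wpM2l h0 Ap) _.
apply: le_trans (_ : W * (q - p) <= _); last by apply: ler_wpM2l => //; lra.
apply: le_trans h.
have : 0 <= m q * (q - p) by apply: mulr_ge0 => //; lra.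
move=> h; rewrite (_ : q * m q - p * m p = (m q - m p) * p + m q * (q - p)); last by ring.
lra.
Qed.

Lemma law_lipschitz r : exists2 L : R, 0 < L & forall p q A B A' B',
  0 <= p <= r -> 0 <= q <= r ->
  p ^+ 2 = 2 * (A ^+ 2 + B ^+ 2) -> q ^+ 2 = 2 * (A' ^+ 2 + B' ^+ 2) ->
  `|m q * A' - m p * A| <= L * (`|A' - A| + `|B' - B|).
Proof.
have [W W0 HW] := @compact_cont_bounded R R `[0, r] w (@segment_compact _ _ _) (gr_cw G).
have mr0 : 0 < m r by exact: lt_le_trans (gr_m0 G) (gr_m0_le G r).
exists (m r + 2 * W); first by lra.
have HW' t : 0 <= t <= r -> w t <= W.
  by move=> tr; apply: le_trans (ler_norm _) (HW _ _); rewrite /= in_itv/=.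
have key p q A B A' B' : 0 <= p -> p <= q -> q <= r ->
    p ^+ 2 = 2 * (A ^+ 2 + B ^+ 2) -> q ^+ 2 = 2 * (A' ^+ 2 + B' ^+ 2) ->
    `|m q * A' - m p * A| <= (m r + 2 * W) * (`|A' - A| + `|B' - B|).
  move=> p0 pq qr pE qE.
  have Ap : `|A| <= p by apply: le_sqr_norm => //; have := sqr_ge0 A; have := sqr_ge0 B; lra.
  apply: le_trans (law_lipschitz_le _ p0 pq qr W0 HW' Ap (norm_triangle p0 (le_trans p0 pq) pE qE)) _.
  rewrite [leRHS]mulrDl lerD2r; apply: ler_wpM2l; first exact: ltW.
  by rewrite lerDl.
move=> p q A B A' B' /andP[p0 pr] /andP[q0 qr] pE qE.
have [pq|/ltW qp] := leP p q; first exact: key.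
by rewrite distrC [`|A' - A|]distrC [`|B' - B|]distrC; apply: key.
Qed.

(** The Euclidean norm of the strain, symmetric and trace-free, whence the factor 2. In [grad_norm],
    the norm of Du, the doubled term comes from the diagonal entries P12 and - P12. *)
Definition strain_norm (P11 P12 P22 : R -> R -> R) x y : R :=
  Num.sqrt (2 * (P12 x y ^+ 2 + off_strain P11 P22 x y ^+ 2)).
Definition grad_norm (P11 P12 P22 : R -> R -> R) x y : R :=
  Num.sqrt (P11 x y ^+ 2 + 2 * P12 x y ^+ 2 + P22 x y ^+ 2).

Section fields.
Variables (Ps P1 P2 P11 P12 P22 : R -> R -> R).
Hypotheses (c0 : cont2 Ps) (c1 : cont2 P1) (c2 : cont2 P2)
  (c11 : cont2 P11) (c12 : cont2 P12) (c22 : cont2 P22)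
  (d1 : D1 Ps P1) (d2 : D2 Ps P2) (d11 : D1 P1 P11) (d12 : D2 P1 P12)
  (d21 : D1 P2 P12) (d22 : D2 P2 P22).
Notation be := (off_strain P11 P22).
Notation sn := (strain_norm P11 P12 P22).
Notation gn := (grad_norm P11 P12 P22).
Notation M := (fun x y => m (sn x y)).

Lemma ct_sqrt (T : topologicalType) (f : T -> R) : continuous f ->
  continuous (fun x => Num.sqrt (f x)).
Proof. by move=> cf; exact: (ct_comp (@sqrt_continuous R) cf). Qed.

Lemma strain_norm_cont : cont2 sn.
Proof. by rewrite /strain_norm /off_strain; apply: Cont2 => /=; apply: ct_sqrt; prove_cont. Qed.

Lemma grad_norm_cont : cont2 gn.
Proof. by rewrite /grad_norm; apply: Cont2 => /=; apply: ct_sqrt; prove_cont. Qed.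

Lemma strain_normE x y : sn x y ^+ 2 = 2 * (P12 x y ^+ 2 + be x y ^+ 2).
Proof. by rewrite sqr_sqrtr// mulr_ge0// addr_ge0 ?sqr_ge0. Qed.

Lemma grad_sqr_ge0 x y : 0 <= P11 x y ^+ 2 + 2 * P12 x y ^+ 2 + P22 x y ^+ 2.
Proof.
by have := sqr_ge0 (P11 x y); have := sqr_ge0 (P12 x y); have := sqr_ge0 (P22 x y); lra.
Qed.

Lemma grad_normE x y : gn x y ^+ 2 = P11 x y ^+ 2 + 2 * P12 x y ^+ 2 + P22 x y ^+ 2.
Proof. by rewrite sqr_sqrtr// grad_sqr_ge0. Qed.

Lemma strain_norm_ge0 x y : 0 <= sn x y. Proof. exact: sqrtr_ge0. Qed.
Lemma grad_norm_ge0 x y : 0 <= gn x y. Proof. exact: sqrtr_ge0. Qed.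

Lemma viscosity_cont : cont2 M.
Proof.
have cm := gr_cm G; have cs := strain_norm_cont.
by apply: Cont2 => /=; apply: (ct_1 cm); exact: (cont2P cs).
Qed.

Lemma flow_of_growth :
  weak_eq (weak1 P1 P2 P12 M) (weak2 P1 P2 P11 P22 M) -> flow Ps P1 P2 P11 P12 P22 M m0.
Proof.
move=> we; have cM := viscosity_cont; split => //.
- exact: gr_m0 G.
- by move=> x y; exact: gr_m0_le G _.
- move=> x y x' y'; exact: (law_monotone (strain_norm_ge0 x y) (strain_norm_ge0 x' y')
    (strain_normE x y) (strain_normE x' y')).
- move=> r; have [C C0 HC] := cont2_bounded r strain_norm_cont.
  have [L L0 HL] := law_lipschitz C; exists L => // x y x' y' xr yr x'r y'r.
  have b1 : 0 <= sn x y <= C.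
    by rewrite strain_norm_ge0 (le_trans (ler_norm _) (HC _ _ xr yr)).
  have b2 : 0 <= sn x' y' <= C.
    by rewrite strain_norm_ge0 (le_trans (ler_norm _) (HC _ _ x'r y'r)).
  have e1 := strain_normE x y; have e2 := strain_normE x' y'.
  split; first exact: HL.
  rewrite [leRHS](_ : _ = L * (`|be x' y' - be x y| + `|P12 x' y' - P12 x y|)); last by rewrite addrC.
  by apply: HL => //; rewrite addrC.
Qed.

(** The constant 6 a serves [en_T], where |TA| + |TB| <= 2 m |Du| meets [sum_abs] <= 3 |Du|; 2 / m0
    serves [en_D] through the quadratic lower bound. For [en_T1], either the strain is at most 1 and
    the viscosity at most [m 1], or |Du| >= 1 and |Du| <= |Du|^2. *)
Lemma energy_of_growth E0 :
  (forall N, 0 <= N -> Ibox N (fun x y => (6 * a + 2 / m0) * g (gn x y)) <= E0) ->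
  energy P11 P12 P22 M (fun x y => (6 * a + 2 / m0) * g (gn x y)) (m 1) E0.
Proof.
move=> HE; have m00 := gr_m0 G; have a0 := gr_a0 G.
have k0 : 0 <= 2 / m0 by rewrite divr_ge0// ltW.
have m_ge0 t : 0 <= m t by exact: le_trans (ltW m00) (gr_m0_le G t).
have g_ge0 t : 0 <= g t.
  by apply: le_trans (gr_quad G t); rewrite mulr_ge0 ?sqr_ge0// divr_ge0// ltW.
have sg x y : sn x y <= gn x y.
  rewrite ler_sqrt; last exact: grad_sqr_ge0.
  by rewrite /off_strain; have := sqr_ge0 (P11 x y + P22 x y); lra.
have gx x y : gn x y ^+ 2 * m (gn x y) <= a * g (gn x y) := gr_a G _.
have mg x y : m (sn x y) <= m (gn x y) by apply: (gr_mono G); rewrite strain_norm_ge0 sg.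
have kg x y : 0 <= 2 / m0 * g (gn x y) by exact: mulr_ge0.
have ag x y : 0 <= a * g (gn x y) by exact: mulr_ge0.
have kE x y : (6 * a + 2 / m0) * g (gn x y) = 6 * (a * g (gn x y)) + 2 / m0 * g (gn x y).
  by rewrite mulrDl mulrA.
have sq x y := (sqr_ge0 (P11 x y), sqr_ge0 (P12 x y), sqr_ge0 (P22 x y)).
have b11 x y : `|P11 x y| <= gn x y.
  by apply: le_sqr_norm; rewrite ?grad_norm_ge0// grad_normE; have := sq x y; case=> [[]]; lra.
have b12 x y : `|P12 x y| <= gn x y.
  by apply: le_sqr_norm; rewrite ?grad_norm_ge0// grad_normE; have := sq x y; case=> [[]]; lra.
have b22 x y : `|P22 x y| <= gn x y.
  by apply: le_sqr_norm; rewrite ?grad_norm_ge0// grad_normE; have := sq x y; case=> [[]]; lra.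
have bbe x y : `|be x y| <= gn x y.
  rewrite /off_strain normrM [`|2^-1|]ger0_norm//.
  by have := ler_normB (P22 x y) (P11 x y); have := b11 x y; have := b22 x y; lra.
have T x y : `|TA P12 M x y| + `|TB P11 P22 M x y| <= 2 * (m (gn x y) * gn x y).
  rewrite /TA /TB (normrM _ (P12 x y)) (normrM _ (be x y)) !(ger0_norm (m_ge0 _)).
  have h1 : m (sn x y) * `|P12 x y| <= m (gn x y) * gn x y by exact: ler_pM.
  have h2 : m (sn x y) * `|be x y| <= m (gn x y) * gn x y by exact: ler_pM.
  lra.
split => //.
- have cg := grad_norm_cont; have cG := der_cont (gr_g G).
  apply: Cont2 => /=; apply: ct_mul; first exact: ct_cst.
  by apply: (ct_1 cG); exact: (cont2P cg).
- by move=> x y; rewrite mulr_ge0// addr_ge0// mulr_ge0.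
- move=> x y; rewrite kE.
  have h : m (sn x y) * (sn x y ^+ 2) <= m (gn x y) * gn x y ^+ 2.
    by apply: ler_pM; rewrite ?sqr_ge0// ler_pXn2r ?nnegrE ?strain_norm_ge0 ?grad_norm_ge0.
  rewrite strain_normE mulrCA in h.
  by have := gx x y; have := kg x y; have := ag x y; lra.
- move=> x y; rewrite kE.
  have h1 : sum_abs P11 P12 P22 x y <= 3 * gn x y.
    by rewrite /sum_abs; have := b11 x y; have := b12 x y; have := b22 x y; lra.
  apply: le_trans (_ : 2 * (m (gn x y) * gn x y) * (3 * gn x y) <= _).
    by apply: ler_pM => //; rewrite /sum_abs ?addr_ge0.
  rewrite (_ : _ * _ * _ = 6 * (gn x y ^+ 2 * m (gn x y))); last by ring.
  by have := gx x y; have := kg x y; lra.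
- move=> x y; rewrite kE.
  have [s1|/ltW s1] := leP (sn x y) 1.
    apply: le_trans (_ : m 1 * (`|P12 x y| + `|be x y|) <= _).
      rewrite /TA /TB (normrM _ (P12 x y)) (normrM _ (be x y)) !(ger0_norm (m_ge0 _)) -mulrDr; apply: ler_wpM2r.
        by rewrite addr_ge0.
      by apply: (gr_mono G); rewrite strain_norm_ge0.
    by rewrite lerDl; have := kg x y; have := ag x y; lra.
  have h0 : 0 <= m 1 * (`|P12 x y| + `|be x y|) by rewrite mulr_ge0// addr_ge0.
  have h1 : 0 <= m (gn x y) * gn x y * (gn x y - 1).
    rewrite !mulr_ge0 ?grad_norm_ge0// subr_ge0; exact: le_trans (sg x y).
  have h2 : m (gn x y) * gn x y <= gn x y ^+ 2 * m (gn x y).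
    by rewrite -subr_ge0 (_ : _ - _ = m (gn x y) * gn x y * (gn x y - 1))//; ring.
  by have := T x y; have := gx x y; have := kg x y; have := ag x y; lra.
- move=> x y; rewrite kE.
  have h := gr_quad G (gn x y).
  have h1 : gn x y ^+ 2 <= 2 / m0 * g (gn x y).
    have := ler_wpM2l k0 h.
    by rewrite (_ : 2 / m0 * (m0 / 2 * _) = gn x y ^+ 2)//; field; exact: lt0r_neq0.
  rewrite grad_normE in h1.
  by have := sq x y; case=> [[]]; have := ag x y; lra.
Qed.

End fields.
End monotone_law.

(** * The stress tensor *)

Lemma ord2_cases (i : 'I_2) : i = 0 \/ i = 1.
Proof. by case: i => -[|[|//]] ?; [left|right]; apply/val_inj. Qed.

Lemma sum_ord2 (V : nmodType) (F : 'I_2 -> V) : \sum_(i < 2) F i = F 0 + F 1.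
Proof.
by rewrite big_ord_recl big_ord1; congr (F _ + F _); apply/val_inj.
Qed.

Section stress.
Context {R : realType}.
Variables (h h' h'' : R -> R).
Notation g := (fun t : R => h `|t|).
Notation m := (fun t : R => mu h' h'' `|t|).
Notation w := (fun t : R => h'' `|t|).
Variables (m0 a : R).
Hypothesis G : growth g m w m0 a.
Implicit Types A B V : 'M[R]_2.

Lemma mxdotE A B : mxdot A B = A 0 0 * B 0 0 + A 0 1 * B 0 1 + (A 1 0 * B 1 0 + A 1 1 * B 1 1).
Proof. by rewrite /mxdot !sum_ord2. Qed.

Lemma mxdotZl k A B : mxdot (k *: A) B = k * mxdot A B.
Proof. by rewrite !mxdotE !mxE; ring. Qed.

Lemma mxdot_ge0 A : 0 <= mxdot A A.
Proof. by rewrite mxdotE !addr_ge0// -expr2 sqr_ge0. Qed.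

Lemma mxdot_eq0 A V : mxdot A A = 0 -> mxdot A V = 0.
Proof.
rewrite !mxdotE -!expr2 => /eqP.
rewrite !paddr_eq0 ?addr_ge0 ?sqr_ge0// !sqrf_eq0.
by move=> /andP[/andP[/eqP-> /eqP->] /andP[/eqP-> /eqP->]]; rewrite !mul0r !addr0.
Qed.

Lemma mxdot_line A V (s : R) : mxdot (s *: V + A) (s *: V + A) =
  mxdot A A + (2 * s * mxdot A V + s ^+ 2 * mxdot V V).
Proof. by rewrite !mxdotE !mxE; ring. Qed.

Lemma potentialE A : potential h A = g (Num.sqrt (mxdot A A)).
Proof. by rewrite /potential /eucl_norm ger0_norm// sqrtr_ge0. Qed.

(** Along the line the squared norm is a quadratic polynomial, and the chain rule applies when A is
    nonzero. At A = 0 the square root is singular, but there the restriction of H is g(s |V|), with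
    g even and differentiable. *)
Lemma derive_potential A V :
  'D_V (potential h) A = m (eucl_norm A) * mxdot A V.
Proof.
pose F (s : R) := g (Num.sqrt (mxdot A A + (2 * s * mxdot A V + s ^+ 2 * mxdot V V))).
have FE s : potential h (s *: V + A) = F s by rewrite potentialE mxdot_line.
suff D : is_derive (0 : R) (1 : R) F (m (eucl_norm A) * mxdot A V).
  rewrite -(@derive_val _ _ _ _ _ _ _ D) /derive.
  have E : (fun s : R => s^-1 *: ((potential h \o shift A) (s *: V) - potential h A)) =
      (fun s : R => s^-1 *: ((F \o shift 0) s%:A - F 0)).
    apply/funext => s /=; rewrite FE (_ : potential h A = F 0).
      by rewrite addr0 (mulr1 s : s%:A = s).
    by rewrite -FE scale0r add0r.
  by rewrite E.
have dg := gr_g G.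
have := mxdot_ge0 A; rewrite le_eqVlt => /predU1P[/esym A0|A0].
  rewrite (mxdot_eq0 _ A0) mulr0.
  have D : der (fun s : R => g (s * Num.sqrt (mxdot V V)))
     (fun s => s * Num.sqrt (mxdot V V) * m (s * Num.sqrt (mxdot V V)) * Num.sqrt (mxdot V V)).
    apply: der_eq (der_comp dg (der_mul (@der_id R) (der_cst (Num.sqrt (mxdot V V))))) _ => s /=.
    by ring.
  have := D 0; rewrite !mul0r => {}D.
  rewrite (_ : F = (fun s : R => g (s * Num.sqrt (mxdot V V))))//.
  apply/funext => s; rewrite /F A0 (mxdot_eq0 _ A0) mulr0 !add0r sqrtrM ?sqr_ge0// sqrtr_sqr.
  by rewrite !normrM normr_id.
pose q (s : R) := mxdot A A + (2 * s * mxdot A V + s ^+ 2 * mxdot V V).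
have diff_quot : der q (fun s => 2 * mxdot A V + 2 * s * mxdot V V).
  by rewrite /q; prove_der; ring.
have q0 : q 0 = mxdot A A by rewrite /q; ring.
have p0 : 0 < q 0 by rewrite q0.
have D1 := is_derive1_comp (is_derive1_sqrt p0) (diff_quot 0).
have D2 := @is_derive1_comp R g (Num.sqrt \o q) 0 _ _ (dg (Num.sqrt (q 0))) D1.
rewrite (_ : _ * _ = Num.sqrt (q 0) * m (Num.sqrt (q 0)) * ((2 * Num.sqrt (q 0))^-1 * (2 * mxdot A V + 2 * 0 * mxdot V V)))//.
rewrite /eucl_norm -q0; set r := Num.sqrt (q 0).
have r0 : r != 0 by rewrite /r gt_eqF// sqrtr_gt0.
by field.
Qed.

Lemma stressE A : A 1 0 = A 0 1 -> stress h A = m (eucl_norm A) *: A.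
Proof.
move=> As; apply/matrixP => i j; rewrite /stress mxE derive_potential mxE; congr (_ * _).
rewrite mxdotE /symm_part !mxE.
have [->|->] := ord2_cases i.
  have [->|->] := ord2_cases j.
    by rewrite /=; field.
  by rewrite /= As; field.
have [->|->] := ord2_cases j.
  by rewrite /= As; field.
by rewrite /=; field.
Qed.

End stress.

(** * Stream function *)

Section curry.
Context {R : realType}.
Implicit Types (f : 'rV[R]_2 -> 'rV[R]_2) (i : 'I_2).

Definition basis (k : 'I_2) : 'rV[R]_2 := delta_mx 0 k.
Definition curry_field f i (x y : R) : R := f (plane_point (x, y)) 0 i.

Lemma plane_pointE (x y : R) : plane_point (x, y) = x *: basis 0 + y *: basis 1.
Proof.
apply/rowP => j; rewrite !mxE.
have [->|->] := ord2_cases j.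
  by rewrite /= mulr1 mulr0 addr0.
by rewrite /= mulr0 mulr1 add0r.
Qed.

Lemma plane_point_continuous : continuous (fun p : R * R => plane_point p).
Proof.
rewrite (_ : (fun p => plane_point p) = fun p : R * R => p.1 *: basis 0 + p.2 *: basis 1).
  by move=> p; apply: cvgD; apply: cvgZr_tmp; [exact: cvg_fst|exact: cvg_snd].
by apply/funext => -[x y]; exact: plane_pointE.
Qed.

Lemma curry_field_cont f i : continuous f -> cont2 (curry_field f i).
Proof.
move=> cf; apply: Cont2 => p /=; rewrite /curry_field.
have c1 : continuous (fun p : R * R => f (plane_point p)).
  by move=> q; apply: continuous_comp; [exact: plane_point_continuous|exact: cf].
apply: (@continuous_comp _ _ _ (fun p : R * R => f (plane_point (p.1, p.2))) (fun v : 'rV[R]_2 => v 0 i)).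
  by have := c1 p; case: p.
exact: coord_continuous.
Qed.

Lemma curry_field_D1 f i : (forall x, derivable f x (basis 0)) ->
  D1 (curry_field f i) (curry_field ('D_(basis 0) f) i).
Proof.
move=> df y x; have C := df (plane_point (x, y)).
have {}C : (s^-1 *: (curry_field f i (s *: (1 : R) + x) y - curry_field f i x y)) @[s --> 0^']
   --> curry_field ('D_(basis 0) f) i x y.
  have := @cvg_comp _ _ _ _ (fun v : 'rV[R]_2 => v 0 i) _ _ _ C (@coord_continuous _ _ _ 0 i _).
  apply: cvg_trans; apply: near_eq_cvg; near=> s.
  rewrite /= !mxE /curry_field; congr (_ * (f _ 0 i - _)).
  by rewrite !plane_pointE scalerDl (mulr1 s : s%:A = s) addrA.
by split; [apply/cvg_ex; eexists; exact: C|apply/cvg_lim].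
Unshelve. all: by end_near. Qed.

Lemma curry_field_D2 f i : (forall x, derivable f x (basis 1)) ->
  D2 (curry_field f i) (curry_field ('D_(basis 1) f) i).
Proof.
move=> df x y; have C := df (plane_point (x, y)).
have {}C : (s^-1 *: (curry_field f i x (s *: (1 : R) + y) - curry_field f i x y)) @[s --> 0^']
   --> curry_field ('D_(basis 1) f) i x y.
  have := @cvg_comp _ _ _ _ (fun v : 'rV[R]_2 => v 0 i) _ _ _ C (@coord_continuous _ _ _ 0 i _).
  apply: cvg_trans; apply: near_eq_cvg; near=> s.
  rewrite /= !mxE /curry_field; congr (_ * (f _ 0 i - _)).
  by rewrite !plane_pointE scalerDl (mulr1 s : s%:A = s) addrCA.
by split; [apply/cvg_ex; eexists; exact: C|apply/cvg_lim].
Unshelve. all: by end_near. Qed.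

Lemma DuE f x i k : differentiable f x -> Du f x i k = 'D_(basis k) f x 0 i.
Proof. by move=> df; rewrite /Du /jacobian mxE mxE deriveE. Qed.

End curry.

Section stream_function.
Context {R : realType}.
Implicit Types (f F : R -> R).

(** The oriented integral of f from 0 to x, substituted to the fixed interval [[0, 1]]: there is no
    case distinction on the sign of x, and continuity in parameters is immediate. *)
Definition line f x : R := Sint 0 1 (fun t => x * f (t * x)).

Lemma line_FTC F f x : der F f -> continuous f -> line f x = F x - F 0.
Proof.
move=> dF cf; have D : der (fun t => F (t * x)) (fun t => x * f (t * x)).
  apply: der_eq (der_comp dF (der_mul (@der_id R) (der_cst x))) _ => t; ring.
have c : continuous (fun t : R => x * f (t * x)) by prove_cont.
by have := Sint_FTC ler01 c D; rewrite mul1r mul0r.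
Qed.

Lemma der_line f : continuous f -> der (line f) f.
Proof.
move=> cf; have dp : der (prim f) f by move=> t; exact: is_derive_prim.
rewrite (_ : line f = fun x => prim f x + - prim f 0).
  by prove_der; rewrite addr0.
by apply/funext => x; exact: line_FTC.
Qed.

Variables (P1 P2 P12 : R -> R -> R).
Hypotheses (c1 : cont2 P1) (c2 : cont2 P2) (c12 : cont2 P12)
  (d12 : D2 P1 P12) (d21 : D1 P2 P12).

(** The closed form P1 dx + P2 dy integrated along the x-axis and then vertically. *)
Definition stream x y : R := line (P1^~ 0) x + line (P2 x) y.

(** Path independence: the vertical increments of P1 and the horizontal ones of P2 are integrals of
    the same P12, so the two paths differ by one double integral taken in both orders. *)
Lemma stream_sym x y : stream x y = line (P2 0) y + line (P1^~ y) x.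
Proof.
have e1 t : P2 x t - P2 0 t = line (P12^~ t) x.
  by rewrite (line_FTC (F := P2^~ t))//; prove_cont.
have e2 t : P1 t y - P1 t 0 = line (P12 t) y.
  by rewrite (line_FTC (F := P1 t))//; prove_cont.
have E : line (P2 x) y - line (P2 0) y = line (P1^~ y) x - line (P1^~ 0) x.
  rewrite /line -SintN; [|by prove_cont]. rewrite -SintD; [|by prove_cont|by prove_cont].
  rewrite -SintN; [|by prove_cont]. rewrite -SintD; [|by prove_cont|by prove_cont].
  rewrite (@eq_Sint _ _ _ _ (fun s => Sint 0 1 (fun t => y * (x * P12 (t * x) (s * y))))).
    rewrite Sint_Fubini; last by apply: Cont2 => /=; prove_cont.
    apply: eq_Sint => t _; rewrite -mulrBr e2 /line -SintZ; last by prove_cont.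
    by apply: eq_Sint => s _ /=; ring.
  move=> s _; rewrite -mulrBr e1 /line -SintZ; last by prove_cont.
  by [].
by rewrite /stream; lra.
Qed.

Lemma stream_cont : cont2 stream.
Proof. by rewrite /stream /line; prove_cont. Qed.

Lemma stream_D2 : D2 stream P2.
Proof.
move=> x; have D := @der_line (P2 x) (ltac:(prove_cont)).
by rewrite /stream; prove_der; rewrite add0r.
Qed.

Lemma stream_D1 : D1 stream P1.
Proof.
move=> y; have D := @der_line (P1^~ y) (ltac:(prove_cont)).
rewrite (_ : stream^~ y = fun x => line (P2 0) y + line (P1^~ y) x); last first.
  by apply/funext => x; exact: stream_sym.
by prove_der; rewrite add0r.
Qed.

End stream_function.

(** * Iterated integrals and the measure of the plane *)

Section plane_integrals.
Context {R : realType}.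
Implicit Types f : R -> R -> R.
Notation box N := (`[- N, N] `*` `[- N, N] : set (measurableTypeR R * measurableTypeR R)).

Lemma plane_Ibox_in f N : cont2 f -> \int[plane_measure R]_(p in box N) f p.1 p.2 = Ibox N f.
Proof. by move=> cf; rewrite IboxE//; exact: (@plane_Sint R f (- N) N (- N) N cf). Qed.

Lemma plane_Ibox f N : cont2 f -> bsupp N f ->
  \int[plane_measure R]_p f p.1 p.2 = Ibox N f.
Proof.
move=> cf fN; rewrite -plane_Ibox_in//.
have -> : \int[plane_measure R]_(p in box N) f p.1 p.2 =
    \int[plane_measure R]_p ((fun p => f p.1 p.2) \_ (box N)) p by exact: Rintegral_mkcond.
congr Rintegral.
apply/funext => -[x y]; rewrite /patch; case: ifPn => //.
rewrite in_setX/= negb_and => /orP[] /negP h; apply: fN; [left|right];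
  by move: h; rewrite inE/= in_itv/= -ler_norml => /negP; rewrite -ltNge => /ltW.
Qed.

Lemma plane_measurable f : cont2 f -> measurable_fun [set: measurableTypeR R * measurableTypeR R]
  (fun p => (f p.1 p.2)%:E).
Proof. by move=> cf; apply/measurable_EFinP; exact: continuous_prod_measurable (cont2P cf). Qed.

(** Finiteness is essential: the real-valued integral takes the default value 0 when the extended
    one is infinite. *)
Lemma Ibox_le_plane f N : cont2 f -> (forall x y, 0 <= f x y) ->
  (\int[plane_measure R]_p (f p.1 p.2)%:E < +oo)%E ->
  Ibox N f <= \int[plane_measure R]_p f p.1 p.2.
Proof.
move=> cf f0 foo; rewrite -plane_Ibox_in// /Rintegral.
have mb : measurable (box N) by exact: measurableX.
have le : (\int[plane_measure R]_(p in box N) (f p.1 p.2)%:E <=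
    \int[plane_measure R]_p (f p.1 p.2)%:E)%E.
  apply: ge0_subset_integral => //; first exact: plane_measurable.
  by move=> p _; rewrite lee_fin.
apply: (fine_le _ _ le); rewrite ge0_fin_numE ?integral_ge0// => *; rewrite ?lee_fin//.
apply: (le_lt_trans _ foo).
exact: le.
Qed.

End plane_integrals.

(** * Smooth solenoidal test fields *)

Section smooth_line.
Context {R : realType}.
Implicit Types f g : R -> R.

Fixpoint smooth_to n f : Prop :=
  if n is n'.+1 then exists2 f' : R -> R, der f f' & smooth_to n' f' else continuous f.

Lemma smooth_to_cont n f : smooth_to n f -> continuous f.
Proof. by case: n => [//|n] [f' df _]; exact: der_cont df. Qed.

Lemma smooth_to_pred n f : smooth_to n.+1 f -> smooth_to n f.
Proof.
elim: n f => [|n IH] f; first exact: smooth_to_cont.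
by move=> [f' df sf]; exists f' => //; exact: IH.
Qed.

Lemma smooth_to_cst n (k : R) : smooth_to n (fun=> k).
Proof.
elim: n k => [|n IH] k /=; first exact: ct_cst.
by exists (fun=> 0); [exact: der_cst|exact: IH].
Qed.

Lemma smooth_to_add n f g : smooth_to n f -> smooth_to n g ->
  smooth_to n (fun x => f x + g x).
Proof.
elim: n f g => [|n IH] f g /=; first by move=> cf cg; prove_cont.
move=> [f' df sf] [g' dg sg]; exists (fun x => f' x + g' x); last exact: IH.
exact: der_add.
Qed.

Lemma smooth_to_mul n f g : smooth_to n f -> smooth_to n g ->
  smooth_to n (fun x => f x * g x).
Proof.
elim: n f g => [|n IH] f g; first by move=> /= cf cg; prove_cont.
move=> sf sg; case: (sf) => f' df sf'; case: (sg) => g' dg sg'.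
exists (fun x => f' x * g x + f x * g' x); first exact: der_mul.
by apply: smooth_to_add; apply: IH => //; exact: smooth_to_pred.
Qed.

Lemma smooth_to_affine n f (a b : R) : smooth_to n f -> smooth_to n (fun x => f (a * x + b)).
Proof.
elim: n f => [|n IH] f /=; first by move=> cf; prove_cont.
move=> [f' df sf]; exists (fun x => f' (a * x + b) * a).
  by prove_der; ring.
by apply: smooth_to_mul; [exact: IH|exact: smooth_to_cst].
Qed.

(** The class of functions q(1/x) e^(-1/x), extended by 0, is closed under differentiation
    ([der_flat]), which gives smoothness of all orders by induction. *)
Definition flat (q : {poly R}) (x : R) : R := if 0 < x then q.[x^-1] * expR (- x^-1) else 0.

(** The inequality 1 + z <= e^z at z = y / n, raised to the power n. *)
Lemma expR_dominates n (y : R) : 0 <= y -> y ^+ n <= n%:R ^+ n * expR y.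
Proof.
case: n => [|n] y0; first by rewrite !expr0 mul1r -expR0 ler_expR.
have y1 : y / n.+1%:R <= expR (y / n.+1%:R).
  by apply: le_trans (expR_ge1Dx _); rewrite lerDr.
have -> : expR y = expR (y / n.+1%:R) ^+ n.+1.
  by rewrite -expRM_natl mulrC divfK// pnatr_eq0.
rewrite -exprMn; apply: lerXn2r; rewrite ?nnegrE ?mulr_ge0 ?expR_ge0//.
by rewrite mulrC -ler_pdivrMr ?ltr0n.
Qed.

Lemma flat_bounded (q : {poly R}) : exists2 C : R, 0 <= C & forall x : R, `|flat q x| <= C.
Proof.
exists (\sum_(i < size q) `|q`_i| * i%:R ^+ i) => [|x].
  by apply: sumr_ge0 => i _; rewrite mulr_ge0// exprn_ge0.
rewrite /flat; case: ifPn => [x0|_]; last first.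
  by rewrite normr0 sumr_ge0// => i _; rewrite mulr_ge0// exprn_ge0.
have y0 : 0 <= x^-1 by rewrite invr_ge0 ltW.
move: (x^-1) y0 => y y0.
rewrite normrM [`|expR _|]ger0_norm ?expR_ge0// expRN ler_pdivrMr ?expR_gt0//.
rewrite horner_coef mulr_suml; apply: le_trans (ler_norm_sum _ _ _) _.
apply: ler_sum => i _; rewrite normrM -mulrA ler_wpM2l// normrX ger0_norm//.
exact: expR_dominates.
Qed.

Lemma der_flat q : der (flat q) (flat ('X^2 * (q - q^`()))).
Proof.
move=> x; case: (ltrgtP x 0) => [x0|x0|->].
- rewrite {2}/flat ltNge (ltW x0)/=.
  apply: near_eq_is_derive (is_derive_cst 0 x 1); near=> z; rewrite /flat ltNge ltW//.
  by near: z; exact: lt_nbhsl.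
- have xn := lt0r_neq0 x0.
  have D1 : is_derive x (1 : R) (fun y : R => y^-1) (- x ^- 2).
    by have := @is_deriveV R id x 1 1 xn (is_derive_id x (1 : R)); rewrite /GRing.scale/= mulr1.
  have D2 : is_derive x (1 : R) (fun y : R => - y^-1) (x ^- 2).
    by have := is_deriveN D1; rewrite opprK.
  have D3 := @is_derive1_comp R (fun y => q.[y]) (fun y => y^-1) x _ _ (is_derive_poly _ _) D1.
  have D4 := @is_derive1_comp R expR (fun y => - y^-1) x _ _ (is_derive_expR _) D2.
  have := is_deriveM D3 D4; rewrite /GRing.scale/= => D5.
  have -> : flat ('X^2 * (q - q^`())) x =
      q.[x^-1] * (expR (- x^-1) * x ^- 2) + expR (- x^-1) * (q^`().[x^-1] * - x ^- 2).
    rewrite /flat x0 hornerM hornerXn hornerD hornerN exprVn.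
    by move: q.[_] q^`().[_] (expR _) (x ^- 2) => a b e c; ring.
  apply: near_eq_is_derive D5; near=> z.
  have z0 : 0 < z by near: z; exact: lt_nbhsr.
  by rewrite /flat z0.
(* At 0 the function is s^2 times a bounded member of the same class, so its derivative there is
   0. *)
- have [C C0 HC] := flat_bounded ('X^2 * q).
  have fE s : flat q s = s ^+ 2 * flat ('X^2 * q) s.
    rewrite /flat; case: ifPn => [s0|_]; last by rewrite mulr0.
    by rewrite hornerM hornerXn exprVn !mulrA divff ?mul1r// expf_neq0// lt0r_neq0.
  apply: is_derive_dist => k k0.
  exists (k / (C + 1)) => [|s]; first by rewrite divr_gt0// ltr_wpDl.
  rewrite subr0 ltr_pdivlMr ?ltr_wpDl// => sk.
  rewrite [flat q 0]/flat [flat (_ * _) 0]/flat ltxx mul0r !subr0 fE normrM.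
  rewrite expr2 normrM -mulrA mulrC ler_wpM2r//.
  apply: le_trans (ltW sk); apply: ler_wpM2l => //.
  by apply: le_trans (HC s) _; rewrite lerDl.
Unshelve. all: by end_near. Qed.

Lemma smooth_flat n q : smooth_to n (flat q).
Proof.
elim: n q => [|n IH] q; first exact: der_cont (der_flat q).
by exists (flat ('X^2 * (q - q^`()))); [exact: der_flat|exact: IH].
Qed.

Definition kern x : R := flat 1 (x + 1) * flat 1 (- x + 1).

Lemma smooth_kern n : smooth_to n kern.
Proof.
rewrite /kern; apply: smooth_to_mul.
  have := smooth_to_affine 1 1 (smooth_flat n 1).
  by under [X in smooth_to _ X]eq_fun do rewrite mul1r.
have := smooth_to_affine (-1) 1 (smooth_flat n 1).
by under [X in smooth_to _ X]eq_fun do rewrite mulN1r.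
Qed.

Lemma flat_ge0 x : 0 <= flat 1 x.
Proof. by rewrite /flat; case: ifP => // _; rewrite hornerE mulr_ge0 ?expR_ge0. Qed.

Lemma kern_ge0 x : 0 <= kern x.
Proof. by rewrite mulr_ge0// flat_ge0. Qed.

Lemma kern_supp x : 1 <= `|x| -> kern x = 0.
Proof.
rewrite /kern /flat ler_normr => /orP[] x1.
  by rewrite [0 < - x + 1]ltNge (_ : - x + 1 <= 0) ?mulr0//; lra.
by rewrite [0 < x + 1]ltNge (_ : x + 1 <= 0) ?mul0r//; lra.
Qed.

Lemma kern_gt0 : 0 < kern 0.
Proof.
by rewrite /kern /flat oppr0 add0r ltr01 !hornerE !mulr_gt0 ?expR_gt0.
Qed.

End smooth_line.

Section tensor.
Context {R : realType}.
Implicit Types (f g : R -> R) (phi chi : 'rV[R]_2 -> 'rV[R]_2) (c v x : 'rV[R]_2).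

Definition tensor f g c x : 'rV[R]_2 := (f (x 0 0) * g (x 0 1)) *: c.

Lemma coord_differentiable f f' (i : 'I_2) x : der f f' ->
  differentiable (fun x => f (x 0 i)) x.
Proof.
move=> df; apply: (@differentiable_comp _ _ _ _ (fun x => x 0 i) f).
  exact: differentiable_coord.
by apply/derivable1_diffP; case: (df (x 0 i)).
Qed.

Lemma tensor_differentiable f f' g g' c x : der f f' -> der g g' ->
  differentiable (tensor f g c) x.
Proof.
move=> df dg; apply: differentiableZl; apply: differentiableM; exact: coord_differentiable.
Qed.

Lemma derive_tensor f f' g g' c v x : der f f' -> der g g' ->
  'D_v (tensor f g c) x = tensor f' g (v 0 0 *: c) x + tensor f g' (v 0 1 *: c) x.
Proof.
move=> df dg.
have dk : differentiable (fun x => f (x 0 0) * g (x 0 1)) x.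
  by apply: differentiableM; exact: coord_differentiable.
rewrite deriveE; last exact: tensor_differentiable df dg.
rewrite diffZl// -deriveE//.
suff -> : 'D_v (fun x => f (x 0 0) * g (x 0 1)) x =
    f' (x 0 0) * g (x 0 1) * v 0 0 + f (x 0 0) * g' (x 0 1) * v 0 1.
  by rewrite /tensor !scalerA scalerDl.
pose F (s : R) := f (s * v 0 0 + x 0 0) * g (s * v 0 1 + x 0 1).
have D : der F (fun s => f' (s * v 0 0 + x 0 0) * v 0 0 * g (s * v 0 1 + x 0 1) +
   f (s * v 0 0 + x 0 0) * (g' (s * v 0 1 + x 0 1) * v 0 1)).
  have d1 : der (fun s => f (s * v 0 0 + x 0 0)) (fun s => f' (s * v 0 0 + x 0 0) * v 0 0).
    apply: der_eq (der_comp df (der_add (der_mul (@der_id R) (der_cst (v 0 0))) (der_cst (x 0 0)))) _ => s /=.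
    by ring.
  have d2 : der (fun s => g (s * v 0 1 + x 0 1)) (fun s => g' (s * v 0 1 + x 0 1) * v 0 1).
    apply: der_eq (der_comp dg (der_add (der_mul (@der_id R) (der_cst (v 0 1))) (der_cst (x 0 1)))) _ => s /=.
    by ring.
  exact: der_mul d1 d2.
have E : (fun s : R => s^-1 *: (((fun x => f (x 0 0) * g (x 0 1)) \o shift x) (s *: v) - (fun x => f (x 0 0) * g (x 0 1)) x)) =
      (fun s : R => s^-1 *: ((F \o shift 0) s%:A - F 0)).
  apply/funext => s /=; rewrite /F addr0 (mulr1 s : s%:A = s) !mul0r !add0r.
  by rewrite !mxE.
rewrite /derive E; have := D 0; rewrite !mul0r !add0r => D0.
rewrite [lim _](@derive_val _ _ _ _ _ _ _ D0).
by ring.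
Qed.

(** Sums of products of one-variable functions are stable under directional derivatives, each
    costing one order; iterated differentiability in the plane thus reduces to the line. *)
Inductive tensor_field (n : nat) : ('rV[R]_2 -> 'rV[R]_2) -> Prop :=
| Tensor f g c of smooth_to n f & smooth_to n g : tensor_field n (tensor f g c)
| TensorD phi chi of tensor_field n phi & tensor_field n chi :
    tensor_field n (phi + chi).

Lemma tensor_field_continuous n phi : tensor_field n phi -> continuous phi.
Proof.
elim=> {phi} [f g c sf sg|phi chi _ cp _ cc] x; last exact: (cvgD (cp x) (cc x)).
have cc (f0 : R -> R) (i : 'I_2) : continuous f0 ->
    (fun y : 'rV[R]_2 => f0 (y 0 i)) @ x --> f0 (x 0 i).
  move=> cf; apply: (@continuous_comp _ _ _ (fun x : 'rV[R]_2 => x 0 i) f0); last exact: cf.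
  exact: coord_continuous.
have C := cvgM (cc _ 0 (smooth_to_cont sf)) (cc _ 1 (smooth_to_cont sg)).
exact: (cvgZr_tmp (a := c) (C _)).
Qed.

Lemma tensor_field_derive n phi v : tensor_field n.+1 phi ->
  (forall x, differentiable phi x) /\ tensor_field n ('D_v phi).
Proof.
elim=> {phi} [f g c sf sg|phi chi _ [dp tp] _ [dc tc]]; last first.
  split=> [x|]; first exact: differentiableD.
  rewrite (_ : 'D_v _ = 'D_v phi + 'D_v chi); first exact: TensorD.
  by apply/funext => x; rewrite deriveD//; exact: diff_derivable.
case: (sf) => f' df sf'; case: (sg) => g' dg sg'.
split=> [x|]; first exact: tensor_differentiable df dg.
rewrite (_ : 'D_v _ = tensor f' g (v 0 0 *: c) + tensor f g' (v 0 1 *: c)).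
  by apply: TensorD; apply: Tensor => //; exact: smooth_to_pred.
by apply/funext => x; exact: derive_tensor.
Qed.

Lemma tensor_field_class_C n phi : tensor_field n phi -> class_C n phi.
Proof.
elim: n phi => [|n IH] phi tp /=; first exact: tensor_field_continuous tp.
split=> [x|v]; first by have [] := tensor_field_derive 0 tp.
by apply: IH; have [] := tensor_field_derive v tp.
Qed.

Lemma test_field_tensor phi (r : R) : (forall n, tensor_field n phi) ->
  (forall x, phi x != 0 -> `|x 0 0 : R| <= r /\ `|x 0 1| <= r) -> test_field phi.
Proof.
move=> tp sp; split=> [n|]; first exact: tensor_field_class_C.
have cB : compact [set x : 'rV[R]_2 | forall i : 'I_2, `[- r, r]%classic (x 0 i)].
  by apply: (@rV_compact _ _ (fun _ => `[- r, r]%classic)) => i; exact: segment_compact.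
apply: (subclosed_compact _ cB); first exact: closed_closure.
rewrite [X in _ `<=` X](closure_id _).1; last exact: compact_closed (@norm_hausdorff _ _) cB.
apply: closure_subset => x /sp[x0 x1] i /=; rewrite in_itv/= -ler_norml.
by have [->|->] := ord2_cases i.
Qed.

End tensor.

Lemma smooth_to_derivative (R : realType) (f f' : R -> R) :
  (forall n, smooth_to n f) -> der f f' -> forall n, smooth_to n f'.
Proof.
move=> sf df n; have [g dg sg] := sf n.+1.
rewrite (_ : f' = g)//; apply/funext => x.
by rewrite -(@derive_val _ _ _ _ _ _ _ (df x)) (@derive_val _ _ _ _ _ _ _ (dg x)).
Qed.

(** * Stream-function data of the given solution *)

Section flow_data.
Context {R : realType}.
Variables (u : 'rV[R]_2 -> 'rV[R]_2).
Hypotheses (uC1 : class_C 1 u) (div0 : forall x, divergence u x = 0).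

(** As u = (P2, - P1), [flow1] is minus the second component. The remaining fields are the second
    derivatives of the stream function read off Du; incompressibility makes [flow12] the common
    mixed derivative. *)
Definition flow1 x y : R := - curry_field u 1 x y.
Definition flow2 := curry_field u 0.
Definition flow11 x y : R := - curry_field ('D_(basis 0) u) 1 x y.
Definition flow12 := curry_field ('D_(basis 0) u) 0.
Definition flow22 := curry_field ('D_(basis 1) u) 0.

Let du x : differentiable u x. Proof. by case: uC1. Qed.
Let cdu v : continuous ('D_v u). Proof. by case: uC1 => _ /(_ v). Qed.
Let cu : continuous u.
Proof. by move=> x; apply: differentiable_continuous; exact: du. Qed.
Let dv v x : derivable u x v. Proof. exact: diff_derivable. Qed.

Lemma divergence_free x y : curry_field ('D_(basis 1) u) 1 x y = - flow12 x y.
Proof.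
have := div0 (plane_point (x, y)); rewrite /divergence /mxtrace sum_ord2 !DuE//.
by move=> /eqP; rewrite addrC addr_eq0 => /eqP.
Qed.

Lemma flow1_cont : cont2 flow1.
Proof. by have c := curry_field_cont 1 cu; rewrite /flow1; prove_cont. Qed.
Lemma flow2_cont : cont2 flow2. Proof. exact: curry_field_cont. Qed.
Lemma flow11_cont : cont2 flow11.
Proof. by have c := curry_field_cont 1 (@cdu (basis 0)); rewrite /flow11; prove_cont. Qed.
Lemma flow12_cont : cont2 flow12. Proof. exact: curry_field_cont. Qed.
Lemma flow22_cont : cont2 flow22. Proof. exact: curry_field_cont. Qed.

Lemma flow1_D1 : D1 flow1 flow11.
Proof. by have d := curry_field_D1 1 (@dv (basis 0)) => y; apply: der_opp; exact: d. Qed.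
Lemma flow1_D2 : D2 flow1 flow12.
Proof.
have d := curry_field_D2 1 (@dv (basis 1)) => x.
by apply: der_eq (der_opp (d x)) _ => y; rewrite divergence_free opprK.
Qed.
Lemma flow2_D1 : D1 flow2 flow12. Proof. exact: curry_field_D1. Qed.
Lemma flow2_D2 : D2 flow2 flow22. Proof. exact: curry_field_D2. Qed.

Notation be := (off_strain flow11 flow22).
Notation pt x y := (plane_point (x, y)).

Lemma Du_flow x y : [/\ Du u (pt x y) 0 0 = flow12 x y, Du u (pt x y) 0 1 = flow22 x y,
  Du u (pt x y) 1 0 = - flow11 x y & Du u (pt x y) 1 1 = - flow12 x y].
Proof.
by rewrite !DuE//; split=> //; [rewrite /flow11 opprK|rewrite -divergence_free].
Qed.

Lemma sym_gradE (f : 'rV[R]_2 -> 'rV[R]_2) X i j :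
  sym_grad f X i j = (Du f X i j + Du f X j i) / 2.
Proof. by rewrite /sym_grad /symm_part !mxE mulrC. Qed.

Lemma sym_grad_flow x y : [/\ sym_grad u (pt x y) 0 0 = flow12 x y,
  sym_grad u (pt x y) 0 1 = be x y, sym_grad u (pt x y) 1 0 = be x y &
  sym_grad u (pt x y) 1 1 = - flow12 x y].
Proof.
have [e00 e01 e10 e11] := Du_flow x y.
by rewrite !sym_gradE e00 e01 e10 e11 /off_strain; split; field.
Qed.

Lemma eucl_norm_sym_grad x y :
  eucl_norm (sym_grad u (pt x y)) = strain_norm flow11 flow12 flow22 x y.
Proof.
have [e00 e01 e10 e11] := sym_grad_flow x y.
by rewrite /eucl_norm mxdotE e00 e01 e10 e11 /strain_norm; congr Num.sqrt; ring.
Qed.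

Lemma eucl_norm_Du x y :
  eucl_norm (Du u (pt x y)) = grad_norm flow11 flow12 flow22 x y.
Proof.
have [e00 e01 e10 e11] := Du_flow x y.
by rewrite /eucl_norm mxdotE e00 e01 e10 e11 /grad_norm; congr Num.sqrt; ring.
Qed.

Lemma mxdot_sym_grad (f : 'rV[R]_2 -> 'rV[R]_2) x y X :
  mxdot (sym_grad u (pt x y)) (sym_grad f X) =
  flow12 x y * (Du f X 0 0 - Du f X 1 1) + be x y * (Du f X 0 1 + Du f X 1 0).
Proof.
have [e00 e01 e10 e11] := sym_grad_flow x y.
have := sym_gradE f X; move: (sym_grad f X) => B BE.
by rewrite mxdotE e00 e01 e10 e11 !BE; field.
Qed.

Section tensor_test.
Variables (h h' h'' : R -> R) (m0 a : R).
Notation g := (fun t : R => h `|t|).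
Notation m := (fun t : R => mu h' h'' `|t|).
Notation w := (fun t : R => h'' `|t|).
Hypothesis G : growth g m w m0 a.
Hypothesis u_sol : weak_solution h u.
Notation M := (fun x y => m (strain_norm flow11 flow12 flow22 x y)).
Notation S1 := (weak1 flow1 flow2 flow12 M).
Notation S2 := (weak2 flow1 flow2 flow11 flow22 M).

Variables (k k1 k2 l l1 l2 : R -> R) (r : R).
Hypotheses (sk : forall n, smooth_to n k) (sl : forall n, smooth_to n l)
  (dk : der k k1) (dk1 : der k1 k2) (dl : der l l1) (dl1 : der l1 l2)
  (k0 : forall x, r <= `|x| -> k x = 0 /\ k1 x = 0 /\ k2 x = 0)
  (l0 : forall x, r <= `|x| -> l x = 0 /\ l1 x = 0 /\ l2 x = 0).

(** The solenoidal field (psi_2, - psi_1) with potential psi(x, y) = k(x) l(y). *)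
Definition swirl : 'rV[R]_2 -> 'rV[R]_2 := tensor k l1 (basis 0) + tensor k1 l (- basis 1).

Lemma Du_swirl x y : [/\ Du swirl (pt x y) 0 0 = k1 x * l1 y, Du swirl (pt x y) 0 1 = k x * l2 y,
  Du swirl (pt x y) 1 0 = - (k2 x * l y) & Du swirl (pt x y) 1 1 = - (k1 x * l1 y)].
Proof.
have d1 X : differentiable (tensor k l1 (basis 0)) X by exact: tensor_differentiable dk dl1.
have d2 X : differentiable (tensor k1 l (- basis 1)) X by exact: tensor_differentiable dk1 dl.
have d X : differentiable swirl X by exact: differentiableD.
have E i j : Du swirl (pt x y) i j =
    (k1 x * l1 y * basis j 0 0 + k x * l2 y * basis j 0 1) * basis 0 0 i -
    (k2 x * l y * basis j 0 0 + k1 x * l1 y * basis j 0 1) * basis 1 0 i.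
  rewrite DuE// deriveD; [|exact: diff_derivable|exact: diff_derivable].
  rewrite (derive_tensor _ _ _ dk dl1) (derive_tensor _ _ _ dk1 dl) /tensor /basis !mxE /=.
  ring.
by rewrite !E /basis !mxE /=; split; ring.
Qed.

Lemma swirl_test : test_field swirl.
Proof.
have sk1 := smooth_to_derivative sk dk; have sl1 := smooth_to_derivative sl dl.
apply: (@test_field_tensor _ _ r) => [n|x].
  by apply: TensorD; apply: Tensor.
have [xr|/ltW rx] := leP `|x 0 0| r; last first.
  have [e [e1 _]] := k0 rx.
  by rewrite /swirl /GRing.add/= /tensor e e1 !mul0r !scale0r addr0 eqxx.
have [//|/ltW ry] := leP `|x 0 1| r.
have [e [e1 _]] := l0 ry.
by rewrite /swirl /GRing.add/= /tensor e e1 !mulr0 !scale0r addr0 eqxx.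
Qed.

Lemma weak_tensor : continuous k2 -> continuous l2 ->
  Ibox r (fun x y => S1 x y * (k1 x * l1 y) + S2 x y * (k x * l2 y - k2 x * l y) / 2) = 0.
Proof.
move=> ck2 cl2; case: u_sol => _ /(_ _ swirl_test).
have div X : divergence swirl X = 0.
  have -> : X = pt (X 0 0) (X 0 1).
    apply/rowP => j; rewrite !mxE.
    by have [->|->] := ord2_cases j.
  by have [e00 _ _ e11] := Du_swirl (X 0 0) (X 0 1); rewrite /divergence /mxtrace sum_ord2 e00 e11 subrr.
move=> /(_ div).
have c1 := flow1_cont; have c2 := flow2_cont; have c11 := flow11_cont;
  have c12 := flow12_cont; have c22 := flow22_cont; have cM := viscosity_cont G c11 c12 c22.
have ck := der_cont dk; have ck1 := der_cont dk1; have cl := der_cont dl; have cl1 := der_cont dl1.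
(* The viscosity is a composition with a square root; the abstract [Mf] makes it an atom for the
   continuity proofs. *)
have [Mf MfE cMf] : exists2 Mf : R -> R -> R, (forall x y, Mf x y = M x y) & cont2 Mf by exists M.
pose F x y : R := 2 * Mf x y * (flow12 x y * (k1 x * l1 y) + be x y * (k x * l2 y - k2 x * l y) / 2).
pose N x y : R := (flow2 x y ^+ 2 - flow1 x y ^+ 2) * (k1 x * l1 y) - flow1 x y * flow2 x y * (k x * l2 y - k2 x * l y).
have cb : cont2 be by rewrite /off_strain; prove_cont.
have cF : cont2 F by rewrite /F; prove_cont.
have cN : cont2 N by rewrite /N; prove_cont.
have FE : (fun p : R * R => let x := plane_point p in mxdot (stress h (sym_grad u x)) (sym_grad swirl x))
    = (fun p => F p.1 p.2).
  apply/funext => -[x y] /=.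
  have [e00 e01 e10 e11] := sym_grad_flow x y.
  have [s00 s01 s10 s11] := Du_swirl x y.
  rewrite (stressE G); last by rewrite e01 e10.
  rewrite mxdotZl mxdot_sym_grad s00 s01 s10 s11 (eucl_norm_sym_grad x y).
  by rewrite /F MfE; field.
have NE : (fun p : R * R => let x := plane_point p in
    \sum_(k < 2) \sum_(i < 2) u x 0 k * u x 0 i * Du swirl x i k) = (fun p => N p.1 p.2).
  apply/funext => -[x y] /=; rewrite !sum_ord2.
  have [-> -> -> ->] := Du_swirl x y.
  by rewrite /N /flow1 /flow2 /curry_field; ring.
rewrite FE NE.
have zF : bsupp r F.
  by move=> x y [/k0|/l0] [e [e1 e2]]; rewrite /F e e1 e2; ring.
have zN : bsupp r N.
  by move=> x y [/k0|/l0] [e [e1 e2]]; rewrite /N e e1 e2; ring.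
rewrite (plane_Ibox cF zF) (plane_Ibox cN zN) -(IboxB r cF cN) => <-.
apply: eq_Ibox => x y _ _.
by rewrite /weak1 /weak2 /TA /TB /Na /Nb /F /N MfE; field.
Qed.

End tensor_test.
End flow_data.

(** * Test functions of class C^2 *)

Section mollifier.
Context {R : realType}.
Implicit Types (a b B : R -> R) (S : R -> R -> R).

(** The difference a(x - z) - a(x) is an integral of - a' along a segment, and by Fubini the
    increment in z becomes the primitive of a continuous function. This replaces differentiation
    under the integral sign. *)
Lemma der_convolution a a' B p q : der a a' -> continuous a' -> continuous B ->
  der (fun z => Sint p q (fun x => a (x - z) * B x))
      (fun z => - Sint p q (fun x => a' (x - z) * B x)).
Proof.
move=> da ca' cB; have ca := der_cont da.
pose g1 z := Sint p q (fun x => a' (x - z) * B x).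
have cg1 : continuous g1 by rewrite /g1; prove_cont.
have E z : Sint p q (fun x => a (x - z) * B x) = Sint p q (fun x => a x * B x) - line g1 z.
  have L x : line (fun s => - a' (x - s)) z = a (x - z) - a x.
    have D : der (fun s => a (x - s)) (fun s => - a' (x - s)).
      by apply: der_eq (der_comp da (der_add (der_cst x) (der_opp (@der_id R)))) _ => s; ring.
    have c : continuous (fun s : R => - a' (x - s)) by prove_cont; exact: ct_opp (@ct_id R).
    by rewrite (line_FTC _ D c) subr0.
  rewrite /line -SintN; last by prove_cont.
  have -> : Sint 0 1 (fun t => - (z * g1 (t * z))) =
      Sint 0 1 (fun t => Sint p q (fun x => - (z * (a' (x - t * z) * B x)))).
    by apply: eq_Sint => t _; rewrite /g1 -SintZ; [rewrite -SintN//; prove_cont|prove_cont].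
  rewrite Sint_Fubini; last by prove_cont.
  rewrite -SintD; [|by prove_cont|by prove_cont].
  apply: eq_Sint => x _; rewrite -[a (x - z)](subrK (a x)) -L mulrDl addrC; congr (_ + _).
  by rewrite /line mulrC -SintZ; [apply: eq_Sint => t _; ring|prove_cont].
have dl := der_line cg1.
rewrite (_ : (fun z => _) = (fun z => Sint p q (fun x => a x * B x) - line g1 z)); last by apply/funext.
by apply: der_eq (der_add (der_cst _) (der_opp dl)) _ => z; rewrite add0r.
Qed.

Variables (n : R).
(** Correlation of S with the product kernel a(x) b(y) centred at (z1, z2); each derivative in the
    centre falls on the kernel with a minus sign. *)
Definition conv2 a b S z1 z2 : R :=
  Sint (- n) n (fun x => a (x - z1) * Sint (- n) n (fun y => b (y - z2) * S x y)).

Lemma conv2_cont a b S : continuous a -> continuous b -> cont2 S -> cont2 (conv2 a b S).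
Proof. by move=> ca cb cS; rewrite /conv2; prove_cont. Qed.

Lemma conv2_swap a b S z1 z2 : continuous a -> continuous b -> cont2 S ->
  conv2 a b S z1 z2 = Sint (- n) n (fun y => b (y - z2) * Sint (- n) n (fun x => a (x - z1) * S x y)).
Proof.
move=> ca cb cS.
transitivity (Sint (- n) n (fun x => Sint (- n) n (fun y => a (x - z1) * (b (y - z2) * S x y)))).
  by apply: eq_Sint => x _; rewrite SintZ//; prove_cont.
rewrite Sint_Fubini; last by prove_cont.
by apply: eq_Sint => y _; rewrite -SintZ; [apply: eq_Sint => x _; ring|prove_cont].
Qed.

Lemma conv2_D1 a a' b S : der a a' -> continuous a' -> continuous b -> cont2 S ->
  D1 (conv2 a b S) (fun z1 z2 => - conv2 a' b S z1 z2).
Proof. by move=> da ca' cb cS z2; apply: der_convolution => //; prove_cont. Qed.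

Lemma conv2_D2 a b b' S : continuous a -> der b b' -> continuous b' -> cont2 S ->
  D2 (conv2 a b S) (fun z1 z2 => - conv2 a b' S z1 z2).
Proof.
move=> ca db cb' cS z1; have cb := der_cont db.
have := @der_convolution b b' (fun y => Sint (- n) n (fun x => a (x - z1) * S x y)) (- n) n db cb' _.
rewrite (_ : conv2 a b S z1 = fun z2 => Sint (- n) n (fun y => b (y - z2) * Sint (- n) n (fun x => a (x - z1) * S x y))).
  move=> D; apply: der_eq (D _) _ => [|z2]; first by prove_cont.
  by rewrite conv2_swap.
by apply/funext => z2; rewrite conv2_swap.
Qed.

End mollifier.

Section mollified_weak.
Context {R : realType}.
Variables (S1 S2 : R -> R -> R).
Hypotheses (cS1 : cont2 S1) (cS2 : cont2 S2).

(* Not normalised: the mass of K is divided out in [weak_eq_of_kernels]. *)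
Record kernel (d : R) (K K1 K2 : R -> R) : Prop := Kernel {
  ke_1 : der K K1; ke_2 : der K1 K2; ke_c : continuous K2;
  ke_ge0 : forall x, 0 <= K x; ke_gt0 : 0 < K 0;
  ke_supp : forall x, d <= `|x| -> K x = 0 /\ K1 x = 0 /\ K2 x = 0 }.

Lemma bsupp_D1 (N : R) f f1 : D1 f f1 -> bsupp N f -> bsupp (N + 1) f1.
Proof.
move=> df fN x y h.
suff D : is_derive x (1 : R) (f^~ y) 0.
  by rewrite -(@derive_val _ _ _ _ _ _ _ (df y x)) (@derive_val _ _ _ _ _ _ _ D).
apply: near_eq_is_derive (is_derive_cst 0 x (1 : R)).
near=> t; apply/esym/fN; case: h => h; last by right; apply: le_trans h; rewrite lerDl.
have tx : `|x - t| < 1 by near: t; apply: (@cvgr_dist_lt _ _ _ _ _ (fun t : R => t)) => //; exact: cvg_id.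
by left; have := lerB_dist x t; lra.
Unshelve. all: by end_near. Qed.

Lemma bsupp_D2 (N : R) f f2 : D2 f f2 -> bsupp N f -> bsupp (N + 1) f2.
Proof.
move=> df fN x y h.
have h' : N + 1 <= `|y| \/ N + 1 <= `|x| by case: h; [right|left].
by apply: (@bsupp_D1 N (fun y x => f x y) (fun y x => f2 x y)) h' => // a b [?|?]; apply: fN; [right|left].
Qed.

Lemma bsuppW (N N' : R) f : N <= N' -> bsupp N f -> bsupp N' f.
Proof. by move=> NN fN x y [h|h]; apply: fN; [left|right]; exact: le_trans h. Qed.

Lemma Ibox_zero (N : R) f : 0 <= N ->
  (forall x y, `|x| <= N -> `|y| <= N -> f x y = 0) -> Ibox N f = 0.
Proof. by move=> N0 /eq_Ibox ->; rewrite Ibox_cst// mul0r. Qed.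

Lemma Ibox_combine (N : R) f1 f2 f3 g1 g2 g3 : 0 <= N ->
  cont2 f1 -> cont2 f2 -> cont2 f3 -> cont2 g1 -> cont2 g2 -> cont2 g3 ->
  Ibox N f1 = Ibox N g1 -> Ibox N f2 = Ibox N g2 -> Ibox N f3 = Ibox N g3 ->
  (forall x y, `|x| <= N -> `|y| <= N -> f1 x y + (2^-1 * f2 x y - 2^-1 * f3 x y) = 0) ->
  Ibox N (fun x y => g1 x y + (2^-1 * g2 x y - 2^-1 * g3 x y)) = 0.
Proof.
move=> N0 cf1 cf2 cf3 cg1 cg2 cg3 e1 e2 e3 /(Ibox_zero N0).
have split f g k : cont2 f -> cont2 g -> cont2 k ->
    Ibox N (fun x y => f x y + (2^-1 * g x y - 2^-1 * k x y)) =
    Ibox N f + (2^-1 * Ibox N g - 2^-1 * Ibox N k).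
  move=> cf cg ck; rewrite IboxD; [|by []|by prove_cont]; congr (_ + _).
  by rewrite IboxB; [rewrite !IboxZ|prove_cont|prove_cont].
by rewrite (split _ _ _ cf1 cf2 cf3) (split _ _ _ cg1 cg2 cg3) e1 e2 e3.
Qed.

Section fixed_kernel.
Variables (d : R) (K K1 K2 : R -> R).
Hypothesis ke : kernel d K K1 K2.
Variables (N : R).
Hypotheses (N0 : 0 <= N) (d0 : 0 < d).
Notation T := (conv2 (N + d)).
Let j := Sint (- d) d K.

Let dK := ke_1 ke. Let dK1 := ke_2 ke. Let cK2 := ke_c ke.
Let cK := der_cont dK. Let cK1 := der_cont dK1.

Lemma kernel_mass (z : R) : `|z| <= N -> Sint (- (N + d)) (N + d) (fun x => K (x - z)) = j.
Proof.
rewrite ler_norml => /andP[z1 z2].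
rewrite (@Sint_shift _ K _ _ (- z))//; last by move: d0; lra.
apply: Sint_supp => //; [exact: ltW|by lra|by lra|].
by move=> x /(ke_supp ke)[].
Qed.

Lemma kernel_mass_gt0 : 0 < j.
Proof.
have j0 : 0 <= j by apply: Sint_ge0 => x _; exact: ke_ge0 ke x.
rewrite lt_neqAle eq_sym j0 andbT; apply/eqP => jz.
have dd : - d < d by move: d0; lra.
have := Sint_eq0 dd cK (ke_ge0 ke) jz (x := 0).
by have := ke_gt0 ke => /lt0r_neq0/eqP k0 /(_ _)E; apply/k0/E; move: d0; lra.
Qed.

Lemma conv2_cst (c z1 z2 : R) : `|z1| <= N -> `|z2| <= N -> T K K (fun _ _ => c) z1 z2 = c * j ^+ 2.
Proof.
move=> h1 h2; rewrite /conv2.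
have ck z : continuous (fun x => K (x - z)) by prove_cont.
transitivity (Sint (- (N + d)) (N + d) (fun x => (c * j) * K (x - z1))).
  apply: eq_Sint => x _; rewrite [RHS]mulrC; congr (_ * _).
  rewrite -(kernel_mass h2) -SintZ; last by prove_cont.
  by apply: eq_Sint => y _; rewrite mulrC.
by rewrite SintZ// kernel_mass//; ring.
Qed.

Lemma le_conv2 F G z1 z2 : cont2 F -> cont2 G ->
  (forall x y, `|x - z1| <= d -> `|y - z2| <= d -> F x y <= G x y) ->
  T K K F z1 z2 <= T K K G z1 z2.
Proof.
move=> cF cG FG; apply: le_Sint; [by prove_cont|by prove_cont|] => x _.
have [xd|/ltW xd] := leP `|x - z1| d; last first.
  by have [-> _] := ke_supp ke xd; rewrite !mul0r.
apply: ler_wpM2l; first exact: ke_ge0 ke _.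
apply: le_Sint; [by prove_cont|by prove_cont|] => y _.
have [yd|/ltW yd] := leP `|y - z2| d; last first.
  by have [-> _] := ke_supp ke yd; rewrite !mul0r.
by apply: ler_wpM2l; [exact: ke_ge0 ke _|exact: FG].
Qed.

(** The kernel is nonnegative, so the mollified function is squeezed between those of two
    constants. *)
Lemma conv2_near F k z1 z2 : cont2 F -> `|z1| <= N -> `|z2| <= N ->
  (forall x y, `|x - z1| <= d -> `|y - z2| <= d -> `|F x y - F z1 z2| <= k) ->
  `|T K K F z1 z2 - F z1 z2 * j ^+ 2| <= k * j ^+ 2.
Proof.
move=> cF h1 h2 Fk; have cc c : cont2 (fun _ _ : R => c : R) by prove_cont.
have u1 : T K K F z1 z2 <= T K K (fun _ _ => F z1 z2 + k) z1 z2.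
  by apply: le_conv2 => // x y hx hy; have := Fk x y hx hy; rewrite ler_norml; lra.
have u2 : T K K (fun _ _ => F z1 z2 - k) z1 z2 <= T K K F z1 z2.
  by apply: le_conv2 => // x y hx hy; have := Fk x y hx hy; rewrite ler_norml; lra.
rewrite !conv2_cst// in u1 u2; rewrite ler_norml; lra.
Qed.

Variables (psi p1 p2 p11 p12 p22 : R -> R -> R).
Hypotheses (C2 : C2data psi p1 p2 p11 p12 p22) (sp : bsupp N psi) (sp1 : bsupp N p1) (sp2 : bsupp N p2).
Hypothesis W : forall z1 z2, `|z1| <= N -> `|z2| <= N ->
  Ibox (N + d) (fun x y => S1 x y * (K1 (x - z1) * K1 (y - z2)) +
    S2 x y * (K (x - z1) * K2 (y - z2) - K2 (x - z1) * K (y - z2)) / 2) = 0.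

Lemma conv2E a b S z1 z2 : continuous a -> continuous b -> cont2 S ->
  T a b S z1 z2 = Ibox (N + d) (fun x y => S x y * (a (x - z1) * b (y - z2))).
Proof.
move=> ca cb cS; rewrite IboxE; last by prove_cont.
apply: eq_Sint => x _; rewrite -SintZ; last by prove_cont.
by apply: eq_Sint => y _; ring.
Qed.

Lemma conv2_zero z1 z2 : `|z1| <= N -> `|z2| <= N ->
  T K1 K1 S1 z1 z2 + (2^-1 * T K K2 S2 z1 z2 - 2^-1 * T K2 K S2 z1 z2) = 0.
Proof.
move=> h1 h2; rewrite (conv2E _ _ cK1 cK1 cS1) (conv2E _ _ cK cK2 cS2) (conv2E _ _ cK2 cK cS2).
rewrite -!IboxZ; [|by prove_cont|by prove_cont].
rewrite -IboxB; [|by prove_cont|by prove_cont]. rewrite -IboxD; [|by prove_cont|by prove_cont].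
by rewrite -[RHS](W h1 h2); apply: eq_Ibox => s t _ _; field.
Qed.

Opaque conv2.

(** The minus sign from differentiating in the centre cancels that of the integration by parts. *)
Lemma Ibox_conv2_D1 q q1 a a' b S : D1 q q1 -> cont2 q -> cont2 q1 -> bsupp N q ->
  der a a' -> continuous a' -> continuous b -> cont2 S ->
  Ibox N (fun x y => q x y * T a' b S x y) = Ibox N (fun x y => q1 x y * T a b S x y).
Proof.
move=> diff_quot cq cq1 sq da ca' cb cS; have ca := der_cont da.
have dT := conv2_D1 (N + d) da ca' cb cS.
have cT := conv2_cont (N + d) ca cb cS; have cT' := conv2_cont (N + d) ca' cb cS.
have D : D1 (fun x y => q x y * T a b S x y) (fun x y => q1 x y * T a b S x y - q x y * T a' b S x y).
  by move=> y; apply: der_eq (der_mul (diff_quot y) (dT y)) _ => x; ring.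
have := Ibox_D1 N0 D _ _; rewrite IboxB; [|by prove_cont|by prove_cont].
move=> H; apply/esym/eqP; rewrite -subr_eq0; apply/eqP/H; first by prove_cont.
by move=> x y h; rewrite (sq x y h) mul0r.
Qed.

Lemma Ibox_conv2_D2 q q2 a b b' S : D2 q q2 -> cont2 q -> cont2 q2 -> bsupp N q ->
  continuous a -> der b b' -> continuous b' -> cont2 S ->
  Ibox N (fun x y => q x y * T a b' S x y) = Ibox N (fun x y => q2 x y * T a b S x y).
Proof.
move=> diff_quot cq cq2 sq ca db cb' cS; have cb := der_cont db.
have dT := conv2_D2 (N + d) ca db cb' cS.
have cT := conv2_cont (N + d) ca cb cS; have cT' := conv2_cont (N + d) ca cb' cS.
have D : D2 (fun x y => q x y * T a b S x y) (fun x y => q2 x y * T a b S x y - q x y * T a b' S x y).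
  by move=> x; apply: der_eq (der_mul (diff_quot x) (dT x)) _ => y; ring.
have := Ibox_D2 N0 D _ _; rewrite IboxB; [|by prove_cont|by prove_cont].
move=> H; apply/esym/eqP; rewrite -subr_eq0; apply/eqP/H; first by prove_cont.
by move=> x y h; rewrite (sq x y h) mul0r.
Qed.

(** The equation tested with kernels centred at z is multiplied by psi(z) and integrated in z; two
    integrations by parts per term move the derivatives from the kernels to psi. *)
Lemma mollified_identity : cont2 psi -> cont2 p1 -> cont2 p2 ->
  Ibox N (fun x y => T K K S1 x y * p12 x y + T K K S2 x y * ((p22 x y - p11 x y) / 2)) = 0.
Proof.
move=> cp cp1 cp2; have [[d1 d2 d11 d12] [d21 d22 c11 c12 c22]] := C2.
have cT a b S := @conv2_cont R (N + d) a b S.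
have cT1 := cT _ _ _ cK cK cS1; have cT2 := cT _ _ _ cK cK cS2.
have cT3 := cT _ _ _ cK1 cK1 cS1; have cT4 := cT _ _ _ cK cK2 cS2; have cT5 := cT _ _ _ cK2 cK cS2.
have e1 : Ibox N (fun x y => psi x y * T K1 K1 S1 x y) = Ibox N (fun x y => p12 x y * T K K S1 x y).
  exact: (etrans (Ibox_conv2_D1 d1 cp cp1 sp dK cK1 cK1 cS1) (Ibox_conv2_D2 d12 cp1 c12 sp1 cK dK cK1 cS1)).
have e2 : Ibox N (fun x y => psi x y * T K K2 S2 x y) = Ibox N (fun x y => p22 x y * T K K S2 x y).
  exact: (etrans (Ibox_conv2_D2 d2 cp cp2 sp cK dK1 cK2 cS2) (Ibox_conv2_D2 d22 cp2 c22 sp2 cK dK cK1 cS2)).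
have e3 : Ibox N (fun x y => psi x y * T K2 K S2 x y) = Ibox N (fun x y => p11 x y * T K K S2 x y).
  exact: (etrans (Ibox_conv2_D1 d1 cp cp1 sp dK1 cK2 cK cS2) (Ibox_conv2_D1 d11 cp1 c11 sp1 dK cK1 cK cS2)).
move: (conv2_zero) e1 e2 e3 cT1 cT2 cT3 cT4 cT5.
move: (T K K S1) (T K K S2) (T K1 K1 S1) (T K K2 S2) (T K2 K S2) => t1 t2 t3 t4 t5.
move=> Z e1 e2 e3 cT1 cT2 cT3 cT4 cT5.
have H := Ibox_combine N0 _ _ _ _ _ _ e1 e2 e3 _.
rewrite -[RHS]H; [|by prove_cont|by prove_cont|by prove_cont|by prove_cont|by prove_cont|by prove_cont|].
  by apply: eq_Ibox => x y _ _; field.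
move=> x y xN yN; rewrite -[RHS](mulr0 (psi x y)) -(Z _ _ xN yN); ring.
Qed.

End fixed_kernel.
Lemma cont2_of_partials (f f1 f2 : R -> R -> R) : D1 f f1 -> D2 f f2 -> cont2 f1 -> cont2 f2 -> cont2 f.
Proof.
move=> d1 d2 c1 c2.
have -> : f = fun x y => f 0 0 + line (f1^~ 0) x + line (f2 x) y.
  apply/funext => x; apply/funext => y.
  have ca : continuous (f1^~ 0) by prove_cont.
  have cb : continuous (f2 x) by prove_cont.
  by rewrite (line_FTC x (d1 0) ca) (line_FTC y (d2 x) cb); ring.
by rewrite /line; prove_cont.
Qed.

Lemma mollified_error (N k c : R) (t1 t2 p q : R -> R -> R) : 0 <= N -> cont2 t1 -> cont2 t2 -> cont2 p -> cont2 q ->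
  (forall x y, `|x| <= N -> `|y| <= N -> `|t1 x y - S1 x y * c| <= k /\ `|t2 x y - S2 x y * c| <= k) ->
  Ibox N (fun x y => t1 x y * p x y + t2 x y * q x y) = 0 ->
  `|c * Ibox N (fun x y => S1 x y * p x y + S2 x y * q x y)| <= k * Ibox N (fun x y => `|p x y| + `|q x y|).
Proof.
move=> N0 cont_step ct2 cp cq H Z.
rewrite -IboxZ; last by prove_cont.
rewrite -[X in `|X|]subr0 -Z -IboxB; [|by prove_cont|by prove_cont].
apply: le_trans (Ibox_norm _ _) _; first by prove_cont.
rewrite -IboxZ; last by prove_cont.
apply: le_Ibox; [by prove_cont|by prove_cont|] => x y xN yN.
have [h1 h2] := H x y xN yN.
rewrite (_ : _ - _ = - ((t1 x y - S1 x y * c) * p x y) - (t2 x y - S2 x y * c) * q x y); last by ring.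
apply: le_trans (ler_normB _ _) _; rewrite normrN !normrM mulrDr.
by apply: lerD; apply: ler_wpM2r.
Qed.

(** Product kernels at all centres suffice: the mollified coefficients satisfy the identity for psi
    and, relative to the squared mass of the kernel, lie within k of S1 and S2 once d is small. *)
Lemma weak_eq_of_kernels :
  (forall N d, 0 <= N -> 0 < d -> exists K K1 K2, kernel d K K1 K2 /\
    forall z1 z2, `|z1| <= N -> `|z2| <= N ->
    Ibox (N + d) (fun x y => S1 x y * (K1 (x - z1) * K1 (y - z2)) +
      S2 x y * (K (x - z1) * K2 (y - z2) - K2 (x - z1) * K (y - z2)) / 2) = 0) ->
  weak_eq S1 S2.
Proof.
move=> HK N psi p1 p2 p11 p12 p22 N0 C2 sp [s11 s12 s22].
have [[d1 d2 d11 d12] [d21 d22 c11 c12 c22]] := C2.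
have cp1 := cont2_of_partials d11 d12 c11 c12; have cp2 := cont2_of_partials d21 d22 c12 c22.
have cp := cont2_of_partials d1 d2 cp1 cp2.
(* The first derivatives of psi are shown to vanish only outside this larger square, by [bsupp_D1]
   and [bsupp_D2]. *)
have N1 : N <= N + 1 by rewrite lerDl.
have N10 : 0 <= N + 1 by exact: le_trans N1.
rewrite -(Ibox_supp (N := N + 1)); [|by prove_cont|by rewrite N0|]; last first.
  by move=> x y h; rewrite (s11 x y h) (s12 x y h) (s22 x y h); ring.
pose q x y : R := (p22 x y - p11 x y) / 2.
have cq : cont2 q by rewrite /q; prove_cont.
set I0 := Ibox _ _; set C := Ibox (N + 1) (fun x y => `|p12 x y| + `|q x y|).
have C0 : 0 <= C by apply: Ibox_ge0 => *; rewrite addr_ge0.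
have key k : 0 < k -> `|I0| <= k * C.
  move=> k0; have [e1 e10 H1] := cont2_unif (N + 1) cS1 k0; have [e2 e20 H2] := cont2_unif (N + 1) cS2 k0.
  pose d := Num.min e1 e2; have d0 : 0 < d by rewrite lt_min e10.
  have [K [K1 [K2 [ke W]]]] := HK _ _ N10 d0.
  have Z := mollified_identity ke N10 C2 (bsuppW N1 sp) (bsupp_D1 d1 sp) (bsupp_D2 d2 sp) W cp cp1 cp2.
  have cK := der_cont (ke_1 ke).
  have j0 := kernel_mass_gt0 ke d0.
  have nr (S : R -> R -> R) e (eS : d <= e) z1 z2 (cS : cont2 S) (HS : forall x y a b : R, `|x| <= N + 1 -> `|y| <= N + 1 ->
      `|a| <= e -> `|b| <= e -> `|S (x + a) (y + b) - S x y| <= k) : `|z1| <= N + 1 -> `|z2| <= N + 1 ->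
      `|conv2 (N + 1 + d) K K S z1 z2 - S z1 z2 * Sint (- d) d K ^+ 2| <= k * Sint (- d) d K ^+ 2.
    move=> h1 h2; apply: (conv2_near ke d0 cS h1 h2) => x y hx hy.
    have := HS z1 z2 (x - z1) (y - z2) h1 h2 (le_trans hx eS) (le_trans hy eS).
    by rewrite !subrKC.
  have d_e1 : d <= e1 by rewrite ge_min lexx.
  have d_e2 : d <= e2 by rewrite ge_min lexx orbT.
  have := @mollified_error (N + 1) (k * Sint (- d) d K ^+ 2) (Sint (- d) d K ^+ 2) _ _ p12 q N10
    (conv2_cont (N + 1 + d) cK cK cS1) (conv2_cont (N + 1 + d) cK cK cS2) c12 cq _ Z.
  rewrite -/C -/I0 normrM [`|_ ^+ 2|]ger0_norm ?sqr_ge0//.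
  have j2 : 0 < Sint (- d) d K ^+ 2 by rewrite exprn_gt0.
  move=> H; rewrite -(ler_pM2l j2) [leRHS]mulrCA mulrA; apply: H => x y hx hy.
  by split; [exact: nr d_e1 _ _ cS1 H1 hx hy|exact: nr d_e2 _ _ cS2 H2 hx hy].
apply/eqP; rewrite -normr_le0; apply/ler_addgt0Pr => e e0; rewrite add0r.
have Ce : 0 < C + 1 by rewrite ltr_wpDl.
apply: le_trans (key (e / (C + 1)) _) _; first by rewrite divr_gt0.
by rewrite mulrAC ler_pdivrMr// ler_pM2l// lerDl.
Qed.

End mollified_weak.

Section kernels.
Context {R : realType}.

Lemma der_vanish (f f' : R -> R) : der f f' -> (forall x, 1 < `|x| -> f x = 0) ->
  forall x, 1 < `|x| -> f' x = 0.
Proof.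
move=> df f0 x x1; suff D : is_derive x (1 : R) f 0.
  by rewrite -(@derive_val _ _ _ _ _ _ _ (df x)) (@derive_val _ _ _ _ _ _ _ D).
apply: near_eq_is_derive (is_derive_cst 0 x (1 : R)).
have C : (fun t : R => `|t|) @ x --> `|x| by apply: cvg_norm; exact: cvg_id.
near=> t; apply/esym/f0; near: t; exact: cvgr_gt C _ x1.
Unshelve. all: by end_near. Qed.

Lemma smooth_kernel (d : R) : 0 < d -> exists2 K : R -> R, forall n z, smooth_to n (fun x => K (x - z)) &
  exists K1 K2 : R -> R, kernel d K K1 K2.
Proof.
move=> d0; have [k1 dk1 [k2 dk2 ck2]] := @smooth_kern R 2.
(* With 2 / d instead of 1 / d, the condition |x| >= d gives |e x| > 1 strictly, where the
   derivatives of [kern] vanish as well. *)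
pose e := 2 / d; have e0 : 0 < e by rewrite divr_gt0.
have s0 (x : R) : 1 < `|x| -> kern x = 0 by move=> /ltW; exact: kern_supp.
have s1 := der_vanish dk1 s0; have s2 := der_vanish dk2 s1.
have de : der (fun x => e * x) (fun=> e).
  by apply: der_eq (der_mul (der_cst e) (@der_id R)) _ => x; ring.
exists (fun x => kern (e * x)) => [n z|].
  have := smooth_to_affine e (- (e * z)) (smooth_kern n).
  by congr smooth_to; apply/funext => x; rewrite mulrBr.
exists (fun x => e * k1 (e * x)), (fun x => e ^+ 2 * k2 (e * x)); split.
- by apply: der_eq (der_comp dk1 de) _ => x; rewrite mulrC.
- apply: der_eq (der_mul (der_cst e) (der_comp dk2 de)) _ => x; ring.
- by prove_cont.
- by move=> x; exact: kern_ge0.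
- by rewrite mulr0; exact: kern_gt0.
- move=> x dx; have ex : 1 < `|e * x|.
    rewrite normrM gtr0_norm// (lt_le_trans _ (ler_wpM2l (ltW e0) dx))// divfK ?lt0r_neq0//.
    by rewrite ltr1n.
  by rewrite (s0 _ ex) (s1 _ ex) (s2 _ ex) !mulr0.
Qed.

Lemma der_translate (f f' : R -> R) z : der f f' -> der (fun x => f (x - z)) (fun x => f' (x - z)).
Proof.
move=> df; apply: der_eq (der_comp df (der_add (@der_id R) (der_cst (- z)))) _ => x.
by ring.
Qed.

End kernels.

Lemma cont2_S1 (R : realType) (P1 P2 P12 M : R -> R -> R) : cont2 P1 -> cont2 P2 -> cont2 P12 ->
  cont2 M -> cont2 (weak1 P1 P2 P12 M).
Proof. by move=> *; rewrite /weak1 /TA /Na; prove_cont. Qed.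

Lemma cont2_S2 (R : realType) (P1 P2 P11 P22 M : R -> R -> R) : cont2 P1 -> cont2 P2 -> cont2 P11 ->
  cont2 P22 -> cont2 M -> cont2 (weak2 P1 P2 P11 P22 M).
Proof. by move=> *; rewrite /weak2 /TB /off_strain /Nb; prove_cont. Qed.

(** * From the given solution to the abstract flow *)

Section conclusion.
Context {R : realType}.
Variables (u : 'rV[R]_2 -> 'rV[R]_2).
Hypotheses (uC1 : class_C 1 u) (div0 : forall x, divergence u x = 0).
Variables (h h' h'' : R -> R) (m0 a : R).
Notation g := (fun t : R => h `|t|).
Notation m := (fun t : R => mu h' h'' `|t|).
Notation w := (fun t : R => h'' `|t|).
Hypothesis G : growth g m w m0 a.
Hypothesis u_sol : weak_solution h u.
Notation f1 := (flow1 u).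
Notation f2 := (flow2 u).
Notation f11 := (flow11 u).
Notation f12 := (flow12 u).
Notation f22 := (flow22 u).
Notation M := (fun x y => m (strain_norm f11 f12 f22 x y)).

Lemma flow_weak_eq : weak_eq (weak1 f1 f2 f12 M) (weak2 f1 f2 f11 f22 M).
Proof.
have c1 := flow1_cont uC1; have c2 := flow2_cont uC1; have c11 := flow11_cont uC1.
have c12 := flow12_cont uC1; have c22 := flow22_cont uC1.
have cM := viscosity_cont G c11 c12 c22.
apply: weak_eq_of_kernels.
- exact: cont2_S1.
- exact: cont2_S2.
move=> N d N0 d0; have [K sK [K1 [K2 ke]]] := smooth_kernel d0.
exists K, K1, K2; split=> // z1 z2 h1 h2.
have supp z : `|z| <= N -> forall x, N + d <= `|x| -> K (x - z) = 0 /\ K1 (x - z) = 0 /\ K2 (x - z) = 0.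
  by move=> zN x xr; apply: (ke_supp ke); have := lerB_dist x z; lra.
have cK2 := ke_c ke.
by apply: (weak_tensor uC1 div0 G u_sol (k := fun x => K (x - z1)) (l := fun y => K (y - z2))
  (fun n => sK n z1) (fun n => sK n z2) (der_translate z1 (ke_1 ke)) (der_translate z1 (ke_2 ke))
  (der_translate z2 (ke_1 ke)) (der_translate z2 (ke_2 ke)) (supp z1 h1) (supp z2 h2)); prove_cont.
Qed.

Hypothesis u_energy : (\int[plane_measure R]_p
  (h (eucl_norm (Du u (plane_point p))))%:E < +oo)%E.

Lemma flow_energy : exists E0, energy f11 f12 f22 M
  (fun x y => (6 * a + 2 / m0) * g (grad_norm f11 f12 f22 x y)) (m 1) E0.
Proof.
have c11 := flow11_cont uC1; have c12 := flow12_cont uC1; have c22 := flow22_cont uC1.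
have cG := der_cont (gr_g G); have cn := grad_norm_cont c11 c12 c22.
have cgn : cont2 (fun x y => g (grad_norm f11 f12 f22 x y)).
  by apply: Cont2 => /=; apply: (ct_1 cG); exact: (cont2P cn).
have g0 t : 0 <= g t.
  by apply: le_trans (gr_quad G t); rewrite mulr_ge0 ?sqr_ge0// divr_ge0// ltW// (gr_m0 G).
have E : (fun p : R * R => (h (eucl_norm (Du u (plane_point p))))%:E) =
    (fun p => (g (grad_norm f11 f12 f22 p.1 p.2))%:E).
  apply/funext => -[x y]; rewrite eucl_norm_Du//=.
  by rewrite [`|grad_norm _ _ _ _ _|]ger0_norm// grad_norm_ge0.
move: u_energy; rewrite E => fin.
eexists; apply: (energy_of_growth G c11 c12 c22) => N N0.
rewrite IboxZ//; apply: ler_wpM2l.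
  have k0 : 0 <= 2 / m0 by rewrite divr_ge0// ltW// (gr_m0 G).
  by have := gr_a0 G; lra.
apply: (@Ibox_le_plane R _ N cgn) => // x y; exact: g0.
Qed.

Lemma flow_constant : exists c : 'rV[R]_2, forall x, u x = c.
Proof.
have c1 := flow1_cont uC1; have c2 := flow2_cont uC1; have c11 := flow11_cont uC1.
have c12 := flow12_cont uC1; have c22 := flow22_cont uC1.
have d12 := flow1_D2 uC1 div0; have d21 := flow2_D1 uC1.
have [E0 En] := flow_energy.
have FL := flow_of_growth G (stream_cont c1 c2) c1 c2 c11 c12 c22
  (stream_D1 c1 c2 c12 d12 d21) (stream_D2 _ c2) (flow1_D1 uC1) d12 d21 (flow2_D2 uC1) flow_weak_eq.
have L := liouville FL En.
exists (u (plane_point (0, 0))) => X; apply/rowP => j.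
have -> : X = plane_point (X 0 0, X 0 1).
  apply/rowP => i; rewrite !mxE.
  by have [->|->] := ord2_cases i.
have [e1 e2] := L (X 0 0) (X 0 1).
have [->|->] := ord2_cases j.
  exact: e2.
exact: oppr_inj e1.
Qed.

End conclusion.

Theorem theorem1p1 (R : realType) (h h' h'' : R -> R)
    (u : 'rV[R]_2 -> 'rV[R]_2)
    (h_ge0 : forall t, 0 <= t -> 0 <= h t)
    (hC2 : C2_halfline h h' h'')
    (hA1 : condA1 h h'')
    (hA2 : condA2 h)
    (hA3 : condA3 h' h'')
    (uC1 : class_C 1 u)
    (u_sol : weak_solution h u)
    (u_energy : (\int[plane_measure R]_p
                   (h (eucl_norm (Du u (plane_point p))))%:E < +oo)%E) :
  exists c : 'rV[R]_2, forall x, u x = c.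
Proof.
have [a G] := potential_gt0_growth h_ge0 hC2 hA1 hA2 hA3.
have [div0 _] := u_sol.
exact: (flow_constant uC1 div0 G u_sol u_energy).
Qed.
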